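(* Let $F$ be an $\mathcal F_T$-measurable real random variable such that $E[e^{p\alpha F^+}]<\infty$ and $E[e^{\varepsilon F^-}]<\infty$ for some integer $p>1$ and some $\varepsilon>0$. Then the component $Y$ of the solution of BSDE$(F,f)$ admits the convex dual representation $$Y_t=\operatorname*{ess\,sup}_{q\in\mathcal A_D^\star}E^{\mathbb Q^q}\left[F-\int_t^Tf^\star(s,q_s)ds\,\Big|\,\mathcal F_t\right],\qquad t\in[0,T].$$ Moreover, there exists an optimal density process $q^\star\in\mathcal A_D^\star$ such that $$Y_t=E^{\mathbb Q^{q^\star}}\left[F-\int_t^Tf^\star(s,q^\star_s)ds\,\Big|\,\mathcal F_t\right],\qquad t\in[0,T].$$
   Context: Fix $T>0$, integers $1\le d\le m$ and $\alpha>0$. $B$ is a standard $m$-dimensional Brownian motion on a complete probability space $(\Omega,\mathcal F,\mathbb P)$ with augmented natural filtration $(\mathcal F_t)$; predictability is with respect to this filtration, $E$ is expectation under $\mathbb P$, and $A^{tr}$ is the transpose of $A$. The processes $b$ ($\mathbb R^d$-valued) and $\sigma$ ($\mathbb R^{d\times m}$-valued) are predictable and bounded, $\sigma_t\sigma_t^{tr}$ is invertible, and $\theta_t=\sigma_t^{tr}(\sigma_t\sigma_t^{tr})^{-1}b_t$ is bounded. $\mathcal C\subset\mathbb R^d$ is closed and convex with $0\in\mathcal C$; $\sigma_t^{tr}\mathcal C=\{\sigma_t^{tr}\pi:\pi\in\mathcal C\}$, and $\mathrm{dist}_K$ is the Euclidean distance to $K$. Generator: for $(t,z)\in[0,T]\times\mathbb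 R^m$, $$f(t,z)=\frac{\alpha}{2}\mathrm{dist}^2_{\sigma_t^{tr}\mathcal C}\left(z+\frac1\alpha\theta_t\right)-z^{tr}\theta_t-\frac{1}{2\alpha}|\theta_t|^2 ,$$ which is convex in $z$; its convex dual is $f^\star(t,q)=\sup_{z\in\mathbb R^m}(z^{tr}q-f(t,z))\in\mathbb R\cup\{+\infty\}$, $q\in\mathbb R^m$. A solution of BSDE$(F,f)$ is a pair of predictable processes $(Y,Z)$ with values in $\mathbb R\times\mathbb R^m$, $Y$ continuous, $\int_0^T|Z_t|^2dt<\infty$ and $\int_0^T|f(t,Z_t)|dt<\infty$ a.s., and $Y_t=F+\int_t^Tf(s,Z_s)ds-\int_t^TZ_s^{tr}dB_s$, $t\in[0,T]$. The solution considered satisfies $E[e^{p\alpha Y^+_\star}+e^{\varepsilon Y^-_\star}+\int_0^T|Z_s|^2ds]<\infty$, where $Y^\pm_\star=\sup_{t\in[0,T]}Y_t^\pm$, $y^+=\max\{y,0\}$, $y^-=\max\{-y,0\}$. For an $\mathbb R^m$-valued predictable $q$ with $\int_0^T|q_t|^2dt<\infty$ a.s. (written $q\in L^2[0,T]$), put $L^q=\mathcal E(\int_0^\cdot q_u^{tr}dB_u)$ (stochastic exponential). $L_T^q$ has finite entropy if $E[L_T^q\ln L_T^q]<\infty$; then $L^q$ is a uniformly integrable martingale and $d\mathbb Q^q/d\mathbb P=L_T^q$ defines a probability on $\mathcal F_T$. The admissible set is $$\mathcal A_D^\star=\left\{q\in L^2[0,T]:\ L_T^q\text{ has finite entropy and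 }E^{\mathbb Q^q}\left[|F|+\int_0^T|f^\star(s,q_s)|ds\right]<\infty\right\}.$$
   Formalization: The admissible set additionally requires that L_T^q have expectation 1, so that Q^q is a probability; finite entropy E[L_T^q ln L_T^q]<∞ alone does not imply this (L^q may be a strict local martingale with L_T^q=1/2, and then the representation fails). *)

(* Defs.v *)
From HB Require Import structures.
From mathcomp Require Import all_boot all_order all_algebra.
From mathcomp Require Import all_classical all_reals all_analysis.
From mathcomp Require Import measurable_realfun.

Set Implicit Arguments.
Unset Strict Implicit.
Unset Printing Implicit Defensive.

Import Order.TTheory GRing.Theory Num.Theory.
Import numFieldNormedType.Exports.

Local Open Scope classical_set_scope.
Local Open Scope ring_scope.

(* Euclidean geometry of column vectors; the library norm `|x| on matrices is
   the maximum norm. *)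
Section euclidean.
Context {R : realType}.

Definition dot {n} (u v : 'cV[R]_n) : R := (u^T *m v) 0 0.
Definition enorm {n} (u : 'cV[R]_n) : R := Num.sqrt (dot u u).
Definition edist {n} (K : set 'cV[R]_n) (x : 'cV[R]_n) : R :=
  inf [set enorm (x - y) | y in K].

Definition convex_dual {n} (g : 'cV[R]_n -> R) (q : 'cV[R]_n) : \bar R :=
  ereal_sup [set (dot z q - g z)%:E | z in [set: 'cV[R]_n]].

Definition risk_premium {d m} (s : 'M[R]_(d, m)) (b : 'cV[R]_d) : 'cV[R]_m :=
  s^T *m invmx (s *m s^T) *m b.

Definition generator {d m} (alpha : R) (C : set 'cV[R]_d)
    (s : 'M[R]_(d, m)) (b : 'cV[R]_d) (z : 'cV[R]_m) : R :=
  let th := risk_premium s b in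
  alpha / 2 * edist [set s^T *m x | x in C] (z + alpha^-1 *: th) ^+ 2
  - dot z th - (2 * alpha)^-1 * enorm th ^+ 2.

End euclidean.

(* As in the library's integral, Q is a bare set function; it is meant to be a
   probability. Sub-sigma-algebras are given by generators G. *)
Section conditioning.
Context d (Omega : measurableType d) (R : realType).
Implicit Types (P : probability Omega R) (Q : set Omega -> \bar R).
Implicit Types (G : set (set Omega)) (X V : Omega -> \bar R).

(* V is a version of E^Q[X | <<s G >>]. *)
Definition is_condexp Q G X V : Prop :=
  [/\ measurable_fun [set: g_sigma_algebraType G]
        (V : g_sigma_algebraType G -> \bar R),
      (\int[Q]_w `|V w| < +oo)%E &
      forall A, <<s G >> A ->
        (\int[Q]_(w in A) V w = \int[Q]_(w in A) X w)%E].

(* V is the essential supremum of the family S of random variables. This is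
   not the library's ess_sup, which concerns a single function. *)
Definition is_esssup P (S : set (Omega -> \bar R)) V : Prop :=
  [/\ measurable_fun [set: Omega] V,
      forall U, S U -> {ae P, forall w, (U w <= V w)%E} &
      forall W, measurable_fun [set: Omega] W ->
        (forall U, S U -> {ae P, forall w, (U w <= W w)%E}) ->
        {ae P, forall w, (V w <= W w)%E}].

Definition cvg_in_prob P (X : nat -> Omega -> \bar R) : Prop :=
  forall e : R, 0 < e ->
    P [set w | (e%:E < X n w)%E] @[n --> \oo] --> 0%E.

End conditioning.

(* Only the restriction of B to [0, T] is ever constrained or used. *)
Section brownian.
Context d (Omega : measurableType d) (R : realType) (P : probability Omega R).
Context (T : R) (m : nat) (B : R -> Omega -> 'cV[R]_m).

Definition natural_gen (t : R) : set (set Omega) :=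
  [set A | exists s (i : 'I_m) (U : set R),
     [/\ 0 <= s <= t, measurable U & A = [set w | U (B s w i 0)]]].

(* The augmented natural filtration is (<<s augmented_gen t >>)_t. *)
Definition augmented_gen (t : R) : set (set Omega) :=
  natural_gen t `|` P.-negligible.

(* Measurability with respect to F_t. *)
Definition filtration_measurable (t : R) (X : Omega -> R) : Prop :=
  measurable_fun [set: g_sigma_algebraType (augmented_gen t)]
    (X : g_sigma_algebraType (augmented_gen t) -> R).

Definition continuous_process (X : R -> Omega -> R) : Prop :=
  {ae P, forall w, {within `[0, T], continuous (X ^~ w)}}.

(* The last clause says that B_t - B_s is independent of sigma(B_u, u <= s)
   with law N(0, (t - s) I_m), tested on boxes. *)
Definition is_brownian_motion : Prop :=
  [/\ forall t i, 0 <= t <= T ->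
        measurable_fun [set: Omega] (fun w => B t w i 0),
      {ae P, forall w, B 0 w = 0},
      forall i, continuous_process (fun t w => B t w i 0) &
      forall s t, 0 <= s -> s < t -> t <= T ->
      forall A, <<s natural_gen s >> A ->
      forall U : 'I_m -> set R, (forall i, measurable (U i)) ->
        P (A `&` [set w | forall i, U i ((B t w - B s w) i 0)]) =
        (P A * \prod_(i < m) normal_prob 0%R (Num.sqrt (t - s)%R) (U i))%E].

Definition predictable_gen : set (set (R * Omega)) :=
  [set S | (exists2 A, <<s augmented_gen 0 >> A & S = [set 0] `*` A) \/
     (exists s t A, [/\ 0 <= s, s < t, t <= T, <<s augmented_gen s >> A &
        S = [set` `]s, t]] `*` A])].

(* The predictable sigma-algebra of [0, T] x Omega is the trace on
   [0, T] x Omega of the one generated on R x Omega. *)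
Definition predictable (X : R -> Omega -> R) : Prop :=
  measurable_fun
    ([set` `[0, T]] `*` [set: Omega] :
       set (g_sigma_algebraType predictable_gen))
    ((fun x => X x.1 x.2) : g_sigma_algebraType predictable_gen -> R).

Definition predictable_mx {a b} (X : R -> Omega -> 'M[R]_(a, b)) : Prop :=
  forall i j, predictable (fun t w => X t w i j).

Definition bounded_mx {a b} (X : R -> Omega -> 'M[R]_(a, b)) : Prop :=
  exists K : R, forall t w i j, 0 <= t <= T -> `|X t w i j| <= K.

Definition square_integrable (q : R -> Omega -> 'cV[R]_m) : Prop :=
  {ae P, forall w,
    (\int[lebesgue_measure]_(t in `[0%R, T]) (enorm (q t w) ^+ 2)%:E < +oo)%E}.

(* sum_(k < n) xi_k 1_(t_k, t_(k+1)] *)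
Record simple_process := SimpleProcess {
  sp_size : nat;
  sp_time : nat -> R;
  sp_value : nat -> Omega -> 'cV[R]_m }.

Definition is_simple (H : simple_process) : Prop :=
  [/\ forall k, (k <= sp_size H)%N -> 0 <= sp_time H k <= T,
      forall k, (k < sp_size H)%N -> sp_time H k <= sp_time H k.+1,
      forall k i, (k < sp_size H)%N ->
        filtration_measurable (sp_time H k) (fun w => sp_value H k w i 0) &
      exists K : R, forall k w i, (k < sp_size H)%N ->
        `|sp_value H k w i 0| <= K].

Definition sp_eval (H : simple_process) (t : R) (w : Omega) : 'cV[R]_m :=
  \sum_(k < sp_size H)
    (if sp_time H k < t <= sp_time H k.+1 then sp_value H k w else 0).

Definition sp_integral (H : simple_process) (t : R) (w : Omega) : R :=
  \sum_(k < sp_size H)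
    dot (sp_value H k w)
      (B (Num.min (sp_time H k.+1) t) w - B (Num.min (sp_time H k) t) w).

(* M is a version of int_0^. Z_s^tr dB_s: a limit, uniformly in t and in
   probability, of integrals of simple processes H_n with
   int_0^T |H_n - Z|^2 ds -> 0 in probability. *)
Definition is_stochastic_integral (Z : R -> Omega -> 'cV[R]_m)
    (M : R -> Omega -> R) : Prop :=
  [/\ forall t, 0 <= t <= T -> filtration_measurable t (M t),
      continuous_process M &
      exists H : nat -> simple_process,
      [/\ forall n, is_simple (H n),
          cvg_in_prob P (fun n w =>
            \int[lebesgue_measure]_(s in `[0%R, T])
              (enorm (sp_eval (H n) s w - Z s w) ^+ 2)%:E)%E &
          cvg_in_prob P (fun n w =>
            ereal_sup [set `|sp_integral (H n) t w - M t w|%:E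
                      | t in `[0, T]])]].

(* A choice of version; is_stochastic_integral determines it up to
   indistinguishability on [0, T]. *)
Definition stochastic_integral (Z : R -> Omega -> 'cV[R]_m) :
    R -> Omega -> R :=
  xget (fun _ _ => 0) [set M | is_stochastic_integral Z M].

Definition stochastic_exponential (q : R -> Omega -> 'cV[R]_m) (t : R)
    (w : Omega) : R :=
  expR (stochastic_integral q t w -
        2^-1 * \int[lebesgue_measure]_(s in `[0%R, t]) (enorm (q s w) ^+ 2)).

(* Q^q, with density L^q_T with respect to P. *)
Definition density_measure (q : R -> Omega -> 'cV[R]_m) (A : set Omega) :
    \bar R :=
  (\int[P]_(w in A) (stochastic_exponential q T w)%:E)%E.

Definition finite_entropy (q : R -> Omega -> 'cV[R]_m) : Prop :=
  let L := stochastic_exponential q T in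
  (\int[P]_w (L w * ln (L w))%:E < +oo)%E.

Definition bsde_solution (F : Omega -> R) (f : R -> Omega -> 'cV[R]_m -> R)
    (Y : R -> Omega -> R) (Z : R -> Omega -> 'cV[R]_m) : Prop :=
  [/\ predictable Y /\ predictable_mx Z,
      continuous_process Y,
      square_integrable Z,
      {ae P, forall w, (\int[lebesgue_measure]_(t in `[0%R, T])
                          `|f t w (Z t w)|%:E < +oo)%E} &
      {ae P, forall w, forall t, 0 <= t <= T ->
        Y t w = F w + \int[lebesgue_measure]_(s in `[t, T]) f s w (Z s w)
                - (stochastic_integral Z T w - stochastic_integral Z t w)}].

Definition exp_integrable_solution (a eps : R) (Y : R -> Omega -> R)
    (Z : R -> Omega -> 'cV[R]_m) : Prop :=
  let Ypos w := ereal_sup [set (Num.max (Y t w) 0)%:E | t in `[0, T]] in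
  let Yneg w := ereal_sup [set (Num.max (- Y t w) 0)%:E | t in `[0, T]] in
  (\int[P]_w (expeR (a%:E * Ypos w) + expeR (eps%:E * Yneg w) +
     \int[lebesgue_measure]_(s in `[0%R, T]) (enorm (Z s w) ^+ 2)%:E)
   < +oo)%E.

(* E[L^q_T ln L^q_T] < oo alone does not exclude that L^q is a strict local
   martingale (L^q_T may even be a constant in ]0, 1[), hence the explicit
   requirement that Q^q is a probability, i.e. that the nonnegative local
   martingale L^q is a (uniformly integrable) martingale on [0, T]. *)
Definition admissible (F : Omega -> R)
    (fstar : R -> Omega -> 'cV[R]_m -> \bar R)
    (q : R -> Omega -> 'cV[R]_m) : Prop :=
  [/\ predictable_mx q, square_integrable q, finite_entropy q,
      density_measure q [set: Omega] = 1%E &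
      (\int[density_measure q]_w
        (`|F w|%:E +
         \int[lebesgue_measure]_(s in `[0%R, T]) `|fstar s w (q s w)|)
       < +oo)%E].

Definition dual_payoff (F : Omega -> R)
    (fstar : R -> Omega -> 'cV[R]_m -> \bar R)
    (q : R -> Omega -> 'cV[R]_m) (t : R) (w : Omega) : \bar R :=
  ((F w)%:E - \int[lebesgue_measure]_(s in `[t, T]) fstar s w (q s w))%E.

(* V is a version of
   E^{Q^q}[F - int_t^T fstar(s, q_s) ds | F_t]. *)
Definition is_dual_value (F : Omega -> R)
    (fstar : R -> Omega -> 'cV[R]_m -> \bar R)
    (q : R -> Omega -> 'cV[R]_m) (t : R) (V : Omega -> \bar R) : Prop :=
  is_condexp (density_measure q) (augmented_gen t)
    (dual_payoff F fstar q t) V.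

End brownian.

(* Main.v *)
From HB Require Import structures.
Require Import Defs.
From mathcomp Require Import all_boot all_order all_algebra.
From mathcomp Require Import all_classical all_reals all_analysis.
From mathcomp Require Import measurable_realfun.
From mathcomp Require Import ring lra.

Set Implicit Arguments.
Unset Strict Implicit.
Unset Printing Implicit Defensive.

Import Order.TTheory GRing.Theory Num.Theory.
Import numFieldNormedType.Exports.

Local Open Scope classical_set_scope.
Local Open Scope ring_scope.

(* For a density process q put X = int Z dB - int Z.q ds, the martingale part of Y
   under Q^q. The equation gives
     Y_u - Y_t = X_u - X_t + int_t^u (Z.q - f(Z)) ds,
   and Z.q - f(Z) <= f*(q) by Fenchel-Young, with equality if q is a subgradient of f
   at Z. Young's inequality between the entropy of L^q_T and the exponential moments
   of Y makes X_u - X_t bounded below by a Q^q-integrable variable, so X is a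
   Q^q-supermartingale and F - int_t^T f*(q) <= Y_t + X_T - X_t gives one inequality.
   The squared distance to a convex set is differentiable, so f has a gradient
   q* = grad f(Z) of linear growth; since f* >= 0, the process -X is then bounded
   below as well, hence X is a martingale and q* is optimal.

   Finite entropy of q*: as f* >= |q|^2 / (2 alpha),
     alpha X_s + 1/2 int_0^s |q*|^2 <= alpha (Y_s^+ + Y_0^-),
   so the entropy of L^{q*} is at most E^{Q*}[alpha (sup Y^+ + Y_0^-)], and Young's
   inequality with a moment of order p > 1 absorbs the entropy produced on the right.

   Neither Ito's formula nor stopping times are used: the estimates come from the
   identity E[W exp(int H dB - 1/2 int |H|^2)] = E[W] for simple H and F_0-measurable
   W >= 0, applied to simple approximations stopped along a grid, and from Fatou's
   lemma. Supermartingale inequalities are obtained by perturbing the exponent q into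
   q + u Z 1_A and letting u decrease to 0. *)

(** The perturbation works because the exponent is quadratic: for A in F_t, the density of q + u Z
    1_A on ]t, T] is that of q times exp(u 1_A D - u^2/2 1_A int_t^T |Z|^2), where D is the
    increment of X. Its mean is at most 1 while that of q is 1, so dividing by u and letting u tend
    to 0 leaves E^Q[1_A D] <= 0. The obstacle is the unbounded quadratic term: Z is stopped when its
    bracket passes K, the increment up to the unknown stopping time is replaced by its lower bound,
    and only afterwards does K tend to infinity. This is why lower bounds on X are required along
    the whole path and not only at T. The entropy bound uses the same device in another direction:
    (1 + v) q - v alpha Z has log density l + v (l - S) up to order v^2, with l the log density of q
    and S = alpha X + 1/2 int |q|^2, so that to first order E[L l] <= E[L S]. Here L is not yet
    known to have mean 1. The estimate is made for stopped simple approximants, whose mean is 1, and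
    the uniform entropy bound gives the uniform integrability that carries the mean over to the
    limit. *)

Import HBSimple HBNNSimple.

(** * Integration tools: transfer of weighted laws, Fatou's lemma, Gaussian moments *)

Section transfer.
Local Open Scope ereal_scope.
Context d1 d2 d3 (T1 : measurableType d1) (T2 : measurableType d2)
  (T3 : measurableType d3) (R : realType).

Lemma integral_nnsfun_density d (T : measurableType d)
    (mu : {measure set T -> \bar R}) (X : T -> T3) (r : T -> R)
    (mX : measurable_fun [set: T] X) (mr : measurable_fun [set: T] r)
    (r_ge0 : forall x, (0 <= r x)%R) (h : {nnsfun T3 >-> R}) :
  \int[mu]_x ((r x)%:E * (h (X x))%:E) = \sum_(y \in range h)
    (y%:E * \int[mu]_x ((r x)%:E * (\1_(h @^-1` [set y]) (X x))%:E)).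
Proof.
have mi y : measurable_fun [set: T]
    (fun x => (\1_(h @^-1` [set y]) (X x) : R)%:E).
  by apply/measurable_EFinP; apply: measurableT_comp => //.
have {}mr : measurable_fun [set: T] (EFin \o r) by exact/measurable_EFinP.
transitivity (\int[mu]_x (\sum_(y \in range h)
    (y%:E * ((r x)%:E * (\1_(h @^-1` [set y]) (X x))%:E)))).
  apply: eq_integral => x _; rewrite fimfunE -fsumEFin//.
  rewrite ge0_mule_fsumr; last by move=> y; rewrite nnfun_muleindic_ge0.
  by apply: eq_fsbigr => y _; rewrite EFinM muleCA.
rewrite ge0_integral_fsum//.
- apply: eq_fsbigr => y; rewrite inE => -[t _ <-].
  rewrite ge0_integralZl ?lee_fin ?fun_ge0//.
  + by apply: emeasurable_funM.
  + by move=> x _; rewrite mule_ge0// lee_fin.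
- by move=> y; apply: emeasurable_funM => //; apply: emeasurable_funM.
- move=> y x _.
  have [/[!inE] hy|hy] := boolP (y \in range h).
    by case: hy => t _ <-; rewrite !mule_ge0 ?lee_fin// fun_ge0.
  rewrite (_ : \1__ _ = 0%R) ?mule0//.
  rewrite indicE; apply/eqP; rewrite pnatr_eq0 eqb0; apply: contra hy.
  by rewrite inE/= => <-; rewrite inE; exists (X x).
Qed.

Lemma integral_nnsfun_approx_lim d (T : measurableType d)
    (mu : {measure set T -> \bar R}) (X : T -> T3) (r : T -> R)
    (mX : measurable_fun [set: T] X) (mr : measurable_fun [set: T] r)
    (r_ge0 : forall x, (0 <= r x)%R) (g : T3 -> \bar R)
    (mg : measurable_fun [set: T3] g) : (forall x, 0 <= g x) ->
  \int[mu]_x ((r x)%:E * g (X x)) =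
  limn (fun n => \int[mu]_x ((r x)%:E * (nnsfun_approx measurableT mg n (X x))%:E)).
Proof.
move=> g0; rewrite -monotone_convergence//=; last 3 first.
- move=> n; apply: emeasurable_funM => //; apply/measurable_EFinP => //.
  exact: measurableT_comp.
- by move=> n x _; rewrite mule_ge0// lee_fin.
- move=> x _ m n mn; apply: lee_wpmul2l; rewrite lee_fin//.
  by have /lefP := nd_nnsfun_approx measurableT mg mn; exact.
apply: eq_integral => x _; apply/esym/cvg_lim => //.
by apply: cvgeZl => //; apply: cvg_nnsfun_approx.
Qed.

(** The image of [r1 mu1] under [X1] and the image of [r2 mu2] under [X2] are measures on the same
    space; if they agree on measurable sets, they integrate nonnegative functions alike. This one
    form serves for the Gaussian density, for independence of increments, for random weights
    measurable at an earlier time, and for the change of measure. *)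
Lemma ge0_integral_transfer
    (mu1 : {measure set T1 -> \bar R}) (mu2 : {measure set T2 -> \bar R})
    (X1 : T1 -> T3) (X2 : T2 -> T3) (r1 : T1 -> R) (r2 : T2 -> R) :
  measurable_fun [set: T1] X1 -> measurable_fun [set: T2] X2 ->
  measurable_fun [set: T1] r1 -> measurable_fun [set: T2] r2 ->
  (forall x, 0 <= r1 x)%R -> (forall x, 0 <= r2 x)%R ->
  (forall U, measurable U -> \int[mu1]_x ((r1 x)%:E * (\1_U (X1 x))%:E) =
     \int[mu2]_x ((r2 x)%:E * (\1_U (X2 x))%:E)) ->
  forall g : T3 -> \bar R, measurable_fun [set: T3] g -> (forall x, 0 <= g x) ->
  \int[mu1]_x ((r1 x)%:E * g (X1 x)) = \int[mu2]_x ((r2 x)%:E * g (X2 x)).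
Proof.
move=> mX1 mX2 mr1 mr2 r1_ge0 r2_ge0 E g mg g0.
rewrite !(integral_nnsfun_approx_lim _ _ _ _ mg)//.
congr (limn _); apply/funext => n.
by rewrite !integral_nnsfun_density//; apply: eq_fsbigr => y _; rewrite E.
Qed.

End transfer.

Section real_expectation.
Local Open Scope ereal_scope.
Context d (T : measurableType d) (R : realType) (mu : {measure set T -> \bar R}).

Lemma limn_einf_supE (u : (\bar R)^nat) : limn_einf u = ereal_sup (range (einfs u)).
Proof. by rewrite limn_einf_lim; apply/cvg_lim => //; exact: cvg_einfs_sup. Qed.

Lemma limn_einf_ge_near (u : (\bar R)^nat) (a : \bar R) :
  (\forall n \near \oo, a <= u n) -> a <= limn_einf u.
Proof.
move=> [N _ aN]; rewrite limn_einf_supE.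
apply: (@le_trans _ _ (einfs u N)); last by apply: ereal_sup_ubound; exists N.
by apply: le_ereal_inf_tmp => _ [k /= Nk <-]; exact: aN.
Qed.

Lemma limn_einf_le_near (u : (\bar R)^nat) (c : \bar R) :
  (\forall n \near \oo, u n <= c) -> limn_einf u <= c.
Proof.
move=> [N _ cN]; rewrite limn_einf_supE.
apply: ge_ereal_sup => _ [n _ <-].
apply: (@le_trans _ _ (u (maxn n N))).
  by apply: ereal_inf_lbound; exists (maxn n N) => //=; exact: leq_maxl.
by apply: cN => /=; exact: leq_maxr.
Qed.

(** Fatou's lemma for real integrands, with an error [e] allowed both in the pointwise comparison
    and in the bound of the integrals. Estimates for simple processes pass to general processes
    through this form, which needs only a one-sided almost sure comparison. *)
Lemma fatou_ae_le (X : nat -> T -> R) (X0 : T -> R) (c : \bar R) :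
  (forall n, measurable_fun [set: T] (X n)) -> measurable_fun [set: T] X0 ->
  (forall n x, 0 <= X n x)%R -> (forall x, 0 <= X0 x)%R ->
  {ae mu, forall x, forall e, (0 < e)%R -> \forall n \near \oo, (X0 x <= X n x + e)%R} ->
  (forall e, (0 < e)%R -> \forall n \near \oo, \int[mu]_x (X n x)%:E <= c + e%:E) ->
  \int[mu]_x (X0 x)%:E <= c.
Proof.
move=> mX mX0 X_ge0 X0_ge0 Xle Xc.
have mXE n : measurable_fun [set: T] (fun x => (X n x)%:E) by exact/measurable_EFinP.
apply: (@le_trans _ _ (\int[mu]_x limn_einf (fun n => (X n x)%:E))).
  apply: ae_ge0_le_integral => //.
  - by move=> x _; rewrite lee_fin.
  - exact/measurable_EFinP.
  - by move=> x _; apply: limn_einf_ge_near; apply: nearW => n; rewrite lee_fin.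
  - under eq_fun do rewrite limn_einf_lim.
    apply: (emeasurable_fun_cvg (fun n x => einfs (fun k => (X k x)%:E) n)).
      by move=> n; exact: measurable_fun_einfs.
    by move=> x _; exact: is_cvg_einfs.
  apply: filterS Xle => x Xx _.
  apply/lee_addgt0Pr => e e0.
  rewrite -leeBlDr//; apply: limn_einf_ge_near.
  by apply: filterS (Xx e e0) => n; rewrite -EFinB lee_fin lerBlDr.
apply: (le_trans (fatou mu measurableT mXE _)).
  by move=> n x _; rewrite lee_fin.
by apply/lee_addgt0Pr => e e0; apply: limn_einf_le_near; exact: Xc.
Qed.

End real_expectation.

Lemma dotE (R : realType) n (x y : 'cV[R]_n) : dot x y = \sum_(i < n) x i 0 * y i 0.
Proof. by rewrite /dot mxE; apply: eq_bigr => i _; rewrite mxE. Qed.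

Lemma normal_prob_expR (R : realType) (s v : R) : s != 0 ->
  (\int[normal_prob 0 s]_x (expR (v * x))%:E = (expR (2^-1 * v ^+ 2 * s ^+ 2))%:E)%E.
Proof.
move=> s0.
have key : (\int[normal_prob 0 s]_x (1%:E * (expR (v * x))%:E) =
    \int[lebesgue_measure]_x ((normal_pdf 0 s x)%:E * (expR (v * x))%:E))%E.
  have := @ge0_integral_transfer _ _ _ _ _ _ R (normal_prob 0 s)
    (@lebesgue_measure R) id id (cst 1) (normal_pdf 0 s).
  move=> /(_ _ _ _ _ _ _ _ (fun x => (expR (v * x))%:E)); apply => //.
  - exact: measurable_normal_pdf.
  - by move=> x; exact: normal_pdf_ge0.
  - move=> U mU; under eq_integral do rewrite mul1e.
    rewrite integral_indic// setIT /= /normal_prob.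
    rewrite integral_mkcond; apply: eq_integral => x _.
    by rewrite patchE indicE; case: ifPn => _; rewrite ?mule1 ?mule0.
  - apply/measurable_EFinP; apply: measurableT_comp => //.
under eq_integral do rewrite -[(expR _)%:E]mul1e.
rewrite key.
(* Completing the square: tilting N(0, s^2) by exp(v x) gives a multiple of the density of N(v s^2,
   s^2), and the multiple is the moment sought. *)
have E x : (normal_pdf 0 s x * expR (v * x) =
    expR (2^-1 * v ^+ 2 * s ^+ 2) * normal_pdf (v * s ^+ 2) s x).
  rewrite !normal_pdfE//. rewrite -[LHS]mulrA [RHS]mulrCA; congr (_ * _).
  rewrite /normal_fun -!expRD; congr expR; rewrite -mulr_natl.
  by field.
under eq_integral do rewrite -EFinM E EFinM.
rewrite ge0_integralZl//.
- by rewrite integral_normal_pdf mule1.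
- by apply/measurable_EFinP; exact: measurable_normal_pdf.
- by move=> x _; rewrite lee_fin normal_pdf_ge0.
Qed.

Lemma ae_iff_measure d (T : measurableType d) (R : realType)
    (mu : {measure set T -> \bar R}) (C1 C2 : set T) :
  measurable C1 -> measurable C2 -> {ae mu, forall w, C1 w <-> C2 w} ->
  mu C1 = mu C2.
Proof.
move=> mC1 mC2 CC; rewrite -[C1]setIT -[C2]setIT -!integral_indic//.
apply: ge0_ae_eq_integral => //; try by move=> x _; rewrite lee_fin.
- by apply/measurable_EFinP; exact: measurable_indic.
- by apply/measurable_EFinP; exact: measurable_indic.
apply: filterS CC => w CC _; rewrite !indicE; congr (_ %:R%:E).
by rewrite (_ : (w \in C1) = (w \in C2))//; apply/idP/idP; rewrite !inE => /CC.
Qed.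

(** * Brownian increments and the augmented filtration *)

Section filtration.
Context d (Omega : measurableType d) (R : realType) (P : probability Omega R)
  (T : R) (m : nat) (B : R -> Omega -> 'cV[R]_m).

Lemma augmented_genS (s t : R) : s <= t ->
  <<s augmented_gen P B s >> `<=` <<s augmented_gen P B t >>.
Proof.
move=> st; apply: sub_sigma_algebra2 => A [[u [i [U [/andP[u0 us] mU ->]]]]|].
  by left; exists u, i, U; rewrite u0 (le_trans us).
by right.
Qed.

Lemma measurable_fun_gen (C1 C2 : set (set Omega)) d' (S : measurableType d')
    (X : Omega -> S) : <<s C1 >> `<=` <<s C2 >> ->
  measurable_fun [set: g_sigma_algebraType C1] (X : g_sigma_algebraType C1 -> S) ->
  measurable_fun [set: g_sigma_algebraType C2] (X : g_sigma_algebraType C2 -> S).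
Proof. by move=> C12 mX _ Y mY; apply: C12; exact: mX. Qed.

Lemma filtration_measurableS (s t : R) (X : Omega -> R) : s <= t ->
  filtration_measurable P B s X -> filtration_measurable P B t X.
Proof. by move=> st; apply: measurable_fun_gen; exact: augmented_genS. Qed.

Lemma filtration_measurable_B (s t : R) (i : 'I_m) : 0 <= s <= t ->
  filtration_measurable P B t (fun w => B s w i 0).
Proof.
move=> st _ Y mY; rewrite setTI; apply: sub_sigma_algebra; left.
by exists s, i, Y.
Qed.

Hypothesis P_complete : measure_is_complete P.
Hypothesis B_brownian : is_brownian_motion P T B.

Lemma augmented_gen_measurable (t : R) : t <= T ->
  <<s augmented_gen P B t >> `<=` measurable.
Proof.
move=> tT; apply: smallest_sub; first exact: sigma_algebra_measurable.
move=> A [[u [i [U [/andP[u0 us] mU ->]]]]|]; last exact: P_complete.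
have [mB _ _ _] := B_brownian.
have := mB u i; rewrite u0 (le_trans us tT) => /(_ isT) /(_ measurableT _ mU).
by rewrite setTI.
Qed.

Lemma measurable_fun_filtration d' (S : measurableType d') (t : R)
    (X : Omega -> S) : t <= T ->
  measurable_fun [set: g_sigma_algebraType (augmented_gen P B t)]
    (X : g_sigma_algebraType (augmented_gen P B t) -> S) ->
  measurable_fun [set: Omega] X.
Proof.
by move=> tT mX _ Y mY; apply: (augmented_gen_measurable tT); exact: mX.
Qed.

(** The sets that agree almost surely with some set of the natural filtration form a sigma-algebra.
    It contains both kinds of generators, a negligible set being compared with the empty set.
    Independence of the increments, given for the natural filtration, thereby extends to the
    augmented one. *)
Lemma augmented_gen_natural (t : R) (A : set Omega) :
  <<s augmented_gen P B t >> A ->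
  exists2 A', <<s natural_gen B t >> A' & {ae P, forall w, A w <-> A' w}.
Proof.
pose E := [set A | exists2 A', <<s natural_gen B t >> A' & {ae P, forall w, A w <-> A' w}].
suff : <<s augmented_gen P B t >> `<=` E by exact.
apply: smallest_sub.
  split.
  - by exists set0; [exact: sigma_algebra0|exact: aeW].
  - move=> A1 [A2 sA2 A12]; exists (setT `\` A2).
      by have [_ h _] := @smallest_sigma_algebra _ setT (natural_gen B t); exact: h.
    apply: filterS A12 => w A12; rewrite /setD/=; split=> -[_] nA; split => //.
      by move=> /A12.
    by move=> /A12.
  - move=> A1 h; have /choice[A2 hA2] : forall n, exists A', <<s natural_gen B t >> A' /\
      {ae P, forall w, A1 n w <-> A' w}.
      by move=> n; have [A' ? ?] := h n; exists A'.
    exists (\bigcup_n A2 n).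
      have [_ _ h'] := @smallest_sigma_algebra _ setT (natural_gen B t).
      by apply: h' => n; have [] := hA2 n.
    have /ae_foralln : forall n, {ae P, forall w, A1 n w <-> A2 n w}.
      by move=> n; have [] := hA2 n.
    by apply: filterS => w hw; split=> -[n _ /hw ?]; exists n.
move=> A1 [nA1|nA1].
  by exists A1; [exact: sub_sigma_algebra|exact: aeW].
exists set0; first exact: sigma_algebra0.
have [N [mN N0 A1N]] := nA1; exists N; split => // w /= nw; apply: A1N.
by apply: contrapT => nA; apply: nw.
Qed.

Lemma augmented_independence (s t : R) : 0 <= s -> s < t -> t <= T ->
  forall A, <<s augmented_gen P B s >> A ->
  forall U : 'I_m -> set R, (forall i, measurable (U i)) ->
    P (A `&` [set w | forall i, U i ((B t w - B s w) i 0)]) =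
    (P A * \prod_(i < m) normal_prob 0%R (Num.sqrt (t - s)%R) (U i))%E.
Proof.
move=> s0 st tT A FA U mU.
have [A' FA' AA'] := augmented_gen_natural FA.
have [mB _ _ ind] := B_brownian.
have mA : measurable A by apply: augmented_gen_measurable FA; rewrite (le_trans (ltW st)).
have mA' : measurable A'.
  apply: (@augmented_gen_measurable s); first by rewrite (le_trans (ltW st)).
  by apply: sub_sigma_algebra2 FA' => C; left.
have mbox : measurable [set w | forall i, U i ((B t w - B s w) i 0)].
  rewrite (_ : [set w | _] = \bigcap_(i in [set: 'I_m])
      ((fun w => (B t w - B s w) i 0) @^-1` (U i))).
    apply: fin_bigcap_measurable => // i _.
    rewrite -[X in measurable X]setTI.
    suff : measurable_fun [set: Omega] (fun w => (B t w - B s w) i 0).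
      by apply => //.
    under eq_fun do rewrite !mxE.
    apply: measurable_funB; apply: mB.
      by rewrite (le_trans s0 (ltW st)).
    by rewrite s0 (le_trans (ltW st)).
  by apply/seteqP; split => w /= h i; [move=> _|]; exact: h.
rewrite (ae_iff_measure mA mA' AA') -ind//.
apply: ae_iff_measure => //; try exact: measurableI.
by apply: filterS AA' => w AA'; split=> -[/AA'? ?].
Qed.

Local Notation dB s t i := (fun w : Omega => (B t w - B s w)%R i 0%R).

Lemma measurable_increment (s t : R) (i : 'I_m) : 0 <= s -> s <= t -> t <= T ->
  measurable_fun [set: Omega] (dB s t i).
Proof.
move=> s0 st tT; have [mB _ _ _] := B_brownian.
under eq_fun do rewrite !mxE.
apply: measurable_funB; apply: mB.
  by rewrite (le_trans s0 st).
by rewrite s0 (le_trans st).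
Qed.

Lemma prod_indic n (x : 'I_n -> R) (U : 'I_n -> set R) :
  \prod_(i < n) (\1_(U i) (x i) : R) = (`[< forall i, U i (x i) >])%:R.
Proof.
case: asboolP => [h|/existsNP[i ni]].
  by rewrite big1// => i _; rewrite indicE mem_set//; exact: h.
by rewrite (bigD1 i)//= indicE memNset// mul0r.
Qed.

(* Induction on the number k of coordinates in which the indicator of a box has
   been replaced by an exponential. *)
Lemma increment_expR_box (s t : R) (A : set Omega) (v : 'cV[R]_m) (k : nat)
    (U : 'I_m -> set R) : 0 <= s -> s < t -> t <= T ->
  <<s augmented_gen P B s >> A -> (forall i, measurable (U i)) ->
  (\int[P]_w (\1_A w * \prod_(i < m)
     (if (i < k)%N then expR (v i 0 * dB s t i w) else \1_(U i) (dB s t i w)))%R%:E =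
   (fine (P A) * \prod_(i < m) (if (i < k)%N
      then expR (2^-1 * v i 0 ^+ 2 * (t - s))
      else fine (normal_prob 0 (Num.sqrt (t - s)) (U i))))%R%:E)%E.
Proof.
move=> s0 st tT FA.
have mA : measurable A by apply: augmented_gen_measurable FA; rewrite (le_trans (ltW st)).
have mX i : measurable_fun [set: Omega] (dB s t i) by apply: measurable_increment => //; exact: ltW.
elim: k U => [|k IH] U mU.
  have -> : (\int[P]_w (\1_A w * \prod_(i < m) \1_(U i) (dB s t i w))%R%:E =
      P (A `&` [set w | forall i, U i ((B t w - B s w)%R i 0%R)]))%E.
    rewrite -[in RHS](setIT (A `&` _)) -integral_indic//; last first.
      apply: measurableI => //.
      rewrite (_ : [set w | _] = \bigcap_(i in [set: 'I_m]) (dB s t i @^-1` (U i))).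
        apply: fin_bigcap_measurable => // i _.
        by rewrite -[X in measurable X]setTI; exact: mX.
      by apply/seteqP; split => w /= h i; [move=> _|]; exact: h.
    apply: eq_integral => w _; rewrite prod_indic !indicE in_setI -mulnb natrM.
    rewrite (_ : (w \in [set w | _]) = `[< forall i, U i (dB s t i w) >])//.
  rewrite augmented_independence// EFinM fineK ?fin_num_measure//.
  rewrite -prodEFin; congr (_ * _)%E; apply: eq_bigr => i _.
  by rewrite fineK//; apply: (fin_num_measure (normal_prob 0 (Num.sqrt (t - s)))); exact: mU.
have [km|mk] := ltnP k m; last first.
  have lk (i : 'I_m) : (i < k)%N by rewrite (leq_trans (ltn_ord i)).
  have lkS (i : 'I_m) : (i < k.+1)%N by rewrite ltnS ltnW.
  have := IH U mU.
  under eq_integral do under eq_bigr do rewrite lk.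
  under eq_bigr do rewrite lk.
  move=> {}IH; under eq_integral do under eq_bigr do rewrite lkS.
  by under [in RHS]eq_bigr do rewrite lkS.
pose k' := Ordinal km.
pose g (i : 'I_m) (x : R) : R := if (i < k)%N then expR (v i 0 * x) else \1_(U i) x.
pose e (i : 'I_m) : R := if (i < k)%N then expR (2^-1 * v i 0 ^+ 2 * (t - s))
  else fine (normal_prob 0 (Num.sqrt (t - s)) (U i)).
pose r (w : Omega) : R := \1_A w * \prod_(i < m | i != k') g i (dB s t i w).
pose c : R := fine (P A) * \prod_(i < m | i != k') e i.
have sig0 : Num.sqrt (t - s) != 0 by rewrite gt_eqF// sqrtr_gt0 subr_gt0.
have e_ge0 i : 0 <= e i by rewrite /e; case: ifPn => // _; rewrite ?expR_ge0 ?fine_ge0.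
have c_ge0 : 0 <= c by rewrite mulr_ge0 ?fine_ge0// prodr_ge0.
have keq (i : 'I_m) : i != k' -> (i < k.+1)%N = (i < k)%N.
  move=> ik; rewrite ltnS leq_eqVlt orbC; case: ltnP => //= _.
  by apply: contraNF ik => /eqP ik; apply/eqP/val_inj.
have mg i : measurable_fun [set: R] (g i).
  rewrite /g; case: (_ < _)%N; last exact: measurable_indic.
  by apply: measurableT_comp => //; exact: measurable_funM.
(* Only coordinate [k] moves: the weight [r] carries [A] and all other coordinates, and the
   agreement on a set V required for the transfer is the induction hypothesis for the box whose side
   [k] is V. *)
have := @ge0_integral_transfer _ _ _ _ _ _ R P
    (normal_prob 0 (Num.sqrt (t - s))) (dB s t k') id r (cst c).
move=> /(_ _ _ _ _ _ _ _ (fun x => (expR (v k' 0 * x))%:E)) H.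
transitivity (\int[P]_x ((r x)%:E * (expR (v k' 0 * dB s t k' x))%:E))%E.
  apply: eq_integral => w _; rewrite -EFinM; congr EFin.
  rewrite (bigD1 k')//= ltnSn /r [RHS]mulrAC mulrA; congr (_ * _).
  by apply: eq_bigr => i ik; rewrite keq.
rewrite H//.
- under eq_integral do rewrite /=.
  rewrite ge0_integralZl//.
  + rewrite normal_prob_expR// -EFinM sqr_sqrtr ?subr_ge0 ?ltW//; congr EFin.
    rewrite [in RHS](bigD1 k')//= ltnSn.
    rewrite [in RHS](eq_bigr e); last by move=> i ik; rewrite keq.
    by rewrite /c; ring.
  + apply/measurable_EFinP; apply: measurableT_comp => //; exact: measurable_funM.
- rewrite /r; under eq_fun do rewrite big_mkcond.
  apply: measurable_funM => //; apply: measurable_prod => i _.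
  by case: (i != k') => //; apply: measurableT_comp; [exact: mg|exact: mX].
- move=> w; rewrite mulr_ge0// prodr_ge0// => i _; rewrite /g.
  by case: ifPn => // _; rewrite expR_ge0.
- move=> V mV; pose U' i := if i == k' then V else U i.
  have mU' i : measurable (U' i) by rewrite /U'; case: ifPn.
  transitivity (\int[P]_w (\1_A w * \prod_(i < m)
     (if (i < k)%N then expR (v i 0 * dB s t i w) else \1_(U' i) (dB s t i w)))%R%:E)%E.
    apply: eq_integral => w _; rewrite -EFinM; congr EFin.
    rewrite [in RHS](bigD1 k')//= ltnn {1}/U' eqxx /r mulrAC -mulrA; congr (_ * (_ * _)).
    by apply: eq_bigr => i ik; rewrite /U' (negbTE ik).
  rewrite IH//; under [RHS]eq_integral do rewrite /=.
  rewrite ge0_integralZl//; last first.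
    by apply/measurable_EFinP; exact: measurable_indic.
  rewrite integral_indic// setIT.
  have NV := fin_num_measure (normal_prob 0 (Num.sqrt (t - s))) V mV.
  rewrite -[X in (_ * X)%E]fineK// -EFinM; congr EFin.
  rewrite [in LHS](bigD1 k')//= ltnn {1}/U' eqxx.
  rewrite (eq_bigr e); last by move=> i ik; rewrite /U' (negbTE ik).
  by rewrite /c; ring.
- by apply/measurable_EFinP; apply: measurableT_comp => //; exact: measurable_funM.
Qed.

Lemma increment_expR (s t : R) (A : set Omega) (v : 'cV[R]_m) :
  0 <= s -> s < t -> t <= T -> <<s augmented_gen P B s >> A ->
  (\int[P]_w (\1_A w * expR (dot v (B t w - B s w)
     - 2^-1 * dot v v * (t - s)))%R%:E = P A)%E.
Proof.
move=> s0 st tT FA.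
have mA : measurable A by apply: augmented_gen_measurable FA; rewrite (le_trans (ltW st)).
have := @increment_expR_box s t A v m (fun=> setT) s0 st tT FA (fun=> measurableT).
under eq_integral do under eq_bigr do rewrite ltn_ord.
under eq_bigr do rewrite ltn_ord.
have -> : \prod_(i < m) expR (2^-1 * v i 0 ^+ 2 * (t - s)) = expR (2^-1 * dot v v * (t - s)).
  rewrite -expR_sum dotE mulr_sumr mulr_suml; congr expR.
move=> E.
have mX i : measurable_fun [set: Omega] (dB s t i) by apply: measurable_increment => //; exact: ltW.
transitivity (\int[P]_w ((expR (- (2^-1 * dot v v * (t - s))))%:E *
  (\1_A w * \prod_(i < m) expR (v i 0 * dB s t i w))%R%:E))%E.
  apply: eq_integral => w _; rewrite -EFinM; congr EFin.
  by rewrite -expR_sum -dotE expRD; ring.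
rewrite ge0_integralZl ?lee_fin ?expR_ge0//.
- rewrite E -EFinM mulrCA -expRD addNr expR0 mulr1 fineK// fin_num_measure//.
- apply/measurable_EFinP; apply: measurable_funM => //.
  apply: measurable_prod => i _; apply: measurableT_comp => //.
  by apply: measurable_funM => //; exact: mX.
- by move=> w _; rewrite lee_fin mulr_ge0// prodr_ge0// => i _; rewrite expR_ge0.
Qed.

(** If every coordinate of h is at most C in absolute value, then exp(h.x) is at most the term of
    this sum whose signs are those of x. The sum is thus an integrable dominating function valid for
    all such h at once. *)
Lemma integral_sum_signs (s t C : R) : 0 <= s -> s < t -> t <= T ->
  (\int[P]_w (\sum_(f : {ffun 'I_m -> bool})
     expR (dot (\col_i (if f i then C else - C)) (B t w - B s w)))%R%:E < +oo)%E.
Proof.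
move=> s0 st tT.
have mX i : measurable_fun [set: Omega] (dB s t i) by apply: measurable_increment => //; exact: ltW.
have mE (v : 'cV[R]_m) : measurable_fun [set: Omega] (fun w => expR (dot v (B t w - B s w))).
  apply: measurableT_comp => //; under eq_fun do rewrite dotE.
  apply: measurable_sum => i; apply: measurable_funM => //; exact: mX.
under eq_integral do rewrite -sumEFin.
rewrite ge0_integral_sum//; last by move=> f; apply/measurable_EFinP; exact: mE.
apply: lte_sum_pinfty => f _.
set v := \col_i _.
have mT : <<s augmented_gen P B s >> [set: Omega].
  exact: (@measurableT _ (g_sigma_algebraType (augmented_gen P B s))).
have := @increment_expR s t [set: Omega] v s0 st tT mT.
rewrite probability_setT => E.
have <- : (\int[P]_w ((expR (2^-1 * dot v v * (t - s)))%:E * (\1_[set: Omega] w *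
    expR (dot v (B t w - B s w) - 2^-1 * dot v v * (t - s)))%:E) =
  \int[P]_w (expR (dot v (B t w - B s w)))%:E)%E.
  apply: eq_integral => w _; rewrite -EFinM indicT mul1r -expRD.
  by congr (expR _)%:E; ring.
rewrite ge0_integralZl ?lee_fin ?expR_ge0//; last first.
  apply/measurable_EFinP; apply: measurable_funM => //.
  under eq_fun do rewrite expRD; apply: measurable_funM => //; exact: mE.
by rewrite E mule1 ltry.
Qed.

Definition exp_increment (h x : 'cV[R]_m) (a : R) : R :=
  expR (dot h x - 2^-1 * dot h h * a).

Lemma measurable_dot d' (S : measurableType d') (D : set S) (f g : S -> 'cV[R]_m) :
  (forall i, measurable_fun D (fun w => f w i 0)) ->
  (forall i, measurable_fun D (fun w => g w i 0)) ->
  measurable_fun D (fun w => dot (f w) (g w)).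
Proof.
move=> mf mg; under eq_fun do rewrite dotE.
by apply: measurable_sum => i; apply: measurable_funM.
Qed.

(** For an exponent with finitely many values, split [A] according to the value taken: on each piece
    the exponent is deterministic and the piece is still known at time [s]. *)
Lemma exp_increment_random_finite (s t : R) (A : set Omega) (M : nat)
    (c : 'I_m -> Omega -> nat) (u : nat -> R) :
  0 <= s -> s < t -> t <= T -> <<s augmented_gen P B s >> A ->
  (forall i w, (c i w < M)%N) ->
  (forall i j, <<s augmented_gen P B s >> [set w | c i w = j]) ->
  (\int[P]_w (\1_A w *
     exp_increment (\col_i u (c i w)) (B t w - B s w) (t - s))%R%:E = P A)%E.
Proof.
move=> s0 st tT FA cM mc.
pose S (f : {ffun 'I_m -> 'I_M}) : set Omega := [set w | forall i, c i w = f i].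
pose v (f : {ffun 'I_m -> 'I_M}) : 'cV[R]_m := \col_i u (f i).
have FS f : <<s augmented_gen P B s >> (A `&` S f).
  pose Ft := g_sigma_algebraType (augmented_gen P B s).
  apply: (@measurableI _ Ft) => //.
  rewrite (_ : S f = \bigcap_(i in [set: 'I_m]) [set w | c i w = f i]); last first.
    by apply/seteqP; split => w /= h i; [move=> _|]; exact: h.
  by apply: (@fin_bigcap_measurable _ Ft) => // i _; exact: mc.
have sT : s <= T by rewrite (le_trans (ltW st)).
have mFS f : measurable (A `&` S f) by exact: augmented_gen_measurable (FS f).
have sum1 w (g : {ffun 'I_m -> 'I_M} -> R) :
    \sum_f \1_(A `&` S f) w * g f = \1_A w * g [ffun i => Ordinal (cM i w)].
  rewrite (bigD1 [ffun i => Ordinal (cM i w)])//= big1 ?addr0.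
    rewrite !indicE; congr (_%:R * _); congr nat_of_bool.
    apply/idP/idP; rewrite !inE; first by case.
    by move=> Aw; split=> // i; rewrite ffunE.
  move=> f /eqP fn; rewrite indicE memNset ?mul0r// => -[_ fw]; apply: fn.
  by apply/ffunP => i; apply/val_inj; rewrite ffunE/= fw.
transitivity (\int[P]_w \sum_f (\1_(A `&` S f) w *
    exp_increment (v f) (B t w - B s w) (t - s))%:E)%E.
  apply: eq_integral => w _; rewrite sumEFin; congr EFin.
  rewrite (sum1 w (fun f => exp_increment (v f) (B t w - B s w) (t - s))).
  suff -> : \col_i u (c i w) = v [ffun i => Ordinal (cM i w)] by [].
  by apply/colP => i; rewrite !mxE ffunE.
rewrite ge0_integral_sum//; last 2 first.
- move=> f; apply/measurable_EFinP; apply: measurable_funM => //.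
  apply: measurableT_comp => //; apply: measurable_funB => //.
  by apply: measurable_dot => // i; apply: measurable_increment => //; exact: ltW.
- by move=> f w _; rewrite lee_fin mulr_ge0// expR_ge0.
under eq_bigr do rewrite increment_expR//.
have -> : P A = (\sum_f (\int[P]_w (\1_(A `&` S f) w)%:E))%E.
  rewrite -ge0_integral_sum//; last first.
    by move=> f; apply/measurable_EFinP; exact: measurable_indic.
  rewrite -[in LHS](setIT A) -integral_indic//; last first.
    exact: augmented_gen_measurable FA.
  apply: eq_integral => w _; rewrite sumEFin; congr EFin.
  have := sum1 w (fun=> 1); rewrite mulr1 => <-.
  by apply: eq_bigr => f _; rewrite mulr1.
by apply: eq_bigr => f _; rewrite integral_indic// setIT.
Qed.

Lemma measurable_exp_increment (s t : R) (h : Omega -> 'cV[R]_m) :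
  0 <= s -> s < t -> t <= T ->
  (forall i, filtration_measurable P B s (fun w => h w i 0)) ->
  measurable_fun [set: Omega]
    (fun w => exp_increment (h w) (B t w - B s w) (t - s)).
Proof.
move=> s0 st tT mh.
have {}mh i : measurable_fun [set: Omega] (fun w => h w i 0).
  by apply: (@measurable_fun_filtration _ _ s); [rewrite (le_trans (ltW st))|exact: mh].
apply: measurableT_comp => //; apply: measurable_funB; last first.
  by do 2!(apply: measurable_funM => //); exact: measurable_dot.
by apply: measurable_dot => // i; apply: measurable_increment => //; exact: ltW.
Qed.

Lemma exp_increment_random_indic (s t : R) (A : set Omega) (K : R)
    (h : Omega -> 'cV[R]_m) :
  0 <= s -> s < t -> t <= T -> <<s augmented_gen P B s >> A ->
  (forall i, filtration_measurable P B s (fun w => h w i 0)) ->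
  (forall i w, `|h w i 0| <= K) ->
  (\int[P]_w (\1_A w *
     exp_increment (h w) (B t w - B s w) (t - s))%R%:E = P A)%E.
Proof.
move=> s0 st tT FA mh hK.
have sT : s <= T by rewrite (le_trans (ltW st)).
(* Each coordinate is rounded down to the grid of step 1/(n+1) starting at -K. The shift by K makes
   the rounded index a natural number, and boundedness leaves finitely many of them. *)
pose c n (i : 'I_m) w : nat := Num.truncn ((h w i 0 + K) * n.+1%:R).
pose u n (j : nat) : R := j%:R / n.+1%:R - K.
pose hn n w : 'cV[R]_m := \col_i u n (c n i w).
have hK0 i w : 0 <= h w i 0 + K by have := hK i w; rewrite ler_norml; lra.
have hnh n i w : `|hn n w i 0 - h w i 0| <= n.+1%:R^-1.
  have := truncn_itv (mulr_ge0 (hK0 i w) (ler0n R n.+1)).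
  rewrite mxE /u -/(c n i w) => /andP[c1 c2].
  have n0 : (0 : R) < n.+1%:R by [].
  rewrite -addrA -opprD (addrC K) -ler_pdivrMr// in c1 *.
  rewrite -ltr_pdivlMr// -natr1 mulrDl mul1r in c2.
  move: ((c n i w)%:R / n.+1%:R : R) (n.+1%:R^-1 : R) c1 c2 => a e c1 c2.
  by rewrite ler_norml; apply/andP; split; lra.
have cM n i w : (c n i w < (Num.truncn ((K + K) * n.+1%:R)).+1)%N.
  rewrite ltnS; apply: le_truncn; rewrite ler_wpM2r//.
  by have := hK i w; rewrite ler_norml; lra.
have mc n i j : <<s augmented_gen P B s >> [set w | c n i w = j].
  pose Ft := g_sigma_algebraType (augmented_gen P B s).
  have mg : measurable_fun [set: Ft] (fun w => (h w i 0 + K) * n.+1%:R).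
    by apply: measurable_funM => //; apply: measurable_funD => //; exact: mh.
  have := mg (@measurableT _ Ft) _ (measurable_itv `[j%:R, j.+1%:R[).
  rewrite setTI; congr (_ _); apply/seteqP; split => w /=; rewrite in_itv/=.
    exact: truncn_def.
  by move=> <-; apply: truncn_itv; rewrite mulr_ge0.
have mA : measurable A by exact: augmented_gen_measurable FA.
have mhn n i : filtration_measurable P B s (fun w => hn n w i 0).
  pose Ft := g_sigma_algebraType (augmented_gen P B s).
  move=> _ Y mY; rewrite setTI.
  rewrite (_ : _ @^-1` Y = \bigcup_(j in [set j | Y (u n j)]) [set w | c n i w = j]).
    by apply: (@bigcup_measurable _ Ft) => j _; exact: mc.
  apply/seteqP; split => w /=; rewrite mxE; first by move=> ?; exists (c n i w).
  by move=> [j /= Yj jw]; rewrite jw.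
pose F n w : \bar R := (\1_A w * exp_increment (hn n w) (B t w - B s w) (t - s))%:E.
pose F0 w : \bar R := (\1_A w * exp_increment (h w) (B t w - B s w) (t - s))%:E.
(* The bound is K + 1 rather than K to leave room for the rounding error, which is at most 1. *)
pose G w : \bar R := (\sum_(f : {ffun 'I_m -> bool})
     expR (dot (\col_i (if f i then K + 1 else - (K + 1))) (B t w - B s w)))%:E.
have mF n : measurable_fun [set: Omega] (F n).
  apply/measurable_EFinP; apply: measurable_funM => //.
  exact: measurable_exp_increment.
have FF0 w : [set: Omega] w -> F ^~ w @ \oo --> F0 w.
  move=> _; apply: cvg_EFin; first exact: nearW.
  apply: cvgM; first exact: cvg_cst.
  apply: continuous_cvg; first exact: continuous_expR.
  have hi i : (fun n => hn n w i 0) @ \oo --> h w i 0.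
    apply/cvgrPdist_le => e e0.
    have [N _ HN] := near_infty_natSinv_lt (PosNum e0).
    exists N => // n /= Nn; rewrite distrC (le_trans (hnh n i w))//.
    by apply: ltW; exact: HN.
  under eq_fun do rewrite !dotE; rewrite !dotE.
  apply: cvgB.
    by apply: cvg_big => [|i _]; [exact: add_continuous|]; apply: cvgM; [exact: hi|exact: cvg_cst].
  apply: cvgM; last exact: cvg_cst.
  apply: cvgM; first exact: cvg_cst.
  by apply: cvg_big => [|i _]; [exact: add_continuous|]; apply: cvgM; exact: hi.
have iG : P.-integrable [set: Omega] G.
  apply/integrableP; split.
    apply/measurable_EFinP; apply: measurable_sum => f.
    apply: measurableT_comp => //; apply: measurable_dot => // i.
    by apply: measurable_increment => //; exact: ltW.
  under eq_integral do rewrite gee0_abs ?lee_fin ?sumr_ge0// => *; rewrite ?expR_ge0//.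
  exact: integral_sum_signs.
have FG n w : [set: Omega] w -> (`|F n w| <= G w)%E.
  move=> _; rewrite /F /G abse_EFin lee_fin ger0_norm; last by rewrite mulr_ge0// expR_ge0.
  (* The signs of the increment select the dominating term; the other terms of the sum are
     nonnegative. *)
  pose f : {ffun 'I_m -> bool} := [ffun i => 0 <= (B t w - B s w) i 0].
  rewrite (bigD1 f)//= -[leLHS]addr0 lerD//; last by rewrite sumr_ge0// => *; exact: expR_ge0.
  apply: (@le_trans _ _ (exp_increment (hn n w) (B t w - B s w) (t - s))).
    by rewrite ler_piMl ?expR_ge0// indicE; case: (_ \in _).
  rewrite ler_expR lerBlDr -[leLHS]addr0 lerD//; last first.
    rewrite !mulr_ge0 ?subr_ge0 ?(ltW st)// dotE sumr_ge0// => i _.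
    by rewrite -expr2 sqr_ge0.
  rewrite !dotE ler_sum// => i _.
  have hnK : `|hn n w i 0| <= K + 1.
    rewrite -[X in `|X|](subrK (h w i 0)) (le_trans (ler_normD _ _))//.
    rewrite addrC lerD// (le_trans (hnh n i w))// invf_le1// ler1n//.
  rewrite [X in _ <= X * _]mxE ffunE.
  move: hnK ((B t w - B s w) i 0) => + x; rewrite ler_norml => /andP[].
  by move: (hn n w i 0) => y y1 y2; case: (leP 0 x) => x0; nra.
have := @dominated_cvg _ _ _ P _ measurableT F F0 G mF FF0 _ iG FG.
rewrite (_ : (fun n => _) = cst (P A)); last first.
  by apply/funext => n; exact: (@exp_increment_random_finite s t A _ (c n) (u n)).
by move=> /(_ _)/cvg_lim <-//; rewrite lim_cst.
Qed.

Lemma exp_increment_random (s t : R) (W : Omega -> R) (K : R)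
    (h : Omega -> 'cV[R]_m) :
  0 <= s -> s < t -> t <= T ->
  filtration_measurable P B s W -> (forall w, 0 <= W w) ->
  (forall i, filtration_measurable P B s (fun w => h w i 0)) ->
  (forall i w, `|h w i 0| <= K) ->
  (\int[P]_w (W w * exp_increment (h w) (B t w - B s w) (t - s))%R%:E =
   \int[P]_w (W w)%:E)%E.
Proof.
move=> s0 st tT mW W0 mh hK.
have sT : s <= T by rewrite (le_trans (ltW st)).
pose Ft := g_sigma_algebraType (augmented_gen P B s).
have mid : measurable_fun [set: Omega] (id : Omega -> Ft).
  by move=> _ Y mY; rewrite setTI; exact: augmented_gen_measurable mY.
(* Both maps are the identity into Omega endowed with the sigma-algebra of time [s]. The test
   functions are then exactly the weights [W], and the test sets are those treated in
   [exp_increment_random_indic]. *)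
have := @ge0_integral_transfer _ _ _ Omega Omega Ft R P P id id
  (fun w => exp_increment (h w) (B t w - B s w) (t - s)) (cst 1).
move=> /(_ _ _ _ _ _ _ _ (fun w => (W w)%:E)) E.
transitivity (\int[P]_w ((exp_increment (h w) (B t w - B s w) (t - s))%:E * (W w)%:E))%E.
  by apply: eq_integral => w _; rewrite -EFinM mulrC.
rewrite E//.
- by under eq_integral do rewrite mul1e.
- exact: measurable_exp_increment.
- by move=> w; exact: expR_ge0.
- move=> U FU; under [RHS]eq_integral do rewrite mul1e.
  rewrite integral_indic//; last exact: augmented_gen_measurable FU.
  rewrite setIT.
  etransitivity; last exact: (exp_increment_random_indic s0 st tT FU mh hK).
  by apply: eq_integral => w _; rewrite -EFinM mulrC.
- by apply/measurable_EFinP.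
Qed.

End filtration.

(** * Algebra of the scalar product *)

Section dot.
Context (R : realType) (n : nat).
Implicit Types (x y z : 'cV[R]_n) (a : R).

Lemma dotC x y : dot x y = dot y x.
Proof. by rewrite !dotE; apply: eq_bigr => i _; rewrite mulrC. Qed.

Lemma dotDr x y z : dot x (y + z) = dot x y + dot x z.
Proof. by rewrite /dot mulmxDr mxE. Qed.

Lemma dotZr a x y : dot x (a *: y) = a * dot x y.
Proof. by rewrite /dot -scalemxAr mxE. Qed.

Lemma dotDl x y z : dot (x + y) z = dot x z + dot y z.
Proof. by rewrite dotC dotDr !(dotC z). Qed.

Lemma dotZl a x y : dot (a *: x) y = a * dot x y.
Proof. by rewrite dotC dotZr dotC. Qed.

Lemma dotNr x y : dot x (- y) = - dot x y.
Proof. by rewrite -scaleN1r dotZr mulN1r. Qed.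

Lemma dotNl x y : dot (- x) y = - dot x y.
Proof. by rewrite dotC dotNr dotC. Qed.

Lemma dotBr x y z : dot x (y - z) = dot x y - dot x z.
Proof. by rewrite dotDr dotNr. Qed.

Lemma dotBl x y z : dot (x - y) z = dot x z - dot y z.
Proof. by rewrite dotDl dotNl. Qed.

Lemma dot0r x : dot x 0 = 0.
Proof. by rewrite -(scale0r (0 : 'cV[R]_n)) dotZr mul0r. Qed.

Lemma dot0l x : dot 0 x = 0.
Proof. by rewrite dotC dot0r. Qed.

Lemma dot_sumr (I : Type) (s : seq I) (p : pred I) x (F : I -> 'cV[R]_n) :
  dot x (\sum_(i <- s | p i) F i) = \sum_(i <- s | p i) dot x (F i).
Proof. by apply: (big_morph (dot x)) => [y z|]; rewrite ?dotDr ?dot0r. Qed.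

Lemma dot_suml (I : Type) (s : seq I) (p : pred I) x (F : I -> 'cV[R]_n) :
  dot (\sum_(i <- s | p i) F i) x = \sum_(i <- s | p i) dot (F i) x.
Proof. by rewrite dotC dot_sumr; apply: eq_bigr => i _; rewrite dotC. Qed.

Lemma dot_ge0 x : 0 <= dot x x.
Proof. by rewrite dotE sumr_ge0// => i _; rewrite -expr2 sqr_ge0. Qed.

Lemma enorm_sqr x : enorm x ^+ 2 = dot x x.
Proof. by rewrite /enorm sqr_sqrtr// dot_ge0. Qed.

End dot.

(** * Simple processes on grids *)

Section grid.
Context (R : realType) (T : R).
Hypothesis T_gt0 : 0 < T.

Definition is_grid (N : nat) (r : nat -> R) : Prop :=
  [/\ r 0%N = 0, r N = T & forall k, (k < N)%N -> r k < r k.+1].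

Definition on_grid (N : nat) (r : nat -> R) (x : R) : Prop :=
  exists2 k, (k <= N)%N & x = r k.

Lemma grid_exists (l : seq R) : (forall x, x \in l -> 0 <= x <= T) ->
  exists N r, is_grid N r /\ forall x, x \in l -> on_grid N r x.
Proof.
move=> l0T; pose g := sort <=%R (undup (0 :: T :: l)).
have gE x : x \in g = (x \in 0 :: T :: l) by rewrite mem_sort mem_undup.
have g0T x : x \in g -> 0 <= x <= T.
  by rewrite gE !inE => /or3P[/eqP->|/eqP->|/l0T//]; rewrite lexx ltW.
have g0 : 0 \in g by rewrite gE inE eqxx.
have gT : T \in g by rewrite gE !inE eqxx orbT.
have sg : sorted <%R g by rewrite sort_lt_sorted undup_uniq.
have gs : (0 < size g)%N by case: (g) g0.
have gth k : (k <= (size g).-1)%N -> (k < size g)%N by rewrite -ltnS prednK.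
have glt i j : (i < j)%N -> (j < size g)%N -> nth T g i < nth T g j.
  move=> ij js; apply: (sorted_ltn_nth lt_trans T sg) => //.
  by rewrite inE (ltn_trans ij).
have gle i j : (i <= j)%N -> (j < size g)%N -> nth T g i <= nth T g j.
  by rewrite leq_eqVlt => /orP[/eqP->//|ij /(glt _ _ ij)/ltW].
exists (size g).-1, (nth T g); split; last first.
  move=> x xl; exists (index x g).
    by rewrite -ltnS prednK// index_mem gE !inE xl !orbT.
  by rewrite nth_index// gE !inE xl !orbT.
split.
- apply/eqP; rewrite eq_le; apply/andP; split.
    by rewrite -[leRHS](nth_index T g0) gle// index_mem.
  by have /andP[] := g0T _ (mem_nth T gs).
- apply/eqP; rewrite eq_le; apply/andP; split.
    by have /andP[] := g0T _ (mem_nth T (gth _ (leqnn _))).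
  by rewrite -[leLHS](nth_index T gT) gle ?gth// -ltnS prednK// index_mem.
- by move=> k kN; apply: glt => //; exact: gth.
Qed.

Context (N : nat) (r : nat -> R).
Hypothesis r_grid : is_grid N r.

Lemma grid_lt i j : (i < j)%N -> (j <= N)%N -> r i < r j.
Proof.
have [_ _ rS] := r_grid; elim: j => // j IH; rewrite ltnS leq_eqVlt.
move=> /orP[/eqP->|ij] jN; first exact: rS.
by rewrite (lt_trans (IH ij (ltnW jN)))// rS.
Qed.

Lemma grid_le i j : (i <= j)%N -> (j <= N)%N -> r i <= r j.
Proof. by rewrite leq_eqVlt => /orP[/eqP->//|ij jN]; rewrite ltW// grid_lt. Qed.

Lemma grid_ltE i j : (i <= N)%N -> (j <= N)%N -> (r i < r j) = (i < j)%N.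
Proof.
move=> iN jN; apply/idP/idP => [|ij]; last exact: grid_lt.
by apply: contraTT; rewrite -leqNgt -leNgt => ji; exact: grid_le.
Qed.

Lemma grid_leE i j : (i <= N)%N -> (j <= N)%N -> (r i <= r j) = (i <= j)%N.
Proof. by move=> iN jN; rewrite leNgt grid_ltE// -leqNgt. Qed.

Lemma grid_itv i : (i <= N)%N -> 0 <= r i <= T.
Proof.
by have [<- <- _] := r_grid => iN; rewrite !grid_le.
Qed.

Lemma grid_telescope (V : zmodType) (g : R -> V) (x y : R) :
  on_grid N r x -> on_grid N r y -> x <= y ->
  \sum_(i < N) (if x < r i.+1 <= y then g (r i.+1) - g (r i) else 0) = g y - g x.
Proof.
move=> [a aN ->] [b bN ->]; rewrite grid_leE// => ab.
rewrite -(big_mkord xpredT (fun i => if r a < r i.+1 <= r b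
  then g (r i.+1) - g (r i) else 0)).
rewrite (big_cat_nat (leq0n a) aN)/= big_nat big1 ?add0r; last first.
  move=> i /andP[_ ia]; rewrite grid_ltE//; last by rewrite (leq_trans ia).
  by rewrite ltnS leqNgt ia.
rewrite (big_cat_nat ab bN)/= addrC big_nat big1 ?add0r; last first.
  move=> i /andP[bi iN]; rewrite [X in _ && X]grid_leE// ltnNge bi andbF//.
rewrite -(telescope_sumr (g \o r) ab); apply: eq_big_nat => i /andP[ai ib].
have iN := leq_trans ib bN.
by rewrite (grid_ltE aN iN) (grid_leE iN bN) ltnS ai ib.
Qed.

Lemma grid_cell (x : R) : 0 < x <= T -> exists2 k, (k < N)%N & r k < x <= r k.+1.
Proof.
move=> /andP[x0 xT]; have [r0 rN _] := r_grid.
have : exists k, x <= r k by exists N; rewrite rN.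
case/ex_minnP => -[|k] xk mink; first by move: x0; rewrite ltNge -r0 xk.
exists k; first by rewrite -ltnS; apply: mink; rewrite rN.
by rewrite xk andbT ltNge; apply/negP => /mink; rewrite ltnn.
Qed.

Lemma integral_grid_step (F : R -> R) (v : nat -> R) (i : nat) :
  measurable_fun [set: R] F -> (i <= N)%N ->
  (forall k s, (k < N)%N -> r k < s <= r k.+1 -> F s = v k) ->
  (\int[lebesgue_measure]_(s in `[0%R, r i]) (F s)%:E =
   (\sum_(k < i) v k * (r k.+1 - r k))%R%:E)%E.
Proof.
move=> mF; have [r0 _ rS] := r_grid.
elim: i => [_ _|i IH iN Fv].
  by rewrite r0 set_itv1 integral_set1 big_ord0.
rewrite (@itv_bndbnd_setU _ _ _ (BRight (r i)))//; last 2 first.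
- by rewrite bnd_simp; have /andP[] := grid_itv (ltnW iN).
- by rewrite bnd_simp ltW// rS.
rewrite integral_setU//=; last 2 first.
- by apply/measurable_EFinP; exact: measurable_funTS.
- apply/disj_setPS => x [/=]; rewrite !in_itv/= => /andP[_ xi] /andP[ix _].
  by move: ix; rewrite ltNge xi.
rewrite (IH (ltnW iN) Fv) big_ord_recr/= EFinD; congr (_ + _)%E.
rewrite (eq_integral (cst (v i)%:E)); last first.
  by move=> x; rewrite inE/= in_itv/= => xi; rewrite (Fv i).
by rewrite integral_cst//= lebesgue_measure_itv/= lte_fin rS// -EFinB EFinM.
Qed.

End grid.

(** Discrete stopping. Read [c k] as the permission to run cell k; once withdrawn it never returns,
    so the weighted sum is an ordinary sum up to a random index. An integral stopped in this way is
    again the integral of a simple process, which replaces stopping times. *)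
Lemma stopped_sumE (R : pzRingType) (N : nat) (c : nat -> bool) (u : nat -> R) :
  (forall k, c k.+1 -> c k) ->
  exists2 n, [/\ (n <= N)%N, (forall k, (k < n)%N -> c k) & (n < N)%N -> ~~ c n]
    & \sum_(k < N) (c k)%:R * u k = \sum_(k < n) u k.
Proof.
move=> cS; elim: N => [|N [n [nN cn nc] IH]].
  by exists 0%N; rewrite ?big_ord0.
have [nN'|] := ltnP n N.
  exists n; first by split=> //; [exact: leqW|move=> _; exact: nc].
  have cN j : (n <= j)%N -> c j = false.
    elim: j => [|j IHj]; first by rewrite leqn0 => /eqP <-; exact/negbTE/nc.
    rewrite leq_eqVlt => /orP[/eqP <-|nj]; first exact/negbTE/nc.
    by apply/negP => /cS; rewrite IHj.
  by rewrite big_ord_recr/= IH cN ?mul0r ?addr0// ltnW.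
move=> Nn; have {nN Nn} nE : n = N by apply/eqP; rewrite eqn_leq nN.
rewrite {}nE in cn nc IH; have [cN|cN] := boolP (c N).
  exists N.+1; last by rewrite !big_ord_recr/= IH cN mul1r.
  split=> [//|k|]; last by rewrite ltnn.
  by rewrite ltnS leq_eqVlt => /orP[/eqP->|/cn].
exists N; last by rewrite big_ord_recr/= IH (negbTE cN) mul0r addr0.
by split.
Qed.

Lemma integral_probability_cst d (Omega : measurableType d) (R : realType)
  (P : probability Omega R) (c : \bar R) : (\int[P]_(_ in [set: Omega]) c = c)%E.
Proof.
transitivity (c * P [set: Omega])%E; first exact: (integral_cst P measurableT c).
by rewrite probability_setT mule1.
Qed.

(** * Exponential identity, second moments and maximal inequality for simple integrals *)

Section simple_processes.
Context d (Omega : measurableType d) (R : realType) (P : probability Omega R)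
  (T : R) (m : nat) (B : R -> Omega -> 'cV[R]_m).
Hypothesis T_gt0 : 0 < T.
Hypothesis P_complete : measure_is_complete P.
Hypothesis B_brownian : is_brownian_motion P T B.

Local Notation Ft t := (g_sigma_algebraType (augmented_gen P B t)).

Lemma filtration_measurable_dB (s t u : R) (i : 'I_m) : 0 <= s -> 0 <= t ->
  s <= u -> t <= u -> filtration_measurable P B u (fun w => (B t w - B s w) i 0).
Proof.
move=> s0 t0 su tu.
have mB v : 0 <= v -> v <= u ->
    measurable_fun [set: Ft u] (fun w : Ft u => B v w i 0).
  by move=> v0 vu; apply: filtration_measurable_B; rewrite v0.
rewrite /filtration_measurable; under eq_fun do rewrite !mxE.
by apply: measurable_funB; exact: mB.
Qed.

(** Cells are peeled off from the last one: [W] times the factors of the earlier cells is measurable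
    at the left end of the cell, so it acts as the weight in [exp_increment_random] and the last
    factor integrates out. *)
Lemma simple_expR_martingale (H : simple_process Omega R m) (W : Omega -> R) :
  is_simple P T B H -> filtration_measurable P B 0 W -> (forall w, 0 <= W w) ->
  (\int[P]_w (W w * expR (\sum_(k < sp_size H)
     (dot (sp_value H k w) (B (sp_time H k.+1) w - B (sp_time H k) w) -
      2^-1 * dot (sp_value H k w) (sp_value H k w) *
        (sp_time H k.+1 - sp_time H k))))%R%:E =
   \int[P]_w (W w)%:E)%E.
Proof.
case: H => N r h [/= r0T rS mh [K hK]] mW W0.
pose e k w := expR (\sum_(j < k)
     (dot (h j w) (B (r j.+1) w - B (r j) w) -
      2^-1 * dot (h j w) (h j w) * (r j.+1 - r j))).
have rle i j : (i <= j)%N -> (j <= N)%N -> r i <= r j.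
  elim: j => [|j IH]; first by rewrite leqn0 => /eqP ->.
  rewrite leq_eqVlt => /orP[/eqP->//|ij] jN.
  by rewrite (le_trans (IH ij (ltnW jN)))// rS.
have me k : (k <= N)%N -> filtration_measurable P B (r k) (e k).
  move=> kN; have [rk0 rkT] := andP (r0T _ kN).
  apply: (@measurableT_comp _ _ _ (Ft (r k)) _ _ (@expR R)) => //.
  apply: measurable_sum => j; have jk := ltn_ord j.
  have jN := leq_trans jk kN.
  have mhj i : measurable_fun [set: Ft (r k)] (fun w : Ft (r k) => h j w i 0).
    apply: filtration_measurableS (mh j i jN).
    by apply: rle => //; exact: ltnW.
  apply: measurable_funB.
    apply: measurable_dot => // i.
    apply: filtration_measurable_dB.
    - by have /andP[] := r0T _ (ltnW jN).
    - by have /andP[] := r0T _ jN.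
    - by apply: rle => //; exact: ltnW.
    - by apply: rle.
  by do 2!(apply: measurable_funM => //); exact: measurable_dot.
suff : forall k, (k <= N)%N -> (\int[P]_w (W w * e k w)%R%:E = \int[P]_w (W w)%:E)%E.
  by move/(_ N (leqnn _)).
elim=> [|k IH] kN.
  by apply: eq_integral => w _; rewrite /e big_ord0 expR0 mulr1.
(* The times of a simple process may repeat. An empty cell contributes the factor 1 and is treated
   apart, since the increment identity is for [s < t]. *)
rewrite -[RHS](IH (ltnW kN)); have := rS k kN; rewrite le_eqVlt => /orP[/eqP rk|rk].
  apply: eq_integral => w _; rewrite /e big_ord_recr/= -rk.
  by rewrite !subrr mulr0 subr0 dot0r addr0.
have [rk0 rkT] := andP (r0T _ (ltnW kN)).
have [_ rk1T] := andP (r0T _ kN).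
transitivity (\int[P]_w (W w * e k w *
    exp_increment (h k w) (B (r k.+1) w - B (r k) w) (r k.+1 - r k))%R%:E)%E.
  apply: eq_integral => w _; congr EFin.
  by rewrite /e big_ord_recr/= expRD mulrA.
apply: (exp_increment_random P_complete B_brownian rk0 rk rk1T
  (W := fun w => W w * e k w) (K := K)).
- apply: (@measurable_funM _ (Ft (r k))); last exact: me (ltnW kN).
  exact: filtration_measurableS mW.
- by move=> w; rewrite mulr_ge0// expR_ge0.
- by move=> i; exact: mh.
- by move=> i w; exact: hK.
Qed.

(** Cells are open on the left and closed on the right, so the value on a cell of a finer grid is
    read at its right end. Rewriting two processes over one grid makes them comparable cell by
    cell. *)
Definition regrid (N : nat) (r : nat -> R) (H : simple_process Omega R m) :=
  SimpleProcess N r (fun k w => sp_eval H (r k.+1) w).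

Definition times_on (N : nat) (r : nat -> R) (H : simple_process Omega R m) :=
  forall k, (k <= sp_size H)%N -> on_grid N r (sp_time H k).

Lemma times_on_exists (l : seq R) (H1 H2 : simple_process Omega R m) :
  (forall x, x \in l -> 0 <= x <= T) -> is_simple P T B H1 -> is_simple P T B H2 ->
  exists N r, [/\ is_grid T N r, (forall x, x \in l -> on_grid N r x),
    times_on N r H1 & times_on N r H2].
Proof.
move=> lT [h1 _ _ _] [h2 _ _ _].
pose times H := [seq @sp_time _ Omega R m H k | k <- iota 0 (sp_size H).+1].
have timesP H k : (k <= sp_size H)%N -> sp_time H k \in times H.
  by move=> kH; apply/map_f; rewrite mem_iota.
have l'T x : x \in l ++ times H1 ++ times H2 -> 0 <= x <= T.
  rewrite !mem_cat => /or3P[/lT//| |] /mapP[k]; rewrite mem_iota/= add0n ltnS.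
    by move=> kH ->; exact: h1.
  by move=> kH ->; exact: h2.
have [N [r [rg rl]]] := grid_exists T_gt0 l'T.
exists N, r; split=> // [x xl|k kH|k kH]; apply: rl; rewrite !mem_cat.
- by rewrite xl.
- by rewrite timesP// orbT.
- by rewrite timesP// !orbT.
Qed.

Section regrid.
Context (N : nat) (r : nat -> R).
Hypothesis r_grid : is_grid T N r.

Lemma regrid_simple H : is_simple P T B H -> times_on N r H ->
  is_simple P T B (regrid N r H).
Proof.
move=> [tT tS mh [K hK]] Hr; have [_ _ rS] := r_grid; split=> /=.
- by move=> k kN; exact: (grid_itv r_grid).
- by move=> k kN; rewrite ltW// rS.
- move=> k i kN; rewrite /filtration_measurable.
  under eq_fun do rewrite /sp_eval summxE.
  apply: measurable_sum => j; have jH := ltn_ord j.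
  have [/andP[tr _]|_] := boolP (sp_time H j < r k.+1 <= sp_time H j.+1); last first.
    by under eq_fun do rewrite mxE; exact: measurable_cst.
  apply: filtration_measurableS (mh j i jH).
  have [a aN ta] := Hr j (ltnW jH).
  by move: tr; rewrite ta (grid_ltE r_grid)// ltnS => ak; exact: (grid_le r_grid) (ltnW kN).
- exists (\sum_(j < sp_size H) `|K|) => k i w kN.
  rewrite /sp_eval summxE (le_trans (ler_norm_sum _ _ _))// ler_sum// => j _.
  case: ifPn => _; last by rewrite mxE normr0.
  by rewrite (le_trans (hK _ _ _ (ltn_ord j)))// ler_norm.
Qed.

Lemma sp_integral_regrid H t w : is_simple P T B H -> times_on N r H ->
  sp_integral B (regrid N r H) t w = sp_integral B H t w.
Proof.
move=> [tT tS _ _] Hr; rewrite /sp_integral/=.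
transitivity (\sum_(i < N) \sum_(j < sp_size H)
  (dot (sp_value H j w) (if sp_time H j < r i.+1 <= sp_time H j.+1 then
     B (Num.min (r i.+1) t) w - B (Num.min (r i) t) w else 0))).
  apply: eq_bigr => i _; rewrite /sp_eval dot_suml; apply: eq_bigr => j _.
  by case: ifPn => _; rewrite ?dot0l ?dot0r.
rewrite exchange_big/=; apply: eq_bigr => j _; rewrite -dot_sumr; congr dot.
have jH := ltn_ord j.
by rewrite (grid_telescope r_grid (fun x => B (Num.min x t) w) (Hr j (ltnW jH)) (Hr _ jH))// tS.
Qed.

Lemma sp_eval_cell H k s w : times_on N r H -> (k < N)%N -> r k < s <= r k.+1 ->
  sp_eval H s w = sp_eval H (r k.+1) w.
Proof.
move=> Hr kN /andP[ks sk]; rewrite /sp_eval; apply: eq_bigr => j _.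
have jH := ltn_ord j.
have [a aN ->] := Hr j (ltnW jH); have [b bN ->] := Hr _ jH.
congr (if _ then _ else _); rewrite (grid_ltE r_grid aN kN) (grid_leE r_grid kN bN).
congr (_ && _).
  apply/idP/idP => [|ak].
    move=> ras; rewrite ltnS -(grid_leE r_grid aN (ltnW kN)) leNgt.
    apply/negP; rewrite (grid_ltE r_grid (ltnW kN) aN) => ka.
    by have := lt_le_trans ras sk; rewrite (grid_ltE r_grid)// ltnS leqNgt ka.
  by apply: le_lt_trans ks; apply: (grid_le r_grid) => //; exact: ltnW.
apply/idP/idP => [srb|kb]; last first.
  by rewrite (le_trans sk)//; exact: (grid_le r_grid).
by rewrite -(grid_ltE r_grid (ltnW kN) bN) (lt_le_trans ks).
Qed.

Lemma sp_eval_grid (h : nat -> Omega -> 'cV[R]_m) k s w :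
  (k < N)%N -> r k < s <= r k.+1 -> sp_eval (SimpleProcess N r h) s w = h k w.
Proof.
move=> kN /andP[ks sk]; rewrite /sp_eval/= (bigD1 (Ordinal kN))//= ks sk/= big1 ?addr0//.
move=> j jk; case: ifPn => // /andP[js sj].
have jN := ltn_ord j.
have jk' : (j <= k)%N.
  by rewrite -ltnS -(grid_ltE r_grid (ltnW jN) kN) (lt_le_trans js).
have kj' : (k <= j)%N.
  by rewrite -ltnS -(grid_ltE r_grid (ltnW kN) jN) (lt_le_trans ks).
by case/negP: jk; apply/eqP/val_inj/eqP; rewrite /= eqn_leq jk'.
Qed.

Lemma sp_integral_grid (h : nat -> Omega -> 'cV[R]_m) i w : (i <= N)%N ->
  sp_integral B (SimpleProcess N r h) (r i) w =
  \sum_(k < i) dot (h k w) (B (r k.+1) w - B (r k) w).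
Proof.
move=> iN; rewrite /sp_integral/=.
pose u k := dot (h k w) (B (Num.min (r k.+1) (r i)) w - B (Num.min (r k) (r i)) w).
rewrite -(big_mkord xpredT u) (big_cat_nat (leq0n i) iN)/= addrC big_nat big1 ?add0r.
  rewrite big_mkord; apply: eq_bigr => k _; rewrite /u !min_l//.
    by apply: (grid_le r_grid) => //; exact: ltnW.
  exact: (grid_le r_grid).
move=> k /andP[ik kN]; rewrite /u !min_r ?subrr ?dot0r//.
  by apply: (grid_le r_grid) => //; exact: ltnW.
by apply: (grid_le r_grid) => //; exact: leqW.
Qed.

End regrid.

Lemma sp_eval_out H s w : is_simple P T B H -> (s <= 0) || (T < s) ->
  sp_eval H s w = 0.
Proof.
move=> [tT _ _ _] sT; rewrite /sp_eval big1// => j _; have jH := ltn_ord j.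
case: ifPn => // /andP[ts st]; move: sT => /orP[s0|Ts].
  by have := lt_le_trans ts s0; rewrite ltNge; have /andP[->] := tT _ (ltnW jH).
by have := lt_le_trans Ts st; rewrite ltNge; have /andP[_ ->] := tT _ jH.
Qed.

Lemma measurable_sp_eval (H : simple_process Omega R m) w i : measurable_fun [set: R] (fun s => sp_eval H s w i 0).
Proof.
under eq_fun do rewrite /sp_eval summxE.
apply: measurable_sum => j.
rewrite (_ : (fun s : R => _) = fun s => if (sp_time H j < s) && (s <= sp_time H j.+1)
  then sp_value H j w i 0 else 0).
  apply: measurable_fun_ifT => //; apply: measurable_and.
    by apply: measurable_fun_ltr.
  by apply: measurable_fun_ler.
by apply/funext => s; case: ifPn => _; rewrite ?mxE.
Qed.

Lemma filtration_measurable_fun (t : R) (X : Omega -> R) : t <= T ->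
  filtration_measurable P B t X -> measurable_fun [set: Omega] X.
Proof. by move=> tT; exact: (measurable_fun_filtration P_complete B_brownian). Qed.

Lemma measurable_dB (s t : R) (i : 'I_m) : 0 <= s -> s <= t -> t <= T ->
  measurable_fun [set: Omega] (fun w => (B t w - B s w) i 0).
Proof. by move=> s0 st tT; exact: (measurable_increment B_brownian). Qed.

Section grid_estimates.
Context (N : nat) (r : nat -> R).
Hypothesis r_grid : is_grid T N r.

Lemma grid_simple (h : nat -> Omega -> 'cV[R]_m) (K : R) :
  (forall k i, (k < N)%N -> filtration_measurable P B (r k) (fun w => h k w i 0)) ->
  (forall k w i, (k < N)%N -> `|h k w i 0| <= K) ->
  is_simple P T B (SimpleProcess N r h).
Proof.
move=> mh hK; have [_ _ rS] := r_grid; split=> //=.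
- by move=> k kN; exact: (grid_itv r_grid).
- by move=> k kN; rewrite ltW// rS.
- by exists K.
Qed.

Lemma measurable_grid_value (h : nat -> Omega -> 'cV[R]_m) k i :
  is_simple P T B (SimpleProcess N r h) -> (k < N)%N ->
  measurable_fun [set: Omega] (fun w => h k w i 0).
Proof.
move=> [_ _ mh _] kN; apply: (@filtration_measurable_fun (r k)); last exact: mh.
by have /andP[] := grid_itv r_grid (ltnW kN).
Qed.

Lemma measurable_grid_sum (h : nat -> Omega -> 'cV[R]_m) n :
  is_simple P T B (SimpleProcess N r h) -> (n <= N)%N ->
  measurable_fun [set: Omega] (fun w => \sum_(k < n) dot (h k w) (B (r k.+1) w - B (r k) w)).
Proof.
move=> hs nN; apply: measurable_sum => k; have kN := leq_trans (ltn_ord k) nN.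
apply: measurable_dot => i; first exact: measurable_grid_value.
have [_ _ rS] := r_grid.
apply: measurable_dB.
- by have /andP[] := grid_itv r_grid (ltnW kN).
- by rewrite ltW// rS.
- by have /andP[] := grid_itv r_grid kN.
Qed.

Lemma measurable_grid_bracket (h g : nat -> Omega -> 'cV[R]_m) n :
  is_simple P T B (SimpleProcess N r h) -> is_simple P T B (SimpleProcess N r g) ->
  (n <= N)%N ->
  measurable_fun [set: Omega] (fun w => \sum_(k < n) dot (h k w) (g k w) * (r k.+1 - r k)).
Proof.
move=> hs gs nN; apply: measurable_sum => k; have kN := leq_trans (ltn_ord k) nN.
by apply: measurable_funM => //; apply: measurable_dot => i; exact: measurable_grid_value.
Qed.

(* The identity simple_expR_martingale for all multiples of a process controls
   its second moment, up to a constant. *)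
Lemma second_moment_le (G V : Omega -> R) (C : R) :
  measurable_fun [set: Omega] G -> measurable_fun [set: Omega] V ->
  (forall w, 0 <= V w <= C) ->
  (forall u : R, \int[P]_w (expR (u * G w - 2^-1 * u ^+ 2 * V w))%:E <= 1)%E ->
  (\int[P]_w (G w ^+ 2)%:E <= 8%:E * \int[P]_w (V w)%:E)%E.
Proof.
move=> mG mV V0C E1.
have [C0|C_lt0] := leP 0 C; last first.
  have Om (w : Omega) : False by have /andP[V0 /(le_trans V0)] := V0C w; rewrite leNgt C_lt0.
  rewrite (_ : (fun w => (G w ^+ 2)%:E) = cst 0%E); last by apply/funext => w; have := Om w.
  by rewrite integral0 mule_ge0// integral_ge0// => w; have := Om w.
(* With u^2 = 1/(C + 1) the compensator u^2 V / 2 never exceeds 1/2; adding 1 to C avoids dividing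
   by zero. *)
pose u := Num.sqrt (C + 1)^-1.
have C1 : 0 < C + 1 by rewrite ltr_wpDl.
have uE : u ^+ 2 = (C + 1)^-1 by rewrite sqr_sqrtr// invr_ge0 ltW.
have u0 : 0 < u ^+ 2 by rewrite uE invr_gt0.
have uC : u ^+ 2 * C <= 1 by rewrite uE ler_pdivrMl// mulr1 lerDl.
have sinh2 (x : R) : x ^+ 2 <= (expR x - expR (- x)) ^+ 2.
  wlog x0 : x / 0 <= x => [hw|].
    have [/hw//|/ltW x0] := leP 0 x.
    have := hw (- x); rewrite oppr_ge0 opprK sqrrN => /(_ x0).
    by rewrite -[X in _ -> _ <= X]sqrrN opprB.
  have h1 := expR_ge1Dx x; have h2 : expR (- x) <= 1 by rewrite -expR0 ler_expR; lra.
  by rewrite ler_sqr ?nnegrE//; lra.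
have cosh (b : R) : 2 + b ^+ 2 / 4 <= expR b + expR (- b).
  have := sinh2 (b / 2); have -> : (b / 2) ^+ 2 = b ^+ 2 / 4 by field.
  have -> : (expR (b / 2) - expR (- (b / 2))) ^+ 2 = expR b + expR (- b) - 2.
    rewrite sqrrB -!expRM_natl mulr2n.
    rewrite -expRD subrr expR0 (_ : 2%:R * (b / 2) = b); last by field.
    by rewrite (_ : 2%:R * (- (b / 2)) = - b); last field; ring.
  lra.
(* Averaging the exponents u and -u removes the odd part. With a = u^2 V / 2 and b = u G, cosh b >=
   1 + b^2/8 and exp(-a) >= 1 - a >= 1/2 give a product at least 1 - a + b^2/16. Comparing u^2/16
   with u^2/2 after integration yields the constant 8. *)
have key w : 1 + 16^-1 * u ^+ 2 * G w ^+ 2 <=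
    2^-1 * (expR (u * G w - 2^-1 * u ^+ 2 * V w) +
      expR (- u * G w - 2^-1 * (- u) ^+ 2 * V w)) + 2^-1 * u ^+ 2 * V w.
  have /andP[V0 VC] := V0C w; rewrite sqrrN.
  set a := 2^-1 * u ^+ 2 * V w; rewrite mulNr !expRD.
  have a0 : 0 <= a.
    by apply: mulr_ge0 => //; apply: mulr_ge0 => //; exact: ltW.
  have a1 : a <= 2^-1.
    by rewrite /a -mulrA ler_piMr// (le_trans _ uC)// ler_wpM2l// ltW.
  have ea : 1 - a <= expR (- a) by exact: expR_ge1Dx.
  have := cosh (u * G w); rewrite exprMn.
  set b2 := u ^+ 2 * G w ^+ 2.
  have b20 : 0 <= b2 by rewrite mulr_ge0 ?sqr_ge0// ltW.
  have -> : 16^-1 * u ^+ 2 * G w ^+ 2 = 16^-1 * b2 by rewrite /b2; ring.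
  have e0 := expR_ge0 (- a).
  set X := expR (u * G w); set X' := expR (- (u * G w)); set ea' := expR (- a) in ea e0 *.
  move=> hX; nra.
have mE (v : R) : measurable_fun [set: Omega]
    (fun w => (expR (v * G w - 2^-1 * v ^+ 2 * V w))%:E).
  apply/measurable_EFinP; apply: measurableT_comp => //.
  by apply: measurable_funB; apply: measurable_funM.
have mVE : measurable_fun [set: Omega] (fun w => (V w)%:E) by exact/measurable_EFinP.
have mGE : measurable_fun [set: Omega] (fun w => (G w ^+ 2)%:E).
  by apply/measurable_EFinP; exact: measurable_funX.
have : (1 + (16^-1 * u ^+ 2)%:E * \int[P]_w (G w ^+ 2)%:E <=
    1 + (2^-1 * u ^+ 2)%:E * \int[P]_w (V w)%:E)%E.
  have V0 w : 0 <= V w by have /andP[] := V0C w.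
  have c0 (x : R) : 0 < x -> 0 <= x^-1 * u ^+ 2.
    by move=> x0; rewrite mulr_ge0// ?ltW// invr_gt0.
  have -> : (1 + (16^-1 * u ^+ 2)%:E * \int[P]_w (G w ^+ 2)%:E =
      \int[P]_w (1%:E + (16^-1 * u ^+ 2)%:E * (G w ^+ 2)%:E))%E.
    rewrite ge0_integralD//.
    - rewrite (integral_probability_cst P) ge0_integralZl//.
      + by move=> w _; rewrite lee_fin sqr_ge0.
      + by rewrite lee_fin c0.
    - by move=> w _; rewrite -EFinM lee_fin mulr_ge0 ?c0 ?sqr_ge0.
    - exact: emeasurable_funM.
  apply: (@le_trans _ _ (\int[P]_w ((2^-1)%:E * ((expR (u * G w - 2^-1 * u ^+ 2 * V w))%:E +
      (expR (- u * G w - 2^-1 * (- u) ^+ 2 * V w))%:E) + (2^-1 * u ^+ 2)%:E * (V w)%:E))%E).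
    apply: ge0_le_integral => //.
    - by move=> w _; rewrite -EFinM lee_fin addr_ge0// mulr_ge0 ?c0 ?sqr_ge0.
    - by apply: emeasurable_funD => //; exact: emeasurable_funM.
    - apply: emeasurable_funD; apply: emeasurable_funM => //.
      by apply: emeasurable_funD; exact: mE.
    - by move=> w _; rewrite -!EFinM -!EFinD lee_fin; exact: key.
  rewrite ge0_integralD//.
  - rewrite ge0_integralZl//; last 2 first.
    + by apply: emeasurable_funD; exact: mE.
    + by move=> w _; rewrite -EFinD lee_fin addr_ge0// expR_ge0.
    rewrite ge0_integralD//.
    rewrite ge0_integralZl ?lee_fin ?c0//; last by move=> w _; rewrite lee_fin.
    apply: leeD => //.
    apply: (@le_trans _ _ ((2^-1)%:E * (1 + 1)))%E.
      by apply: lee_wpmul2l => //; apply: leeD; exact: E1.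
    by rewrite -EFinD -EFinM lee_fin; lra.
  - move=> w _; rewrite -!EFinD -EFinM lee_fin mulr_ge0// addr_ge0// expR_ge0.
  - by apply: emeasurable_funM => //; apply: emeasurable_funD; exact: mE.
  - by move=> w _; rewrite -EFinM lee_fin mulr_ge0// c0.
  - exact: emeasurable_funM.
rewrite leeD2lE//.
have -> : 2^-1 * u ^+ 2 = 16^-1 * u ^+ 2 * 8 by field.
rewrite (EFinM _ 8) -muleA lee_pmul2l// lte_fin mulr_gt0//.
Qed.

Lemma grid_second_moment (h : nat -> Omega -> 'cV[R]_m) :
  is_simple P T B (SimpleProcess N r h) ->
  (\int[P]_w ((\sum_(k < N) dot (h k w) (B (r k.+1) w - B (r k) w)) ^+ 2)%:E <=
   8%:E * \int[P]_w (\sum_(k < N) dot (h k w) (h k w) * (r k.+1 - r k))%R%:E)%E.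
Proof.
move=> hs; have [r0T rS mh [K hK]] := hs.
have dr k : (k < N)%N -> 0 <= r k.+1 - r k by move=> kN; rewrite subr_ge0 rS.
apply: (second_moment_le (C := \sum_(k < N) (\sum_(i < m) K ^+ 2) * (r k.+1 - r k))).
- exact: measurable_grid_sum.
- exact: measurable_grid_bracket.
- move=> w; rewrite sumr_ge0/=; last first.
    by move=> k _; rewrite mulr_ge0 ?dot_ge0 ?dr.
  rewrite ler_sum// => k _; rewrite ler_wpM2r ?dr// dotE ler_sum// => i _.
  have hk : `|h k w i 0| <= K := hK k w i (ltn_ord k).
  by rewrite -expr2 -[leLHS]real_normK ?num_real// ler_sqr ?nnegrE// (le_trans _ hk).
- move=> u.
  have us : is_simple P T B (SimpleProcess N r (fun k w => u *: h k w)).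
    apply: (grid_simple (K := `|u| * K)).
      move=> k i kN; rewrite /filtration_measurable; under eq_fun do rewrite mxE.
      by apply: measurable_funM => //; exact: mh.
    by move=> k w i kN; rewrite mxE normrM ler_wpM2l// hK.
  have := @simple_expR_martingale _ (fun=> 1) us (@measurable_cst _ _ _ _ _ _) (fun=> ler01).
  rewrite /= [X in _ = X -> _]integral_cst//= probability_setT mul1e => <-.
  rewrite le_eqVlt; apply/orP; left; apply/eqP.
  apply: eq_integral => w _; rewrite mul1r; congr (expR _)%:E.
  rewrite !mulr_sumr -sumrB; apply: eq_bigr => k _.
  by rewrite !dotZl !dotZr; ring.
Qed.

End grid_estimates.

Lemma maximal_finite (H : simple_process Omega R m) (l : seq R) (e : R) :
  is_simple P T B H -> (forall x, x \in l -> 0 <= x <= T) -> 0 < e ->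
  measurable [set w | has (fun t => e < `|sp_integral B H t w|) l] /\
  ((e ^+ 2)%:E * P [set w | has (fun t => e < `|sp_integral B H t w|)%R l] <=
   8%:E * \int[P]_w \int[lebesgue_measure]_(s in `[0%R, T])
     (dot (sp_eval H s w) (sp_eval H s w))%:E)%E.
Proof.
move=> Hs lT e0.
have [N [r [rg rl Hr _]]] := times_on_exists lT Hs Hs.
have [r0 rN rS] := rg.
have hs := regrid_simple rg Hs Hr.
pose h k w := sp_eval H (r k.+1) w.
pose S i w := \sum_(k < i) dot (h k w) (B (r k.+1) w - B (r k) w).
have SE i w : (i <= N)%N -> sp_integral B H (r i) w = S i w.
  by move=> iN; rewrite -(sp_integral_regrid rg _ _ Hs Hr) /regrid (sp_integral_grid rg).
have mS i : (i <= N)%N -> filtration_measurable P B (r i) (S i).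
  move=> iN; apply: measurable_sum => k; have ki := ltn_ord k.
  have kN := leq_trans ki iN.
  apply: measurable_dot => j.
    have [_ _ mh _] := hs.
    by apply: filtration_measurableS (mh k j kN); exact: (grid_le rg (ltnW ki)).
  apply: filtration_measurable_dB.
  - by have /andP[] := grid_itv rg (ltnW kN).
  - by have /andP[] := grid_itv rg kN.
  - exact: (grid_le rg (ltnW ki)).
  - exact: (grid_le rg ki).
(* Cell k is run if the partial sums up to its left end, index k included, have stayed within [e].
   This is known at time [r k], so the stopped process remains adapted. *)
pose c k w := all (fun i => `|S i w| <= e) (iota 0 k.+1).
have cP k w : c k w -> forall i, (i <= k)%N -> `|S i w| <= e.
  by move=> /allP h' i ik; apply: h'; rewrite mem_iota.
have cS w k : c k.+1 w -> c k w.
  by rewrite /c -[X in iota _ X]addn1 iotaD all_cat => /andP[].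
have mc k : (k <= N)%N -> measurable_fun [set: Ft (r k)] (c k : Ft (r k) -> bool).
  move=> kN; rewrite /c; have : forall i, i \in iota 0 k.+1 -> (i <= k)%N.
    by move=> i; rewrite mem_iota ltnS.
  elim: (iota 0 k.+1) => [_|i s IH hi] /=; first exact: measurable_cst.
  apply: measurable_and; last by apply: IH => j js; apply: hi; rewrite inE js orbT.
  have ik : (i <= k)%N by apply: hi; rewrite mem_head.
  apply: measurable_fun_ler => //; apply: measurableT_comp => //.
  apply: filtration_measurableS (mS i (leq_trans ik kN)).
  exact: (grid_le rg ik).
pose h' k w := (c k w)%:R *: h k w.
have h's : is_simple P T B (SimpleProcess N r h').
  have [_ _ mh [K hK]] := hs.
  apply: (grid_simple rg (K := K)).
    move=> k i kN; rewrite /filtration_measurable /h'.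
    under eq_fun do rewrite mxE.
    apply: measurable_funM; last exact: mh.
    rewrite (_ : (fun _ => _) = fun w : Ft (r k) => if c k w then 1 else 0).
      by apply: measurable_fun_ifT => //; exact: mc (ltnW kN).
    by apply/funext => w; case: (c k w).
  move=> k w i kN; rewrite mxE normrM; have := hK k w i kN => /= hk.
  by case: (c k w); rewrite ?normr1 ?mul1r// normr0 mul0r (le_trans _ hk).
pose G w := \sum_(k < N) dot (h' k w) (B (r k.+1) w - B (r k) w).
have GE w : has (fun t => e < `|sp_integral B H t w|) l -> e < `|G w|.
  move=> /hasP[t tl et]; have [j jN tj] := rl t tl.
  rewrite tj SE// in et.
  have [n [nN cn nc] E] := stopped_sumE N
    (fun k => dot (h k w) (B (r k.+1) w - B (r k) w)) (cS w).
  have -> : G w = S n w.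
    by rewrite /S -E; apply: eq_bigr => k _; rewrite dotZl.
  have Si i : (i < n)%N -> e < `|S i w| -> False.
    by move=> /cn/cP/(_ _ (leqnn i)); rewrite leNgt => /negP.
  move: nN; rewrite leq_eqVlt => /orP[/eqP nE|/nc].
    move: jN; rewrite -nE leq_eqVlt => /orP[/eqP <-//|/Si]; exact.
  move=> /allPn[i]; rewrite mem_iota/= add0n ltnS -ltNge leq_eqVlt.
  by move=> /orP[/eqP->//|/Si hi /hi].
have mA : measurable [set w | has (fun t => e < `|sp_integral B H t w|) l].
  elim: l rl {lT GE} => [_|t s IH rl] /=; first by rewrite (_ : [set w | _] = set0) ?measurable0//; apply/seteqP; split.
  rewrite (_ : [set w | _] = [set w | e < `|sp_integral B H t w|] `|`
    [set w | has (fun t => e < `|sp_integral B H t w|) s]); last first.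
    by apply/seteqP; split => w /= /orP.
  apply: measurableU; last by apply: IH => x xs; apply: rl; rewrite inE xs orbT.
  have [j jN ->] := rl t (mem_head _ _).
  have mSj : measurable_fun [set: Omega] (fun w => `|S j w|).
    apply: measurableT_comp => //; apply: filtration_measurable_fun (mS j jN).
    by have /andP[] := grid_itv rg jN.
  have := measurable_fun_ltr (@measurable_cst _ _ _ _ setT e) mSj.
  move=> /(_ measurableT [set true] I); rewrite setTI; congr measurable.
  by apply/seteqP; split => w /=; rewrite SE.
split=> //.
have mG := measurable_grid_sum rg h's (leqnn N).
apply: (@le_trans _ _ (\int[P]_w (G w ^+ 2)%:E)%E).
  rewrite -[X in (_ * P X)%E]setIT -integral_indic// -ge0_integralZl ?lee_fin ?sqr_ge0//; last first.
    by apply/measurable_EFinP; exact: measurable_indic.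
  apply: ge0_le_integral => //.
  - by move=> w _; rewrite -EFinM lee_fin mulr_ge0// sqr_ge0.
  - by apply: emeasurable_funM => //; apply/measurable_EFinP; exact: measurable_indic.
  - by apply/measurable_EFinP; exact: measurable_funX.
  - move=> w _; rewrite -EFinM lee_fin indicE.
    case: (boolP (w \in _)) => [|_]; last by rewrite mulr0 sqr_ge0.
    rewrite inE mulr1 => /GE eG; rewrite -[leRHS]real_normK ?num_real// ler_sqr ?nnegrE// ltW//.
apply: (le_trans (grid_second_moment rg h's)).
apply: lee_wpmul2l => //.
have mint : measurable_fun [set: Omega] (fun w => (\sum_(k < N) dot (h k w) (h k w) * (r k.+1 - r k))%R%:E).
  by apply/measurable_EFinP; exact: (measurable_grid_bracket rg hs hs).
have -> : (\int[P]_w \int[lebesgue_measure]_(s in `[0%R, T])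
     (dot (sp_eval H s w) (sp_eval H s w))%:E =
   \int[P]_w (\sum_(k < N) dot (h k w) (h k w) * (r k.+1 - r k))%R%:E)%E.
  apply: eq_integral => w _; rewrite -rN.
  rewrite (integral_grid_step rg (v := fun k => dot (h k w) (h k w)))//.
    by apply: measurable_dot => i; exact: measurable_sp_eval.
  by move=> k s kN ks; rewrite (sp_eval_cell rg _ Hr kN ks).
apply: ge0_le_integral => //.
- move=> w _; rewrite lee_fin sumr_ge0// => k _.
  by rewrite mulr_ge0 ?dot_ge0// subr_ge0 ltW// rS.
- by apply/measurable_EFinP; exact: (measurable_grid_bracket rg h's h's).
- move=> w _; rewrite lee_fin ler_sum// => k _.
  have dr : 0 <= r k.+1 - r k by rewrite subr_ge0 ltW// rS.
  rewrite ler_wpM2r// dotZl dotZr mulrA -natrM mulnb andbb.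
  by case: (c k w); rewrite ?mul1r// mul0r dot_ge0.
Qed.

End simple_processes.

(** * Predictable processes and their simple approximation *)

Section time_integrals.
Context d (Omega : measurableType d) (R : realType) (P : probability Omega R)
  (T : R).
Local Open Scope ereal_scope.

(** Processes are constrained only for times in [0, T], so joint measurability in time and scenario
    is always relative to this set. *)
Definition strip : set (R * Omega) := [set` `[0%R, T]] `*` [set: Omega].

Lemma stripP t w : strip (t, w) <-> (0 <= t <= T)%R.
Proof. by rewrite /strip/= in_itv/=; split=> [[]|]. Qed.

Lemma measurable_strip : measurable strip.
Proof. exact: measurableX. Qed.

Lemma integral_section (f : R -> Omega -> \bar R) w :
  \int[lebesgue_measure]_(t in `[0%R, T]) f t w =
  \int[lebesgue_measure]_t (((fun x => f x.1 x.2) \_ strip) (t, w)).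
Proof.
rewrite integral_mkcond; apply: eq_integral => t _; rewrite !patchE.
congr (if _ then _ else _); rewrite /strip.
by apply/idP/idP; rewrite !inE/= => //; case.
Qed.

Section one_function.
Context (f : R -> Omega -> \bar R).
Hypothesis mf : measurable_fun strip (fun x => f x.1 x.2).
Hypothesis f_ge0 : forall t w, (0 <= t <= T)%R -> 0 <= f t w.

Let g : R * Omega -> \bar R := (fun x => f x.1 x.2) \_ strip.

Let mg : measurable_fun [set: R * Omega] g.
Proof. exact/(measurable_restrictT _ measurable_strip). Qed.

Let g_ge0 x : 0 <= g x.
Proof.
rewrite /g patchE; case: ifPn => //; rewrite inE; case: x => t w /stripP; exact: f_ge0.
Qed.

Lemma measurable_strip_integral : measurable_fun [set: Omega]
  (fun w => \int[lebesgue_measure]_(t in `[0%R, T]) f t w).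
Proof.
under eq_fun do rewrite integral_section.
exact: (measurable_fun_fubini_tonelli_G (m1 := lebesgue_measure) g mg g_ge0).
Qed.

Lemma strip_integralE :
  \int[P]_w \int[lebesgue_measure]_(t in `[0%R, T]) f t w =
  \int[lebesgue_measure \x P]_x g x.
Proof.
rewrite (fubini_tonelli2 (m1 := lebesgue_measure) (m2 := P) g mg g_ge0).
by apply: eq_integral => w _; rewrite integral_section.
Qed.

Lemma measurable_section w :
  measurable_fun `[0%R, T]%classic (f ^~ w).
Proof.
have mgw : measurable_fun [set: R] (fun t => g (t, w)).
  exact: (measurable_fun_pair1 w mg).
apply: (eq_measurable_fun (fun t => g (t, w))) => //; last exact: measurable_funTS.
by move=> t; rewrite inE/= in_itv/= => t0T; rewrite /g patchE mem_set//; exact/stripP.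
Qed.

End one_function.

Lemma measurable_subinterval_integral (a b : R) (f : R -> Omega -> \bar R) :
  (0 <= a)%R -> (b <= T)%R -> measurable_fun strip (fun x => f x.1 x.2) ->
  (forall t w, (0 <= t <= T)%R -> 0 <= f t w) ->
  measurable_fun [set: Omega]
  (fun w => \int[lebesgue_measure]_(t in `[a, b]) f t w).
Proof.
move=> a0 bT mf f0.
pose f' t w := if (a <= t <= b)%R then f t w else 0.
have -> : (fun w => \int[lebesgue_measure]_(t in `[a, b]) f t w) =
    (fun w => \int[lebesgue_measure]_(t in `[0%R, T]) f' t w).
  apply/funext => w; rewrite integral_mkcond [RHS]integral_mkcond.
  apply: eq_integral => t _; rewrite !patchE /f' !mem_setE !in_itv/=.
  case: (boolP (a <= t <= b)%R) => [/andP[at_ tb]|_]; last by case: ifP.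
  by rewrite (le_trans a0 at_) (le_trans tb bT).
apply: measurable_strip_integral.
- apply: measurable_fun_if => //=.
  + apply: measurable_strip.
  + apply: measurable_and; apply: measurable_fun_ler => //; exact: measurable_funTS measurable_fst.
  + apply: measurable_funS mf => //; exact: measurable_strip.
- by move=> t w tT; rewrite /f'; case: ifP => // _; exact: f0.
Qed.

Notation SI f := (\int[P]_w \int[lebesgue_measure]_(t in `[0%R, T]) f t w).

Lemma strip_integralD (f g : R -> Omega -> \bar R) :
  measurable_fun strip (fun x => f x.1 x.2) ->
  measurable_fun strip (fun x => g x.1 x.2) ->
  (forall t w, (0 <= t <= T)%R -> 0 <= f t w) ->
  (forall t w, (0 <= t <= T)%R -> 0 <= g t w) ->
  SI (fun t w => f t w + g t w) = SI f + SI g.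
Proof.
move=> mf mg f0 g0; rewrite -ge0_integralD//; last 4 first.
- by move=> w _; apply: integral_ge0 => t; rewrite /= in_itv/=; exact: f0.
- exact: measurable_strip_integral.
- by move=> w _; apply: integral_ge0 => t; rewrite /= in_itv/=; exact: g0.
- exact: measurable_strip_integral.
apply: eq_integral => w _; rewrite ge0_integralD//.
- by move=> t; rewrite /= in_itv/=; exact: f0.
- exact: measurable_section.
- by move=> t; rewrite /= in_itv/=; exact: g0.
- exact: measurable_section.
Qed.

Lemma strip_integralZ (k : R) (f : R -> Omega -> \bar R) : (0 <= k)%R ->
  measurable_fun strip (fun x => f x.1 x.2) ->
  (forall t w, (0 <= t <= T)%R -> 0 <= f t w) ->
  SI (fun t w => k%:E * f t w) = k%:E * SI f.
Proof.
move=> k0 mf f0; rewrite -ge0_integralZl//; last 2 first.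
- exact: measurable_strip_integral.
- by move=> w _; apply: integral_ge0 => t; rewrite /= in_itv/=; exact: f0.
apply: eq_integral => w _; rewrite ge0_integralZl//.
- exact: measurable_section.
- by move=> t; rewrite /= in_itv/=; exact: f0.
Qed.

Lemma le_strip_integral (f g : R -> Omega -> \bar R) :
  measurable_fun strip (fun x => f x.1 x.2) ->
  measurable_fun strip (fun x => g x.1 x.2) ->
  (forall t w, (0 <= t <= T)%R -> 0 <= f t w) ->
  (forall t w, (0 <= t <= T)%R -> f t w <= g t w) ->
  SI f <= SI g.
Proof.
move=> mf mg f0 fg.
have g0 t w : (0 <= t <= T)%R -> 0 <= g t w.
  by move=> tT; rewrite (le_trans (f0 t w tT))// fg.
apply: ge0_le_integral => //.
- by move=> w _; apply: integral_ge0 => t; rewrite /= in_itv/=; exact: f0.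
- exact: measurable_strip_integral.
- exact: measurable_strip_integral.
move=> w _; apply: ge0_le_integral => //.
- by move=> t; rewrite /= in_itv/=; exact: f0.
- exact: measurable_section.
- exact: measurable_section.
- by move=> t; rewrite /= in_itv/=; exact: fg.
Qed.

Lemma strip_dominated_cvg0 (f : nat -> R -> Omega -> R) (g : R -> Omega -> R) :
  (forall n, measurable_fun strip (fun x => f n x.1 x.2)) ->
  measurable_fun strip (fun x => g x.1 x.2) ->
  (forall n t w, (0 <= t <= T)%R -> (0 <= f n t w <= g t w)%R) ->
  (forall t w, (0 <= t <= T)%R -> (f n t w @[n --> \oo] --> (0 : R))%R) ->
  SI (fun t w => (g t w)%:E) < +oo ->
  forall e : R, (0 < e)%R -> exists n, SI (fun t w => (f n t w)%:E) <= e%:E.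
Proof.
move=> mf mg fg fcvg goo e e0.
have mfE n : measurable_fun strip (fun x => (f n x.1 x.2)%:E) by exact/measurable_EFinP.
have mgE : measurable_fun strip (fun x => (g x.1 x.2)%:E) by exact/measurable_EFinP.
pose fn n : R * Omega -> \bar R := (fun x => (f n x.1 x.2)%:E) \_ strip.
pose G : R * Omega -> \bar R := (fun x => (g x.1 x.2)%:E) \_ strip.
have f0 n t w : (0 <= t <= T)%R -> 0 <= (f n t w)%:E.
  by move=> tT; have /andP[] := fg n t w tT; rewrite lee_fin.
have g0 t w : (0 <= t <= T)%R -> 0 <= (g t w)%:E.
  move=> tT; have /andP[f00 ?] := fg 0%N t w tT; rewrite lee_fin.
  exact: (le_trans f00).
have mfn n : measurable_fun [set: R * Omega] (fn n).
  exact/(measurable_restrictT _ measurable_strip).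
have mG : measurable_fun [set: R * Omega] G.
  exact/(measurable_restrictT _ measurable_strip).
have fnG n x : [set: R * Omega] x -> `|fn n x| <= G x.
  move=> _; rewrite /fn /G !patchE; case: ifPn => [|_]; last by rewrite abse0.
  rewrite inE; case: x => t w /stripP tT; rewrite gee0_abs ?f0//= lee_fin.
  by have /andP[] := fg n t w tT.
have G0 x : 0 <= G x by rewrite (le_trans _ (fnG 0%N x I)).
have := @dominated_cvg _ _ _ (lebesgue_measure \x P) _ measurableT fn (cst 0) G mfn.
move=> /(_ _ _ _ fnG); rewrite integral0 => /(_ _ _ _)/fine_cvgP[].
- move=> x _; rewrite /fn; under eq_fun do rewrite patchE.
  have [|_] := boolP (x \in strip); last exact: cvg_cst.
  rewrite inE; case: x => t w /stripP tT; apply: cvg_EFin; first exact: nearW.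
  exact: fcvg.
- move=> x _; rewrite /G patchE; by case: ifPn.
- apply/integrableP; split=> //.
  under eq_integral do rewrite gee0_abs//.
  by rewrite -(strip_integralE (f := fun t w => (g t w)%:E) mgE g0).
move=> [N1 _ HN1] /cvgrPdist_le/(_ e e0)[N2 _ HN2].
exists (maxn N1 N2).
have := HN1 _ (leq_maxl N1 N2); have := HN2 _ (leq_maxr N1 N2).
rewrite /= sub0r normrN => le1 fin.
rewrite strip_integralE; [|exact: mfE|by move=> *; exact: f0].
by rewrite -(fineK fin) lee_fin (le_trans _ le1)// ler_norm.
Qed.

End time_integrals.

Notation strip_int P T f :=
  (\int[P]_w \int[lebesgue_measure]_(t in `[0%R, T]) f t w)%E.

Section predictable.
Context d (Omega : measurableType d) (R : realType) (P : probability Omega R)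
  (T : R) (m : nat) (B : R -> Omega -> 'cV[R]_m).
Hypothesis T_gt0 : 0 < T.
Hypothesis P_complete : measure_is_complete P.
Hypothesis B_brownian : is_brownian_motion P T B.

Local Notation Ft t := (g_sigma_algebraType (augmented_gen P B t)).
Local Notation PT := (g_sigma_algebraType (predictable_gen P T B)).

Lemma measurable_strip_predictable : measurable (strip T : set PT).
Proof.
have -> : strip T = ([set 0] `*` [set: Omega]) `|` ([set` `]0, T]] `*` [set: Omega]).
  apply/seteqP; split => -[t w] /=; rewrite !in_itv/=.
    move=> [/=]; rewrite in_itv/= => /andP[]; rewrite le_eqVlt => /orP[/eqP <-|-> ->].
      by left.
    by right.
  by move=> H; apply/stripP; case: H => [[-> _]|[/andP[/ltW -> ->] _]]; rewrite ?lexx ?ltW.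
have FT (t : R) : <<s augmented_gen P B t >> [set: Omega] by exact: (@measurableT _ (Ft t)).
apply: measurableU; apply: sub_sigma_algebra; [left|right].
  by exists [set: Omega].
by exists 0, T, [set: Omega].
Qed.

Lemma predictable_gen_measurable :
  <<s predictable_gen P T B >> `<=` (measurable : set (set (R * Omega))).
Proof.
apply: smallest_sub; first exact: sigma_algebra_measurable.
have mF t A : t <= T -> <<s augmented_gen P B t >> A -> measurable A.
  by move=> tT; exact: (augmented_gen_measurable P_complete B_brownian).
move=> S [[A FA ->]|[s [t [A [s0 st tT FA ->]]]]].
  by apply: measurableX => //; apply: mF FA; exact: ltW.
by apply: measurableX => //; apply: mF FA; rewrite (le_trans (ltW st)).
Qed.

Lemma predictable_measurable_fun d' (S : measurableType d') (X : R * Omega -> S) :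
  measurable_fun (strip T : set PT) (X : PT -> S) -> measurable_fun (strip T) X.
Proof.
move=> mX _ Y mY; apply: predictable_gen_measurable.
by apply: mX => //; exact: measurable_strip_predictable.
Qed.

(** Predictable processes are adapted. It is enough to see it on generators: a rectangle over ]s, u]
    has a nonempty section at t only if s < t, and then its base lies in F_s, hence in F_t. *)
Lemma predictable_section d' (S : measurableType d') (X : R * Omega -> S) t :
  0 <= t <= T -> measurable_fun (strip T : set PT) (X : PT -> S) ->
  measurable_fun [set: Ft t] (fun w : Ft t => X (t, w)).
Proof.
move=> t0T mX _ Y mY; rewrite setTI.
have sec : forall A : set PT, <<s predictable_gen P T B >> A ->
    <<s augmented_gen P B t >> [set w | A (t, w)].
  apply: smallest_sub.
    split => [|A FA|A FA].
    - exact: (@measurable0 _ (Ft t)).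
    - rewrite (_ : [set w | _] = ~` [set w | A (t, w)]).
        exact: (@measurableC _ (Ft t)).
      by apply/seteqP; split => w /=; [case|split].
    - rewrite (_ : [set w | _] = \bigcup_k [set w | A k (t, w)]).
        exact: (@bigcupT_measurable _ (Ft t)).
      by apply/seteqP; split => w [n _ ?]; exists n.
  move=> _ [[A FA ->]|[s [u [A [s0 su uT FA ->]]]]].
    have [t0|t0] := eqVneq t 0.
      rewrite (_ : [set w | _] = A).
        by apply: augmented_genS FA; have /andP[] := t0T.
      by apply/seteqP; split => w //= [].
    rewrite (_ : [set w | _] = set0); first exact: (@measurable0 _ (Ft t)).
    by apply/seteqP; split => w //= [] /eqP; rewrite (negbTE t0).
  have [/andP[st tu]|nst] := boolP (s < t <= u).
    rewrite (_ : [set w | _] = A).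
      by apply: augmented_genS FA; exact: ltW.
    by apply/seteqP; split => w //=; [case|rewrite in_itv/= st tu].
  rewrite (_ : [set w | _] = set0); first exact: (@measurable0 _ (Ft t)).
  by apply/seteqP; split => w //=; rewrite in_itv/= (negbTE nst) => -[].
have /sec := mX measurable_strip_predictable Y mY.
rewrite [X in _ X -> _](_ : _ = [set w | Y (X (t, w))])//.
apply/seteqP; split => w /=; first by case.
by move=> ?; split=> //; rewrite in_itv.
Qed.

Definition measurable_process (Z : R -> Omega -> 'cV[R]_m) :=
  forall i, measurable_fun (strip T) (fun x => Z x.1 x.2 i 0).

Lemma predictable_process Z : predictable_mx P T B Z -> measurable_process Z.
Proof.
move=> mZ i; exact: (@predictable_measurable_fun _ _ (fun x => Z x.1 x.2 i 0) (mZ i 0)).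
Qed.

Lemma measurable_processD Z1 Z2 (a : R) : measurable_process Z1 -> measurable_process Z2 ->
  measurable_process (fun t w => Z1 t w + a *: Z2 t w).
Proof.
move=> m1 m2 i; under eq_fun do rewrite !mxE.
by apply: measurable_funD; [exact: m1|apply: measurable_funM => //; exact: m2].
Qed.

Lemma measurable_process_dot Z1 Z2 : measurable_process Z1 -> measurable_process Z2 ->
  measurable_fun (strip T) (fun x => dot (Z1 x.1 x.2) (Z2 x.1 x.2)).
Proof. by move=> m1 m2; apply: measurable_dot => i; [exact: m1|exact: m2]. Qed.

Lemma measurable_process_simple (H : simple_process Omega R m) :
  is_simple P T B H -> measurable_process (sp_eval H).
Proof.
move=> Hs; have [tT _ mh _] := Hs => i.
under eq_fun do rewrite /sp_eval summxE.
apply: measurable_sum => j; have jH := ltn_ord j.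
rewrite (_ : (fun x : R * Omega => _) = fun x => if (sp_time H j < x.1) && (x.1 <= sp_time H j.+1)
  then sp_value H j x.2 i 0 else 0); last first.
  by apply/funext => x; case: ifPn => _; rewrite ?mxE.
apply: measurable_fun_if => //=.
- exact: measurable_strip.
- apply: measurable_and.
    by apply: measurable_fun_ltr => //; exact: measurable_funTS measurable_fst.
  by apply: measurable_fun_ler => //; exact: measurable_funTS measurable_fst.
- have mv : measurable_fun [set: Omega] (fun w => sp_value H j w i 0).
    apply: (filtration_measurable_fun P_complete B_brownian _ (mh j i jH)).
    by have /andP[] := tT _ (ltnW jH).
  exact: measurable_funTS (measurableT_comp mv measurable_snd).
Qed.

Definition sq_norm (Z : R -> Omega -> 'cV[R]_m) : \bar R :=
  strip_int P T (fun t w => (dot (Z t w) (Z t w))%:E).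

Lemma sq_normD Z1 Z2 a : measurable_process Z1 -> measurable_process Z2 ->
  (sq_norm (fun t w => Z1 t w + a *: Z2 t w)%R <=
   2%:E * sq_norm Z1 + (2 * a ^+ 2)%:E * sq_norm Z2)%E.
Proof.
move=> m1 m2.
have md Z (mZ : measurable_process Z) :
    measurable_fun (strip T) (fun x => (dot (Z x.1 x.2) (Z x.1 x.2))%:E).
  by apply/measurable_EFinP; exact: measurable_process_dot.
have c0 : 0 <= 2 * a ^+ 2 by rewrite mulr_ge0 ?sqr_ge0.
rewrite /sq_norm -!strip_integralZ//; try exact: md; try by move=> *; rewrite lee_fin dot_ge0.
rewrite -strip_integralD//; last 4 first.
- by apply: emeasurable_funM => //; exact: md.
- by apply: emeasurable_funM => //; exact: md.
- by move=> t w _; rewrite -EFinM lee_fin mulr_ge0// dot_ge0.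
- by move=> t w _; rewrite -EFinM lee_fin mulr_ge0// dot_ge0.
apply: le_strip_integral.
- by apply: (md (fun t w => Z1 t w + a *: Z2 t w)); exact: measurable_processD.
- by apply: emeasurable_funD; apply: emeasurable_funM => //; exact: md.
- by move=> t w _; rewrite lee_fin dot_ge0.
move=> t w _; rewrite -!EFinM -EFinD lee_fin.
have := dot_ge0 (Z1 t w - a *: Z2 t w).
rewrite !(dotDl, dotDr, dotNl, dotNr, dotZl, dotZr) (dotC (Z2 t w) (Z1 t w)); lra.
Qed.

Definition approximable (Z : R -> Omega -> 'cV[R]_m) :=
  forall e : R, 0 < e -> exists2 H, is_simple P T B H &
    (sq_norm (fun t w => sp_eval H t w - Z t w)%R <= e%:E)%E.

Lemma simple_linear (H1 H2 : simple_process Omega R m) (a : R) :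
  is_simple P T B H1 -> is_simple P T B H2 ->
  exists H, [/\ is_simple P T B H,
    forall s w, sp_eval H s w = sp_eval H1 s w + a *: sp_eval H2 s w &
    forall s w, sp_integral B H s w = sp_integral B H1 s w + a * sp_integral B H2 s w].
Proof.
move=> h1 h2; have [//|N [r [rg _ r1 r2]]] := @times_on_exists _ _ _ P _ _ B T_gt0 [::] _ _ _ h1 h2.
have [r0 rN _] := rg.
pose h k w := sp_eval H1 (r k.+1) w + a *: sp_eval H2 (r k.+1) w.
have [_ _ mh1 [K1 hK1]] := regrid_simple rg h1 r1.
have [_ _ mh2 [K2 hK2]] := regrid_simple rg h2 r2.
have hs : is_simple P T B (SimpleProcess N r h).
  apply: (grid_simple rg (K := K1 + `|a| * K2)).
    move=> k i kN; rewrite /filtration_measurable /h; under eq_fun do rewrite !mxE.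
    apply: measurable_funD; first exact: mh1.
    by apply: measurable_funM => //; exact: mh2.
  move=> k w i kN; rewrite !mxE (le_trans (ler_normD _ _))// lerD ?hK1//.
  by rewrite normrM ler_wpM2l// hK2.
exists (SimpleProcess N r h); split=> // s w.
  have [/andP[s0 sT]|] := boolP (0 < s <= T); last first.
    rewrite negb_and -leNgt -ltNge => s0T.
    by rewrite !(sp_eval_out (P := P) (B := B) (T := T))// scaler0 addr0.
  have [k kN ks] : exists2 k, (k < N)%N & r k < s <= r k.+1.
    by apply: (grid_cell rg); rewrite s0.
  rewrite (sp_eval_grid rg _ _ kN ks) (sp_eval_cell rg _ r1 kN ks).
  by rewrite (sp_eval_cell rg _ r2 kN ks).
rewrite -(sp_integral_regrid rg _ _ h1 r1) -(sp_integral_regrid rg _ _ h2 r2).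
rewrite /sp_integral/= mulr_sumr -big_split/=; apply: eq_bigr => k _.
by rewrite dotDl dotZl.
Qed.

Lemma approximableD Z1 Z2 (a : R) : measurable_process Z1 -> measurable_process Z2 ->
  approximable Z1 -> approximable Z2 ->
  approximable (fun t w => Z1 t w + a *: Z2 t w).
Proof.
move=> m1 m2 a1 a2 e e0.
(* [sq_normD] charges 2 for the first error and 2 a^2 for the second. The tolerances below make each
   contribution at most e/2, and the added 2 covers the case a = 0. *)
have c0 : 0 < 2 * a ^+ 2 + 2 by rewrite ltr_wpDl// mulr_ge0// sqr_ge0.
have [H1 h1 e1] := a1 (e / 4) (divr_gt0 e0 (ltr0n _ 4)).
have [H2 h2 e2] := a2 (e / 2 / (2 * a ^+ 2 + 2)) (divr_gt0 (divr_gt0 e0 (ltr0n _ 2)) c0).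
have [H [hs HE _]] := simple_linear a h1 h2.
exists H => //.
rewrite (_ : (fun t w => _) = fun t w => (sp_eval H1 t w - Z1 t w) + a *: (sp_eval H2 t w - Z2 t w)).
  have ms H' (h' : is_simple P T B H') Z (mZ : measurable_process Z) :
      measurable_process (fun t w => sp_eval H' t w - Z t w).
    have := measurable_processD (-1) (measurable_process_simple h') mZ.
    by under eq_fun do under eq_fun do rewrite scaleN1r.
  apply: (le_trans (sq_normD a (ms _ h1 _ m1) (ms _ h2 _ m2))).
  apply: (@le_trans _ _ (2%:E * (e / 4)%:E + (2 * a ^+ 2)%:E * (e / 2 / (2 * a ^+ 2 + 2))%:E)%E).
    apply: leeD; apply: lee_wpmul2l => //; by rewrite lee_fin mulr_ge0// sqr_ge0.
  rewrite -!EFinM -EFinD lee_fin.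
  have : 2 * a ^+ 2 * (e / 2 / (2 * a ^+ 2 + 2)) <= e / 2.
    rewrite [X in X <= _]mulrA ler_pdivrMr// mulrDr [X in X <= _]mulrC lerDl.
    by rewrite mulr_ge0// divr_ge0// ltW.
  by rewrite (_ : 2 * (e / 4) = e / 2); [lra|field].
apply/funext => t; apply/funext => w; rewrite HE scalerBr opprD addrACA//.
Qed.

Lemma approximable_close Z : measurable_process Z ->
  (forall e : R, 0 < e -> exists Z', [/\ measurable_process Z', approximable Z' &
    (sq_norm (fun t w => Z' t w - Z t w)%R <= e%:E)%E]) -> approximable Z.
Proof.
move=> mZ aZ e e0; have e4 : 0 < e / 4 by rewrite divr_gt0.
have [Z' [mZ' aZ' e']] := aZ _ e4.
have [H hs eH] := aZ' _ e4.
have ms Z1 (m1 : measurable_process Z1) Z2 (m2 : measurable_process Z2) :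
    measurable_process (fun t w => Z1 t w - Z2 t w).
  have := measurable_processD (-1) m1 m2.
  by under eq_fun do under eq_fun do rewrite scaleN1r.
exists H => //.
rewrite (_ : (fun t w => _) = fun t w => (sp_eval H t w - Z' t w) + 1 *: (Z' t w - Z t w)).
  have mH := measurable_process_simple hs.
  apply: (le_trans (sq_normD 1 (ms _ mH _ mZ') (ms _ mZ' _ mZ))).
  rewrite expr1n mulr1.
  apply: (@le_trans _ _ (2%:E * (e / 4)%:E + 2%:E * (e / 4)%:E)%E).
    apply: leeD.
      by apply: lee_wpmul2l; [rewrite lee_fin|exact: eH].
    by apply: lee_wpmul2l; [rewrite lee_fin|exact: e'].
  by rewrite -!EFinM -EFinD lee_fin; lra.
by apply/funext => t; apply/funext => w; rewrite scale1r addrA subrK.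
Qed.

(** Time 0 is excluded because every simple process vanishes there, whatever process it represents
    on ]0, T]; a single time is negligible. *)
Lemma sq_norm_eq0 (Z : R -> Omega -> 'cV[R]_m) :
  (forall t w, 0 < t <= T -> Z t w = 0) -> sq_norm Z = 0%E.
Proof.
move=> Z0; rewrite /sq_norm; under eq_integral => w _.
  rewrite -integral_itv_obnd_cbnd; last first.
    apply: (eq_measurable_fun (cst 0%E)) => //.
    by move=> t; rewrite inE/= in_itv/= => t0T; rewrite Z0// dot0l.
  rewrite (eq_integral (cst 0%E)); last first.
    by move=> t; rewrite inE/= in_itv/= => t0T; rewrite Z0// dot0l.
  rewrite integral0; over.
by rewrite integral0.
Qed.

Lemma dot_delta (i : 'I_m) (a : R) :
  dot (a *: delta_mx i 0 : 'cV[R]_m) (a *: delta_mx i 0) = a ^+ 2.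
Proof.
rewrite dotE (bigD1 i)//= big1; last by move=> j /negbTE ji; rewrite !mxE ji/= mulr0 mul0r.
by rewrite !mxE !eqxx/= mulr1 addr0 expr2.
Qed.

(** Makes the generators a pi-system, as required by the Dynkin argument for indicators. *)
Lemma predictable_gen_setI : setI_closed (predictable_gen P T B).
Proof.
have F0 : <<s augmented_gen P B 0 >> set0 by exact: (@measurable0 _ (Ft 0)).
have FI (s t u : R) (A C : set Omega) : s <= u -> t <= u -> <<s augmented_gen P B s >> A ->
    <<s augmented_gen P B t >> C -> <<s augmented_gen P B u >> (A `&` C).
  move=> su tu FA FC; apply: (@measurableI _ (Ft u)).
    exact: augmented_genS FA.
  exact: augmented_genS FC.
have empty (S : set (R * Omega)) : S = set0 -> predictable_gen P T B S.
  by move=> ->; left; exists set0 => //; rewrite setX0.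
move=> S S' [[A FA ->]|[s [t [A [s0 st tT FA ->]]]]].
  move=> [[A' FA' ->]|[s' [t' [A' [s0' st' tT' FA' ->]]]]].
    by left; exists (A `&` A'); [exact: FI FA FA'|rewrite -setXI setIid].
  apply: empty; rewrite -subset0 => -[x w] [[/= -> _] []/=].
  by rewrite in_itv/= => /andP[]; rewrite ltNge s0'.
move=> [[A' FA' ->]|[s' [t' [A' [s0' st' tT' FA' ->]]]]].
  apply: empty; rewrite -subset0 => -[x w] [[/= + _] [/= x0 _]].
  by rewrite x0 in_itv/= => /andP[]; rewrite ltNge s0.
have [lt|le] := ltP (Num.max s s') (Num.min t t').
  right; exists (Num.max s s'), (Num.min t t'), (A `&` A'); split=> //.
  - by rewrite le_max s0.
  - by rewrite ge_min tT.
  - by apply: FI FA FA'; rewrite le_max lexx ?orbT.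
  - rewrite -setXI; congr (_ `*` _); apply/seteqP; split => x /=; rewrite !in_itv/=.
      by move=> [/andP[? ?] /andP[? ?]]; rewrite gt_max le_min; apply/and3P; split=> //; apply/andP.
    by rewrite gt_max le_min => /andP[/andP[-> ->] /andP[-> ->]].
apply: empty; rewrite -subset0 => -[x w] [[/= + _] [/= + _]]; rewrite !in_itv/=.
move=> /andP[sx xt] /andP[sx' xt'].
have : Num.max s s' < x by rewrite gt_max sx.
by rewrite ltNge (le_trans _ le)// le_min xt.
Qed.

Local Notation unit_process i f := (fun t w => (f t w : R) *: (delta_mx i 0 : 'cV[R]_m)).

Lemma measurable_unit_process i (f : R -> Omega -> R) :
  measurable_fun (strip T) (fun x => f x.1 x.2) -> measurable_process (unit_process i f).
Proof.
move=> mf j; under eq_fun do rewrite mxE.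
exact: measurable_funM.
Qed.

Lemma sq_norm_unit i (f g : R -> Omega -> R) :
  sq_norm (fun t w => unit_process i f t w - unit_process i g t w) =
  strip_int P T (fun t w => ((f t w - g t w) ^+ 2)%:E).
Proof.
rewrite /sq_norm; apply: eq_integral => w _; apply: eq_integral => t _.
by rewrite -scalerBl dot_delta.
Qed.

Lemma approximable_unit i (fn : nat -> R -> Omega -> R) (f g : R -> Omega -> R) :
  (forall n, measurable_fun (strip T) (fun x => fn n x.1 x.2)) ->
  measurable_fun (strip T) (fun x => f x.1 x.2) ->
  measurable_fun (strip T) (fun x => g x.1 x.2) ->
  (forall n, approximable (unit_process i (fn n))) ->
  (forall n t w, 0 <= t <= T -> (fn n t w - f t w) ^+ 2 <= g t w) ->
  (forall t w, 0 <= t <= T -> fn n t w @[n --> \oo] --> f t w) ->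
  (strip_int P T (fun t w => (g t w)%:E) < +oo)%E ->
  approximable (unit_process i f).
Proof.
move=> mfn mf mg an fg fnf goo; apply: approximable_close.
  exact: measurable_unit_process.
move=> e e0.
have [n en] : exists n, (strip_int P T (fun t w => ((fn n t w - f t w) ^+ 2)%:E) <= e%:E)%E.
  apply: (@strip_dominated_cvg0 _ _ _ P T (fun n t w => (fn n t w - f t w) ^+ 2) g) => //.
  - by move=> n; apply: measurable_funX; exact: measurable_funB.
  - by move=> n t w tT; rewrite sqr_ge0 fg.
  - move=> t w tT; have := fnf t w tT => /cvgB/(_ (cvg_cst (f t w))); rewrite subrr.
    by move=> h; have := cvgM h h; rewrite mulr0 => {}h; exact: h.
exists (unit_process i (fn n)); split.
- exact: measurable_unit_process.
- exact: an.
- by rewrite sq_norm_unit.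
Qed.

Lemma is_simple0 : is_simple P T B (SimpleProcess 0 (fun=> 0) (fun _ _ => 0)).
Proof. by split=> //= [k _|]; [rewrite lexx ltW|exists 0]. Qed.

Lemma strip_int_cst (c : R) : 0 <= c ->
  (strip_int P T (fun _ _ => c%:E) < +oo)%E.
Proof.
move=> c0; under eq_integral do rewrite integral_cst//= lebesgue_measure_itv/= lte_fin T_gt0.
by rewrite (integral_probability_cst P) oppr0 -EFinD -EFinM ltry.
Qed.

(** Dynkin's theorem. A rectangle over ]s, t] is a one-cell simple process, one over {0} is
    indistinguishable from 0 in square norm, and complements and disjoint unions follow from
    linearity and dominated convergence. *)
Lemma approximable_indic (i : 'I_m) (S : set (R * Omega)) :
  <<s predictable_gen P T B >> S ->
  approximable (unit_process i (fun t w => \1_S (t, w))).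
Proof.
pose mS (S' : set PT) (h : <<s predictable_gen P T B >> S') := predictable_gen_measurable h.
have mI (S' : set PT) : <<s predictable_gen P T B >> S' ->
    measurable_fun (strip T) (fun x : R * Omega => (\1_S' (x.1, x.2) : R)).
  move=> /mS h; rewrite (_ : (fun _ => _) = \1_S'); first exact: measurable_indic.
  by apply/funext => -[].
have exact_simple (H : simple_process Omega R m) S' : is_simple P T B H ->
    (forall t w, 0 < t <= T -> sp_eval H t w = (\1_S' (t, w) : R) *: delta_mx i 0) ->
    approximable (unit_process i (fun t w => \1_S' (t, w))).
  move=> Hs HE e e0; exists H => //; rewrite sq_norm_eq0 ?lee_fin ?ltW//.
  by move=> t w tT; rewrite HE// subrr.
have F0T : <<s augmented_gen P B 0 >> [set: Omega] by exact: (@measurableT _ (Ft 0)).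
have rect s t (A : set Omega) : 0 <= s -> s < t -> t <= T -> <<s augmented_gen P B s >> A ->
    is_simple P T B (SimpleProcess 1 (fun k => if k == 0%N then s else t)
       (fun _ w => (\1_A w : R) *: (delta_mx i 0 : 'cV[R]_m))).
  move=> s0 st tT FA; split=> /=.
  - by move=> [|k] _ /=; rewrite ?s0 ?tT ?(le_trans s0 (ltW st)) ?(le_trans (ltW st) tT).
  - by move=> [|k]//= _; exact: ltW.
  - move=> [|k] j //= _; rewrite /filtration_measurable; under eq_fun do rewrite mxE.
    by apply: measurable_funM => //; exact: (@measurable_indic _ (Ft s)).
  - exists 1 => k w j _; rewrite !mxE indicE normrM !normr_nat.
    by case: (w \in A); case: (_ && _); rewrite ?mulr1 ?mulr0 ?mul0r.
have rectE s t (A : set Omega) x w :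
    sp_eval (SimpleProcess 1 (fun k => if k == 0%N then s else t)
       (fun _ w => (\1_A w : R) *: (delta_mx i 0 : 'cV[R]_m))) x w =
    (\1_([set` `]s, t]] `*` A) (x, w) : R) *: delta_mx i 0.
  rewrite /sp_eval big_ord1/= !indicE in_setX mem_setE in_itv/=.
  by case: ifP => //; rewrite scale0r.
move: S; apply: (@dynkin_induction _ PT (predictable_gen P T B)
  (fun S => approximable (unit_process i (fun t w => \1_S (t, w))))).
- by [].
- exact: predictable_gen_setI.
- apply: (exact_simple _ _ (rect 0 T [set: Omega] _ _ _ _)) => // t w tT.
  by rewrite rectE !indicE in_setX !in_setT mem_setE in_itv/= tT.
- move=> S' [[A FA ->]|[s [t [A [s0 st tT FA ->]]]]].
    apply: (exact_simple (SimpleProcess 0 (fun=> 0) (fun _ _ => 0))) => //.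
      exact: is_simple0.
    move=> t w /andP[t0 _]; rewrite /sp_eval big_ord0 indicE memNset ?scale0r//.
    by move=> [/= t0' _]; move: t0; rewrite t0' ltxx.
  by apply: (exact_simple _ _ (rect s t A _ _ _ _)).
- move=> S' mS' aS'.
  have aT := exact_simple _ [set: PT] (rect 0 T [set: Omega] (lexx _) T_gt0 (lexx _) F0T).
  have {}aT : approximable (unit_process i (fun t w => \1_[set: PT] (t, w))).
    by apply: aT => t w tT; rewrite rectE !indicE in_setX !in_setT mem_setE in_itv/= tT.
  have mT := mI [set: PT] (@measurableT _ PT).
  have := approximableD (-1) (measurable_unit_process i mT)
    (measurable_unit_process i (mI _ mS')) aT aS'.
  congr approximable; apply/funext => t; apply/funext => w.
  rewrite scaleN1r -scalerBl; congr (_ *: _); rewrite !indicE in_setT in_setC.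
  by case: (_ \in _); rewrite ?subrr ?subr0.
- move=> F mF tF aF.
  pose U n := \big[setU/set0]_(k < n) F k.
  have mU n : <<s predictable_gen P T B >> (U n) by apply: (@bigsetU_measurable _ PT) => k _; exact: mF.
  have aU n : approximable (unit_process i (fun t w => \1_(U n) (t, w))).
    elim: n => [|n IH].
      apply: (exact_simple (SimpleProcess 0 (fun=> 0) (fun _ _ => 0))) => //.
        exact: is_simple0.
      by move=> t w _; rewrite /sp_eval /U !big_ord0 indicE in_set0 scale0r.
    have := approximableD 1 (measurable_unit_process i (mI _ (mU n)))
      (measurable_unit_process i (mI _ (mF n))) IH (aF n).
    congr approximable; apply/funext => t; apply/funext => w.
    rewrite scale1r -scalerDl; congr (_ *: _); rewrite /U big_ord_recr/=.
    have dis : ~ ((\big[setU/set0]_(k < n) F k) (t, w) /\ F n (t, w)).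
      rewrite -bigcup_mkord => -[[k /= kn Fk] Fx].
      have kE := tF k n I I (ex_intro _ (t, w) (conj Fk Fx)).
      by rewrite kE ltnn in kn.
    rewrite !indicE in_setU.
    have [xU|] := boolP (_ \in \big[setU/set0]_(k < n) F k); last by rewrite add0r.
    have [xF|] := boolP (_ \in F n); last by rewrite addr0.
    by exfalso; apply: dis; rewrite !inE in xU xF.
  apply: (@approximable_unit i (fun n t w => \1_(U n) (t, w)) _ (fun _ _ => 1)) => //.
  + by move=> n; exact: mI.
  + by apply: mI; exact: (@bigcupT_measurable _ PT).
  + move=> t w _; have [[k _ Fk]|nF] := pselect ((\bigcup_k F k) (t, w)).
      apply/cvgrPdist_le => e e0; exists k.+1 => // n /= kn.
      rewrite !indicE !mem_set; first by rewrite subrr normr0 ltW.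
        by rewrite /U -bigcup_mkord; exists k.
      by exists k.
    apply/cvgrPdist_le => e e0; apply: nearW => n.
    rewrite !indicE !memNset; first by rewrite subrr normr0 ltW.
      by rewrite /U -bigcup_mkord => -[k _ Fk]; apply: nF; exists k.
    exact: nF.
  + exact: strip_int_cst.
Qed.

Lemma approximable_unitD i (f g : R -> Omega -> R) (c : R) :
  measurable_fun (strip T) (fun x => f x.1 x.2) ->
  measurable_fun (strip T) (fun x => g x.1 x.2) ->
  approximable (unit_process i f) -> approximable (unit_process i g) ->
  approximable (unit_process i (fun t w => f t w + c * g t w)).
Proof.
move=> mf mg af ag.
have := approximableD c (measurable_unit_process i mf) (measurable_unit_process i mg) af ag.
congr approximable; apply/funext => t; apply/funext => w.
by rewrite scalerDl scalerA.
Qed.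

Lemma approximable_unit0 i : approximable (unit_process i (fun _ _ => 0)).
Proof.
move=> e e0; exists (SimpleProcess 0 (fun=> 0) (fun _ _ => 0)); first exact: is_simple0.
rewrite sq_norm_eq0 ?lee_fin ?ltW// => t w _.
by rewrite /sp_eval big_ord0 scale0r subrr.
Qed.

Lemma approximable_unit_sum i (f : nat -> R -> Omega -> R) (c : R) n :
  (forall j, measurable_fun (strip T) (fun x => f j x.1 x.2)) ->
  (forall j, approximable (unit_process i (f j))) ->
  approximable (unit_process i (fun t w => \sum_(j < n) c * f j t w)).
Proof.
move=> mf af; elim: n => [|n IH].
  have := approximable_unit0 i; congr approximable.
  by apply/funext => t; apply/funext => w; rewrite big_ord0.
have mS : measurable_fun (strip T) (fun x => \sum_(j < n) c * f j x.1 x.2).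
  by apply: measurable_sum => j; exact: measurable_funM.
have := approximable_unitD (i := i) c mS (mf n) IH (af n); congr approximable.
by apply/funext => t; apply/funext => w; rewrite big_ord_recr.
Qed.

(** The sum counts the levels j M/N, j >= 1, that x has reached, so it equals x rounded down to a
    multiple of M/N. A bounded process is thereby a uniform limit of sums of indicators. *)
Lemma staircase_le (M x : R) (N : nat) : (0 < N)%N -> 0 < M -> 0 <= x <= M ->
  `|\sum_(j < N) M / N%:R * (j.+1%:R * (M / N%:R) <= x)%R%:R - x| <= M / N%:R.
Proof.
move=> N0 M0 /andP[x0 xM]; set dl := M / N%:R.
have d0 : 0 < dl by rewrite divr_gt0// ltr0n.
have y0 : 0 <= x / dl by rewrite divr_ge0// ltW.
have kN : (Num.truncn (x / dl) <= N)%N.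
  rewrite -(ler_nat R); have /andP[+ _] := truncn_itv y0 => /le_trans; apply.
  by rewrite ler_pdivrMr// /dl mulrC divfK// pnatr_eq0 -lt0n.
have -> : \sum_(j < N) dl * (j.+1%:R * dl <= x)%R%:R = dl * (Num.truncn (x / dl))%:R.
  rewrite -mulr_sumr; congr (_ * _).
  under eq_bigr do rewrite -ler_pdivlMr// -truncn_ge_nat//.
  rewrite -natr_sum; congr _%:R.
  move: (Num.truncn (x / dl)) kN => k kN; clear y0 d0 dl N0.
  elim: N k kN => [k|N IH k].
    by rewrite leqn0 => /eqP ->; rewrite big_ord0.
  rewrite leq_eqVlt big_ord_recr/= => /orP[/eqP ->|].
    rewrite ltnSn -[RHS]addn1; congr (_ + _)%N.
    rewrite -[RHS](IH N)//; apply: eq_bigr => j _.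
    by rewrite ltnS ltnW ltn_ord.
  by rewrite ltnS => kN; rewrite (IH k)// ltnNge kN addn0.
have /andP[] := truncn_itv y0; rewrite -natr1 ler_pdivlMr// ltr_pdivrMr//.
move: (Num.truncn _)%:R => k k1 k2; rewrite ler_norml; apply/andP; split; nra.
Qed.

Lemma measurable_predictable (f : R -> Omega -> R) : predictable P T B f ->
  measurable_fun (strip T) (fun x => f x.1 x.2).
Proof. by move=> mf; exact: (@predictable_measurable_fun _ _ (fun x => f x.1 x.2) mf). Qed.

Lemma approximable_bounded i (f : R -> Omega -> R) (M : R) : 0 < M ->
  predictable P T B f -> (forall t w, 0 <= t <= T -> 0 <= f t w <= M) ->
  approximable (unit_process i f).
Proof.
move=> M0 pf fM; have mf := measurable_predictable pf.
pose S n j : set PT := strip T `&` [set x : R * Omega | j.+1%:R * (M / n.+1%:R) <= f x.1 x.2].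
have mS n j : <<s predictable_gen P T B >> (S n j).
  have := pf measurable_strip_predictable _ (measurable_itv `[j.+1%:R * (M / n.+1%:R), +oo[).
  congr (<<s _ >> (_ `&` _)).
  by apply/seteqP; split => x /=; rewrite in_itv/= andbT.
have mSf n j : measurable_fun (strip T) (fun x : R * Omega => (\1_(S n j) (x.1, x.2) : R)).
  rewrite (_ : (fun _ => _) = \1_(S n j)); last by apply/funext => -[].
  by apply: measurable_indic; exact: predictable_gen_measurable.
pose fn n t w : R := \sum_(j < n.+1) M / n.+1%:R * \1_(S n j) (t, w).
have fnf n t w : 0 <= t <= T -> `|fn n t w - f t w| <= M / n.+1%:R.
  move=> tT; have := staircase_le (ltn0Sn n) M0 (fM t w tT).
  rewrite (_ : \sum_(j < n.+1) _ = fn n t w)//; apply: eq_bigr => j _.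
  rewrite indicE; congr (_ * (nat_of_bool _)%:R); apply/idP/idP; rewrite inE.
    by move=> ?; split => //; exact/stripP.
  by case.
apply: (@approximable_unit i fn f (fun _ _ => M ^+ 2)) => //.
- by move=> n; apply: measurable_sum => j; exact: measurable_funM.
- move=> n; apply: (approximable_unit_sum (f := fun j t w => \1_(S n j) (t, w))).
    exact: mSf.
  by move=> j; exact: approximable_indic.
- move=> n t w tT; rewrite -[leLHS]real_normK ?num_real// ler_sqr ?nnegrE// ?(ltW M0)//.
  by rewrite (le_trans (fnf n t w tT))// ler_piMr ?(ltW M0)// invf_le1// ler1n.
- move=> t w tT; apply/cvgrPdist_le => e e0.
  have Me : 0 < e / M by rewrite divr_gt0.
  have [N _ HN] := near_infty_natSinv_lt (PosNum Me).
  exists N => // n /= Nn; rewrite distrC (le_trans (fnf n t w tT))//.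
  by have := HN n Nn; rewrite /= ltr_pdivlMr// mulrC => /ltW.
- by apply: strip_int_cst; rewrite sqr_ge0.
Qed.

Lemma approximable_nonneg i (f : R -> Omega -> R) :
  predictable P T B f -> (forall t w, 0 <= t <= T -> 0 <= f t w) ->
  (strip_int P T (fun t w => (f t w ^+ 2)%:E) < +oo)%E ->
  approximable (unit_process i f).
Proof.
move=> pf f0 foo; have mf := measurable_predictable pf.
apply: (@approximable_unit i (fun n t w => Num.min (f t w) n.+1%:R) f
    (fun t w => f t w ^+ 2)) => //.
- by move=> n; exact: measurable_minr.
- exact: measurable_funX.
- move=> n; apply: (@approximable_bounded _ _ n.+1%:R) => //.
    by apply: (@measurable_minr _ PT) => //.
  by move=> t w tT; rewrite le_min f0 ?tT// ler0n ge_min lexx orbT.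
- move=> n t w tT; have := f0 t w tT; rewrite -sqrrN opprB => fw.
  rewrite ler_sqr ?nnegrE//; last by rewrite subr_ge0 ge_min lexx.
  by rewrite gerBl le_min fw/=.
- move=> t w tT; apply/cvgrPdist_le => e e0.
  exists (Num.truncn (f t w)) => // n /= Nn; rewrite min_l ?subrr ?normr0 ?ltW//.
  have /andP[_ h] := truncn_itv (f0 t w tT).
  by rewrite (lt_le_trans h)// ler_nat ltnS.
Qed.

(** Reduction to one nonnegative coordinate: positive and negative parts of each coordinate are
    approximable, and the coordinates are added one at a time by linearity. *)
Lemma predictable_approximable Z : predictable_mx P T B Z -> (sq_norm Z < +oo)%E ->
  approximable Z.
Proof.
move=> pZ Zoo.
have mZi i := measurable_predictable (pZ i 0).
have aZi i : approximable (unit_process i (fun t w => Z t w i 0)).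
  pose fp (t : R) (w : Omega) := Num.max (Z t w i 0) 0.
  pose fm (t : R) (w : Omega) := Num.max (- Z t w i 0) 0.
  have pfp : predictable P T B fp by apply: (@measurable_maxr _ PT); [exact: pZ|exact: measurable_cst].
  have pfm : predictable P T B fm.
    apply: (@measurable_maxr _ PT); last exact: measurable_cst.
    by apply: (@measurable_funN _ PT); exact: pZ.
  have sqle t w : Z t w i 0 ^+ 2 <= dot (Z t w) (Z t w).
    rewrite dotE (bigD1 i)//= -expr2 lerDl sumr_ge0// => j _.
    by rewrite -expr2 sqr_ge0.
  have fin (g : R -> Omega -> R) : predictable P T B g ->
      (forall t w, g t w ^+ 2 <= Z t w i 0 ^+ 2) ->
      (strip_int P T (fun t w => (g t w ^+ 2)%:E) < +oo)%E.
    move=> pg gZ; apply: le_lt_trans Zoo; apply: le_strip_integral.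
    - by apply/measurable_EFinP; apply: measurable_funX; exact: measurable_predictable.
    - apply/measurable_EFinP; apply: measurable_process_dot; exact: predictable_process.
    - by move=> t w _; rewrite lee_fin sqr_ge0.
    - by move=> t w _; rewrite lee_fin (le_trans (gZ t w)).
  have ap : approximable (unit_process i fp).
    apply: approximable_nonneg; [exact: pfp|by move=> t w _; rewrite le_max lexx orbT|].
    apply: fin; [exact: pfp|move=> t w]; rewrite /fp; case: (leP 0 (Z t w i 0)) => // _.
    by rewrite expr0n/= sqr_ge0.
  have am : approximable (unit_process i fm).
    apply: approximable_nonneg; [exact: pfm|by move=> t w _; rewrite le_max lexx orbT|].
    apply: fin; [exact: pfm|move=> t w]; rewrite /fm; case: (leP 0 (- Z t w i 0)) => _.
      by rewrite sqrrN.
    by rewrite expr0n/= sqr_ge0.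
  have := approximable_unitD (i := i) (-1) (measurable_predictable pfp) (measurable_predictable pfm) ap am.
  congr approximable; apply/funext => t; apply/funext => w; congr (_ *: _).
  by rewrite /fp /fm; case: (leP 0 (Z t w i 0)); case: (leP 0 (- Z t w i 0)); lra.
have aS n : approximable (fun t w => \sum_(i < m | (i < n)%N) Z t w i 0 *: (delta_mx i 0 : 'cV[R]_m)) /\
    measurable_process (fun t w => \sum_(i < m | (i < n)%N) Z t w i 0 *: (delta_mx i 0 : 'cV[R]_m)).
  elim: n => [|n [IHa IHm]].
    split; last first.
      by move=> i; under eq_fun do rewrite big_pred0// mxE; exact: measurable_cst.
    move=> e e0; exists (SimpleProcess 0 (fun=> 0) (fun _ _ => 0)); first exact: is_simple0.
    rewrite sq_norm_eq0 ?lee_fin ?ltW// => t w _.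
    by rewrite /sp_eval big_ord0 big_pred0// subrr.
  have [nm|mn] := ltnP n m; last first.
    suff -> : (fun t w => \sum_(i < m | (i < n.+1)%N) Z t w i 0 *: (delta_mx i 0 : 'cV[R]_m)) =
       (fun t w => \sum_(i < m | (i < n)%N) Z t w i 0 *: delta_mx i 0) by [].
    apply/funext => t; apply/funext => w; apply: eq_bigl => i.
    by rewrite (leq_trans (ltn_ord i) mn) (leq_trans (ltn_ord i) (leqW mn)).
  have E : (fun t w => \sum_(i < m | (i < n.+1)%N) Z t w i 0 *: (delta_mx i 0 : 'cV[R]_m)) =
       (fun t w => \sum_(i < m | (i < n)%N) Z t w i 0 *: delta_mx i 0 +
          1 *: (Z t w (Ordinal nm) 0 *: delta_mx (Ordinal nm) 0)).
    apply/funext => t; apply/funext => w; rewrite scale1r.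
    rewrite (bigD1 (Ordinal nm))//= addrC; congr (_ + _).
    by apply: eq_bigl => i; rewrite ltnS [in RHS]ltn_neqAle andbC.
  rewrite E; split.
    apply: approximableD; [exact: IHm| |exact: IHa|exact: aZi].
    by apply: measurable_unit_process; exact: mZi.
  apply: measurable_processD; first exact: IHm.
  by apply: measurable_unit_process; exact: mZi.
have [+ _] := aS m; congr approximable.
apply/funext => t; apply/funext => w; apply/colP => j.
rewrite summxE (bigD1 j)//= big1 ?addr0 ?mxE ?eqxx ?mulr1//.
by move=> i /andP[_ ij]; rewrite !mxE eq_sym (negbTE ij)/= mulr0.
Qed.

End predictable.

(** * Path suprema *)

Section continuity.
Context (R : realType) (T : R).
Hypothesis T_gt0 : 0 < T.

(** Continuity for the subspace topology of [0, T] in elementary form, so that paths may be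
    arbitrary outside the interval. *)
Definition cont_on (g : R -> R) := forall t, 0 <= t <= T -> forall e : R, 0 < e ->
  exists2 dl : R, 0 < dl & forall s, 0 <= s <= T -> `|s - t| < dl -> `|g s - g t| <= e.

Lemma cont_onP g : {within `[0, T], continuous g} <-> cont_on g.
Proof.
split=> [/subspace_continuousP cg t tT e e0|cg].
  have /cg : `[0, T]%classic t by rewrite /= in_itv.
  move=> /cvgrPdist_le/(_ e e0)/nbhs_ballP[dl/= dl0 H].
  exists dl => // s sT st; rewrite distrC; apply: H.
    by rewrite -ball_normE/= distrC.
  by rewrite /= in_itv.
apply/subspace_continuousP => t; rewrite /= in_itv/= => tT.
apply/cvgrPdist_le => e e0; have [dl dl0 H] := cg t tT e e0.
apply/nbhs_ballP; exists dl => //= s; rewrite -ball_normE/= => ts.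
by rewrite in_itv/= => sT; rewrite distrC; apply: H => //; rewrite distrC.
Qed.

Lemma cont_onD f g : cont_on f -> cont_on g -> cont_on (fun t => f t + g t).
Proof.
move=> cf cg t tT e e0; have e2 : 0 < e / 2 by rewrite divr_gt0.
have [d1 d10 H1] := cf t tT _ e2; have [d2 d20 H2] := cg t tT _ e2.
exists (Num.min d1 d2); first by rewrite lt_min d10.
move=> s sT; rewrite lt_min => /andP[s1 s2].
rewrite opprD addrACA (le_trans (ler_normD _ _))//.
by have := H1 s sT s1; have := H2 s sT s2; lra.
Qed.

Lemma cont_onZ a f : cont_on f -> cont_on (fun t => a * f t).
Proof.
move=> cf t tT e e0; have a0 : 0 < `|a| + 1 by rewrite ltr_wpDl.
have [dl dl0 H] := cf t tT _ (divr_gt0 e0 a0).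
exists dl => // s sT st; rewrite -mulrBr normrM.
rewrite (le_trans (ler_wpM2l (normr_ge0 a) (H s sT st)))// mulrA ler_pdivrMr//.
by rewrite mulrC ler_wpM2l ?(ltW e0)// lerDl.
Qed.

Lemma cont_on_cst a : cont_on (fun=> a).
Proof. by move=> t _ e e0; exists 1 => // s _ _; rewrite subrr normr0 ltW. Qed.

Lemma cont_on_sum (I : Type) (l : seq I) (f : I -> R -> R) :
  (forall i, cont_on (f i)) -> cont_on (fun t => \sum_(i <- l) f i t).
Proof.
move=> cf; elim: l => [|i l IH].
  rewrite (_ : (fun t => _) = fun=> 0); first exact: cont_on_cst.
  by apply/funext => t; rewrite big_nil.
rewrite (_ : (fun t => _) = fun t => f i t + \sum_(j <- l) f j t); first exact: cont_onD.
by apply/funext => t; rewrite big_cons.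
Qed.

Lemma cont_on_min c g : 0 <= c <= T -> cont_on g -> cont_on (fun t => g (Num.min c t)).
Proof.
move=> cT cg t tT e e0.
have mT s : 0 <= s <= T -> 0 <= Num.min c s <= T.
  by move=> /andP[s0 sT]; have /andP[c0 c1] := cT; rewrite le_min c0 s0 ge_min c1.
have [dl dl0 H] := cg _ (mT t tT) e e0; exists dl => // s sT st.
apply: H; first exact: mT.
apply: le_lt_trans st; case: (leP c s) => cs; case: (leP c t) => ct; rewrite ?subrr ?normr0//.
  by rewrite ger0_norm ?subr_ge0 ?(ltW ct)// ger0_norm; lra.
by rewrite ler0_norm ?ler0_norm; lra.
Qed.

Lemma cont_on_norm f : cont_on f -> cont_on (fun t => `|f t|).
Proof.
move=> cf t tT e e0; have [dl dl0 H] := cf t tT e e0.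
by exists dl => // s sT st; rewrite (le_trans (ler_dist_dist _ _))// H.
Qed.

Lemma cont_on_max f c : cont_on f -> cont_on (fun t => Num.max (f t) c).
Proof.
move=> cf t tT e e0; have [dl dl0 H] := cf t tT e e0.
exists dl => // s sT st; have := H s sT st.
rewrite !ler_norml => /andP[h1 h2].
by case: (leP (f s) c) => ?; case: (leP (f t) c) => ?; apply/andP; split; lra.
Qed.

Lemma cont_on_unif f : (forall e : R, 0 < e -> exists2 g, cont_on g &
  forall t, 0 <= t <= T -> `|g t - f t| <= e) -> cont_on f.
Proof.
move=> fg t tT e e0; have e3 : 0 < e / 3 by rewrite divr_gt0.
have [g cg H] := fg _ e3; have [dl dl0 Hd] := cg t tT _ e3.
exists dl => // s sT st; have := H s sT; have := H t tT; have := Hd s sT st.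
by rewrite !ler_norml => /andP[? ?] /andP[? ?] /andP[? ?]; apply/andP; split; lra.
Qed.

(** An enumeration of the rationals clamped to [0, T]. It is dense in the interval, so the supremum
    of a continuous path is a countable one. *)
Definition rat_point (n : nat) : R :=
  Num.max 0 (Num.min T (ratr (odflt 0 (@unpickle rat n)))).

Lemma rat_point_itv n : 0 <= rat_point n <= T.
Proof. by rewrite /rat_point le_max lexx ge_max ge_min lexx (ltW T_gt0). Qed.

Lemma rat_point_dense t e : 0 <= t <= T -> 0 < e -> exists n, `|rat_point n - t| < e.
Proof.
move=> /andP[t0 tT] e0; have /rat_in_itvoo[q] : t - e < t + e by lra.
rewrite in_itv/= => /andP[q1 q2]; exists (pickle q).
have : Num.max 0 (Num.min T (ratr q)) = rat_point (pickle q) by rewrite /rat_point pickleK.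
move=> <-; rewrite maxEle minEle ltr_norml.
case: (leP T (ratr q)) => h1; case: ifPn => h2; move: h2; rewrite -?ltNge => h2;
  by apply/andP; split; lra.
Qed.

Lemma cont_on_rat g c t : cont_on g -> 0 <= t <= T -> c < g t ->
  exists n, c < g (rat_point n).
Proof.
move=> cg tT ct; have e0 : 0 < (g t - c) / 2 by rewrite divr_gt0 ?subr_gt0.
have [dl dl0 H] := cg t tT _ e0; have [n nt] := rat_point_dense tT dl0.
exists n; have := H _ (rat_point_itv n) nt; rewrite ler_norml => /andP[? ?]; lra.
Qed.

End continuity.

Section processes.
Context d (Omega : measurableType d) (R : realType) (P : probability Omega R).
Hypothesis P_complete : measure_is_complete P.

(** Here completeness of [P] enters the measurability of suprema: the supremum of a path over [0, T]
    agrees with a countable one only on the almost sure event where the path is continuous. *)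
Lemma complete_ae_measurable (A C : set Omega) : measurable A ->
  {ae P, forall w, A w <-> C w} -> measurable C.
Proof.
move=> mA [N [mN N0 ACN]].
have m1 : measurable (C `\` A).
  by apply: P_complete; exists N; split=> // w [Cw Aw]; apply: ACN => /iffRL /(_ Cw).
have m2 : measurable (A `\` C).
  by apply: P_complete; exists N; split=> // w [Aw Cw]; apply: ACN => /iffLR /(_ Aw).
rewrite (_ : C = (A `\` (A `\` C)) `|` (C `\` A)); first by apply: measurableU => //; exact: measurableD.
apply/seteqP; split => w /=.
  by have [Aw|nA] := pselect (A w); [left; split=> // -[]|right].
by move=> [[Aw h]|[]//]; apply: contrapT => nC; apply: h.
Qed.

Section sup.
Context (T : R).
Hypothesis T_gt0 : 0 < T.
Variable X : R -> Omega -> R.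
Hypothesis mX : forall t, 0 <= t <= T -> measurable_fun [set: Omega] (X t).
Hypothesis cX : {ae P, forall w, cont_on T (X ^~ w)}.

Let supX w := ereal_sup [set (X t w)%:E | t in `[0, T]].

Lemma sup_process_gt w c : cont_on T (X ^~ w) ->
  (exists n, c < X (rat_point T n) w) <-> (c%:E < supX w)%E.
Proof.
move=> cw; split; last first.
  move=> /ereal_sup_gt[_ [t + <-]].
  by rewrite /= in_itv/= => tT; rewrite lte_fin => /(cont_on_rat T_gt0 cw tT).
move=> [n cn]; rewrite (@lt_le_trans _ _ (X (rat_point T n) w)%:E) ?lte_fin//.
apply: ereal_sup_ubound; exists (rat_point T n) => //=.
by rewrite in_itv/=; exact: rat_point_itv.
Qed.

Lemma measurable_sup_process_gt c : measurable [set w | (c%:E < supX w)%E].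
Proof.
apply: (@complete_ae_measurable (\bigcup_n [set w | c < X (rat_point T n) w])).
  apply: bigcupT_measurable => n.
  have := measurable_fun_ltr (@measurable_cst _ _ _ _ setT c) (mX (rat_point_itv T_gt0 n)).
  by move=> /(_ measurableT [set true] I); rewrite setTI.
apply: filterS cX => w cw; have h := sup_process_gt c cw.
by split=> [[n _ ?]|/h.2[n ?]]; [apply/h.1; exists n|exists n].
Qed.

Lemma measurable_sup_process : measurable_fun [set: Omega] supX.
Proof.
move=> _ Y mY; apply: (measurability _ (ErealGenOInfty.measurableE R)) => //.
move=> _ [_ [c ->] <-]; rewrite setTI.
rewrite (_ : _ @^-1` _ = [set w | (c%:E < supX w)%E]); first exact: measurable_sup_process_gt.
by apply/seteqP; split => w /=; rewrite in_itv/= andbT.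
Qed.

End sup.

(** Borel-Cantelli: [phi n] is chosen so that X exceeds 2^-(n+1) with probability at most 2^-(n+1).
    These probabilities are summable, so almost surely only finitely many of the events occur. *)
Lemma cvg_in_prob_subseq (X : nat -> Omega -> \bar R) :
  (forall n (e : R), measurable [set w | (e%:E < X n w)%E]) -> cvg_in_prob P X ->
  exists phi : nat -> nat, (forall n, (n <= phi n)%N) /\
    {ae P, forall w, forall e : R, 0 < e -> \forall n \near \oo, (X (phi n) w <= e%:E)%E}.
Proof.
move=> mX cX; pose a n : R := 1 / (2 ^ n.+1)%:R.
have a0 n : 0 < a n by rewrite divr_gt0// ltr0n expn_gt0.
have /choice[phi Hphi] : forall n, exists k, (n <= k)%N /\
    (P [set w | ((a n)%:E < X k w)%E] <= (a n)%:E)%E.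
  move=> n; have /fine_cvgP[[N1 _ H1] /cvgrPdist_le/(_ _ (a0 n))[N2 _ H2]] := cX _ (a0 n).
  exists (maxn n (maxn N1 N2)); split; first exact: leq_maxl.
  set k := maxn _ _.
  have k1 : (N1 <= k)%N by rewrite /k !leq_max leqnn orbT.
  have k2 : (N2 <= k)%N by rewrite /k !leq_max leqnn !orbT.
  rewrite -(fineK (H1 k k1)) lee_fin; have := H2 k k2.
  by rewrite /= sub0r normrN; apply: le_trans; exact: ler_norm.
exists phi; split=> [n|]; first by have [] := Hphi n.
pose F n := [set w | ((a n)%:E < X (phi n) w)%E].
have mF n : measurable (F n) by exact: mX.
have F0 : P (lim_sup_set F) = 0%E.
  apply: lim_sup_set_cvg0 => //.
  apply: (@le_lt_trans _ _ (\sum_(n <oo) (1 / (2 ^ n.+1)%:R)%:E)%E).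
    by apply: lee_nneseries => // n _; have [] := Hphi n.
  by apply: (@le_lt_trans _ _ 1%:E); [exact: (epsilon_trick0 xpredT)|rewrite ltry].
exists (lim_sup_set F); split=> //.
  by apply: bigcapT_measurable => k; apply: bigcup_measurable => j _.
move=> w /=; apply: contra_notP => nw e e0.
have : exists n, forall j, (n <= j)%N -> ~ F j w.
  apply: contrapT => /forallNP h; apply: nw => n _.
  have := h n => /existsNP[j /not_implyP[nj /contrapT Fj]]; by exists j.
move=> [N HN].
have [N2 _ HN2] := near_infty_natSinv_lt (PosNum e0).
exists (maxn N N2) => // n /= Nn.
have nN : (N <= n)%N by rewrite (leq_trans (leq_maxl _ _) Nn).
have nN2 : (N2 <= n)%N by rewrite (leq_trans (leq_maxr _ _) Nn).
rewrite leNgt; apply/negP => ex; apply: (HN n nN).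
apply: lt_trans ex; rewrite lte_fin; apply: le_lt_trans (HN2 n nN2).
rewrite /a div1r lef_pV2 ?posrE ?ltr0n ?expn_gt0// ler_nat.
by rewrite ltnW// ltn_expl.
Qed.

End processes.

Section probability_limits.
Context d (Omega : measurableType d) (R : realType) (P : probability Omega R).
Local Open Scope ereal_scope.

Lemma measurable_gt (X : Omega -> \bar R) (e : R) : measurable_fun [set: Omega] X ->
  measurable [set w | e%:E < X w].
Proof.
move=> mX; rewrite (_ : [set w | _] = setT `&` X @^-1` [set` `]e%:E, +oo[]).
  by apply: mX => //; exact: emeasurable_itv.
by apply/seteqP; split => w /=; rewrite in_itv/= andbT => // -[].
Qed.

Lemma markov_ge0 (X : Omega -> \bar R) (e : R) : measurable_fun [set: Omega] X ->
  (forall w, 0 <= X w) -> (0 < e)%R ->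
  e%:E * P [set w | e%:E < X w] <= \int[P]_w X w.
Proof.
move=> mX X0 e0; have mS := measurable_gt e mX.
rewrite -integral_cst//.
apply: (@le_trans _ _ (\int[P]_(w in [set w | e%:E < X w]) X w)).
  apply: ge0_le_integral => //; first by move=> w _; rewrite lee_fin ltW.
    exact: measurable_funTS.
  by move=> w /= /ltW.
exact: ge0_subset_integral.
Qed.

Lemma ae_cvg_in_prob (X : nat -> Omega -> \bar R) :
  (forall n (e : R), measurable [set w | e%:E < X n w]) ->
  {ae P, forall w, forall e : R, (0 < e)%R -> \forall n \near \oo, X n w <= e%:E} ->
  cvg_in_prob P X.
Proof.
move=> mX Xae e e0; pose S n := [set w | e%:E < X n w].
have mS n : measurable (S n) by exact: mX.
have mU n : measurable (\bigcup_(k >= n) S k) by exact: bigcup_measurable.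
have U0 : P (\bigcup_(k >= 0) S k) < +oo by rewrite (le_lt_trans (probability_le1 P (mU 0%N)))// ltry.
have L0 : P (lim_sup_set S) = 0.
  apply/negligibleP; first exact: bigcapT_measurable.
  move: Xae => [N0 [mN0 PN0 XN0]]; exists N0; split=> // w Sw; apply: XN0 => /(_ e e0)[N _ HN].
  have [k /= Nk Sk] := Sw N I; have := HN k Nk.
  by rewrite leNgt => /negP; apply.
have cU : P (\bigcup_(k >= n) S k) @[n --> \oo] --> 0.
  rewrite -L0; exact: (@lim_sup_set_cvg _ _ _ P S mS U0).
apply: (@squeeze_cvge _ _ _ _ (cst 0) _ _ _ _ _ cU).
- apply: nearW => n; rewrite measure_ge0/=; apply: le_measure; rewrite ?inE//.
  by move=> w Sw; exists n => /=.
- exact: cvg_cst.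
Qed.

Lemma cvg_in_prob_bound (X : nat -> Omega -> \bar R) (c : nat -> R) :
  (forall n, measurable_fun [set: Omega] (X n)) -> (forall n w, 0 <= X n w) ->
  (forall n, \int[P]_w X n w <= (c n)%:E) -> (c n @[n --> \oo] --> (0 : R))%R ->
  cvg_in_prob P X.
Proof.
move=> mX X0 Xc c0 e e0.
apply: (@squeeze_cvge _ _ _ _ (cst 0) _ (fun n => (c n / e)%:E)).
- apply: nearW => n; rewrite measure_ge0/= EFinM muleC lee_pdivlMl//.
  by apply: le_trans (Xc n); exact: markov_ge0.
- exact: cvg_cst.
- apply/fine_cvgP; split; first exact: nearW.
  rewrite -[X in _ --> X](mul0r (e^-1)%R); apply: cvgM => //; exact: cvg_cst.
Qed.

End probability_limits.

(** * Existence of stochastic integrals *)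

Section stochastic_integral.
Context d (Omega : measurableType d) (R : realType) (P : probability Omega R)
  (T : R) (m : nat) (B : R -> Omega -> 'cV[R]_m).
Hypothesis T_gt0 : 0 < T.
Hypothesis P_complete : measure_is_complete P.
Hypothesis B_brownian : is_brownian_motion P T B.

Local Notation Ft t := (g_sigma_algebraType (augmented_gen P B t)).

Lemma ae_cont_on_B : {ae P, forall w, forall i, cont_on T (fun t => B t w i 0)}.
Proof.
have [_ _ cB _] := B_brownian; apply: filter_forall => i.
by apply: filterS (cB i) => w /cont_onP.
Qed.

Lemma cont_on_sp_integral H w : is_simple P T B H ->
  (forall i, cont_on T (fun t => B t w i 0)) -> cont_on T (sp_integral B H ^~ w).
Proof.
move=> [tT _ _ _] cB; apply: cont_on_sum => k; have kH := ltn_ord k.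
have cb s j : 0 <= s <= T -> cont_on T (fun t => B (Num.min s t) w j 0).
  by move=> sT; exact: (cont_on_min sT (cB j)).
rewrite (_ : (fun t => _) = fun t => \sum_(j < m) sp_value H k w j 0 *
  (B (Num.min (sp_time H k.+1) t) w j 0 + -1 * B (Num.min (sp_time H k) t) w j 0)); last first.
  by apply/funext => t; rewrite dotE; apply: eq_bigr => j _; rewrite !mxE mulN1r.
apply: cont_on_sum => j; apply: cont_onZ; apply: cont_onD; first exact/cb/tT.
by apply: cont_onZ; apply/cb/tT/ltnW.
Qed.

Lemma filtration_measurable_sp_integral H t : is_simple P T B H -> 0 <= t <= T ->
  filtration_measurable P B t (sp_integral B H t).
Proof.
move=> [tT tS mh _] /andP[t0 tT']; apply: measurable_sum => k; have kH := ltn_ord k.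
have /andP[k0 _] := tT k (ltnW kH); have /andP[k1 _] := tT k.+1 kH.
have [kt|tk] := leP (sp_time H k) t; last first.
  rewrite (_ : (fun w => _) = fun=> 0); first exact: measurable_cst.
  apply/funext => w; rewrite (min_idPr (ltW (lt_le_trans tk (tS k kH)))) ?(min_idPr (ltW tk)).
  by rewrite subrr dot0r.
apply: measurable_dot => i; first by apply: filtration_measurableS (mh k i kH).
apply: filtration_measurable_dB => //; first by rewrite le_min k1.
by rewrite ge_min lexx orbT.
Qed.

Lemma measurable_sp_integral H t : is_simple P T B H -> 0 <= t <= T ->
  measurable_fun [set: Omega] (sp_integral B H t).
Proof.
move=> Hs tT; apply: (filtration_measurable_fun P_complete B_brownian (t := t)).
  by have /andP[] := tT.
exact: filtration_measurable_sp_integral.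
Qed.

Definition sup_norm (X : R -> Omega -> R) w : \bar R :=
  ereal_sup [set `|X t w|%:E | t in `[0, T]].

Lemma measurable_sup_norm X : (forall t, 0 <= t <= T -> measurable_fun [set: Omega] (X t)) ->
  {ae P, forall w, cont_on T (X ^~ w)} -> measurable_fun [set: Omega] (sup_norm X).
Proof.
move=> mX cX; apply: (measurable_sup_process P_complete T_gt0 (X := fun t w => `|X t w|)).
  by move=> t tT; apply: measurableT_comp => //; exact: mX.
by apply: filterS cX => w /cont_on_norm.
Qed.

(** Continuity of the paths identifies the event, up to a null set, with the increasing union of its
    versions over the first n points of [rat_point]; the bound of [maximal_finite] does not depend
    on n. *)
Lemma sup_integral_prob H (e : R) : is_simple P T B H -> 0 < e ->
  (P [set w | e%:E < sup_norm (sp_integral B H) w] <=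
   ((e ^+ 2)^-1)%:E * (8%:E * sq_norm P T (sp_eval H)))%E.
Proof.
move=> Hs e0; pose l n := [seq rat_point T k | k <- iota 0 n].
pose A n := [set w | has (fun t => e < `|sp_integral B H t w|) (l n)].
have lT n x : x \in l n -> 0 <= x <= T by move=> /mapP[k _ ->]; exact: rat_point_itv.
have mA n : measurable (A n) by have [] := maximal_finite T_gt0 P_complete B_brownian Hs (lT n) e0.
have AC n : (P (A n) <= ((e ^+ 2)^-1)%:E * (8%:E * sq_norm P T (sp_eval H)))%E.
  have [_ h] := maximal_finite T_gt0 P_complete B_brownian Hs (lT n) e0.
  by rewrite lee_pdivlMl ?exprn_gt0.
have cI : {ae P, forall w, cont_on T (sp_integral B H ^~ w)}.
  by apply: filterS ae_cont_on_B => w; exact: cont_on_sp_integral.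
have mS : measurable [set w | (e%:E < sup_norm (sp_integral B H) w)%E].
  apply: measurable_gt; apply: measurable_sup_norm => // t tT; exact: measurable_sp_integral.
have mU : measurable (\bigcup_n A n) by exact: bigcupT_measurable.
rewrite (ae_iff_measure (C2 := \bigcup_n A n) mS mU); last first.
  apply: filterS cI => w cw.
  have h := @sup_process_gt _ Omega R T T_gt0 (fun t w => `|sp_integral B H t w|) w e (cont_on_norm cw).
  apply: iff_trans (iff_sym h) _; split=> [[n nw]|[n _ /hasP[x /mapP[k _ ->] kw]]]; last by exists k.
  by exists n.+1 => //; apply/hasP; exists (rat_point T n) => //; apply/map_f; rewrite mem_iota/=.
have ndA : nondecreasing_seq A.
  move=> i j ij; apply/subsetPset => w /hasP[x /mapP[k + ->] kw].
  rewrite mem_iota/= add0n => ki; apply/hasP; exists (rat_point T k) => //.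
  by apply/map_f; rewrite mem_iota/= add0n (leq_trans ki).
have cA := @nondecreasing_cvg_mu _ _ _ P _ mA mU ndA.
rewrite -(cvg_lim _ cA)//; apply: lime_le; first by apply/cvg_ex; eexists; exact: cA.
by apply: nearW => n; exact: AC.
Qed.

(** Simple approximants converging fast enough in square norm have integrals that are almost surely
    uniformly Cauchy, by the maximal inequality and Borel-Cantelli. *)
Lemma stochastic_integral_exists (Z : R -> Omega -> 'cV[R]_m) :
  predictable_mx P T B Z -> (sq_norm P T Z < +oo)%E ->
  exists M, is_stochastic_integral P T B Z M.
Proof.
move=> pZ Zoo; have mZ := predictable_process T_gt0 P_complete B_brownian pZ.
(* [a n] is the allowed uniform distance between the integrals n and n+1; it is also [s n - s n.+1],
   so the distances from n on telescope to at most [s n]. *)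
pose s n : R := (2 ^ n)%:R^-1; pose a n : R := s n.+1.
have s0 n : 0 < s n by rewrite invr_gt0 ltr0n expn_gt0.
have sS n : s n - s n.+1 = a n.
  by rewrite /a /s expnS natrM invfM; field; rewrite pnatr_eq0 expn_eq0.
have s1 n : s n <= 1 by rewrite invf_le1 ?ler1n ?ltr0n expn_gt0.
(* Two consecutive approximants differ by at most 4 c_n in square norm, and the maximal inequality
   gives probability 8 (4 c_n) / a_n^2, which this choice makes equal to a_n. *)
pose c n : R := a n ^+ 3 / 32.
have c0 n : 0 < c n by rewrite divr_gt0// exprn_gt0// s0.
have cS n : c n.+1 <= c n.
  rewrite /c ler_wpM2r// lerXn2r ?nnegrE ?(ltW (s0 _))//.
  by have := sS n.+1; have := s0 n.+2; rewrite /a; lra.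
have /choice[H HH] : forall n, exists H, is_simple P T B H /\
    (sq_norm P T (fun t w => sp_eval H t w - Z t w)%R <= (c n)%:E)%E.
  by move=> n; have [H Hs Hc] := predictable_approximable T_gt0 P_complete B_brownian pZ Zoo (c0 n); exists H.
have Hs n := (HH n).1.
have mI n t : 0 <= t <= T -> measurable_fun [set: Omega] (sp_integral B (H n) t).
  exact: measurable_sp_integral.
have mHZ n : measurable_process T (fun t w => sp_eval (H n) t w - Z t w).
  have := measurable_processD (-1) (measurable_process_simple P_complete B_brownian (Hs n)) mZ.
  by under eq_fun do under eq_fun do rewrite scaleN1r.
have /choice[D HD] : forall n, exists D, [/\ is_simple P T B D,
    forall s w, sp_eval D s w = sp_eval (H n.+1) s w + (-1) *: sp_eval (H n) s w &
    forall s w, sp_integral B D s w = sp_integral B (H n.+1) s w + (-1) * sp_integral B (H n) s w].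
  by move=> n; exact: simple_linear.
pose A n := [set w | ((a n)%:E < sup_norm (sp_integral B (D n)) w)%E].
have DE n : (sq_norm P T (sp_eval (D n)) <= (4 * c n)%:E)%E.
  have [_ eD _] := HD n.
  have -> : sp_eval (D n) = fun t w => (sp_eval (H n.+1) t w - Z t w) + (-1) *: (sp_eval (H n) t w - Z t w).
    apply/funext => t; apply/funext => w; rewrite eD scalerBr !scaleN1r opprK.
    by rewrite addrACA addNr addr0.
  apply: le_trans (sq_normD P _ (mHZ _) (mHZ _)) _.
  apply: (@le_trans _ _ (2%:E * (c n.+1)%:E + (2 * (-1) ^+ 2)%:E * (c n)%:E)%E).
    by apply: leeD; apply: lee_wpmul2l; rewrite ?lee_fin ?(HH _).2// sqrrN expr1n mulr1.
  by rewrite -!EFinM -EFinD lee_fin sqrrN expr1n; have := cS n; lra.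
have cI : {ae P, forall w, forall i, cont_on T (fun t => B t w i 0)} by exact: ae_cont_on_B.
have mA n : measurable (A n).
  apply: measurable_gt; apply: measurable_sup_norm.
    by move=> t tT; apply: measurable_sp_integral => //; have [] := HD n.
  by apply: filterS cI => w; apply: cont_on_sp_integral; have [] := HD n.
have PA n : (P (A n) <= (a n)%:E)%E.
  have [Ds _ _] := HD n; have an0 : 0 < a n := s0 _.
  apply: le_trans (sup_integral_prob Ds an0) _.
  apply: (@le_trans _ _ (((a n ^+ 2)^-1)%:E * (8%:E * (4 * c n)%:E))%E).
    by rewrite lee_wpmul2l ?lee_fin ?invr_ge0 ?sqr_ge0// lee_wpmul2l.
  by rewrite -!EFinM lee_fin /c le_eqVlt; apply/orP; left; apply/eqP; field; rewrite gt_eqF.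
have A0 : P (lim_sup_set A) = 0%E.
  apply: lim_sup_set_cvg0 => //.
  apply: (@le_lt_trans _ _ (\sum_(n <oo) (1 / (2 ^ n.+1)%:R)%:E)%E).
    by apply: lee_nneseries => // n _; rewrite div1r; exact: PA.
  by apply: (@le_lt_trans _ _ 1%:E); [exact: (epsilon_trick0 xpredT)|rewrite ltry].
have : {ae P, forall w, (forall i, cont_on T (fun t => B t w i 0)) /\
    exists n, forall j, (n <= j)%N -> ~ A j w}.
  apply: filterI => //; exists (lim_sup_set A); split=> //.
    by apply: bigcapT_measurable => k; apply: bigcup_measurable => j _.
  move=> w /=; apply: contra_notP => nw.
  apply: contrapT => /forallNP h; apply: nw => n _.
  by have /existsNP[j /not_implyP[nj /contrapT Aj]] := h n; exists j.
move=> [N0 [mN0 PN0 goodN]].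
have good w : ~ N0 w -> (forall i, cont_on T (fun t => B t w i 0)) /\
    exists n, forall j, (n <= j)%N -> ~ A j w.
  by move=> nN; apply: contrapT => h; apply: nN; exact: goodN.
(* Setting the integrals to 0 on the exceptional null set makes the limit exist everywhere.
   Adaptedness survives because the augmented filtration contains null sets at every time. *)
pose I n t w := \1_(~` N0) w * sp_integral B (H n) t w.
pose M t w := limn (fun n => I n t w).
have IE n t w : ~ N0 w -> I n t w = sp_integral B (H n) t w.
  by move=> nN; rewrite /I indicE mem_set// mul1r.
have I0 n t w : N0 w -> I n t w = 0.
  by move=> nN; rewrite /I indicE memNset ?mul0r// => /(_ nN).
have cauchyI w : ~ N0 w -> exists N, forall n k t, (N <= n)%N -> 0 <= t <= T ->
    `|I (n + k)%N t w - I n t w| <= s n - s (n + k)%N.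
  move=> nN; have [_ [N hN]] := good w nN; exists N => n + t Nn tT.
  elim => [|k IH]; first by rewrite addn0 !subrr normr0.
  rewrite addnS; have [_ _ iD] := HD (n + k)%N.
  have step : `|I (n + k).+1 t w - I (n + k)%N t w| <= a (n + k)%N.
    rewrite !IE//; have := hN (n + k)%N (leq_trans Nn (leq_addr _ _)).
    move=> /negP; rewrite -leNgt => h; rewrite -lee_fin; apply: le_trans h.
    apply: ereal_sup_ubound; exists t; first by rewrite /= in_itv.
    by rewrite iD mulN1r.
  have := sS (n + k)%N => h.
  have -> : I (n + k).+1 t w - I n t w = (I (n + k).+1 t w - I (n + k)%N t w) + (I (n + k)%N t w - I n t w).
    by rewrite addrA subrK.
  apply: le_trans (ler_normD _ _) _; lra.
have s_lt (e : R) : 0 < e -> exists N, forall n, (N <= n)%N -> s n < e.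
  move=> e0; have [N _ hN] := near_infty_natSinv_lt (PosNum e0).
  exists N => n Nn; apply: le_lt_trans (hN n Nn).
  by rewrite lef_pV2 ?posrE ?ltr0n ?expn_gt0// ler_nat ltn_expl.
have s_cvg0 : s n @[n --> \oo] --> (0 : R).
  apply/cvgrPdist_le => e /s_lt[N hN]; exists N => // n /= Nn.
  by rewrite sub0r normrN gtr0_norm ?s0// ltW// hN.
have cvgI t w : 0 <= t <= T -> I n t w @[n --> \oo] --> M t w.
  move=> tT; have [wN|/cauchyI[N hN]] := pselect (N0 w).
    have I00 : (fun n => I n t w) = fun=> 0 by apply/funext => n; exact: I0.
    by rewrite /M I00 lim_cst//; exact: cvg_cst.
  suff : cvgn (fun n => I n t w) by [].
  apply/cauchy_cvgP; apply: cauchy_exP => e e0.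
  have [N1 hN1] := s_lt e e0.
  pose n := maxn N N1; exists (I n t w); exists n => // j /= nj.
  have Nn : (N <= n)%N by exact: leq_maxl.
  have sn := hN1 n (leq_maxr _ _).
  rewrite -ball_normE/= distrC; have := hN n (j - n)%N t Nn tT; rewrite subnKC// => h.
  by apply: le_lt_trans h _; rewrite (le_lt_trans _ sn)// gerBl ltW.
have MI w : ~ N0 w -> exists N, forall n t, (N <= n)%N -> 0 <= t <= T ->
    `|M t w - I n t w| <= s n.
  move=> /cauchyI[N hN]; exists N => n t Nn tT; apply/ler_addgt0Pr => e e0.
  have /cvgrPdist_le/(_ e e0)[N1 _ hN1] := cvgI t w tT.
  pose j := maxn n N1; have nj : (n <= j)%N := leq_maxl _ _.
  have := hN1 j (leq_maxr _ _) => /= h1; have := hN n (j - n)%N t Nn tT; rewrite subnKC// => h2.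
  rewrite (_ : M t w - I n t w = (M t w - I j t w) + (I j t w - I n t w)); last by ring.
  by apply: le_trans (ler_normD _ _) _; have := s0 j; lra.
have cM w : ~ N0 w -> cont_on T (M ^~ w).
  move=> nN; have [N hN] := MI w nN; apply: cont_on_unif => e e0.
  have [N1 hN1] := s_lt e e0.
  pose n := maxn N N1; exists (sp_integral B (H n) ^~ w).
    by apply: cont_on_sp_integral => //; have [] := good w nN.
  move=> t tT; rewrite -(IE n t w nN) distrC (le_trans (hN n t (leq_maxl _ _) tT))//.
  by rewrite ltW// hN1// leq_maxr.
have ae_nN : {ae P, forall w, ~ N0 w} by exists N0; split=> // w /contrapT.
have mIt n t : 0 <= t <= T -> filtration_measurable P B t (I n t).
  move=> tT; apply: measurable_funM; last exact: filtration_measurable_sp_integral.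
  apply: measurable_indic; apply: (@measurableC _ (Ft t)).
  have AN : augmented_gen P B t N0 by right; exists N0; split.
  exact: sub_gen_smallest AN.
have mM t : 0 <= t <= T -> filtration_measurable P B t (M t).
  move=> tT; apply: (@measurable_fun_cvg _ (Ft t) R setT (fun n => I n t)).
    by move=> n; exact: mIt.
  by move=> w _; exact: cvgI.
have mM' t : 0 <= t <= T -> measurable_fun [set: Omega] (M t).
  move=> tT; apply: (filtration_measurable_fun P_complete B_brownian (t := t)); last exact: mM.
  by have /andP[] := tT.
exists M; split => //; first by apply: filterS ae_nN => w /cM /cont_onP.
exists H; split => //.
  apply: (@cvg_in_prob_bound _ _ _ _ _ c).
  - move=> n; apply: measurable_strip_integral.
      apply/measurable_EFinP; under eq_fun do rewrite enorm_sqr; exact: (measurable_process_dot (mHZ n) (mHZ n)).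
    by move=> t w _; rewrite lee_fin sqr_ge0.
  - by move=> n w; apply: integral_ge0 => t _; rewrite lee_fin sqr_ge0.
  - move=> n; have := (HH n).2; rewrite /sq_norm.
    by under eq_integral do under eq_integral do rewrite -enorm_sqr.
  - rewrite /c (_ : 0 = 0 * 0 * 0 / 32 :> R); last by rewrite !mul0r.
    have a_cvg : a n @[n --> \oo] --> (0 : R) by rewrite (cvg_shiftS s).
    apply: cvgM; last exact: cvg_cst.
    by under eq_fun do rewrite 2!exprS expr1 mulrA; apply: cvgM => //; exact: cvgM.
have mX n : measurable_fun [set: Omega] (sup_norm (fun t w => sp_integral B (H n) t w - M t w)).
  apply: measurable_sup_norm.
    by move=> t tT; apply: measurable_funB; [exact: mI|exact: mM'].
  apply: filterS ae_nN => w nN; rewrite (_ : (fun t => _) = fun t => sp_integral B (H n) t w + (-1) * M t w).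
    apply: cont_onD; first by apply: cont_on_sp_integral => //; have [] := good w nN.
    by apply: cont_onZ; exact: cM.
  by apply/funext => t; rewrite mulN1r.
apply: ae_cvg_in_prob.
  by move=> n e; apply: measurable_gt; exact: mX.
apply: filterS ae_nN => w nN e e0; have [N hN] := MI w nN.
have [N1 hN1] := s_lt e e0.
exists (maxn N N1) => // n /= Nn; apply: ge_ereal_sup => _ [t + <-].
rewrite /= in_itv/= => tT; rewrite lee_fin -(IE n t w nN) distrC.
apply: le_trans (hN n t (leq_trans (leq_maxl _ _) Nn) tT) _.
by rewrite ltW// hN1// (leq_trans (leq_maxr _ _) Nn).
Qed.

End stochastic_integral.

(** * Supermartingale inequality *)

Section real_integrable.
Context d (T : measurableType d) (R : realType) (mu : {measure set T -> \bar R}).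

Lemma integrable_realD (D : set T) (f g : T -> R) : measurable D ->
  mu.-integrable D (EFin \o f) -> mu.-integrable D (EFin \o g) ->
  mu.-integrable D (EFin \o (fun x => f x + g x)).
Proof. by move=> mD fi gi; exact: (integrableD mD fi gi). Qed.

Lemma integrable_realZ (D : set T) (a : R) (f : T -> R) : measurable D ->
  mu.-integrable D (EFin \o f) -> mu.-integrable D (EFin \o (fun x => a * f x)).
Proof. by move=> mD fi; exact: (integrableZl mD a fi). Qed.

Lemma ge0_integralDZ (f g : T -> R) (a : R) :
  measurable_fun [set: T] f -> measurable_fun [set: T] g ->
  (forall x, 0 <= f x) -> (forall x, 0 <= g x) -> 0 <= a ->
  (\int[mu]_x (f x + a * g x)%:E = \int[mu]_x (f x)%:E + a%:E * \int[mu]_x (g x)%:E)%E.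
Proof.
move=> mf mg f0 g0 a0; rewrite -ge0_integralZl//; last 2 first.
- exact/measurable_EFinP.
- by move=> x _; rewrite lee_fin.
under eq_integral do rewrite EFinD EFinM.
rewrite ge0_integralD//.
- by move=> x _; rewrite lee_fin.
- exact/measurable_EFinP.
- by move=> x _; rewrite -EFinM lee_fin mulr_ge0.
- by apply: emeasurable_funM => //; exact/measurable_EFinP.
Qed.

Lemma ge0_le_real_integral (f g : T -> R) :
  measurable_fun [set: T] f -> measurable_fun [set: T] g ->
  (forall x, 0 <= f x) -> (forall x, f x <= g x) ->
  (\int[mu]_x (f x)%:E <= \int[mu]_x (g x)%:E)%E.
Proof.
move=> mf mg f0 fg; apply: ge0_le_integral => //.
- by move=> x _; rewrite lee_fin.
- exact/measurable_EFinP.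
- exact/measurable_EFinP.
- by move=> x _; rewrite lee_fin.
Qed.

End real_integrable.

(** * Square-integrable paths and convergence of their brackets *)

Section l2.
Context (R : realType) (T : R) (m : nat).
Implicit Types (z q g h : R -> 'cV[R]_m).

Local Notation leb := (@lebesgue_measure R).

Definition l2 z := (forall i, measurable_fun `[0, T]%classic (fun s => z s i 0)) /\
  (\int[leb]_(s in `[0%R, T]) (dot (z s) (z s))%:E < +oo)%E.

Definition l2norm z : R := \int[leb]_(s in `[0, T]) dot (z s) (z s).

Lemma dot_young (x y : 'cV[R]_m) (eta : R) : 0 < eta ->
  `|dot x y| <= 2^-1 * (eta^-1 * dot x x + eta * dot y y).
Proof.
move=> e0; have h (a : R) : 0 <= dot (x - a *: y) (x - a *: y) by exact: dot_ge0.
have hN := h (- eta); have hP := h eta; move: hN hP.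
rewrite !dotBl !dotBr !dotZl !dotZr (dotC y x) => hN hP.
have e0' : eta != 0 by rewrite gt_eqF.
rewrite -(ler_pM2l e0) -[X in X * `|_|]gtr0_norm// -normrM ler_norml.
have -> : eta * (2^-1 * (eta^-1 * dot x x + eta * dot y y)) =
  2^-1 * (dot x x + eta ^+ 2 * dot y y) by field.
by apply/andP; split; nra.
Qed.

Lemma l2_integrable z : l2 z -> leb.-integrable `[0, T] (EFin \o (fun s => dot (z s) (z s))).
Proof.
move=> [mz zoo]; apply/integrableP; split; first by apply/measurable_EFinP; exact: measurable_dot.
by under eq_integral do rewrite /= ger0_norm ?dot_ge0//.
Qed.

Lemma l2norm_ge0 z : 0 <= l2norm z.
Proof. by apply: Rintegral_ge0 => s _; exact: dot_ge0. Qed.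

Lemma l2normE z : l2 z -> (\int[leb]_(s in `[0%R, T]) (dot (z s) (z s))%:E)%E = (l2norm z)%:E.
Proof.
move=> [mz zoo]; rewrite /l2norm /Rintegral fineK// ge0_fin_numE//.
by apply: integral_ge0 => s _; rewrite lee_fin dot_ge0.
Qed.

Lemma l2D z1 z2 (a : R) : l2 z1 -> l2 z2 -> l2 (fun s => z1 s + a *: z2 s).
Proof.
move=> h1 h2; have [m1 _] := h1; have [m2 _] := h2.
have m12 i : measurable_fun `[0, T]%classic (fun s => (z1 s + a *: z2 s) i 0).
  rewrite (_ : (fun s => _) = fun s => z1 s i 0 + a * z2 s i 0); last first.
    by apply/funext => s; rewrite !mxE.
  by apply: measurable_funD => //; exact: measurable_funM.
split=> //.
pose F s := 2 * dot (z1 s) (z1 s) + (2 * a ^+ 2) * dot (z2 s) (z2 s).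
have iF : leb.-integrable `[0, T] (EFin \o F).
  by apply: integrable_realD => //; apply: integrable_realZ => //; exact: l2_integrable.
apply: le_lt_trans (integrableP _ _ _ iF).2; apply: ge0_le_integral => //.
- by move=> s _; rewrite lee_fin dot_ge0.
- by apply/measurable_EFinP; exact: measurable_dot.
- by apply: measurableT_comp => //; case/integrableP : iF.
move=> s _; rewrite /= lee_fin; apply: le_trans (ler_norm _).
have := dot_ge0 (z1 s - a *: z2 s); rewrite /F dotBl !dotBr dotDl !dotDr !dotZl !dotZr (dotC (z2 s) (z1 s)); lra.
Qed.

Lemma l2B z1 z2 : l2 z1 -> l2 z2 -> l2 (fun s => z1 s - z2 s).
Proof. by move=> h1 h2; have := l2D (-1) h1 h2; under eq_fun do rewrite scaleN1r. Qed.

Lemma integrable_dot z1 z2 : l2 z1 -> l2 z2 ->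
  leb.-integrable `[0, T] (EFin \o (fun s => dot (z1 s) (z2 s))).
Proof.
move=> h1 h2; have [m1 _] := h1; have [m2 _] := h2.
have i1 := l2_integrable h1; have i2 := l2_integrable h2.
have ig : leb.-integrable `[0, T] (EFin \o (fun s => 2^-1 * (dot (z1 s) (z1 s) + dot (z2 s) (z2 s)))).
  by apply: integrable_realZ => //; exact: integrable_realD.
apply: le_integrable ig => //.
  by apply/measurable_EFinP; exact: measurable_dot.
move=> s _ /=; rewrite lee_fin.
have := dot_young (z1 s) (z2 s) ltr01; rewrite invr1 !mul1r => h.
by apply: le_trans h _; exact: ler_norm.
Qed.

Lemma sub_itv0 (s : R) : s <= T -> `[0, s]%classic `<=` `[0, T]%classic.
Proof. by move=> sT x; rewrite /= !in_itv/= => /andP[-> xs]; exact: le_trans xs sT. Qed.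

Lemma Rintegral_dot_le z1 z2 (s eta : R) : l2 z1 -> l2 z2 -> s <= T -> 0 < eta ->
  `|\int[leb]_(x in `[0, s]) dot (z1 x) (z2 x)| <=
    2^-1 * (eta^-1 * l2norm z1 + eta * l2norm z2).
Proof.
move=> h1 h2 sT e0; have i12 := integrable_dot h1 h2.
have i1 := l2_integrable h1; have i2 := l2_integrable h2.
have iS f : leb.-integrable `[0, T] (EFin \o f) -> leb.-integrable `[0, s] (EFin \o f).
  by apply: integrableS => //; exact: sub_itv0.
apply: le_trans (le_normr_Rintegral _ (iS _ i12)) _ => //.
pose F x := 2^-1 * (eta^-1 * dot (z1 x) (z1 x) + eta * dot (z2 x) (z2 x)).
have iF1 : leb.-integrable `[0, T] (EFin \o (fun x => eta^-1 * dot (z1 x) (z1 x))).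
  exact: integrable_realZ.
have iF2 : leb.-integrable `[0, T] (EFin \o (fun x => eta * dot (z2 x) (z2 x))).
  exact: integrable_realZ.
have iF12 : leb.-integrable `[0, T] (EFin \o (fun x => eta^-1 * dot (z1 x) (z1 x) + eta * dot (z2 x) (z2 x))).
  exact: integrable_realD.
have iF : leb.-integrable `[0, T] (EFin \o F) by exact: integrable_realZ.
apply: (@le_trans _ _ (\int[leb]_(x in `[0, s]) F x)).
  apply: le_Rintegral => //.
  - exact: (iS (fun x => `|dot (z1 x) (z2 x)|) (integrable_norm i12)).
  - exact: iS.
  - by move=> x _; exact: dot_young.
apply: (@le_trans _ _ (\int[leb]_(x in `[0, T]) F x)).
  have F0 x : 0 <= F x.
    by rewrite /F mulr_ge0// addr_ge0// mulr_ge0 ?dot_ge0// ?invr_ge0 ltW.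
  rewrite /Rintegral fine_le//.
  - exact: integrable_fin_num (iS _ iF).
  - exact: integrable_fin_num iF.
  - apply: ge0_subset_integral => //; last exact: sub_itv0.
      by case/integrableP : iF.
    by move=> x _; rewrite lee_fin.
by rewrite /F RintegralZl// RintegralD// !RintegralZl.
Qed.

(** Writes g.h - z.q as (g - z).(h - q) + (g - z).q + z.(h - q). Young's inequality with parameter
    [eta] is applied to the last two products: [eta] makes the fixed norms contribute at most e/3,
    and then [dl] makes the vanishing norms small even after division by [eta]. The bound is uniform
    in the upper limit s. *)
Lemma dot_integral_close z q (e : R) : l2 z -> l2 q -> 0 < e -> exists2 dl : R, 0 < dl &
  forall g h, l2 g -> l2 h -> l2norm (fun s => g s - z s) <= dl ->
    l2norm (fun s => h s - q s) <= dl -> forall s, s <= T ->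
    `|\int[leb]_(x in `[0, s]) dot (g x) (h x) - \int[leb]_(x in `[0, s]) dot (z x) (q x)| <= e.
Proof.
move=> hz hq e0; pose C := l2norm q + l2norm z + 1.
have z0 := l2norm_ge0 z; have q0 := l2norm_ge0 q.
have C0 : 0 < C by rewrite /C; lra.
pose eta := e / (3 * C); have eta0 : 0 < eta by rewrite divr_gt0// mulr_gt0.
pose dl := Num.min (e / 3) (e * eta / 3).
have dl0 : 0 < dl by rewrite lt_min !divr_gt0// mulr_gt0.
exists dl => // g h hg hh gz hq' s sT.
have dgz := l2B hg hz; have dhq := l2B hh hq.
have iS f : leb.-integrable `[0, T] (EFin \o f) -> leb.-integrable `[0, s] (EFin \o f).
  by apply: integrableS => //; exact: sub_itv0.
have j1 := iS _ (integrable_dot dgz dhq).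
have j2 := iS _ (integrable_dot dgz hq).
have j3 := iS _ (integrable_dot hz dhq).
have j0 := iS _ (integrable_dot hz hq); have jj := iS _ (integrable_dot hg hh).
rewrite -RintegralB//.
pose f1 x := dot (g x - z x) (h x - q x); pose f2 x := dot (g x - z x) (q x).
pose f3 x := dot (z x) (h x - q x).
have j12 : leb.-integrable `[0, s] (EFin \o (fun x => f1 x + f2 x)) by exact: integrable_realD.
have -> : \int[leb]_(x in `[0, s]) (dot (g x) (h x) - dot (z x) (q x)) =
    \int[leb]_(x in `[0, s]) (f1 x + f2 x + f3 x).
  by apply: eq_Rintegral => x _; rewrite /f1 /f2 /f3 !dotBl !dotBr; ring.
rewrite RintegralD// RintegralD//.
have b1 := Rintegral_dot_le dgz dhq sT ltr01; rewrite invr1 !mul1r in b1.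
have b2 := Rintegral_dot_le dgz hq sT eta0; have b3' : `|\int[leb]_(x in `[0, s]) f3 x| <=
    2^-1 * (eta^-1 * l2norm (fun s => h s - q s) + eta * l2norm z).
  have := Rintegral_dot_le dhq hz sT eta0; rewrite /f3.
  by under eq_Rintegral do rewrite dotC.
have d1 : dl <= e / 3 by rewrite ge_min lexx.
have d2 : dl <= e * eta / 3 by rewrite ge_min lexx orbT.
have etaC : eta * C = e / 3 by rewrite /eta; field; rewrite gt_eqF.
have d3 : eta^-1 * dl <= e / 3.
  by rewrite ler_pdivrMl// (_ : eta * (e / 3) = e * eta / 3)//; ring.
have ei0 : 0 < eta^-1 by rewrite invr_gt0.
have k2 : eta^-1 * l2norm (fun s => g s - z s) <= e / 3.
  by apply: le_trans d3; rewrite ler_wpM2l// ltW.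
have k3 : eta^-1 * l2norm (fun s => h s - q s) <= e / 3.
  by apply: le_trans d3; rewrite ler_wpM2l// ltW.
have kC : eta * l2norm q + eta * l2norm z <= e / 3.
  by rewrite -mulrDr -etaC ler_wpM2l ?(ltW eta0)// /C; lra.
apply: le_trans (ler_normD _ _) _.
apply: le_trans (lerD (le_trans (ler_normD _ _) (lerD b1 b2)) b3') _; lra.
Qed.

End l2.

Section paths.
Context d (Omega : measurableType d) (R : realType) (P : probability Omega R)
  (T : R) (m : nat) (B : R -> Omega -> 'cV[R]_m).
Hypothesis T_gt0 : 0 < T.
Hypothesis P_complete : measure_is_complete P.
Hypothesis B_brownian : is_brownian_motion P T B.

Local Notation Ft t := (g_sigma_algebraType (augmented_gen P B t)).
Local Notation leb := (@lebesgue_measure R).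

(** Passing to the maximum lets a single subsequence serve for the integrands and for the
    integrals. *)
Lemma cvg_in_prob_max (X1 X2 : nat -> Omega -> \bar R) :
  (forall n (e : R), measurable [set w | (e%:E < X1 n w)%E]) ->
  (forall n (e : R), measurable [set w | (e%:E < X2 n w)%E]) ->
  cvg_in_prob P X1 -> cvg_in_prob P X2 ->
  cvg_in_prob P (fun n w => maxe (X1 n w) (X2 n w)).
Proof.
move=> m1 m2 c1 c2 e e0.
have E n : [set w | (e%:E < maxe (X1 n w) (X2 n w))%E] =
    [set w | (e%:E < X1 n w)%E] `|` [set w | (e%:E < X2 n w)%E].
  by apply/seteqP; split => w /=; rewrite lt_max => /orP.
have c12 : (P [set w | (e%:E < X1 n w)%E] + P [set w | (e%:E < X2 n w)%E] @[n --> \oo] --> 0)%E.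
  by rewrite -(adde0 0%E); apply: cvgeD => //; [exact: c1|exact: c2].
apply: (@squeeze_cvge _ _ _ _ (cst 0%E) _ _ _ _ _ c12); last exact: cvg_cst.
apply: nearW => n; rewrite measure_ge0/= E; exact: measureU2.
Qed.

Lemma measurable_process_path (Z : R -> Omega -> 'cV[R]_m) w : measurable_process T Z ->
  forall i, measurable_fun `[0, T]%classic (fun s : R => Z s w i 0).
Proof.
move=> mZ i; apply: (@measurable_comp _ _ _ _ _ _ (strip T)
    (fun x : R * Omega => Z x.1 x.2 i 0) _ (fun s : R => (s, w))).
- exact: measurable_strip.
- by move=> _ [s sT <-].
- exact: mZ.
- by apply: measurable_funTS; exact: measurable_pair2.
Qed.

Lemma square_integrable_l2 (Z : R -> Omega -> 'cV[R]_m) : measurable_process T Z -> square_integrable P T Z ->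
  {ae P, forall w, l2 T (Z ^~ w)}.
Proof.
move=> mZ sZ; apply: filterS sZ => w Zw; split; first exact: measurable_process_path.
by under eq_integral do rewrite -enorm_sqr.
Qed.

Lemma stochastic_integral_approx Z M : measurable_process T Z ->
  is_stochastic_integral P T B Z M ->
  exists H, (forall n, is_simple P T B (H n)) /\
    {ae P, forall w, forall e : R, 0 < e -> \forall n \near \oo,
      (\int[leb]_(s in `[0%R, T]) (dot (sp_eval (H n) s w - Z s w) (sp_eval (H n) s w - Z s w))%:E <= e%:E)%E /\
      forall t, 0 <= t <= T -> `|sp_integral B (H n) t w - M t w| <= e}.
Proof.
move=> mZ [mM cM [H [Hs c1 c2]]].
have mX1 n : measurable_fun [set: Omega] (fun w =>
    (\int[leb]_(s in `[0%R, T]) (enorm (sp_eval (H n) s w - Z s w) ^+ 2)%:E)%E).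
  apply: measurable_strip_integral; last by move=> t w _; rewrite lee_fin sqr_ge0.
  apply/measurable_EFinP; under eq_fun do rewrite enorm_sqr.
  have mHZ : measurable_process T (fun t w => sp_eval (H n) t w - Z t w).
    have := measurable_processD (-1) (measurable_process_simple P_complete B_brownian (Hs n)) mZ.
    by under eq_fun do under eq_fun do rewrite scaleN1r.
  exact: (measurable_process_dot mHZ mHZ).
have mX2 n : measurable_fun [set: Omega] (sup_norm T (fun t w => sp_integral B (H n) t w - M t w)).
  apply: (measurable_sup_norm T_gt0 P_complete).
    move=> t tT; apply: measurable_funB; first exact: (measurable_sp_integral P_complete B_brownian).
    apply: (filtration_measurable_fun P_complete B_brownian (t := t)); last exact: mM.
    by have /andP[] := tT.
  apply: filterS2 (ae_cont_on_B B_brownian) cM => w cB /cont_onP cMw.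
  rewrite (_ : (fun t => _) = fun t => sp_integral B (H n) t w + (-1) * M t w).
    by apply: cont_onD; [exact: (cont_on_sp_integral (Hs n))|exact: cont_onZ].
  by apply/funext => t; rewrite mulN1r.
have c12 := cvg_in_prob_max (fun n e => measurable_gt e (mX1 n)) (fun n e => measurable_gt e (mX2 n)) c1 c2.
have [|phi [_ Hphi]] := cvg_in_prob_subseq _ c12.
  by move=> n e; apply: measurable_gt; exact: measurable_maxe.
exists (H \o phi); split=> [n|]; first exact: Hs.
apply: filterS Hphi => w hw e e0; have [N _ hN] := hw e e0; exists N => // n /= Nn.
have := hN n Nn; rewrite /= ge_max => /andP[h1 h2]; split.
  by under eq_integral do rewrite -enorm_sqr.
move=> t tT; rewrite -lee_fin; apply: le_trans h2; apply: ereal_sup_ubound.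
by exists t => //=; rewrite in_itv.
Qed.

Lemma grid_integral_dot N r (H G : simple_process Omega R m) i w : is_grid T N r ->
  times_on N r H -> times_on N r G -> (i <= N)%N ->
  \int[leb]_(s in `[0, r i]) dot (sp_eval G s w) (sp_eval H s w) =
  \sum_(k < i) dot (sp_eval G (r k.+1) w) (sp_eval H (r k.+1) w) * (r k.+1 - r k).
Proof.
move=> rg Hr Gr iN; rewrite /Rintegral (integral_grid_step rg (v := fun k =>
  dot (sp_eval G (r k.+1) w) (sp_eval H (r k.+1) w)))//.
  by apply: measurable_dot => j; exact: measurable_sp_eval.
by move=> k s kN ks; rewrite (sp_eval_cell rg w Gr kN ks) (sp_eval_cell rg w Hr kN ks).
Qed.

Lemma grid_sp_integral N r (H : simple_process Omega R m) i w : is_grid T N r ->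
  is_simple P T B H -> times_on N r H -> (i <= N)%N ->
  sp_integral B H (r i) w = \sum_(k < i) dot (sp_eval H (r k.+1) w) (B (r k.+1) w - B (r k) w).
Proof.
move=> rg Hs Hr iN; rewrite -(sp_integral_regrid rg (r i) w Hs Hr).
exact: (sp_integral_grid B rg).
Qed.

Lemma sum_split (V : zmodType) (F : nat -> V) (a b : nat) : (a <= b)%N ->
  \sum_(k < b) (if (a <= k)%N then F k else 0) = \sum_(k < b) F k - \sum_(k < a) F k.
Proof.
move=> ab; rewrite -(big_mkord xpredT (fun k => if (a <= k)%N then F k else 0)).
rewrite -(big_mkord xpredT F) -[in X in _ = _ - X](big_mkord xpredT F).
rewrite (big_cat_nat (leq0n a) ab)/= (big_cat_nat (leq0n a) ab (F := F))/=.
rewrite big_nat big1 ?add0r => [|k /andP[_ ka]]; last by rewrite leqNgt ka.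
rewrite addrAC subrr add0r; apply: eq_big_nat => k /andP[-> _]//.
Qed.

(** [E] is the log density of H + u 1_A G, with G switched on after t and off before its bracket
    since t would exceed [K]. The time [s] is where G is switched off. The stopped bracket is at
    most [K], so the quadratic term costs at most u^2 K / 2, and no stopping takes place when the
    whole bracket is at most [K]. *)
Lemma grid_exp_lower_bound (H G : simple_process Omega R m) (t u K : R) (A : set Omega) :
  is_simple P T B H -> is_simple P T B G -> 0 <= t <= T -> 0 <= K ->
  <<s augmented_gen P B t >> A ->
  exists E : Omega -> R, [/\ measurable_fun [set: Omega] E,
    (\int[P]_w (expR (E w))%:E = 1)%E &
    forall w, exists s, [/\ t <= s <= T,
      \int[leb]_(x in `[0, T]) dot (sp_eval G x w) (sp_eval G x w) <= K -> s = T &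
      sp_integral B H T w - 2^-1 * \int[leb]_(x in `[0, T]) dot (sp_eval H x w) (sp_eval H x w) +
      u * \1_A w * ((sp_integral B G s w -
          \int[leb]_(x in `[0, s]) dot (sp_eval G x w) (sp_eval H x w)) -
        (sp_integral B G t w - \int[leb]_(x in `[0, t]) dot (sp_eval G x w) (sp_eval H x w))) -
      2^-1 * u ^+ 2 * K <= E w]].
Proof.
move=> Hs Gs tT K0 FA.
have lT x : x \in [:: t] -> 0 <= x <= T by rewrite inE => /eqP ->.
have [N [r [rg rl Hr Gr]]] := times_on_exists T_gt0 lT Hs Gs.
have [k0 k0N tk0] := rl t (mem_head _ _).
have [r0 rN rS] := rg.
pose q k w := sp_eval H (r k.+1) w; pose z k w := sp_eval G (r k.+1) w.
pose dr k := r k.+1 - r k.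
have dr0 k : (k < N)%N -> 0 <= dr k by move=> kN; rewrite subr_ge0 ltW// rS.
have [_ _ mq [Kq qK]] := regrid_simple rg Hs Hr.
have [_ _ mz [Kz zK]] := regrid_simple rg Gs Gr.
(* The bracket of G is counted from time t on, which is the grid point of index [k0]. *)
pose v k w := if (k0 <= k < N)%N then dot (z k w) (z k w) * dr k else 0.
pose c k w := \sum_(i < k.+1) v i w <= K.
pose a k w := u * \1_A w * (k0 <= k)%N%:R * (c k w)%:R.
pose h k w := q k w + a k w *: z k w.
have v0 k w : 0 <= v k w.
  by rewrite /v; case: ifP => // /andP[_ kN]; rewrite mulr_ge0 ?dot_ge0 ?dr0.
have mv k j : (k < N)%N -> (k <= j)%N -> (j <= N)%N -> filtration_measurable P B (r j) (v k).
  move=> kN kj jN; rewrite /v; case: (boolP (k0 <= k < N)%N) => _; last exact: measurable_cst.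
  apply: (@filtration_measurableS _ _ _ _ _ _ (r k)); first exact: (grid_le rg).
  by apply: measurable_funM => //; apply: measurable_dot => i; exact: mz.
have mc k : (k < N)%N -> measurable_fun [set: Ft (r k)] (c k : Ft (r k) -> bool).
  move=> kN; apply: measurable_fun_ler => //; apply: measurable_sum => i.
  by have ik := ltn_ord i; apply: mv; [exact: leq_ltn_trans kN|exact: ik|exact: ltnW].
have ma k : (k < N)%N -> filtration_measurable P B (r k) (a k).
  move=> kN; have [k0k|kk0] := leqP k0 k; last first.
    have -> : a k = fun=> 0 by apply/funext => w; rewrite /a leqNgt kk0 mulr0 mul0r.
    exact: measurable_cst.
  rewrite /filtration_measurable /a; apply: measurable_funM; last first.
    rewrite (_ : (fun _ => _) = fun w : Ft (r k) => if c k w then 1 else 0).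
      by apply: measurable_fun_ifT => //; exact: mc.
    by apply/funext => w; case: (c k w).
  apply: measurable_funM => //; apply: measurable_funM => //; apply: measurable_indic.
  by move: FA; apply: augmented_genS; rewrite tk0; apply: (grid_le rg) => //; exact: ltnW.
have aK k w : `|a k w| <= `|u|.
  rewrite /a !normrM -mulrA -mulrA ler_piMr// mulr_ile1 ?mulr_ge0// ?normr_nat ?ler1n.
    by case: (w \in A); rewrite ?ler01.
  by case: (c k w); case: (k0 <= k)%N; rewrite ?mulr1 ?mulr0.
have hs : is_simple P T B (SimpleProcess N r h).
  apply: (grid_simple rg (K := Kq + `|u| * Kz)).
    move=> k i kN; rewrite /filtration_measurable /h.
    rewrite (_ : (fun w => _) = fun w => q k w i 0 + a k w * z k w i 0); last first.
      by apply/funext => w; rewrite !mxE.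
    by apply: measurable_funD; [exact: mq|apply: measurable_funM; [exact: ma|exact: mz]].
  move=> k w i kN; rewrite !mxE (le_trans (ler_normD _ _))// lerD//; first exact: qK.
  by rewrite normrM ler_pM//; exact: zK.
pose dBk k w := B (r k.+1) w - B (r k) w.
pose E w := \sum_(k < N) (dot (h k w) (dBk k w) - 2^-1 * dot (h k w) (h k w) * dr k).
exists E; split.
- have mS := measurable_grid_sum P_complete B_brownian rg hs (leqnn N).
  have mV := measurable_grid_bracket P_complete B_brownian rg hs hs (leqnn N).
  rewrite (_ : E = fun w => \sum_(k < N) dot (h k w) (dBk k w) - 2^-1 * \sum_(k < N) dot (h k w) (h k w) * dr k).
    by apply: measurable_funB => //; apply: measurable_funM.
  by apply/funext => w; rewrite mulr_sumr -sumrB; apply: eq_bigr => k _; rewrite mulrA.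
- have := simple_expR_martingale P_complete B_brownian hs (W := fun=> 1) (measurable_cst _) (fun _ => ler01).
  rewrite (integral_probability_cst P) => <-.
  by apply: eq_integral => w _; rewrite mul1r.
move=> w.
have cS k : c k.+1 w -> c k w.
  by rewrite /c; apply: le_trans; rewrite [leRHS]big_ord_recr/= lerDl.
pose x k := dot (z k w) (dBk k w) - dot (z k w) (q k w) * dr k.
pose y k := if (k0 <= k)%N then x k else 0.
have [n [nN cn nc] yE] := stopped_sumE N y cS.
(* Before [k0] nothing is counted and [K] is nonnegative, so stopping cannot occur earlier than
   t. *)
have k0n : (k0 <= n)%N.
  rewrite leqNgt; apply/negP => nk0; have nN' : (n < N)%N := leq_trans nk0 k0N.
  have := nc nN'; rewrite /c big1 ?K0// => i _; rewrite /v ifF// leqNgt.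
  by rewrite (leq_ltn_trans _ nk0)// -ltnS.
exists (r n); split.
- rewrite tk0 (grid_le rg)//=; have /andP[_ ->//] := grid_itv rg nN.
- move=> GK; move: nN; rewrite leq_eqVlt => /orP[/eqP ->//|nN].
  have := nc nN; rewrite -ltNge => /(le_lt_trans GK); rewrite ltNge => /negP; case.
  rewrite -rN (grid_integral_dot w rg Gr Gr (leqnn N)).
  rewrite -(big_mkord xpredT (fun k => v k w)) -(big_mkord xpredT (fun k => dot (z k w) (z k w) * dr k)).
  rewrite (big_cat_nat (leq0n _) nN)/=.
  apply: (@le_trans _ _ (\sum_(0 <= i < n.+1) dot (z i w) (z i w) * dr i)).
    rewrite !big_mkord; apply: ler_sum => i _; rewrite /v; case: ifP => // _.
    by rewrite mulr_ge0 ?dot_ge0 ?dr0// (leq_trans (ltn_ord i)).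
  rewrite lerDl big_nat; apply: sumr_ge0 => i /andP[_ iN].
  by rewrite mulr_ge0 ?dot_ge0 ?dr0.
have IHE : sp_integral B H T w - 2^-1 * \int[leb]_(x in `[0, T]) dot (sp_eval H x w) (sp_eval H x w) =
    \sum_(k < N) (dot (q k w) (dBk k w) - 2^-1 * (dot (q k w) (q k w) * dr k)).
  rewrite -[in LHS]rN (grid_integral_dot w rg Hr Hr (leqnn N)) (grid_sp_integral w rg Hs Hr (leqnn N)).
  by rewrite mulr_sumr -sumrB.
have IGE i : (i <= N)%N -> sp_integral B G (r i) w -
    \int[leb]_(x in `[0, r i]) dot (sp_eval G x w) (sp_eval H x w) = \sum_(k < i) x k.
  move=> iN; rewrite (grid_integral_dot w rg Hr Gr iN) (grid_sp_integral w rg Gs Gr iN).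
  by rewrite -sumrB.
rewrite IHE tk0 (IGE n nN) (IGE k0 k0N) -(sum_split x k0n).
have -> : \sum_(k < n) (if (k0 <= k)%N then x k else 0) = \sum_(k < N) (c k w)%:R * y k by rewrite yE.
have vK : \sum_(k < N) (c k w)%:R * v k w <= K.
  have [n' [n'N cn' _] ->] := stopped_sumE N (v ^~ w) cS.
  by case: n' n'N cn' => [|n'] _ cn'; [rewrite big_ord0|exact: cn'].
have -> : E w = \sum_(k < N) (dot (q k w) (dBk k w) - 2^-1 * (dot (q k w) (q k w) * dr k)) +
    u * \1_A w * \sum_(k < N) (c k w)%:R * y k -
    2^-1 * (u ^+ 2 * \1_A w * \sum_(k < N) (c k w)%:R * v k w).
  rewrite [in RHS]mulr_sumr [in X in _ - X]mulr_sumr [in X in _ - X]mulr_sumr -big_split/= -sumrB.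
  apply: eq_bigr => k _; rewrite /h /a /y /v /x ltn_ord andbT.
  rewrite !(dotDl, dotDr, dotZl, dotZr) (dotC (q k w) (z k w)).
  rewrite indicE; case: (w \in A); case: (k0 <= k)%N; case: (c k w); rewrite /=; by field.
rewrite lerD2l lerN2 -[leRHS]mulrA ler_wpM2l// -[leLHS]mulrA ler_wpM2l ?sqr_ge0//.
rewrite indicE; case: (w \in A); rewrite ?mul1r// mul0r//.
Qed.

(** Along one pair of sequences, both integrals, both brackets and the cross bracket converge almost
    surely and uniformly in time. Uniformity is essential because the stopping time of the
    approximants depends on n and on the scenario. *)
Lemma stochastic_integral_approx2 (q Z : R -> Omega -> 'cV[R]_m) Mq MZ :
  measurable_process T q -> measurable_process T Z ->
  square_integrable P T q -> square_integrable P T Z ->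
  is_stochastic_integral P T B q Mq -> is_stochastic_integral P T B Z MZ ->
  exists H G, [/\ forall n, is_simple P T B (H n), forall n, is_simple P T B (G n) &
    {ae P, forall w, forall e : R, 0 < e -> \forall n \near \oo, forall s, 0 <= s <= T ->
      [/\ `|sp_integral B (H n) s w - Mq s w| <= e,
          `|sp_integral B (G n) s w - MZ s w| <= e,
          `|\int[leb]_(x in `[0, s]) dot (sp_eval (H n) x w) (sp_eval (H n) x w) -
            \int[leb]_(x in `[0, s]) dot (q x w) (q x w)| <= e,
          `|\int[leb]_(x in `[0, s]) dot (sp_eval (G n) x w) (sp_eval (G n) x w) -
            \int[leb]_(x in `[0, s]) dot (Z x w) (Z x w)| <= e &
          `|\int[leb]_(x in `[0, s]) dot (sp_eval (G n) x w) (sp_eval (H n) x w) -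
            \int[leb]_(x in `[0, s]) dot (Z x w) (q x w)| <= e]}].
Proof.
move=> mq mZ sq sZ hq hZ.
have [H [Hs Hae]] := stochastic_integral_approx mq hq.
have [G [Gs Gae]] := stochastic_integral_approx mZ hZ.
exists H, G; split=> //.
have lq := square_integrable_l2 mq sq; have lZ := square_integrable_l2 mZ sZ.
apply: filterS2 (filterI Hae Gae) (filterI lq lZ) => w [hw gw] [qw zw] e e0.
have l2close (H' : simple_process Omega R m) (z : R -> Omega -> 'cV[R]_m) (dl : R) :
    l2 T (z ^~ w) ->
    (\int[leb]_(s in `[0%R, T]) (dot (sp_eval H' s w - z s w) (sp_eval H' s w - z s w))%:E <= dl%:E)%E ->
    l2 T (sp_eval H' ^~ w) /\ l2norm T (fun s => sp_eval H' s w - z s w) <= dl.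
  move=> lz Hz.
  have ld : l2 T (fun s => sp_eval H' s w - z s w).
    split; last by apply: le_lt_trans Hz _; rewrite ltry.
    move=> i; rewrite (_ : (fun s => _) = fun s => sp_eval H' s w i 0 - z s w i 0); last first.
      by apply/funext => s; rewrite !mxE.
    apply: measurable_funB; first by apply: measurable_funTS; exact: measurable_sp_eval.
    by have [] := lz.
  split; last by rewrite -lee_fin -l2normE.
  by have := l2D 1 ld lz; under eq_fun do rewrite scale1r subrK.
have [d1 d10 h1] := dot_integral_close qw qw e0.
have [d2 d20 h2] := dot_integral_close zw zw e0.
have [d3 d30 h3] := dot_integral_close zw qw e0.
pose dl := Num.min e (Num.min d1 (Num.min d2 d3)).
have dl0 : 0 < dl by rewrite !lt_min e0 d10 d20 d30.
have [de dd1 dd2 dd3] : [/\ dl <= e, dl <= d1, dl <= d2 & dl <= d3].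
  by rewrite /dl !ge_min !lexx ?orbT.
have [N1 _ H1] := hw dl dl0; have [N2 _ H2] := gw dl dl0.
exists (maxn N1 N2) => // n /= Nn s sT; have /andP[_ sT'] := sT.
have [hn1 hn2] := H1 n (leq_trans (leq_maxl _ _) Nn).
have [gn1 gn2] := H2 n (leq_trans (leq_maxr _ _) Nn).
have [lh nh] := l2close _ _ _ qw hn1; have [lg ng] := l2close _ _ _ zw gn1.
split.
- exact: le_trans (hn2 s sT) de.
- exact: le_trans (gn2 s sT) de.
- by apply: h1 => //; exact: le_trans nh dd1.
- by apply: h2 => //; exact: le_trans ng dd2.
- by apply: h3 => //; [exact: le_trans ng dd3|exact: le_trans nh dd3].
Qed.

Lemma measurable_Rintegral_sq (q : R -> Omega -> 'cV[R]_m) : measurable_process T q ->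
  measurable_fun [set: Omega] (fun w => \int[leb]_(x in `[0, T]) dot (q x w) (q x w)).
Proof.
move=> mq; rewrite /Rintegral; apply: (@measurableT_comp _ _ _ _ _ _ fine) => //.
apply: measurable_strip_integral; last by move=> t w _; rewrite lee_fin dot_ge0.
by apply/measurable_EFinP; exact: measurable_process_dot.
Qed.

Section supermartingale.
Variables (q Z : R -> Omega -> 'cV[R]_m) (Mq MZ : R -> Omega -> R).
Hypothesis mq : measurable_process T q.
Hypothesis mZ : measurable_process T Z.
Hypothesis sq : square_integrable P T q.
Hypothesis sZ : square_integrable P T Z.
Hypothesis hq : is_stochastic_integral P T B q Mq.
Hypothesis hZ : is_stochastic_integral P T B Z MZ.

Definition log_density w := Mq T w - 2^-1 * \int[leb]_(x in `[0, T]) dot (q x w) (q x w).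

(** The process X of the overview: the integral of Z against the Brownian motion shifted by q, as in
    Girsanov's theorem. *)
Definition drifted s w := MZ s w - \int[leb]_(x in `[0, s]) dot (Z x w) (q x w).

Lemma measurable_log_density : measurable_fun [set: Omega] log_density.
Proof.
apply: measurable_funB; last by apply: measurable_funM => //; exact: measurable_Rintegral_sq.
have [mM _ _] := hq; apply: (filtration_measurable_fun P_complete B_brownian (t := T)) => //.
by apply: mM; rewrite lexx ltW.
Qed.

Context (t : R) (A : set Omega) (D xi : Omega -> R).
Hypothesis tT : 0 <= t <= T.
Hypothesis FA : <<s augmented_gen P B t >> A.
Hypothesis mD : measurable_fun [set: Omega] D.
Hypothesis mxi : measurable_fun [set: Omega] xi.
Hypothesis xi_ge0 : forall w, 0 <= xi w.
Hypothesis D_ge : forall w, - xi w <= D w.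
Hypothesis drifted_ge : {ae P, forall w, forall s, t <= s <= T ->
  - xi w <= drifted s w - drifted t w}.
Hypothesis DE : {ae P, forall w, D w = drifted T w - drifted t w}.

(** A lower bound for the increment of [drifted] from t to the stopping time in both cases: without
    stopping the increment is [D], with stopping only the pathwise bound [- xi] is known. *)
Let Dk (K : R) w :=
  if \int[leb]_(x in `[0, T]) dot (Z x w) (Z x w) < K then D w else - xi w.

Let measurable_Dk K : measurable_fun [set: Omega] (Dk K).
Proof.
apply: measurable_fun_ifT => //; last exact: measurableT_comp.
by apply: measurable_fun_ltr => //; exact: measurable_Rintegral_sq.
Qed.

Let mA : measurable A.
Proof.
by apply: (augmented_gen_measurable P_complete B_brownian (t := t)) => //; have /andP[] := tT.
Qed.

(** The exponents of [grid_exp_lower_bound] have exponential mean 1 for every n, and in the limit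
    they dominate the exponent stated here; Fatou's lemma gives the inequality. *)
Lemma truncated_exp_le1 (u K : R) : 0 <= u -> 0 <= K ->
  (\int[P]_w (expR (log_density w + u * \1_A w * Dk K w - 2^-1 * u ^+ 2 * K))%:E <= 1)%E.
Proof.
move=> u0 K0.
have [H [G [Hs Gs HG]]] := stochastic_integral_approx2 mq mZ sq sZ hq hZ.
have /choice[E HE] := fun n => grid_exp_lower_bound u (Hs n) (Gs n) tT K0 FA.
pose L w := log_density w + u * \1_A w * Dk K w - 2^-1 * u ^+ 2 * K.
have mL : measurable_fun [set: Omega] L.
  apply: measurable_funB => //; apply: measurable_funD; first exact: measurable_log_density.
  by apply: measurable_funM => //; apply: measurable_funM => //; exact: measurable_indic.
apply: (@fatou_ae_le _ _ _ P (fun n w => expR (E n w)) (fun w => expR (L w))).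
- by move=> n; apply: measurableT_comp => //; have [] := HE n.
- exact: measurableT_comp.
- by move=> n w; exact: expR_ge0.
- by move=> w; exact: expR_ge0.
- apply: filterS3 HG drifted_ge DE => w hw dw Dw e e0.
  pose x0 := expR (L w); have x00 : 0 < x0 by exact: expR_gt0.
  pose dl := e / x0; have dl0 : 0 < dl by rewrite divr_gt0.
  pose IZ := \int[leb]_(x in `[0, T]) dot (Z x w) (Z x w).
  pose e1 := dl / (2 + 4 * u); have u2 : 0 < 2 + 4 * u by lra.
  have e10 : 0 < e1 by rewrite divr_gt0.
  (* The minimum with K - IZ forces the bracket of the approximant below K as well, so that it is
     not stopped; the strict inequality in [Dk] makes this gap positive. The denominator 2 + 4 u in
     [e1] collects the errors of the log density and the four errors in the increment, multiplied by
     u. *)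
  pose e2 := if IZ < K then Num.min e1 (K - IZ) else e1.
  have e20 : 0 < e2 by rewrite /e2; case: ifP => h //; rewrite lt_min e10 subr_gt0.
  have e21 : e2 <= e1 by rewrite /e2; case: ifP => // _; rewrite ge_min lexx.
  have [N _ hN] := hw e2 e20; exists N => // n /= Nn.
  have hn := hN n Nn; have [_ _ hE] := HE n; have [s [sT GK LE]] := hE w.
  have T0 : 0 <= T <= T by rewrite lexx ltW.
  have /andP[t0 tT'] := tT; have /andP[ts sT'] := sT.
  have s0T : 0 <= s <= T by rewrite sT' (le_trans t0 ts).
  have [aT bT cT dT eT] := hn T T0; have [at_ bt ct dt et] := hn t tT.
  have [as_ bs cs ds es] := hn s s0T.
  have key : L w - dl <= E n w.
    apply: le_trans LE; rewrite /L.
    have ind : 0 <= u * \1_A w <= u.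
      by rewrite indicE; case: (w \in A); rewrite ?mulr1 ?mulr0 ?lexx ?u0.
    have [v0 vu] := andP ind.
    set v := u * \1_A w in v0 vu *.
    have dk : Dk K w - 4 * e2 <= sp_integral B (G n) s w -
        \int[leb]_(x in `[0, s]) dot (sp_eval (G n) x w) (sp_eval (H n) x w) -
        (sp_integral B (G n) t w -
         \int[leb]_(x in `[0, t]) dot (sp_eval (G n) x w) (sp_eval (H n) x w)).
      have : Dk K w <= drifted s w - drifted t w.
        rewrite /Dk -/IZ; case: (boolP (IZ < K)) => h; last exact: dw.
        rewrite Dw (_ : s = T)//; apply: GK.
        move: dT; rewrite ler_norml -/IZ => /andP[_]; rewrite /e2 h.
        have h2 : Num.min e1 (K - IZ) <= K - IZ by rewrite ge_min lexx orbT.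
        clear aT bT cT eT at_ bt ct dt et as_ bs cs ds es v0 vu hn.
        by move=> h1; lra.
      rewrite /drifted; move: bs es bt et; rewrite !ler_norml.
      clear aT bT cT dT eT at_ ct dt as_ cs ds v0 vu hn.
      move=> /andP[? ?] /andP[? ?] /andP[? ?] /andP[? ?]; lra.
    have vd : v * (Dk K w - 4 * e2) <= v * (sp_integral B (G n) s w -
        \int[leb]_(x in `[0, s]) dot (sp_eval (G n) x w) (sp_eval (H n) x w) -
        (sp_integral B (G n) t w -
         \int[leb]_(x in `[0, t]) dot (sp_eval (G n) x w) (sp_eval (H n) x w))).
      by rewrite ler_wpM2l.
    have dle : (2 + 4 * u) * e1 = dl by rewrite /e1 mulrC divfK ?gt_eqF.
    have ve : v * e2 <= u * e1 by rewrite ler_pM ?(ltW e20).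
    rewrite mulrBr in vd; rewrite /log_density; move: aT cT vd dle ve e21 e10.
    rewrite !ler_norml; clear bT dT eT at_ bt ct dt et as_ bs cs ds es dk v0 vu hn x00 dl0 e20 u0 K0 u2.
    move=> /andP[? ?] /andP[? ?]; lra.
  rewrite -/x0; have : x0 * (1 - dl) <= expR (E n w).
    apply: (@le_trans _ _ (x0 * expR (- dl))).
      by rewrite ler_wpM2l ?(ltW x00)// expR_ge1Dx.
    by rewrite /x0 -expRD ler_expR.
  have : x0 * dl = e by rewrite /dl mulrC divfK ?gt_eqF.
  clear aT bT cT dT eT at_ bt ct dt et as_ bs cs ds es hn key; lra.
- by move=> e e0; apply: nearW => n; have [_ -> _] := HE n; rewrite -EFinD lee_fin lerDl ltW.
Qed.

Let LA (X : Omega -> R) w := expR (log_density w) * \1_A w * X w.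

Let measurable_LA X : measurable_fun [set: Omega] X -> measurable_fun [set: Omega] (LA X).
Proof.
move=> mX; apply: measurable_funM => //; apply: measurable_funM; last exact: measurable_indic.
by apply: measurableT_comp => //; exact: measurable_log_density.
Qed.

Let LA_ge0 X w : (0 <= X w) -> 0 <= LA X w.
Proof. by move=> X0; rewrite mulr_ge0// mulr_ge0 ?expR_ge0. Qed.

Hypothesis EL : (\int[P]_w (expR (log_density w))%:E = 1)%E.
Hypothesis ELxi : (\int[P]_w (expR (log_density w) * xi w)%:E < +oo)%E.

Let Dk_ge K w : - xi w <= Dk K w.
Proof. by rewrite /Dk; case: ifP. Qed.

Let ELAxi : (\int[P]_w (LA xi w)%:E < +oo)%E.
Proof.
apply: le_lt_trans ELxi; apply: ge0_le_integral => //.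
- by move=> w _; rewrite lee_fin LA_ge0.
- by apply/measurable_EFinP; exact: measurable_LA.
- apply/measurable_EFinP; apply: measurable_funM => //.
  by apply: measurableT_comp => //; exact: measurable_log_density.
- move=> w _; rewrite lee_fin /LA ler_wpM2r// ler_piMr ?expR_ge0//.
Qed.

(** Inserts exp(x) >= 1 + x into [truncated_exp_le1], cancels the common mass 1 and divides by u.
    Adding [xi] throughout keeps every integrand nonnegative, so no integrability of the increment
    is presupposed. *)
Let step_bound (u K : R) : 0 < u -> 0 <= K ->
  (\int[P]_w (LA (fun w => xi w + Dk K w)%R w)%:E <= \int[P]_w (LA xi w)%:E + (2^-1 * u * K)%:E)%E.
Proof.
move=> u0 K0; have mL := measurable_log_density.
have E1 := truncated_exp_le1 (ltW u0) K0.
pose L w := log_density w + u * \1_A w * Dk K w - 2^-1 * u ^+ 2 * K.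
have mLK : measurable_fun [set: Omega] (fun w => expR (L w)).
  apply: measurableT_comp => //; apply: measurable_funB => //; apply: measurable_funD => //.
  by apply: measurable_funM => //; apply: measurable_funM => //; exact: measurable_indic.
have mx : measurable_fun [set: Omega] (fun w => xi w + Dk K w) by exact: measurable_funD.
have x0 w : 0 <= xi w + Dk K w by have := Dk_ge K w; lra.
have mLx := measurable_LA mx; have mLxi := measurable_LA mxi.
have mexp : measurable_fun [set: Omega] (fun w => expR (log_density w)) by exact: measurableT_comp.
have [I2 I2E] : exists r : R, (\int[P]_w (LA xi w)%:E = r%:E)%E.
  exists (fine (\int[P]_w (LA xi w)%:E)%E); rewrite fineK// ge0_fin_numE//.
  by apply: integral_ge0 => w _; rewrite lee_fin LA_ge0.
rewrite I2E; set I1 := (\int[P]_w _)%E.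
have pw w : expR (log_density w) + u * LA (fun w => xi w + Dk K w) w <=
    expR (L w) + (u * LA xi w + 2^-1 * u ^+ 2 * K * expR (log_density w)).
  have -> : L w = log_density w + (u * \1_A w * Dk K w - 2^-1 * u ^+ 2 * K) by rewrite addrA.
  rewrite expRD.
  have := ler_wpM2l (expR_ge0 (log_density w)) (expR_ge1Dx (u * \1_A w * Dk K w - 2^-1 * u ^+ 2 * K)).
  rewrite /LA; set l := expR _; set y := l * expR _; set i := \1_A w.
  move=> h; have -> : l + u * (l * i * (xi w + Dk K w)) =
    l * (1 + (u * i * Dk K w - 2^-1 * u ^+ 2 * K)) + (u * (l * i * xi w) + 2^-1 * u ^+ 2 * K * l) by ring.
  by rewrite lerD2r.
have c0 : 0 <= 2^-1 * u ^+ 2 * K by rewrite mulr_ge0// mulr_ge0// sqr_ge0.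
have u0' := ltW u0.
have : (1 + u%:E * I1 <= 1 + u%:E * I2%:E + (2^-1 * u ^+ 2 * K)%:E * 1)%E.
  have -> : (1 + u%:E * I1 = \int[P]_w (expR (log_density w) + u * LA (fun w => xi w + Dk K w) w)%:E)%E.
    rewrite ge0_integralDZ//; last by move=> w; exact: LA_ge0.
    by rewrite EL.
  apply: (@le_trans _ _ (\int[P]_w ((expR (L w) + u * LA xi w) + 2^-1 * u ^+ 2 * K * expR (log_density w))%:E)%E).
    apply: ge0_le_real_integral.
    - by apply: measurable_funD => //; exact: measurable_funM.
    - by apply: measurable_funD; [apply: measurable_funD => //; exact: measurable_funM|exact: measurable_funM].
    - by move=> w; rewrite addr_ge0 ?expR_ge0// mulr_ge0// LA_ge0.
    - by move=> w; rewrite -addrA; exact: pw.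
  rewrite ge0_integralDZ//; last 2 first.
  - by apply: measurable_funD => //; exact: measurable_funM.
  - by move=> w; rewrite addr_ge0 ?expR_ge0// mulr_ge0// LA_ge0.
  rewrite ge0_integralDZ//; last by move=> w; exact: LA_ge0.
  by rewrite EL I2E; apply: leeD2r; apply: leeD2r; exact: E1.
rewrite mule1 -addeA leeD2lE// => h.
have : (u%:E * I1 <= u%:E * (I2%:E + (2^-1 * u * K)%:E))%E.
  move: h; rewrite -EFinM -!EFinD -EFinM mulrDr.
  by rewrite (_ : u * (2^-1 * u * K) = 2^-1 * u ^+ 2 * K)//; ring.
by rewrite lee_pmul2l// lte_fin.
Qed.

(** The supermartingale inequality for the increment, written with [xi] added on both sides: the
    left integrand is nonnegative, so the inequality also yields integrability of [D] under the new
    measure on A. *)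
Lemma density_supermartingale :
  (\int[P]_w (expR (log_density w) * \1_A w * (xi w + D w))%:E <=
   \int[P]_w (expR (log_density w) * \1_A w * xi w)%:E)%E.
Proof.
have I20 : (0 <= \int[P]_w (LA xi w)%:E)%E by apply: integral_ge0 => w _; rewrite lee_fin LA_ge0.
have bound n : (\int[P]_w (LA (fun w => xi w + Dk n.+1%:R w)%R w)%:E <= \int[P]_w (LA xi w)%:E)%E.
  apply/lee_addgt0Pr => e e0.
  (* With K = n + 1 and u = 2 e / (n + 1), the error u K / 2 of [step_bound] is exactly e. *)
  have h : 0 < 2 * e / n.+1%:R by rewrite divr_gt0// mulr_gt0.
  have := step_bound h (ler0n _ n.+1); congr (_ <= _ + _%:E)%E.
  by rewrite !mulrA mulVf// mul1r divfK ?pnatr_eq0.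
apply: (@fatou_ae_le _ _ _ P (fun n => LA (fun w => xi w + Dk n.+1%:R w)) (LA (fun w => xi w + D w))).
- by move=> n; apply: measurable_LA; exact: measurable_funD.
- by apply: measurable_LA; exact: measurable_funD.
- by move=> n w; apply: LA_ge0; have := Dk_ge n.+1%:R w; lra.
- by move=> w; apply: LA_ge0; have := D_ge w; lra.
- apply: aeW => w e e0; pose IZ := \int[leb]_(x in `[0, T]) dot (Z x w) (Z x w).
  exists (Num.truncn IZ) => // n /= In; have DkE : Dk n.+1%:R w = D w; last by rewrite /LA DkE lerDl ltW.
  rewrite /Dk ifT// -/IZ; apply: lt_le_trans (_ : (Num.truncn IZ).+1%:R <= _); last by rewrite ler_nat.
  by rewrite Num.Theory.truncnS_gt.
- by move=> e e0; apply: nearW => n; apply: le_trans (bound n) _; rewrite leeDl// lee_fin ltW.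
Qed.

End supermartingale.

End paths.

(** Compared with [stopped_sumE], one index serves all summands, as required when several integrals
    and brackets are stopped together. *)
Lemma stopped_index (R : pzRingType) (N : nat) (c : nat -> bool) :
  (forall k, c k.+1 -> c k) ->
  exists n, [/\ (n <= N)%N, (forall k, (k < n)%N -> c k), (n < N)%N -> ~~ c n &
    forall u : nat -> R, \sum_(k < N) (c k)%:R * u k = \sum_(k < n) u k].
Proof.
move=> cS; have [n [nN cn nc] _] := stopped_sumE (R := R) N (fun=> 0) cS.
exists n; split=> // u.
have cN k : (n <= k)%N -> (k < N)%N -> c k = false.
  move=> nk kN; apply/negbTE; elim: k nk kN => [|k IH].
    by rewrite leqn0 => /eqP <-.
  rewrite leq_eqVlt => /orP[/eqP <-//|nk kN]; apply: contra (IH nk (ltnW kN)); exact: cS.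
rewrite -(big_mkord xpredT (fun k => (c k)%:R * u k)) (big_cat_nat (leq0n n) nN)/=.
rewrite [X in _ + X]big_nat [X in _ + X]big1 ?addr0 => [|k /andP[nk kN]]; last by rewrite cN ?mul0r.
by rewrite big_mkord; apply: eq_bigr => k _; rewrite cn ?mul1r.
Qed.

(** * Finite entropy *)

Section entropy_function.
Context (R : realType).
Implicit Types l x : R.

(* The relative entropy density y ln y - y + 1 at y = exp l. *)
Definition entropy_fun l : R := expR l * (l - 1) + 1.

Lemma entropy_fun_ge0 l : 0 <= entropy_fun l.
Proof.
have h : expR l * expR (- l) = 1 by rewrite -expRD subrr expR0.
by rewrite /entropy_fun -h -mulrDr mulr_ge0 ?expR_ge0//; have := expR_ge1Dx (- l); lra.
Qed.

(** Young's inequality for the conjugate pair exp and y ln y - y; it is 1 + y <= exp y at y = x - l,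
    multiplied by exp l. *)
Lemma entropy_young x l : x * expR l <= expR x + entropy_fun l - 1.
Proof.
have h : expR l * expR (x - l) = expR x by rewrite -expRD addrC subrK.
have := ler_wpM2l (expR_ge0 l) (expR_ge1Dx (x - l)); rewrite h /entropy_fun; lra.
Qed.

(** The criterion of de la Vallee-Poussin in pointwise form: the part of a density above exp(bt) is
    controlled by its entropy divided by bt - 1, so bounded entropy gives uniform integrability. *)
Lemma entropy_fun_large l bt : 1 < bt ->
  expR l <= Num.min (expR l) (expR bt) + (bt - 1)^-1 * entropy_fun l.
Proof.
move=> b1; have b0 : 0 < bt - 1 by rewrite subr_gt0.
have e0 := entropy_fun_ge0 l; have [lb|bl] := leP (expR l) (expR bt).
  by rewrite lerDl mulr_ge0// invr_ge0 ltW.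
rewrite ltr_expR in bl; apply: ler_wpDl; first exact: expR_ge0.
rewrite ler_pdivlMl// /entropy_fun; have := expR_gt0 l => el.
have : expR l * (bt - 1) <= expR l * (l - 1) by rewrite ler_wpM2l ?ltW//; lra.
by rewrite mulrC; lra.
Qed.

Lemma measurable_entropy_fun : measurable_fun [set: R] entropy_fun.
Proof.
apply: measurable_funD => //; apply: measurable_funM => //.
by apply: measurable_funB.
Qed.

(** Young's inequality is applied at p alpha a and divided by p, so that alpha a exp(l) costs only
    the fraction 1/p of the entropy. Moving it to the left leaves the factor 1 - 1/p, which is
    positive because p > 1. *)
Lemma entropy_pointwise (l S a W E alpha p v K c : R) :
  0 < alpha -> 1 < p -> 0 < v -> S <= alpha * (a + W) + c ->
  expR l * (1 + (v * (l - S) - 2^-1 * v ^+ 2 * K)) <= E ->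
  (1 + v) * expR l + v * (1 - p^-1) * entropy_fun l <=
  E + v * 1 + v * p^-1 * expR (p * alpha * a) + v * alpha * (W * expR l) +
  (v * c + 2^-1 * v ^+ 2 * K) * expR l.
Proof.
move=> al0 p1 v0 SA h1; have p0 : 0 < p by lra.
have ip : 0 < p^-1 by rewrite invr_gt0.
have l0 := expR_ge0 l.
have h2 : expR l * S <= expR l * (alpha * (a + W) + c) by rewrite ler_wpM2l.
have h3 := ler_wpM2l (ltW ip) (entropy_young (p * alpha * a) l).
have h3' : p^-1 * (p * alpha * a * expR l) = alpha * a * expR l.
  by field; rewrite gt_eqF.
rewrite h3' in h3.
have h4 : v * (expR l * S) <= v * (expR l * (alpha * W + c) +
    p^-1 * (expR (p * alpha * a) + entropy_fun l - 1)).
  by rewrite ler_wpM2l ?(ltW v0)//; apply: le_trans h2 _; lra.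
have h5 : 0 <= v * p^-1 by rewrite mulr_ge0// ltW.
rewrite /entropy_fun in h4 *; lra.
Qed.

End entropy_function.

(** Origin of the constant [c] below: an approximation error of at most 1 in the integral, in the
    cross bracket and in the bracket of q costs alpha, alpha and 1/2. *)
Lemma drift_bound (R : realType) (alpha sG hh gh M qq zq r : R) : 0 < alpha ->
  `|sG - M| <= 1 -> `|hh - qq| <= 1 -> `|gh - zq| <= 1 ->
  alpha * (M - zq) + 2^-1 * qq <= r ->
  alpha * (sG - gh) + 2^-1 * hh <= r + (2 * alpha + 2^-1).
Proof.
move=> al0; rewrite !ler_norml => /andP[_ h1] /andP[_ h2] /andP[h3 _] h4.
have : alpha * (sG - gh) <= alpha * ((M - zq) + 2) by rewrite ler_wpM2l ?(ltW al0)//; lra.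
lra.
Qed.

Lemma log_density_close (R : realType) (e e1 sH hh M qq : R) : e1 <= e / 2 ->
  `|sH - M| <= e1 -> `|hh - qq| <= e1 ->
  `|(M - 2^-1 * qq) - (sH - 2^-1 * hh)| <= e.
Proof.
by move=> h; rewrite !ler_norml => /andP[? ?] /andP[? ?]; apply/andP; split; lra.
Qed.

Lemma bracket_le (R : realType) (e1 hh qq mx K : R) : e1 <= 1 ->
  `|hh - qq| <= e1 -> qq <= mx -> mx + 1 <= K -> hh <= K.
Proof. by move=> h; rewrite ler_norml => /andP[_ ?] ? ?; lra. Qed.

Section entropy_step.
Context d (Omega : measurableType d) (R : realType) (P : probability Omega R).
Variables (l S a1 W : Omega -> R) (alpha p v K c rho C1 w1 : R).
Hypothesis ml : measurable_fun [set: Omega] l.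
Hypothesis mS : measurable_fun [set: Omega] S.
Hypothesis ma1 : measurable_fun [set: Omega] a1.
Hypothesis mW : measurable_fun [set: Omega] W.
Hypothesis W_ge0 : forall w, 0 <= W w.
Hypothesis alpha_gt0 : 0 < alpha.
Hypothesis p_gt1 : 1 < p.
Hypothesis v_gt0 : 0 < v.
Hypothesis K_ge0 : 0 <= K.
Hypothesis c_ge0 : 0 <= c.
Hypothesis El : (\int[P]_w (expR (l w))%:E = 1)%E.
Hypothesis EWl : (\int[P]_w (W w * expR (l w))%:E <= w1%:E)%E.
Hypothesis EvS : (\int[P]_w (expR (l w + v * (l w - S w) - 2^-1 * v ^+ 2 * K))%:E <= 1)%E.
Hypothesis Ea1 : (\int[P]_w (expR (p * alpha * a1 w))%:E <= C1%:E)%E.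

Let A := [set w | S w <= alpha * (a1 w + W w) + c].

Hypothesis EA : (\int[P]_w (\1_(~` A) w * expR (l w))%:E <= rho%:E)%E.

Let mA : measurable A.
Proof.
have m2 : measurable_fun [set: Omega] (fun w => alpha * (a1 w + W w) + c).
  by apply: measurable_funD => //; apply: measurable_funM => //; exact: measurable_funD.
have := measurable_fun_ler mS m2; move=> /(_ measurableT [set true] I); rewrite setTI.
by congr measurable; apply/seteqP; split.
Qed.

(** Integrates [entropy_pointwise] over [A], the event on which the upper bound for S survives
    discretisation. Off [A] nothing is known about S; there the left side reduces to (1 + v) exp(l),
    whose integral is controlled by [rho]. *)
Lemma entropy_step :
  ((v * (1 - p^-1))%:E * \int[P]_w (\1_A w * entropy_fun (l w))%:E <=
   ((1 + v) * rho + v * (p^-1 * C1 + alpha * w1 + c) + 2^-1 * v ^+ 2 * K)%:E)%E.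
Proof.
have p0 : 0 < p := lt_trans ltr01 p_gt1.
have ip : 0 < p^-1 by rewrite invr_gt0.
have ip1 : p^-1 < 1 by rewrite invf_lt1.
have v0 := ltW v_gt0.
have mel : measurable_fun [set: Omega] (fun w => expR (l w)) by exact: measurableT_comp.
have mphi : measurable_fun [set: Omega] (fun w => entropy_fun (l w)).
  by apply: measurableT_comp => //; exact: measurable_entropy_fun.
have mAphi : measurable_fun [set: Omega] (fun w => \1_A w * entropy_fun (l w)).
  by apply: measurable_funM => //; exact: measurable_indic.
pose E w := expR (l w + v * (l w - S w) - 2^-1 * v ^+ 2 * K).
have mE : measurable_fun [set: Omega] E.
  apply: measurableT_comp => //; apply: measurable_funB => //; apply: measurable_funD => //.
  by apply: measurable_funM => //; exact: measurable_funB.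
have mexpa : measurable_fun [set: Omega] (fun w => expR (p * alpha * a1 w)).
  by apply: measurableT_comp => //; exact: measurable_funM.
have mWl : measurable_fun [set: Omega] (fun w => W w * expR (l w)) by exact: measurable_funM.
have mAl : measurable_fun [set: Omega] (fun w => \1_(~` A) w * expR (l w)).
  by apply: measurable_funM => //; apply: measurable_indic; exact: measurableC.
have pw w : expR (l w) + v * expR (l w) + v * (1 - p^-1) * (\1_A w * entropy_fun (l w)) <=
  E w + v * 1 + v * p^-1 * expR (p * alpha * a1 w) + v * alpha * (W w * expR (l w)) +
  (v * c + 2^-1 * v ^+ 2 * K) * expR (l w) + (1 + v) * (\1_(~` A) w * expR (l w)).
  have E0 : 0 <= E w := expR_ge0 _.
  have e0 := expR_ge0 (p * alpha * a1 w); have l0 := expR_ge0 (l w).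
  rewrite !indicE in_setC; case: (boolP (w \in A)) => /= [|_]; last first.
    rewrite mul0r mulr0 addr0 [1 * expR (l w)]mul1r [(1 + v) * _]mulrDl mul1r lerDr.
    by rewrite !addr_ge0 ?mulr_ge0 ?addr_ge0 ?mulr_ge0 ?sqr_ge0 ?(ltW ip) ?(ltW alpha_gt0).
  rewrite inE /A/= mul1r mul0r mulr0 addr0 => SA.
  have h1 : expR (l w) * (1 + (v * (l w - S w) - 2^-1 * v ^+ 2 * K)) <= E w.
    by rewrite /E -addrA expRD ler_wpM2l// expR_ge1Dx.
  by have := entropy_pointwise alpha_gt0 p_gt1 v_gt0 SA h1; rewrite mulrDl mul1r.
have i0 := entropy_fun_ge0; have el0 w : 0 <= expR (l w) := expR_ge0 _.
have nn w : 0 <= \1_(~` A) w * expR (l w) by rewrite mulr_ge0.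
have nnW w : 0 <= W w * expR (l w) by rewrite mulr_ge0.
have vip : 0 <= v * p^-1 by rewrite mulr_ge0// ltW.
have va : 0 <= v * alpha by rewrite mulr_ge0// ltW.
have vc : 0 <= v * c + 2^-1 * v ^+ 2 * K by rewrite addr_ge0// mulr_ge0// mulr_ge0// sqr_ge0.
have v1 : 0 <= 1 + v by rewrite addr_ge0.
have vp1 : 0 <= v * (1 - p^-1) by rewrite mulr_ge0// subr_ge0 ltW.
have mv1 : measurable_fun [set: Omega] (fun=> 1 : R) by exact: measurable_cst.
have m1 : measurable_fun [set: Omega] (fun w => E w + v * 1) by exact: measurable_funD.
have m2 : measurable_fun [set: Omega] (fun w => E w + v * 1 + v * p^-1 * expR (p * alpha * a1 w)).
  by apply: measurable_funD => //; exact: measurable_funM.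
have m3 : measurable_fun [set: Omega] (fun w => E w + v * 1 + v * p^-1 * expR (p * alpha * a1 w) +
    v * alpha * (W w * expR (l w))).
  by apply: measurable_funD => //; exact: measurable_funM.
have m4 : measurable_fun [set: Omega] (fun w => E w + v * 1 + v * p^-1 * expR (p * alpha * a1 w) +
    v * alpha * (W w * expR (l w)) + (v * c + 2^-1 * v ^+ 2 * K) * expR (l w)).
  by apply: measurable_funD => //; exact: measurable_funM.
have n1 w : 0 <= E w + v * 1 by rewrite addr_ge0 ?expR_ge0// mulr1.
have n2 w : 0 <= E w + v * 1 + v * p^-1 * expR (p * alpha * a1 w).
  by rewrite addr_ge0// mulr_ge0// expR_ge0.
have n3 w : 0 <= E w + v * 1 + v * p^-1 * expR (p * alpha * a1 w) +
    v * alpha * (W w * expR (l w)) by rewrite addr_ge0// mulr_ge0.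
have n4 w : 0 <= E w + v * 1 + v * p^-1 * expR (p * alpha * a1 w) +
    v * alpha * (W w * expR (l w)) + (v * c + 2^-1 * v ^+ 2 * K) * expR (l w).
  by rewrite addr_ge0// mulr_ge0.
have nA w : 0 <= \1_A w * entropy_fun (l w) by rewrite mulr_ge0// i0.
have nn0 w : 0 <= expR (p * alpha * a1 w) := expR_ge0 _.
have E0 w : 0 <= E w := expR_ge0 _.
have nl w : 0 <= expR (l w) + v * expR (l w) by rewrite addr_ge0// mulr_ge0.
have ml1 : measurable_fun [set: Omega] (fun w => expR (l w) + v * expR (l w)).
  by apply: measurable_funD => //; exact: measurable_funM.
have le := @ge0_le_real_integral _ _ _ P _ _ _ _ _ pw.
have : (1 + v%:E * 1 + (v * (1 - p^-1))%:E * \int[P]_w (\1_A w * entropy_fun (l w))%:E <=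
    1 + v%:E * 1 + (v * p^-1)%:E * C1%:E + (v * alpha)%:E * w1%:E +
    (v * c + 2^-1 * v ^+ 2 * K)%:E * 1 + (1 + v)%:E * rho%:E)%E.
  have <- : (\int[P]_w (expR (l w) + v * expR (l w) + v * (1 - p^-1) * (\1_A w * entropy_fun (l w)))%:E =
     1 + v%:E * 1 + (v * (1 - p^-1))%:E * \int[P]_w (\1_A w * entropy_fun (l w))%:E)%E.
    by rewrite !ge0_integralDZ// El.
  apply: le_trans (le _ _ _) _.
  - by apply: measurable_funD => //; exact: measurable_funM.
  - by apply: measurable_funD => //; exact: measurable_funM.
  - by move=> w; rewrite addr_ge0// mulr_ge0.
  rewrite !ge0_integralDZ// El (integral_probability_cst P 1%E).
  apply: leeD; last by apply: lee_wpmul2l; rewrite ?lee_fin.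
  apply: leeD => //; apply: leeD; last by apply: lee_wpmul2l; rewrite ?lee_fin.
  apply: leeD; last by apply: lee_wpmul2l; rewrite ?lee_fin.
  exact: leeD.
rewrite !mule1 -!EFinM -!EFinD.
set r := (X in (_ <= X%:E)%E); have -> : r = (1 + v) + ((1 + v) * rho +
    v * (p^-1 * C1 + alpha * w1 + c) + 2^-1 * v ^+ 2 * K) by rewrite /r; ring.
by rewrite [X in (_ <= X)%E]EFinD leeD2lE.
Qed.

End entropy_step.

Section entropy_paths.
Context d (Omega : measurableType d) (R : realType) (P : probability Omega R)
  (T : R) (m : nat) (B : R -> Omega -> 'cV[R]_m).
Hypothesis T_gt0 : 0 < T.
Hypothesis P_complete : measure_is_complete P.
Hypothesis B_brownian : is_brownian_motion P T B.

Local Notation Ft t := (g_sigma_algebraType (augmented_gen P B t)).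
Local Notation leb := (@lebesgue_measure R).

(** With q and z the values of H and G stopped once either bracket would exceed K, the log density
    of (1 + v) q - v alpha z is l + v (l - S) - v^2/2 int |q - alpha z|^2, and |q - alpha z|^2 <= 2
    |q|^2 + 2 alpha^2 |z|^2 bounds the last integral by 2 (1 + alpha^2) K. The bound on exp(2 l),
    obtained from the density of 2 q, serves later to neglect events of small probability. *)
Lemma grid_entropy (H G : simple_process Omega R m) (alpha K : R) :
  is_simple P T B H -> is_simple P T B G -> 0 <= K ->
  exists l S : Omega -> R, [/\ measurable_fun [set: Omega] l /\ measurable_fun [set: Omega] S,
    forall W, filtration_measurable P B 0 W -> (forall w, 0 <= W w) ->
      (\int[P]_w (W w * expR (l w))%:E = \int[P]_w (W w)%:E)%E,
    (\int[P]_w (expR (2 * l w))%:E <= (expR K)%:E)%E,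
    forall v : R, (\int[P]_w (expR (l w + v * (l w - S w) -
      2^-1 * v ^+ 2 * (2 * (1 + alpha ^+ 2) * K)))%:E <= 1)%E &
    forall w, exists s, [/\ 0 <= s <= T,
      l w = sp_integral B H s w - 2^-1 * \int[leb]_(x in `[0, s]) dot (sp_eval H x w) (sp_eval H x w),
      S w = alpha * (sp_integral B G s w - \int[leb]_(x in `[0, s]) dot (sp_eval G x w) (sp_eval H x w)) +
        2^-1 * \int[leb]_(x in `[0, s]) dot (sp_eval H x w) (sp_eval H x w) &
      \int[leb]_(x in `[0, T]) dot (sp_eval H x w) (sp_eval H x w) <= K ->
      \int[leb]_(x in `[0, T]) dot (sp_eval G x w) (sp_eval G x w) <= K -> s = T]].
Proof.
move=> Hs Gs K0.
have lT x : x \in [::] -> 0 <= x <= T by [].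
have [N [r [rg _ Hr Gr]]] := times_on_exists T_gt0 lT Hs Gs.
have [r0 rN rS] := rg.
pose q k w := sp_eval H (r k.+1) w; pose z k w := sp_eval G (r k.+1) w.
pose dr k := r k.+1 - r k.
have dr0 k : (k < N)%N -> 0 <= dr k by move=> kN; rewrite subr_ge0 ltW// rS.
have [_ _ mq [Kq qK]] := regrid_simple rg Hs Hr.
have [_ _ mz [Kz zK]] := regrid_simple rg Gs Gr.
pose vq k w := if (k < N)%N then dot (q k w) (q k w) * dr k else 0.
pose vz k w := if (k < N)%N then dot (z k w) (z k w) * dr k else 0.
pose c k w := (\sum_(i < k.+1) vq i w <= K) && (\sum_(i < k.+1) vz i w <= K).
(* One stopped family for all purposes: (1, 0) gives l, (2, 0) the second moment, (1 + v, - v alpha)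
   the perturbed density, and (0, alpha) the part of S that comes from G. *)
pose h a b k w := (c k w)%:R *: (a *: q k w + b *: z k w).
have vq0 k w : 0 <= vq k w by rewrite /vq; case: ifP => // kN; rewrite mulr_ge0 ?dot_ge0 ?dr0.
have vz0 k w : 0 <= vz k w by rewrite /vz; case: ifP => // kN; rewrite mulr_ge0 ?dot_ge0 ?dr0.
have mv (y : nat -> Omega -> 'cV[R]_m) k j : (forall k i, (k < N)%N -> filtration_measurable P B (r k) (fun w => y k w i 0)) ->
    (k < N)%N -> (k <= j)%N -> (j <= N)%N ->
    filtration_measurable P B (r j) (fun w => if (k < N)%N then dot (y k w) (y k w) * dr k else 0).
  move=> my kN kj jN; rewrite kN.
  apply: (@filtration_measurableS _ _ _ _ _ _ (r k)); first exact: (grid_le rg).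
  by apply: measurable_funM => //; apply: measurable_dot => i; exact: my.
have mc k : (k < N)%N -> measurable_fun [set: Ft (r k)] (c k : Ft (r k) -> bool).
  move=> kN; apply: measurable_and; apply: measurable_fun_ler => //; apply: measurable_sum => i;
    have ik := ltn_ord i; apply: mv => //; [exact: leq_ltn_trans kN|exact: ltnW|exact: leq_ltn_trans kN|exact: ltnW].
have hs a b : is_simple P T B (SimpleProcess N r (h a b)).
  apply: (grid_simple rg (K := `|a| * Kq + `|b| * Kz)).
    move=> k i kN; rewrite /filtration_measurable /h.
    rewrite (_ : (fun w => _) = fun w => (if c k w then 1 else 0) * (a * q k w i 0 + b * z k w i 0)); last first.
      by apply/funext => w; rewrite !mxE; case: (c k w).
    apply: measurable_funM; first by apply: measurable_fun_ifT => //; exact: mc.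
    by apply: measurable_funD; apply: measurable_funM => //; [exact: mq|exact: mz].
  move=> k w i kN; rewrite !mxE normrM.
  have qz : `|a * q k w i 0 + b * z k w i 0| <= `|a| * Kq + `|b| * Kz.
    by rewrite (le_trans (ler_normD _ _))// !normrM lerD// ler_wpM2l//; [exact: qK|exact: zK].
  by case: (c k w); rewrite ?normr1 ?mul1r// normr0 mul0r (le_trans _ qz).
pose dBk k w := B (r k.+1) w - B (r k) w.
pose E a b w := \sum_(k < N) (dot (h a b k w) (dBk k w) - 2^-1 * dot (h a b k w) (h a b k w) * dr k).
have mE a b : measurable_fun [set: Omega] (E a b).
  have mS := measurable_grid_sum P_complete B_brownian rg (hs a b) (leqnn N).
  have mV := measurable_grid_bracket P_complete B_brownian rg (hs a b) (hs a b) (leqnn N).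
  rewrite (_ : E a b = fun w => \sum_(k < N) dot (h a b k w) (dBk k w) - 2^-1 * \sum_(k < N) dot (h a b k w) (h a b k w) * dr k).
    by apply: measurable_funB => //; apply: measurable_funM.
  by apply/funext => w; rewrite mulr_sumr -sumrB; apply: eq_bigr => k _; rewrite mulrA.
have EE a b W : filtration_measurable P B 0 W -> (forall w, 0 <= W w) ->
    (\int[P]_w (W w * expR (E a b w))%:E = \int[P]_w (W w)%:E)%E.
  by move=> mW W0; exact: (simple_expR_martingale P_complete B_brownian (hs a b) mW W0).
have E1 a b : (\int[P]_w (expR (E a b w))%:E = 1)%E.
  rewrite -[RHS](integral_probability_cst P) -(EE a b (fun=> 1) (measurable_cst _) (fun _ => ler01)).
  by apply: eq_integral => w _; rewrite mul1r.
pose xl k w := dot (q k w) (dBk k w) - 2^-1 * (dot (q k w) (q k w) * dr k).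
pose xS k w := alpha * (dot (z k w) (dBk k w) - dot (z k w) (q k w) * dr k) +
  2^-1 * (dot (q k w) (q k w) * dr k).
pose l w := \sum_(k < N) (c k w)%:R * xl k w; pose S w := \sum_(k < N) (c k w)%:R * xS k w.
have lE w : E 1 0 w = l w.
  apply: eq_bigr => k _; rewrite /h scale1r scale0r addr0 /xl !(dotZl, dotZr).
  by case: (c k w); rewrite /=; by field.
have E2 v w : E (1 + v) (- (v * alpha)) w = l w + v * (l w - S w) -
    2^-1 * v ^+ 2 * \sum_(k < N) (c k w)%:R * (dot (q k w - alpha *: z k w) (q k w - alpha *: z k w) * dr k).
  rewrite mulr_sumr -[l w - S w]sumrB mulr_sumr -big_split/= -sumrB.
  apply: eq_bigr => k _; rewrite /h /xl /xS.
  rewrite !(dotZl, dotZr, dotDl, dotDr, dotNl, dotNr) (dotC (q k w) (z k w)).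
  by case: (c k w); rewrite /=; by field.
have ml : measurable_fun [set: Omega] l by rewrite (_ : l = E 1 0)//; apply/funext => w; rewrite lE.
have mS : measurable_fun [set: Omega] S.
  have m1 := measurable_grid_sum P_complete B_brownian rg (hs 0 alpha) (leqnn N).
  have m2 := measurable_grid_bracket P_complete B_brownian rg (hs 0 alpha) (hs 1 0) (leqnn N).
  have m3 := measurable_grid_bracket P_complete B_brownian rg (hs 1 0) (hs 1 0) (leqnn N).
  have m4 : measurable_fun [set: Omega] (fun w => 2^-1 * \sum_(k < N) dot (h 1 0 k w) (h 1 0 k w) * (r k.+1 - r k)).
    exact: measurable_funM.
  have m5 := measurable_funD (measurable_funB m1 m2) m4.
  rewrite (_ : S = fun w => \sum_(k < N) dot (h 0 alpha k w) (dBk k w) -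
    \sum_(k < N) dot (h 0 alpha k w) (h 1 0 k w) * (r k.+1 - r k) +
    2^-1 * \sum_(k < N) dot (h 1 0 k w) (h 1 0 k w) * (r k.+1 - r k))//.
  apply/funext => w; rewrite -sumrB mulr_sumr -big_split/=; apply: eq_bigr => k _.
  rewrite /h /xS !scale0r !scale1r add0r addr0 !(dotZl, dotZr) -/(dr k).
  by case: (c k w); rewrite /=; by field.
have cS w k : c k.+1 w -> c k w.
  rewrite /c => /andP[h1 h2]; apply/andP; split; [apply: le_trans h1|apply: le_trans h2];
    by rewrite [leRHS]big_ord_recr/= lerDl.
have cvK w : \sum_(k < N) (c k w)%:R * vq k w <= K /\ \sum_(k < N) (c k w)%:R * vz k w <= K.
  have [n [nN cn _ cE]] := stopped_index R N (cS w).
  rewrite (cE (vq ^~ w)) (cE (vz ^~ w)); case: n nN cn {cE} => [|n] _ cn; first by rewrite !big_ord0.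
  by have /andP[] := cn n (ltnSn n).
exists l, S; split=> //.
- move=> W mW W0; rewrite -(EE 1 0 W mW W0); by under [RHS]eq_integral do rewrite lE.
- have -> : (expR K)%:E = ((expR K)%:E * \int[P]_w (expR (E 2 0 w))%:E)%E by rewrite E1 mule1.
  rewrite -ge0_integralZl ?lee_fin ?expR_ge0//; last first.
    by apply/measurable_EFinP; exact: measurableT_comp.
  apply: ge0_le_integral => //.
  + by apply/measurable_EFinP; apply: measurableT_comp => //; exact: measurable_funM.
  + by apply: emeasurable_funM => //; apply/measurable_EFinP; exact: measurableT_comp.
  + move=> w _; rewrite -EFinM lee_fin -expRD ler_expR.
    have -> : 2 * l w = E 2 0 w + \sum_(k < N) (c k w)%:R * vq k w.
      rewrite /l mulr_sumr -big_split/=; apply: eq_bigr => k _.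
      rewrite /h /xl /vq ltn_ord scale0r addr0 !(dotZl, dotZr).
      by case: (c k w); rewrite /=; by field.
    by rewrite addrC lerD2r; have [] := cvK w.
- move=> v; rewrite -(E1 (1 + v) (- (v * alpha))).
  apply: ge0_le_integral => //.
  + apply/measurable_EFinP; apply: measurableT_comp => //; apply: measurable_funB => //.
    by apply: measurable_funD => //; apply: measurable_funM => //; exact: measurable_funB.
  + by apply/measurable_EFinP; exact: measurableT_comp.
  + move=> w _; rewrite lee_fin ler_expR E2 lerD2l lerN2.
    have v2 : 0 <= 2^-1 * v ^+ 2 by rewrite mulr_ge0// sqr_ge0.
    apply: (ler_wpM2l v2); have [kq kz] := cvK w.
    apply: (@le_trans _ _ (2 * \sum_(k < N) (c k w)%:R * vq k w +
        2 * alpha ^+ 2 * \sum_(k < N) (c k w)%:R * vz k w)); last first.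
      have := ler_wpM2l (sqr_ge0 alpha) kz; lra.
    rewrite !mulr_sumr -big_split/=; apply: ler_sum => k _; rewrite /vq /vz ltn_ord.
    have := dot_ge0 (q k w + alpha *: z k w); have := dr0 k (ltn_ord k).
    rewrite !(dotZl, dotZr, dotDl, dotDr, dotNl, dotNr) (dotC (z k w) (q k w)).
    case: (c k w); rewrite /= ?mul0r ?mulr0 ?addr0// !mul1r => d0 sq0.
    have := mulr_ge0 sq0 d0; lra.
move=> w.
have [n [nN cn nc cE]] := stopped_index R N (cS w).
have IH i : (i <= N)%N -> sp_integral B H (r i) w = \sum_(k < i) dot (q k w) (dBk k w).
  by move=> iN; rewrite (grid_sp_integral w rg Hs Hr iN).
have IG i : (i <= N)%N -> sp_integral B G (r i) w = \sum_(k < i) dot (z k w) (dBk k w).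
  by move=> iN; rewrite (grid_sp_integral w rg Gs Gr iN).
have IHH := grid_integral_dot w rg Hr Hr; have IGG := grid_integral_dot w rg Gr Gr.
have IGH := grid_integral_dot w rg Hr Gr.
exists (r n); split.
- exact: (grid_itv rg).
- rewrite /l (cE (xl ^~ w)) IH// IHH// mulr_sumr -sumrB; exact: eq_bigr.
- rewrite /S (cE (xS ^~ w)) IG// IHH// IGH// -sumrB !mulr_sumr -big_split/=; exact: eq_bigr.
- rewrite -[in X in X -> _]rN -[in X in _ -> X -> _]rN IHH// IGG// => hK zK'.
  move: nN; rewrite leq_eqVlt => /orP[/eqP ->//|nN].
  suff : c n w by rewrite (negbTE (nc nN)).
  have part (y : nat -> Omega -> 'cV[R]_m) : \sum_(k < N) dot (y k w) (y k w) * dr k <= K ->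
      \sum_(i < n.+1) (if (i < N)%N then dot (y i w) (y i w) * dr i else 0) <= K.
    apply: le_trans; rewrite -(big_mkord xpredT (fun k => dot (y k w) (y k w) * dr k)).
    rewrite (big_cat_nat (leq0n _) nN)/= -[leLHS]addr0; apply: lerD.
      rewrite big_mkord; apply: ler_sum => i _; rewrite ifT//; exact: leq_trans (ltn_ord i) nN.
    rewrite big_nat; apply: sumr_ge0 => i /andP[_ iN].
    by rewrite mulr_ge0 ?dot_ge0 ?dr0.
  by apply/andP; split; [exact: part hK|exact: part zK'].
Qed.

(** With v = 1/(K + 1) one has v K = 1 - v, so the quadratic term is of order v; so is the
    exceptional mass v/2. Division by v then leaves a bound that does not depend on K. *)
Lemma entropy_constant (alpha p v C1 w1 c K I : R) : 1 < p -> 0 <= c -> 0 <= C1 -> 0 <= w1 ->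
  0 < alpha -> 0 <= K -> v = (K + 1)^-1 ->
  v * (1 - p^-1) * I <= (1 + v) * (v / 2) + v * (p^-1 * C1 + alpha * w1 + c) + 2^-1 * v ^+ 2 * K ->
  I <= (2 + p^-1 * C1 + alpha * w1 + c) / (1 - p^-1).
Proof.
move=> p1 c0 C10 w10 al0 K0 vE h; have p0 : 0 < p := lt_trans ltr01 p1.
have K1 : 0 < K + 1 by lra.
have v0 : 0 < v by rewrite vE invr_gt0.
have vK : v * K = 1 - v by rewrite vE; field; rewrite gt_eqF.
have ip : 0 < 1 - p^-1 by rewrite subr_gt0 invf_lt1.
rewrite ler_pdivlMr// mulrC -(ler_pM2l v0) mulrA; apply: le_trans h _.
rewrite (_ : 2^-1 * v ^+ 2 * K = 2^-1 * v * (1 - v)); last by rewrite -vK; ring.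
nra.
Qed.

Section finite_entropy.
Variables (q Z : R -> Omega -> 'cV[R]_m) (Mq MZ : R -> Omega -> R).
Hypothesis mq : measurable_process T q.
Hypothesis mZ : measurable_process T Z.
Hypothesis sq : square_integrable P T q.
Hypothesis sZ : square_integrable P T Z.
Hypothesis hq : is_stochastic_integral P T B q Mq.
Hypothesis hZ : is_stochastic_integral P T B Z MZ.
Variables (alpha p C1 w1 : R) (a1 W : Omega -> R).
Hypothesis alpha_gt0 : 0 < alpha.
Hypothesis p_gt1 : 1 < p.
Hypothesis ma1 : measurable_fun [set: Omega] a1.
Hypothesis mW : filtration_measurable P B 0 W.
Hypothesis W_ge0 : forall w, 0 <= W w.
Hypothesis EW : (\int[P]_w (W w)%:E <= w1%:E)%E.
Hypothesis Ea1 : (\int[P]_w (expR (p * alpha * a1 w))%:E <= C1%:E)%E.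
Hypothesis upper : {ae P, forall w, forall s, 0 <= s <= T ->
  alpha * drifted q Z MZ s w + 2^-1 * \int[leb]_(x in `[0, s]) dot (q x w) (q x w) <=
  alpha * (a1 w + W w)}.

Let ld := log_density T q Mq.
Let c := 2 * alpha + 2^-1.
Let C' := (2 + p^-1 * C1 + alpha * w1 + c) / (1 - p^-1).
Let A S := [set w : Omega | S w <= alpha * (a1 w + W w) + c].

Let mW' : measurable_fun [set: Omega] W.
Proof. by apply: (filtration_measurable_fun P_complete B_brownian (t := 0)) => //; exact: ltW. Qed.

Let mA S : measurable_fun [set: Omega] S -> measurable (A S).
Proof.
move=> mS; have m2 : measurable_fun [set: Omega] (fun w => alpha * (a1 w + W w) + c).
  by apply: measurable_funD => //; apply: measurable_funM => //; exact: measurable_funD.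
have := measurable_fun_ler mS m2; move=> /(_ measurableT [set true] I); rewrite setTI.
by congr measurable; apply/seteqP; split.
Qed.

(** A diagonal choice: for each truncation level K the approximation index [nn K] is taken so large
    that the event where the discretised upper bound fails carries little mass under the approximate
    density. Both the unit mass and the entropy bound then hold uniformly in K. *)
Let approximants : exists l S : nat -> Omega -> R, [/\
  forall K, measurable_fun [set: Omega] (l K) /\ measurable_fun [set: Omega] (S K),
  forall K, (\int[P]_w (expR (l K w))%:E = 1)%E,
  forall K, (\int[P]_w (\1_(~` (A (S K))) w * expR (l K w))%:E <= (K.+1%:R^-1)%:E)%E,
  forall K, (\int[P]_w (\1_(A (S K)) w * entropy_fun (l K w))%:E <= C'%:E)%E &
  {ae P, forall w, (l K w @[K --> \oo] --> ld w) /\ \forall K \near \oo, A (S K) w}].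
Proof.
have [H [G [Hs Gs HG]]] := stochastic_integral_approx2 T_gt0 P_complete B_brownian mq mZ sq sZ hq hZ.
have /choice[l0 /choice[S0 HlS]] := fun nK : nat * nat =>
  grid_entropy alpha (Hs nK.1) (Gs nK.1) (ler0n R nK.2).
pose K' (K : nat) : R := 2 * (1 + alpha ^+ 2) * K%:R.
have K'0 K : 0 <= K' K by rewrite /K' !mulr_ge0// addr_ge0// sqr_ge0.
pose v K := (K' K + 1)^-1.
have v0 K : 0 < v K by rewrite invr_gt0 ltr_wpDl.
have C10 : 0 <= C1.
  by rewrite -lee_fin; apply: le_trans Ea1; apply: integral_ge0 => w _; rewrite lee_fin expR_ge0.
have w10 : 0 <= w1.
  by rewrite -lee_fin; apply: le_trans EW; apply: integral_ge0 => w _; rewrite lee_fin.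
have c0 : 0 <= c by rewrite addr_ge0// mulr_ge0// ltW.
have SA w : (forall e : R, 0 < e -> \forall n \near \oo, forall s, 0 <= s <= T ->
      [/\ `|sp_integral B (H n) s w - Mq s w| <= e,
          `|sp_integral B (G n) s w - MZ s w| <= e,
          `|\int[leb]_(x in `[0, s]) dot (sp_eval (H n) x w) (sp_eval (H n) x w) -
            \int[leb]_(x in `[0, s]) dot (q x w) (q x w)| <= e,
          `|\int[leb]_(x in `[0, s]) dot (sp_eval (G n) x w) (sp_eval (G n) x w) -
            \int[leb]_(x in `[0, s]) dot (Z x w) (Z x w)| <= e &
          `|\int[leb]_(x in `[0, s]) dot (sp_eval (G n) x w) (sp_eval (H n) x w) -
            \int[leb]_(x in `[0, s]) dot (Z x w) (q x w)| <= e]) ->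
    (forall s, 0 <= s <= T ->
      alpha * drifted q Z MZ s w + 2^-1 * \int[leb]_(x in `[0, s]) dot (q x w) (q x w) <=
      alpha * (a1 w + W w)) ->
    \forall n \near \oo, forall K, A (S0 (n, K)) w.
  move=> hw up; have [N _ hN] := hw 1 ltr01; exists N => // n /= Nn K.
  have [_ _ _ _ /(_ w)[s [sT _ SE _]]] := HlS (n, K).
  have [_ b1 b2 _ b3] := hN n Nn s sT; rewrite /A/= SE.
  exact: (drift_bound alpha_gt0 b1 b2 b3 (up s sT)).
have PA K : (P (~` A (S0 (n, K))) @[n --> \oo] --> 0)%E.
  have half : 0 < (2^-1 : R) by [].
  (* An indicator exceeds 1/2 exactly on its set, so eventual membership almost surely becomes
     convergence of the probabilities through [ae_cvg_in_prob]. *)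
  have -> : (fun n => P (~` A (S0 (n, K)))) =
      (fun n => P [set w | ((2^-1 : R)%:E < (\1_(~` A (S0 (n, K))) w : R)%:E)%E]).
    apply/funext => n; congr (P _); apply/seteqP; split => w /=; rewrite lte_fin indicE.
      by move=> nA; rewrite mem_set// invf_lt1// ltr1n.
    by case: (boolP (w \in _)) => [|_]; rewrite ?inE// ltNge invr_ge0 ler0n.
  have mS n : measurable_fun [set: Omega] (S0 (n, K)) by have [[_ ?] _ _ _ _] := HlS (n, K).
  apply: (ae_cvg_in_prob (X := fun n w => (\1_(~` A (S0 (n, K))) w : R)%:E)) => //.
    move=> n e; apply: measurable_gt; apply/measurable_EFinP; apply: measurable_indic.
    by apply: measurableC; exact: mA.
  apply: filterS2 HG upper => w hw up e e0.
  have [N _ hN] := SA w hw up; exists N => // n /= Nn; rewrite indicE memNset ?lee_fin ?ltW//.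
  by move=> /=; apply; exact: hN.
have /choice[nn Hnn] : forall K, exists n, (K <= n)%N /\
    (\int[P]_w (\1_(~` A (S0 (n, K))) w * expR (l0 (n, K) w))%:E <= (v K / 2)%:E)%E.
  move=> K; pose rho := v K / 2; have rho0 : 0 < rho by rewrite divr_gt0.
  (* On the bad event x <= b + x^2 / b with x = exp(l). Since E[x^2] <= exp(K), this b makes the
     second term at most rho/2, and probability at most rho/(2 b) does the same for the first. *)
  pose b := 2 * expR K%:R / rho; have b0 : 0 < b by rewrite divr_gt0// mulr_gt0// expR_gt0.
  have rb : 0 < rho / (2 * b) by rewrite divr_gt0// mulr_gt0.
  have /fine_cvgP[[N1 _ H1] /cvgrPdist_le/(_ _ rb)[N2 _ H2]] := PA K.
  exists (maxn K (maxn N1 N2)); split; first exact: leq_maxl.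
  set n := maxn _ _.
  have n1 : (N1 <= n)%N by rewrite /n !leq_max leqnn orbT.
  have n2 : (N2 <= n)%N by rewrite /n !leq_max leqnn !orbT.
  have PAn : (P (~` A (S0 (n, K))) <= (rho / (2 * b))%:E)%E.
    rewrite -(fineK (H1 n n1)) lee_fin; have := H2 n n2.
    by rewrite /= sub0r normrN; apply: le_trans; exact: ler_norm.
  have [[ml mS] _ E2 _ _] := HlS (n, K).
  have mAc : measurable (~` A (S0 (n, K))) by apply: measurableC; exact: mA.
  have mi : measurable_fun [set: Omega] (\1_(~` A (S0 (n, K))) : Omega -> R) by exact: measurable_indic.
  apply: (@le_trans _ _ (\int[P]_w (0 + b * \1_(~` A (S0 (n, K))) w + b^-1 * expR (2 * l0 (n, K) w))%:E)%E).
    apply: ge0_le_real_integral.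
    - by apply: measurable_funM => //; exact: measurableT_comp.
    - apply: measurable_funD; first by apply: measurable_funD => //; exact: measurable_funM.
      by apply: measurable_funM => //; apply: measurableT_comp => //; exact: measurable_funM.
    - by move=> w; rewrite mulr_ge0 ?expR_ge0.
    - move=> w; rewrite add0r; set x := l0 _ _; have x0 := expR_gt0 x.
      have -> : expR (2 * x) = expR x ^+ 2 by rewrite expRM_natl.
      rewrite indicE; case: (_ \in _); rewrite /= ?mul0r ?mulr0 ?add0r ?mul1r ?mulr1.
        rewrite -(ler_pM2l b0) mulrDr mulVKf ?gt_eqF//.
        by have := sqr_ge0 (b - expR x); nra.
      by rewrite mulr_ge0 ?sqr_ge0// invr_ge0 ltW.
  rewrite ge0_integralDZ//; last 4 first.
  - by apply: measurable_funD => //; exact: measurable_funM.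
  - by apply: measurableT_comp => //; exact: measurable_funM.
  - by move=> w; rewrite add0r mulr_ge0// ltW.
  - by rewrite invr_ge0 ltW.
  rewrite ge0_integralDZ ?(ltW b0)//.
  rewrite integral0 add0e integral_indic// setIT.
  apply: (@le_trans _ _ (b%:E * (rho / (2 * b))%:E + b^-1%:E * (expR K%:R)%:E)%E).
    by apply: leeD; apply: lee_wpmul2l => //; rewrite lee_fin ?invr_ge0 ltW.
  rewrite -!EFinM -EFinD lee_fin /b -/rho le_eqVlt; apply/orP; left; apply/eqP.
  field; rewrite !gt_eqF//; exact: expR_gt0.
exists (fun K => l0 (nn K, K)), (fun K => S0 (nn K, K)).
have El K : (\int[P]_w (expR (l0 (nn K, K) w))%:E = 1)%E.
  have [_ EWl _ _ _] := HlS (nn K, K).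
  rewrite -[RHS](integral_probability_cst P) -(EWl (fun=> 1) (measurable_cst _) (fun _ => ler01)).
  by apply: eq_integral => w _; rewrite mul1r.
have vK K : v K <= K.+1%:R^-1.
  rewrite lef_pV2 ?posrE ?ltr_wpDl// -natr1 lerD2r /K'.
  by rewrite ler_peMl// ?ler0n//; have := sqr_ge0 alpha; lra.
split=> //.
- by move=> K; have [] := HlS (nn K, K).
- move=> K; apply: le_trans (Hnn K).2 _; rewrite lee_fin.
  by apply: le_trans (vK K); have := v0 K; lra.
- move=> K; have [[ml mS] EWl _ Ev _] := HlS (nn K, K).
  have EWl' : (\int[P]_w (W w * expR (l0 (nn K, K) w))%:E <= w1%:E)%E by rewrite EWl.
  have := entropy_step ml mS ma1 mW' W_ge0 alpha_gt0 p_gt1 (v0 K) (K'0 K) c0 (El K) EWl' (Ev (v K)) Ea1 (Hnn K).2.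
  have I0 : (0 <= \int[P]_w (\1_(A (S0 (nn K, K))) w * entropy_fun (l0 (nn K, K) w))%:E)%E.
    by apply: integral_ge0 => w _; rewrite lee_fin mulr_ge0// entropy_fun_ge0.
  rewrite -/(A (S0 (nn K, K))); move: I0; case: (\int[P]_w _)%E => [I| |] //=; last first.
    rewrite gt0_muley// ?leye_eq// lte_fin mulr_gt0// subr_gt0 invf_lt1//.
    exact: lt_trans ltr01 p_gt1.
  move=> _; rewrite -EFinM !lee_fin; exact: entropy_constant.
apply: filterS2 HG upper => w hw up; split; last first.
  have [N _ hN] := SA w hw up; exists N => // K /= NK; apply: hN => /=.
  exact: leq_trans NK (Hnn K).1.
apply/cvgrPdist_le => e e0.
pose e1 := Num.min (e / 2) 1; have e10 : 0 < e1 by rewrite lt_min divr_gt0/=.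
have e1e : e1 <= e / 2 by rewrite ge_min lexx.
have e11 : e1 <= 1 by rewrite ge_min lexx orbT.
have [N _ hN] := hw e1 e10.
pose Iq := \int[leb]_(x in `[0, T]) dot (q x w) (q x w).
pose IZ := \int[leb]_(x in `[0, T]) dot (Z x w) (Z x w).
(* From K0 on, K exceeds both limiting brackets by at least 1, the largest error allowed by [e1];
   the approximants are then not stopped. *)
pose K0 := (Num.truncn (Num.max Iq IZ)).+2.
exists (maxn N K0) => // K /= NK.
have nK := leq_trans (leq_trans (leq_maxl _ _) NK) (Hnn K).1.
have [_ _ _ _ /(_ w)[s [sT lE _ sE]]] := HlS (nn K, K).
have T0 : 0 <= T <= T by rewrite lexx ltW.
have [b1 _ b2 b3 _] := hN _ nK T T0.
have KK : Num.max Iq IZ + 1 <= K%:R.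
  apply: (@le_trans _ _ K0%:R); last by rewrite ler_nat (leq_trans (leq_maxr _ _) NK).
  by rewrite /K0 -[in leRHS]natr1 lerD2r ltW// Num.Theory.truncnS_gt.
have [mq' mz'] : Iq <= Num.max Iq IZ /\ IZ <= Num.max Iq IZ by rewrite !le_max !lexx orbT.
have sT' : s = T by apply: sE; [exact: (bracket_le e11 b2 mq' KK)|exact: (bracket_le e11 b3 mz' KK)].
by rewrite lE sT'; exact: (log_density_close e1e b1 b2).
Qed.

(** Fatou gives the entropy bound and mass at most 1. That no mass is lost follows from the entropy:
    at most C'/(bt - 1) of the mass of each approximant lies above the level exp(bt) on [A (S K)],
    and its complement contributes at most 1/(K+1). *)
Lemma finite_entropy_bound :
  (\int[P]_w (expR (ld w))%:E = 1)%E /\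
  (\int[P]_w (entropy_fun (ld w))%:E <= C'%:E)%E.
Proof.
have [l [S [mlS El EA EP lim]]] := approximants.
have mld : measurable_fun [set: Omega] ld.
  exact: (measurable_log_density T_gt0 P_complete B_brownian mq hq).
have mphi (f : Omega -> R) : measurable_fun [set: Omega] f -> measurable_fun [set: Omega] (fun w => entropy_fun (f w)).
  by move=> mf; apply: measurableT_comp => //; exact: measurable_entropy_fun.
have mexp (f : Omega -> R) : measurable_fun [set: Omega] f -> measurable_fun [set: Omega] (fun w => expR (f w)).
  by move=> mf; exact: measurableT_comp.
have mAS K : measurable (A (S K)) by apply: mA; have [] := mlS K.
have mi K : measurable_fun [set: Omega] (\1_(A (S K)) : Omega -> R) by exact: measurable_indic.
have mic K : measurable_fun [set: Omega] (\1_(~` A (S K)) : Omega -> R).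
  by apply: measurable_indic; exact: measurableC.
have ml K : measurable_fun [set: Omega] (l K) by have [] := mlS K.
have cvg_close (u : nat -> R) (x e : R) : (u K @[K --> \oo] --> x) -> 0 < e ->
    \forall K \near \oo, x <= u K + e.
  move=> /cvgrPdist_le h e0; have [N _ hN] := h e e0; exists N => // K NK.
  by have := hN K NK; rewrite /= ler_norml => /andP[_ ?]; lra.
have cexp (u : nat -> R) x : (u K @[K --> \oo] --> x) -> (expR (u K) @[K --> \oo] --> expR x).
  by move=> h; apply: (continuous_cvg _ _ h); exact: continuous_expR.
have cphi (u : nat -> R) x : (u K @[K --> \oo] --> x) -> (entropy_fun (u K) @[K --> \oo] --> entropy_fun x).
  move=> h; apply: cvgD; last exact: cvg_cst.
  by apply: cvgM; [exact: cexp|apply: cvgB => //; exact: cvg_cst].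
have phiC : (\int[P]_w (entropy_fun (ld w))%:E <= C'%:E)%E.
  apply: (@fatou_ae_le _ _ _ P (fun K w => \1_(A (S K)) w * entropy_fun (l K w)) (fun w => entropy_fun (ld w))).
  - by move=> K; apply: measurable_funM => //; exact: mphi.
  - exact: mphi.
  - by move=> K w; rewrite mulr_ge0// entropy_fun_ge0.
  - by move=> w; exact: entropy_fun_ge0.
  - apply: filterS lim => w [lw [N _ Aw]] e e0.
    have [N2 _ hN2] := cvg_close _ _ _ (cphi _ _ lw) e0.
    exists (maxn N N2) => // K /= NK; rewrite indicE mem_set ?mul1r; last first.
      by apply: Aw => /=; rewrite (leq_trans (leq_maxl _ _) NK).
    by apply: hN2 => /=; rewrite (leq_trans (leq_maxr _ _) NK).
  - by move=> e e0; apply: nearW => K; apply: le_trans (EP K) _; rewrite -EFinD lee_fin lerDl ltW.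
have C'0 : 0 <= C'.
  by rewrite -lee_fin; apply: le_trans phiC; apply: integral_ge0 => w _; rewrite lee_fin entropy_fun_ge0.
have E1 : (\int[P]_w (expR (ld w))%:E <= 1)%E.
  apply: (@fatou_ae_le _ _ _ P (fun K w => expR (l K w)) (fun w => expR (ld w))).
  - by move=> K; exact: mexp.
  - exact: mexp.
  - by move=> K w; exact: expR_ge0.
  - by move=> w; exact: expR_ge0.
  - apply: filterS lim => w [lw _] e e0; exact: cvg_close (cexp _ _ lw) e0.
  - by move=> e e0; apply: nearW => K; rewrite El -EFinD lee_fin lerDl ltW.
split=> //; apply/eqP; rewrite eq_le E1/=.
apply/lee_addgt0Pr => e e0.
(* Makes the escaping mass C'/(bt - 1) at most e, while keeping bt > 1 when C' is zero. *)
pose bt := 2 + C' / e; have bt1 : 1 < bt.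
  by apply: (@lt_le_trans _ _ 2); [rewrite ltr1n|rewrite lerDl divr_ge0// ltW].
have bt0 : 0 < bt - 1 by rewrite subr_gt0.
have C'e : (bt - 1)^-1 * C' <= e.
  rewrite ler_pdivrMl// /bt (_ : _ * e = e + C'); last by field; rewrite gt_eqF.
  by rewrite lerDr ltW.
(* The deficit of the truncated density is nonnegative and continuous in x, so Fatou bounds it from
   above in the limit, which is a lower bound for the mass of the limit density. *)
pose g (x : R) := expR bt - Num.min (expR x) (expR bt).
have g0 x : 0 <= g x by rewrite subr_ge0 ge_min lexx orbT.
have mg (f : Omega -> R) : measurable_fun [set: Omega] f -> measurable_fun [set: Omega] (fun w => g (f w)).
  move=> mf; apply: measurable_funB => //; apply: measurable_minr => //; exact: mexp.
have gK K : (\int[P]_w (g (l K w))%:E <= (expR bt - 1 + (bt - 1)^-1 * C' + K.+1%:R^-1)%:E)%E.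
  have b1 : 0 <= (bt - 1)^-1 by rewrite invr_ge0 ltW.
  have nA w : 0 <= \1_(A (S K)) w * entropy_fun (l K w) by rewrite mulr_ge0// entropy_fun_ge0.
  have nAc w : 0 <= \1_(~` A (S K)) w * expR (l K w) by rewrite mulr_ge0// expR_ge0.
  have mAphi : measurable_fun [set: Omega] (fun w => \1_(A (S K)) w * entropy_fun (l K w)).
    by apply: measurable_funM => //; exact: mphi.
  have mAl : measurable_fun [set: Omega] (fun w => \1_(~` A (S K)) w * expR (l K w)).
    by apply: measurable_funM => //; exact: mexp.
  have : (\int[P]_w (expR (l K w) + 1 * g (l K w))%:E <=
      \int[P]_w (expR bt + (bt - 1)^-1 * (\1_(A (S K)) w * entropy_fun (l K w)) +
        1 * (\1_(~` A (S K)) w * expR (l K w)))%:E)%E.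
    apply: ge0_le_real_integral.
    - apply: measurable_funD; first exact: mexp.
      by apply: measurable_funM => //; exact: mg.
    - apply: measurable_funD; first by apply: measurable_funD => //; exact: measurable_funM.
      exact: measurable_funM.
    - by move=> w; rewrite addr_ge0 ?expR_ge0// mulr_ge0.
    - move=> w; rewrite !mul1r !indicE in_setC; case: (w \in _) => /=; last first.
        by rewrite mul0r mulr0 addr0 mul1r addrC lerD2r /g gerBl le_min !expR_ge0.
      rewrite mul1r mul0r addr0 /g; have := entropy_fun_large (l K w) bt1; lra.
  rewrite ge0_integralDZ//; [|exact: mexp|exact: mg].
  rewrite ge0_integralDZ//; last first.
  - by move=> w; rewrite addr_ge0 ?expR_ge0// mulr_ge0.
  - by apply: measurable_funD => //; exact: measurable_funM.
  rewrite ge0_integralDZ//.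
  rewrite El !mul1e (integral_probability_cst P) => h.
  have : (1%:E + \int[P]_w (g (l K w))%:E <= 1%:E + (expR bt - 1 + (bt - 1)^-1 * C' + K.+1%:R^-1)%:E)%E.
    apply: le_trans h _.
    apply: (@le_trans _ _ ((expR bt)%:E + (bt - 1)^-1%:E * C'%:E + (K.+1%:R^-1)%:E)%E).
      by apply: leeD => //; apply: leeD => //; apply: lee_wpmul2l; rewrite ?lee_fin.
    by rewrite -EFinM -!EFinD lee_fin; rewrite le_eqVlt; apply/orP; left; apply/eqP; ring.
  by rewrite leeD2lE.
have gle : (\int[P]_w (g (ld w))%:E <= (expR bt - 1 + (bt - 1)^-1 * C')%:E)%E.
  apply: (@fatou_ae_le _ _ _ P (fun K w => g (l K w)) (fun w => g (ld w))).
  - by move=> K; exact: mg.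
  - exact: mg.
  - by [].
  - by [].
  - apply: filterS lim => w [lw _] e' e'0; have := cexp _ _ lw => /cvgrPdist_le/(_ e' e'0)[N _ hN].
    exists N => // K NK; have := hN K NK; rewrite /= ler_norml => /andP[h1 h2].
    rewrite /g; case: (leP (expR (ld w)) (expR bt)) => ?; case: (leP (expR (l K w)) (expR bt)) => ?; lra.
  - move=> e' e'0; have [N _ hN] := near_infty_natSinv_lt (PosNum e'0).
    exists N => // K NK; apply: le_trans (gK K) _; rewrite -EFinD lee_fin lerD2l.
    by apply: ltW; exact: hN.
have : (\int[P]_(w in [set: Omega]) (expR bt)%:E <= \int[P]_w (g (ld w) + 1 * expR (ld w))%:E)%E.
  apply: ge0_le_real_integral => //.
  - by apply: measurable_funD; [exact: mg|apply: measurable_funM => //; exact: mexp].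
  - by move=> w; rewrite mul1r /g addrAC -addrA lerDl subr_ge0 ge_min lexx.
rewrite ge0_integralDZ//; [|exact: mg|exact: mexp].
rewrite mul1e (integral_probability_cst P).
have I0 : (0 <= \int[P]_w (expR (ld w))%:E)%E by apply: integral_ge0 => w _; rewrite lee_fin expR_ge0.
move: I0 E1; case: (\int[P]_w (expR (ld w))%:E)%E => [I| |] // I0 I1 h.
have := le_trans h (leeD gle (lexx I%:E)); rewrite -!EFinD !lee_fin -subr_ge0 => h'.
rewrite -subr_ge0; apply: le_trans h' _; rewrite -subr_ge0; move: C'e; rewrite -subr_ge0; congr (0 <= _); ring.
Qed.

End finite_entropy.

End entropy_paths.

Local Notation edist := Defs.edist.

(** * The generator and its dual *)

Section coordinatewise_limits.
Context (R : realType).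

Definition cvg_coord n (u : nat -> 'cV[R]_n) (x : 'cV[R]_n) :=
  forall i, u k i 0 @[k --> \oo] --> x i 0.

Lemma cvg_sum_nat (I : Type) (l : seq I) (f : I -> nat -> R) (g : I -> R) :
  (forall i, f i k @[k --> \oo] --> g i) ->
  \sum_(i <- l) f i k @[k --> \oo] --> \sum_(i <- l) g i.
Proof.
move=> h; elim: l => [|i l IH].
  by rewrite big_nil; under eq_fun do rewrite big_nil; exact: cvg_cst.
by rewrite big_cons; under eq_fun do rewrite big_cons; exact: cvgD.
Qed.

Lemma cvg_coord_dot n u v (x y : 'cV[R]_n) : cvg_coord u x -> cvg_coord v y ->
  dot (u k) (v k) @[k --> \oo] --> dot x y.
Proof.
move=> ux vy; rewrite dotE; under eq_fun do rewrite dotE.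
by apply: cvg_sum_nat => i; exact: cvgM.
Qed.

Lemma cvg_coordB n u v (x y : 'cV[R]_n) : cvg_coord u x -> cvg_coord v y ->
  cvg_coord (fun k => u k - v k) (x - y).
Proof. by move=> ux vy i; rewrite !mxE; under eq_fun do rewrite !mxE; exact: cvgB. Qed.

Lemma cvg_coordDZ n u v (a : R) (x y : 'cV[R]_n) : cvg_coord u x -> cvg_coord v y ->
  cvg_coord (fun k => u k + a *: v k) (x + a *: y).
Proof.
by move=> ux vy i; rewrite !mxE; under eq_fun do rewrite !mxE; apply: cvgD => //; exact: cvgMr.
Qed.

Lemma cvg_coord_cst n (x : 'cV[R]_n) : cvg_coord (fun=> x) x.
Proof. by move=> i; exact: cvg_cst. Qed.

Lemma cvg_coord_mulmx n p (s : 'M[R]_(p, n)) u (x : 'cV[R]_n) : cvg_coord u x ->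
  cvg_coord (fun k => s *m u k) (s *m x).
Proof.
move=> ux i; rewrite !mxE; under eq_fun do rewrite !mxE.
by apply: cvg_sum_nat => j; exact: cvgMr.
Qed.

Lemma cvg_squeeze_cst (u : nat -> R) (x c : R) :
  (forall k, `|u k - x| <= c / k.+1%:R) -> u k @[k --> \oo] --> x.
Proof.
move=> h; have c0 : 0 <= c by have := le_trans (normr_ge0 _) (h 0%N); rewrite divr1.
apply/cvgrPdist_lt => e e0.
have c1 : 0 < e / (c + 1) by rewrite divr_gt0// ltr_wpDl.
have [N _ hN] := near_infty_natSinv_lt (PosNum c1).
exists N => // k Nk; rewrite distrC; apply: le_lt_trans (h k) _.
have /= := hN k Nk; rewrite ltr_pdivlMr ?ltr_wpDl// => h'.
by apply: le_lt_trans h'; rewrite mulrC ler_wpM2l ?invr_ge0// lerDl.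
Qed.

End coordinatewise_limits.

Lemma dot_addZ (R : realType) n (g w : 'cV[R]_n) (a : R) :
  dot (g + a *: w) (g + a *: w) = dot g g + 2 * a * dot g w + a ^+ 2 * dot w w.
Proof. by rewrite !(dotDl, dotDr, dotZl, dotZr) (dotC w g); ring. Qed.

Lemma dot_add (R : realType) n (g h : 'cV[R]_n) :
  dot (g + h) (g + h) = dot g g + 2 * dot g h + dot h h.
Proof. by have := dot_addZ g h 1; rewrite scale1r mulr1 expr1n mul1r. Qed.

Lemma dot_obtuse (R : realType) n (g h w : 'cV[R]_n) : dot g w <= 0 ->
  dot g g + 2 * dot g h <= dot (g + h - w) (g + h - w).
Proof.
have := dot_ge0 (h - w); rewrite -addrA (dot_add g (h - w)) (dotBr g h w); lra.
Qed.

Section projection.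
Context (R : realType) (n : nat).
Variable K : set 'cV[R]_n.
Hypothesis K0 : K 0.
Hypothesis K_convex : forall x y (a : R), K x -> K y -> 0 <= a <= 1 -> K (a *: x + (1 - a) *: y).

Lemma edist_has_inf (x : 'cV[R]_n) : has_inf [set enorm (x - y) | y in K].
Proof.
split; first by exists (enorm (x - 0)); exists 0.
by exists 0 => _ [y _ <-]; rewrite sqrtr_ge0.
Qed.

Lemma edist_ge0 (x : 'cV[R]_n) : 0 <= edist K x.
Proof.
by apply: lb_le_inf; [exact: (edist_has_inf x).1|move=> _ [y _ <-]; rewrite sqrtr_ge0].
Qed.

Lemma edist_le (x y : 'cV[R]_n) : K y -> edist K x ^+ 2 <= dot (x - y) (x - y).
Proof.
move=> Ky; rewrite -enorm_sqr ler_sqr ?nnegrE ?edist_ge0 ?sqrtr_ge0//.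
by apply: ge_inf; [exact: (edist_has_inf x).2|exists y].
Qed.

Lemma edist_ge (x : 'cV[R]_n) (c : R) : (forall y, K y -> c <= dot (x - y) (x - y)) ->
  c <= edist K x ^+ 2.
Proof.
move=> h; apply/ler_addgt0Pr => e e0; pose dl := edist K x.
have d0 : 0 <= dl := edist_ge0 x.
have [dl' dl'0 dl'E] : exists2 dl' : R, dl < dl' & dl' ^+ 2 <= dl ^+ 2 + e.
  exists (Num.sqrt (dl ^+ 2 + e)); last by rewrite sqr_sqrtr// addr_ge0 ?sqr_ge0// ltW.
  by rewrite -[ltLHS]ger0_norm// -sqrtr_sqr ltr_sqrt ?ltrDl// ltr_wpDl ?sqr_ge0.
have dd : 0 < dl' - dl by rewrite subr_gt0.
have [_ [y Ky <-] yd] := inf_adherent dd (edist_has_inf x).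
apply: le_trans (h y Ky) _; apply: le_trans dl'E; rewrite -enorm_sqr.
rewrite ler_sqr ?nnegrE ?sqrtr_ge0 ?(le_trans d0 (ltW dl'0))//.
by apply: ltW; apply: lt_le_trans yd _; rewrite -/(edist K x) -/dl addrC subrK.
Qed.

(* [g] is [x] minus its projection on the closure of [K]; the inequalities say that
   the squared distance is differentiable with gradient [2 g] at [x]. *)
Lemma edist_gradient (x : 'cV[R]_n) : exists g : 'cV[R]_n, [/\ edist K x ^+ 2 = dot g g,
  dot g g <= dot x x &
  forall h, dot g g + 2 * dot g h <= edist K (x + h) ^+ 2 <= dot g g + 2 * dot g h + dot h h].
Proof.
pose dl := edist K x; have d0 : 0 <= dl := edist_ge0 x.
(* A minimising sequence: [K] is the image of a closed set under a linear map and is not assumed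
   closed, so the distance need not be attained in it. *)
have /choice[y Hy] : forall k : nat, exists y, K y /\ dot (x - y) (x - y) <= dl ^+ 2 + k.+1%:R^-1.
  move=> k; apply: contrapT => /forallNP h.
  have : dl ^+ 2 + k.+1%:R^-1 <= dl ^+ 2.
    apply: edist_ge => y Ky; rewrite leNgt; apply/negP => /ltW ?; exact: (h y).
  by rewrite gerDl leNgt invr_gt0 ltr0n.
(* Parallelogram identity: the midpoint of two almost minimising points lies in [K] by convexity and
   cannot be closer to x than [dl]. *)
have cauchy j k : dot (y j - y k) (y j - y k) <= 2 * j.+1%:R^-1 + 2 * k.+1%:R^-1.
  have [Kj hj] := Hy j; have [Kk hk] := Hy k.
  have h2 : 0 <= (2^-1 : R) <= 1 by rewrite invr_ge0 ler0n invf_le1// ler1n.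
  have := edist_le x (K_convex Kj Kk h2); rewrite -/dl.
  rewrite (_ : 1 - 2^-1 = 2^-1 :> R); last by field.
  move: hj hk; rewrite !(dotBl, dotBr, dotDl, dotDr, dotZl, dotZr).
  rewrite (dotC (y j) x) (dotC (y k) x) (dotC (y k) (y j)).
  move: (j.+1%:R^-1) (k.+1%:R^-1) => u v; lra.
have ccvg i : cvgn (fun k => y k i 0).
  apply/cauchy_cvgP; apply: cauchy_exP => e e0.
  have e2 : 0 < e ^+ 2 / 4 by rewrite divr_gt0// exprn_gt0.
  have [N _ hN] := near_infty_natSinv_lt (PosNum e2).
  exists (y N i 0); exists N => // k /= Nk; rewrite -ball_normE/=.
  rewrite -(ltr_pXn2r (n := 2))// ?nnegrE ?(ltW e0)// real_normK ?num_real//.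
  apply: le_lt_trans (_ : _ <= dot (y N - y k) (y N - y k)) _.
    rewrite dotE (bigD1 i)//= !mxE expr2 lerDl sumr_ge0// => j _.
    by rewrite -expr2 sqr_ge0.
  apply: le_lt_trans (cauchy N k) _.
  have h1 : N.+1%:R^-1 < e ^+ 2 / 4 by exact: (hN N (leqnn _)).
  have h2 : k.+1%:R^-1 < e ^+ 2 / 4 by exact: (hN k Nk).
  by move: (N.+1%:R^-1) (k.+1%:R^-1) h1 h2 => u v; lra.
pose Pi : 'cV[R]_n := \col_i limn (fun k => y k i 0).
have yPi : cvg_coord y Pi by move=> i; rewrite mxE; exact: ccvg.
pose g := x - Pi.
have cxy h : cvg_coord (fun k => (x + h) - y k) (x + h - Pi).
  by apply: cvg_coordB => //; exact: cvg_coord_cst.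
have inv_cvg : k.+1%:R^-1 @[k --> \oo] --> (0 : R) by exact: cvg_harmonic.
have dl_cvg : dl ^+ 2 + k.+1%:R^-1 @[k --> \oo] --> dl ^+ 2.
  by rewrite -[X in _ --> X]addr0; apply: cvgD => //; exact: cvg_cst.
have gE : dl ^+ 2 = dot g g.
  have cg : cvg_coord (fun k => x - y k) g by apply: cvg_coordB => //; exact: cvg_coord_cst.
  apply/eqP; rewrite eq_le; apply/andP; split.
    apply: (ler_cvg_to (cvg_cst (dl ^+ 2)) (cvg_coord_dot cg cg)); apply: nearW => k.
    by apply: edist_le; have [] := Hy k.
  apply: (ler_cvg_to (cvg_coord_dot cg cg) dl_cvg); apply: nearW => k.
  by have [] := Hy k.
have obtuse z : K z -> dot g (z - Pi) <= 0.
  move=> Kz; have [w wE] : exists w, w = z - Pi by exists (z - Pi).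
  rewrite -wE leNgt; apply/negP => gw.
  have ww := dot_ge0 w; have w1 : 0 < dot w w + 1 by rewrite ltr_wpDl.
  (* If the angle were acute, moving from Pi towards z by this fraction would stay in the closure of
     [K] and come strictly closer: the gain 2 t g.w outweighs the loss t^2 |w|^2. *)
  pose t := Num.min 1 (dot g w / (dot w w + 1)).
  have t0 : 0 < t by rewrite lt_min ltr01 divr_gt0.
  have t1 : t <= 1 by rewrite ge_min lexx.
  have tw : t * dot w w < dot g w.
    apply: (@le_lt_trans _ _ (dot g w / (dot w w + 1) * dot w w)).
      by rewrite ler_wpM2r// ge_min lexx orbT.
    rewrite mulrAC ltr_pdivrMr// ltr_pM2l//; by rewrite ltrDl.
  have ct : cvg_coord (fun k => (x - y k) + (- t) *: (z - y k)) (g + (- t) *: w).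
    by rewrite wE; apply: cvg_coordDZ; apply: cvg_coordB => //; exact: cvg_coord_cst.
  have : dl ^+ 2 <= dot (g + (- t) *: w) (g + (- t) *: w).
    apply: (ler_cvg_to (cvg_cst (dl ^+ 2)) (cvg_coord_dot ct ct)); apply: nearW => k.
    have [Kk _] := Hy k; have t01 : 0 <= t <= 1 by rewrite (ltW t0) t1.
    have -> : (x - y k) + (- t) *: (z - y k) = x - (t *: z + (1 - t) *: y k).
      by apply/matrixP => i j; rewrite !mxE; ring.
    by apply: edist_le; exact: K_convex.
  rewrite gE dot_addZ => h1.
  have : t * (2 * dot g w) <= t * (t * dot w w) by lra.
  rewrite ler_pM2l// => h2; lra.
exists g; split=> //.
  by rewrite -gE; have := edist_le x K0; rewrite subr0.
move=> h; apply/andP; split.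
  apply: edist_ge => z Kz; have := obtuse z Kz.
  have -> : x + h - z = g + h - (z - Pi) by apply/matrixP => i j; rewrite !mxE; ring.
  exact: dot_obtuse.
have cu : cvg_coord (fun k => (x + h) - y k) (g + h).
  have -> : g + h = x + h - Pi by rewrite /g addrAC.
  exact: cxy.
rewrite -dot_add.
apply: (ler_cvg_to (cvg_cst _) (cvg_coord_dot cu cu)); apply: nearW => k.
by apply: edist_le; have [] := Hy k.
Qed.

End projection.

Section generator.
Context (R : realType) (d m : nat).
Variables (alpha : R) (C : set 'cV[R]_d).
Hypothesis alpha_gt0 : 0 < alpha.
Hypothesis C0 : C 0.
Hypothesis C_convex : forall x y (a : R), C x -> C y -> 0 <= a <= 1 -> C (a *: x + (1 - a) *: y).
Variables (s : 'M[R]_(d, m)) (b : 'cV[R]_d).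

Let K := [set s^T *m x | x in C].
Let th := risk_premium s b.
Let f := generator alpha C s b.

Let K0 : K 0. Proof. by exists 0 => //; rewrite mulmx0. Qed.

Let K_convex x y (a : R) : K x -> K y -> 0 <= a <= 1 -> K (a *: x + (1 - a) *: y).
Proof.
move=> [x' Cx <-] [y' Cy <-] a01; exists (a *: x' + (1 - a) *: y'); first exact: C_convex.
by rewrite mulmxDr !scalemxAr.
Qed.

(** The gradient is alpha g - theta, with g from [edist_gradient] at z + theta/alpha. As 0 belongs
    to the constraint set, |g| <= |z + theta/alpha|; two uses of |x + y|^2 <= 2 |x|^2 + 2 |y|^2 give
    4 alpha^2 and 4 + 2 = 6. *)
Lemma generator_gradient z : exists q : 'cV[R]_m, [/\
  forall h, f z + dot q h <= f (z + h) <= f z + dot q h + alpha / 2 * dot h h &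
  dot q q <= 4 * alpha ^+ 2 * dot z z + 6 * dot th th].
Proof.
have [g [gE gx gh]] := edist_gradient K0 K_convex (z + alpha^-1 *: th).
have fE z' : f z' = alpha / 2 * edist K (z' + alpha^-1 *: th) ^+ 2 - dot z' th - (2 * alpha)^-1 * enorm th ^+ 2 by [].
have a2 : 0 < alpha / 2 by rewrite divr_gt0.
exists (alpha *: g - th); split.
  move=> h; rewrite !fE (addrAC z h) gE dotBl dotZl dotDl (dotC th h).
  have /andP[h1 h2] := gh h; have := ler_wpM2l (ltW a2) h1; have := ler_wpM2l (ltW a2) h2.
  rewrite !mulrDr => h3 h4; apply/andP; split; lra.
have t0 := dot_ge0 (alpha *: g + th).
have x0 := dot_ge0 (z - alpha^-1 *: th).
have g2 : alpha ^+ 2 * dot g g <= alpha ^+ 2 * (2 * dot z z + 2 * (alpha^-1 ^+ 2 * dot th th)).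
  rewrite ler_wpM2l ?sqr_ge0//; apply: le_trans gx _.
  by move: x0; rewrite -scaleNr !dot_addZ sqrrN; lra.
have aa : alpha ^+ 2 * (alpha^-1 ^+ 2 * dot th th) = dot th th.
  by rewrite mulrA -exprMn mulfV ?gt_eqF// expr1n mul1r.
have : dot (alpha *: g - th) (alpha *: g - th) <= 2 * (alpha ^+ 2 * dot g g) + 2 * dot th th.
  move: t0; rewrite !(dotBl, dotBr, dotDl, dotDr, dotZl, dotZr) (dotC th g); lra.
by move=> h; apply: le_trans h _; lra.
Qed.

(** Bound the distance by the distance to 0, a point of the constraint set; the terms in theta then
    cancel exactly. *)
Lemma generator_le z : f z <= alpha / 2 * dot z z.
Proof.
have := edist_le K0 (z + alpha^-1 *: th) K0; rewrite subr0 => h.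
have a2 : 0 < alpha / 2 by rewrite divr_gt0.
have := ler_wpM2l (ltW a2) h; rewrite dot_addZ.
have -> : alpha / 2 * (dot z z + 2 * alpha^-1 * dot z th + alpha^-1 ^+ 2 * dot th th) =
   alpha / 2 * dot z z + dot z th + (2 * alpha)^-1 * dot th th.
  by field; rewrite gt_eqF.
rewrite -(enorm_sqr th) /f /generator -/th -/K; lra.
Qed.

(** Duality reverses [generator_le]: the conjugate of alpha/2 |z|^2 is |q|^2/(2 alpha), attained at
    z = q/alpha, which is the test point here. *)
Lemma convex_dual_ge q : (((2 * alpha)^-1 * dot q q)%:E <= convex_dual f q)%E.
Proof.
apply: le_trans (ereal_sup_ubound (_ : _ (dot (alpha^-1 *: q) q - f (alpha^-1 *: q))%:E)); last by exists (alpha^-1 *: q).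
rewrite lee_fin; have := generator_le (alpha^-1 *: q); rewrite !dotZl dotZr.
have -> : alpha / 2 * (alpha^-1 * (alpha^-1 * dot q q)) = alpha^-1 * dot q q - (2 * alpha)^-1 * dot q q.
  by field; rewrite gt_eqF.
lra.
Qed.

Lemma convex_dual_ge0 q : (0 <= convex_dual f q)%E.
Proof.
apply: le_trans (convex_dual_ge q); rewrite lee_fin mulr_ge0 ?dot_ge0//.
by rewrite invr_ge0 mulr_ge0// ltW.
Qed.

Lemma convex_dual_subgradient z q : (forall h, f z + dot q h <= f (z + h)) ->
  convex_dual f q = (dot z q - f z)%:E.
Proof.
move=> h; apply/eqP; rewrite eq_le; apply/andP; split; last by apply: ereal_sup_ubound; exists z.
apply: ge_ereal_sup => _ [z' _ <-]; rewrite lee_fin.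
have := h (z' - z); rewrite dotBr (_ : z + (z' - z) = z') ?(dotC q z') ?(dotC q z); first lra.
by rewrite addrC subrK.
Qed.

Lemma fenchel_young z q : ((dot z q - f z)%:E <= convex_dual f q)%E.
Proof. by apply: ereal_sup_ubound; exists z. Qed.

(** A dense sequence suffices because the quadratic upper bound of [generator_gradient] makes f
    upper semicontinuous. The dual thus becomes a countable supremum, hence measurable. *)
Lemma convex_dual_dense (r : nat -> 'cV[R]_m) q :
  (forall z, exists phi : nat -> nat, cvg_coord (r \o phi) z) ->
  convex_dual f q = ereal_sup (range (fun k => (dot (r k) q - f (r k))%:E)).
Proof.
move=> dense; apply/eqP; rewrite eq_le; apply/andP; split; last first.
  by apply: ge_ereal_sup => _ [k _ <-]; exact: fenchel_young.
apply: ge_ereal_sup => _ [z _ <-].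
have [phi cphi] := dense z; have [g [gz _]] := generator_gradient z.
set S := ereal_sup _.
have rS k : ((dot (r (phi k)) q - (f z + dot g (r (phi k) - z) +
    alpha / 2 * dot (r (phi k) - z) (r (phi k) - z)))%:E <= S)%E.
  apply: le_trans (_ : _ <= (dot (r (phi k)) q - f (r (phi k)))%:E)%E _; last first.
    by apply: ereal_sup_ubound; exists (phi k).
  rewrite lee_fin lerD2l lerN2; have /andP[_] := gz (r (phi k) - z).
  by rewrite addrC subrK.
have cB : cvg_coord (fun k => r (phi k) - z) 0.
  by rewrite -(subrr z); apply: cvg_coordB => //; exact: cvg_coord_cst.
have cv : (dot (r (phi k)) q - (f z + dot g (r (phi k) - z) +
    alpha / 2 * dot (r (phi k) - z) (r (phi k) - z))) @[k --> \oo] --> dot z q - f z.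
  rewrite -[in X in _ --> X](addr0 (f z)) -[in X in _ --> X](addr0 (f z + 0)).
  apply: cvgB; first by apply: cvg_coord_dot => //; exact: cvg_coord_cst.
  apply: cvgD; first apply: cvgD; first exact: cvg_cst.
    by rewrite -(dot0r g); apply: cvg_coord_dot => //; exact: cvg_coord_cst.
  rewrite -(mulr0 (alpha / 2)) -(dot0r (0 : 'cV[R]_m)); apply: cvgM; first exact: cvg_cst.
  exact: cvg_coord_dot.
apply/lee_addgt0Pr => e e0; have /cvgrPdist_le/(_ e e0)[N _ hN] := cv.
apply: le_trans (leeD (rS N) (lexx e%:E)); rewrite -EFinD lee_fin.
by have := hN N (leqnn _); rewrite /= ler_norml => /andP[_]; lra.
Qed.

End generator.

(** * Measurability of the distance, the generator, its dual and its gradient *)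

Section countable_dense.
Context (R : realType) (n : nat).

Let rat_col (k : nat) : 'cV[R]_n := map_mx ratr (odflt (0 : 'cV[rat]_n) (unpickle k)).

Lemma rat_col_close (x : 'cV[R]_n) (e : R) : 0 < e -> exists k, forall i, `|rat_col k i 0 - x i 0| <= e.
Proof.
move=> e0; have /choice[q hq] : forall i : 'I_n, exists q : rat, `|ratr q - x i 0| <= e.
  move=> i; have /rat_in_itvoo[q] : x i 0 - e < x i 0 + e by lra.
  by rewrite in_itv/= => /andP[? ?]; exists q; rewrite ler_norml; apply/andP; split; lra.
exists (pickle (\col_i q i : 'cV[rat]_n)) => i.
by rewrite /rat_col pickleK/= !mxE.
Qed.

(** [C] may contain few rational points, so the sequence is indexed by pairs of a rational column
    and a precision: it picks a point of [C] within that precision if there is one, and 0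
    otherwise. *)
Lemma dense_sequence (C : set 'cV[R]_n) : C 0 -> exists r : nat -> 'cV[R]_n,
  (forall k, C (r k)) /\
  forall x, C x -> exists phi : nat -> nat, cvg_coord (r \o phi) x.
Proof.
move=> C0.
have /choice[c hc] : forall kj : nat * nat, exists y, C y /\
    ((exists2 y', C y' & forall i, `|rat_col kj.1 i 0 - y' i 0| <= kj.2.+1%:R^-1) ->
     forall i, `|rat_col kj.1 i 0 - y i 0| <= kj.2.+1%:R^-1).
  move=> kj; case: (pselect (exists2 y', C y' & forall i, `|rat_col kj.1 i 0 - y' i 0| <= kj.2.+1%:R^-1)).
    by move=> [y' Cy' h]; exists y'.
  by move=> h; exists 0; split.
exists (fun k => c (odflt (0%N, 0%N) (unpickle k))); split=> [k|x Cx]; first by have [] := hc (odflt (0%N, 0%N) (unpickle k)).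
have /choice[psi hpsi] : forall j : nat, exists k, forall i, `|rat_col k i 0 - x i 0| <= j.+1%:R^-1.
  by move=> j; apply: rat_col_close; rewrite invr_gt0.
exists (fun j => pickle (psi j, j)) => i; apply: (@cvg_squeeze_cst _ _ _ 2) => j /=.
rewrite pickleK/=; have [_ h] := hc (psi j, j).
have h1 := h (ex_intro2 _ _ x Cx (hpsi j)) i; have h2 := hpsi j i.
rewrite /= in h1; move: h1 h2; rewrite -[2]/(1 + 1) mulrDl !mul1r; move: (j.+1%:R^-1) => u.
by rewrite !ler_norml => /andP[? ?] /andP[? ?]; apply/andP; split; lra.
Qed.

End countable_dense.

Section measurability.
Context (R : realType) d' (S : measurableType d') (D : set S).

(** Written as f (f^2)^(-1), inversion reduces to the real power of a nonnegative base, and the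
    convention that 0 has inverse 0 is respected. *)
Lemma measurable_fun_inv (f : S -> R) : measurable_fun D f -> measurable_fun D (fun x => (f x)^-1).
Proof.
move=> mf; rewrite (_ : (fun x => _) = fun x => f x * (f x ^+ 2) `^ (-1)); last first.
  apply/funext => x; rewrite powR_inv1 ?sqr_ge0//.
  have [->|fx] := eqVneq (f x) 0; first by rewrite invr0 mul0r.
  by rewrite expr2 invfM mulrA mulfV// mul1r.
apply: measurable_funM => //.
apply: (measurableT_comp (measurable_powR (-1))); exact: measurable_funX.
Qed.

Definition measurable_entries {a b} (A : S -> 'M[R]_(a, b)) :=
  forall i j, measurable_fun D (fun x => A x i j).

Lemma measurable_mulmx a b c (A : S -> 'M[R]_(a, b)) (B : S -> 'M[R]_(b, c)) :
  measurable_entries A -> measurable_entries B -> measurable_entries (fun x => A x *m B x).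
Proof.
move=> mA mB i j; rewrite (_ : (fun x => _) = fun x => \sum_k A x i k * B x k j); last first.
  by apply/funext => x; rewrite mxE.
by apply: measurable_sum => k; exact: measurable_funM.
Qed.

Lemma measurable_trmx a b (A : S -> 'M[R]_(a, b)) : measurable_entries A ->
  measurable_entries (fun x => (A x)^T).
Proof. by move=> mA i j; under eq_fun do rewrite mxE; exact: mA. Qed.

Lemma measurable_prod_seq (I : Type) (l : seq I) (f : I -> S -> R) :
  (forall i, measurable_fun D (f i)) -> measurable_fun D (fun x => \prod_(i <- l) f i x).
Proof.
move=> mf; elim: l => [|i l IH].
  by under eq_fun do rewrite big_nil; exact: measurable_cst.
by under eq_fun do rewrite big_cons; exact: measurable_funM.
Qed.

Lemma measurable_det a (A : S -> 'M[R]_a) : measurable_entries A ->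
  measurable_fun D (fun x => \det (A x)).
Proof.
move=> mA; rewrite /determinant; apply: measurable_sum => s; apply: measurable_funM => //.
exact: measurable_prod_seq.
Qed.

Lemma measurable_invmx a (A : S -> 'M[R]_a) : (forall x, D x -> A x \in unitmx) ->
  measurable_entries A -> measurable_entries (fun x => invmx (A x)).
Proof.
move=> uA mA i j.
apply: (eq_measurable_fun (fun x => (\det (A x))^-1 * cofactor (A x) j i)).
  by move=> x; rewrite inE => Dx; rewrite /invmx uA// !mxE.
apply: measurable_funM; first by apply: measurable_fun_inv; exact: measurable_det.
apply: measurable_funM => //; apply: measurable_det => k l.
by under eq_fun do rewrite !mxE; exact: mA.
Qed.

Lemma measurable_risk_premium d m (s : S -> 'M[R]_(d, m)) (b : S -> 'cV[R]_d) :
  (forall x, D x -> s x *m (s x)^T \in unitmx) ->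
  measurable_entries s -> measurable_entries b ->
  measurable_entries (fun x => risk_premium (s x) (b x)).
Proof.
move=> us ms mb; apply: measurable_mulmx => //; apply: measurable_mulmx; first exact: measurable_trmx.
by apply: measurable_invmx => //; apply: measurable_mulmx => //; exact: measurable_trmx.
Qed.

Lemma measurable_enorm m (p : S -> 'cV[R]_m) : measurable_entries p ->
  measurable_fun D (fun x => enorm (p x)).
Proof.
move=> mp; rewrite (_ : (fun x => _) = fun x => (dot (p x) (p x)) `^ (2^-1)); last first.
  by apply/funext => x; rewrite powR12_sqrt ?dot_ge0.
by apply: (measurableT_comp (measurable_powR _)); exact: measurable_dot.
Qed.

(** One sequence dense in [C] works for every x, since its image under the linear map of x is dense
    in the constraint set of x; the distance is then a countable infimum. *)
Lemma measurable_edist d m (C : set 'cV[R]_d) (s : S -> 'M[R]_(d, m)) (p : S -> 'cV[R]_m) : C 0 ->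
  measurable_entries s -> measurable_entries p ->
  measurable_fun D (fun x => edist [set (s x)^T *m y | y in C] (p x)).
Proof.
move=> C0 ms mp; have [r [Cr dense]] := dense_sequence C0.
pose h k x := enorm (p x - (s x)^T *m r k).
have hl x : has_lbound (range (h ^~ x)) by exists 0 => _ [k _ <-]; rewrite sqrtr_ge0.
have mh k : measurable_fun D (h k).
  apply: measurable_enorm => i j; rewrite (_ : (fun x => _) = fun x => p x i j - ((s x)^T *m r k) i j); last first.
    by apply/funext => x; rewrite !mxE.
  apply: measurable_funB => //; apply: (measurable_mulmx (A := fun x => (s x)^T) (B := fun=> r k)).
    exact: measurable_trmx.
  by move=> ? ?; exact: measurable_cst.
have := measurable_fun_infs 0 (fun x _ => hl x) mh.
rewrite (_ : (fun x => infs _ _) = fun x => edist [set (s x)^T *m y | y in C] (p x))//.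
apply/funext => x; rewrite /infs /edist /=.
have -> : sdrop (h ^~ x) 0 = range (h ^~ x).
  by apply/seteqP; split => _ [k _ <-]; exists k.
apply/eqP; rewrite eq_le; apply/andP; split; last first.
  apply: lb_le_inf; first by exists (h 0%N x); exists 0%N.
  move=> _ [k _ <-]; apply: ge_inf; first by exists 0 => _ [y _ <-]; rewrite sqrtr_ge0.
  by exists ((s x)^T *m r k) => //; exists (r k).
apply: lb_le_inf; first by exists (enorm (p x - 0)); exists 0 => //; exists 0 => //; rewrite mulmx0.
move=> _ [_ [y Cy <-] <-]; have [phi cphi] := dense y Cy.
set I := inf _; have I0 : 0 <= I.
  apply: lb_le_inf; first by exists (h 0%N x); exists 0%N.
  by move=> _ [k _ <-]; rewrite sqrtr_ge0.
rewrite -(ler_sqr (x := I)) ?nnegrE ?sqrtr_ge0// enorm_sqr.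
have cu : cvg_coord (fun k => p x - (s x)^T *m r (phi k)) (p x - (s x)^T *m y).
  by apply: cvg_coordB; [exact: cvg_coord_cst|exact: cvg_coord_mulmx].
apply: (ler_cvg_to (cvg_cst (I ^+ 2)) (cvg_coord_dot cu cu)); apply: nearW => k.
rewrite -enorm_sqr ler_sqr ?nnegrE ?sqrtr_ge0//; apply: ge_inf => //.
Qed.

Lemma measurable_generator d m (alpha : R) (C : set 'cV[R]_d) (s : S -> 'M[R]_(d, m))
    (b : S -> 'cV[R]_d) (z : S -> 'cV[R]_m) : C 0 ->
  (forall x, D x -> s x *m (s x)^T \in unitmx) ->
  measurable_entries s -> measurable_entries b -> measurable_entries z ->
  measurable_fun D (fun x => generator alpha C (s x) (b x) (z x)).
Proof.
move=> C0 us ms mb mz; have mth := measurable_risk_premium us ms mb; rewrite /generator.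
apply: measurable_funB.
  apply: measurable_funB; last by apply: measurable_dot => i; [exact: mz|exact: mth].
  apply: measurable_funM => //; apply: measurable_funX; apply: measurable_edist => // i j.
  rewrite (_ : (fun x => _) = fun x => z x i j + alpha^-1 * risk_premium (s x) (b x) i j); last first.
    by apply/funext => x; rewrite !mxE.
  by apply: measurable_funD; [exact: mz|apply: measurable_funM => //; exact: mth].
by apply: measurable_funM => //; apply: measurable_funX; exact: measurable_enorm.
Qed.

Lemma measurable_convex_dual d m (alpha : R) (C : set 'cV[R]_d) (s : S -> 'M[R]_(d, m))
    (b : S -> 'cV[R]_d) (q : S -> 'cV[R]_m) : 0 < alpha -> C 0 ->
  (forall x y (a : R), C x -> C y -> 0 <= a <= 1 -> C (a *: x + (1 - a) *: y)) ->
  (forall x, D x -> s x *m (s x)^T \in unitmx) ->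
  measurable_entries s -> measurable_entries b -> measurable_entries q ->
  measurable_fun D (fun x => convex_dual (generator alpha C (s x) (b x)) (q x)).
Proof.
move=> al0 C0 Cc us ms mb mq.
have [r [_ dense]] := @dense_sequence R m setT I.
pose h k x : \bar R := (dot (r k) (q x) - generator alpha C (s x) (b x) (r k))%:E.
have mh k : measurable_fun D (h k).
  apply/measurable_EFinP; apply: measurable_funB.
    by apply: measurable_dot => i //; exact: mq.
  by apply: measurable_generator => // i j; exact: measurable_cst.
have := measurable_fun_esups mh 0.
rewrite (_ : (fun x => esups _ _) = fun x => convex_dual (generator alpha C (s x) (b x)) (q x))//.
apply/funext => x; rewrite (convex_dual_dense al0 C0 Cc (s x) (b x) (q x) (r := r)).
  rewrite /esups/=; congr ereal_sup.
  by apply/seteqP; split => _ [k _ <-]; exists k.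
by move=> z; exact: dense.
Qed.

(** The two-sided quadratic bound determines q as the limit of difference quotients, with error at
    most alpha/2 times the step. A gradient chosen pointwise is therefore automatically measurable,
    without a selection theorem. *)
Lemma measurable_gradient d m (alpha : R) (C : set 'cV[R]_d) (s : S -> 'M[R]_(d, m))
    (b : S -> 'cV[R]_d) (z q : S -> 'cV[R]_m) : 0 < alpha -> C 0 ->
  (forall x, D x -> s x *m (s x)^T \in unitmx) ->
  measurable_entries s -> measurable_entries b -> measurable_entries z ->
  (forall x h, let f := generator alpha C (s x) (b x) in
    f (z x) + dot (q x) h <= f (z x + h) <= f (z x) + dot (q x) h + alpha / 2 * dot h h) ->
  measurable_entries q.
Proof.
move=> al0 C0 us ms mb mz grad i j; rewrite (ord1 j).
pose e k : 'cV[R]_m := k.+1%:R^-1 *: delta_mx i 0.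
pose u k x := k.+1%:R * (generator alpha C (s x) (b x) (z x + e k) - generator alpha C (s x) (b x) (z x)).
have mu k : measurable_fun D (u k).
  apply: measurable_funM => //; apply: measurable_funB; last exact: measurable_generator.
  apply: measurable_generator => // i' j'.
  rewrite (_ : (fun x => _) = fun x => z x i' j' + e k i' j'); last by apply/funext => x; rewrite mxE.
  by apply: measurable_funD => //; exact: mz.
apply: (measurable_fun_cvg mu) => x _.
apply: (@cvg_squeeze_cst _ _ _ (alpha / 2)) => k.
have k0 : 0 < (k.+1%:R : R) by rewrite ltr0n.
have de : dot (q x) (e k) = k.+1%:R^-1 * q x i 0.
  rewrite dotZr dotE (bigD1 i)//= big1 ?addr0 => [|l /negbTE li]; last by rewrite !mxE li/= mulr0.
  by rewrite !mxE !eqxx/= mulr1.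
have := grad x (e k); rewrite /= dot_delta de => /andP[h1 h2].
have l1 : 0 <= u k x - q x i 0.
  rewrite subr_ge0 -(ler_pM2l (_ : 0 < k.+1%:R^-1)) ?invr_gt0// /u mulKf ?gt_eqF// lerBrDl//.
rewrite ger0_norm// -(ler_pM2l (_ : 0 < k.+1%:R^-1)) ?invr_gt0// mulrBr /u mulKf ?gt_eqF//.
move: h2; rewrite expr2; move: (k.+1%:R^-1) => v; lra.
Qed.

End measurability.

(** * Change of measure *)

Section density.
Context d (Omega : measurableType d) (R : realType) (P : probability Omega R) (L : Omega -> R).
Local Open Scope ereal_scope.

(* The two proof arguments only make the measure structure inferable. *)
Definition density (mL : measurable_fun [set: Omega] L) (L_ge0 : forall w, (0 <= L w)%R)
  (A : set Omega) : \bar R := \int[P]_(w in A) (L w)%:E.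

Lemma ae_eq0 (g : Omega -> R) : measurable_fun [set: Omega] g -> (forall w, (0 <= g w)%R) ->
  \int[P]_w (g w)%:E <= 0 -> {ae P, forall w, g w = 0%R}.
Proof.
move=> mg g0 Ig.
have mEg : measurable_fun [set: Omega] (fun w => (g w)%:E) by exact/measurable_EFinP.
have /ae_foralln : forall n, {ae P, forall w, (g w <= n.+1%:R^-1)%R}.
  move=> n; exists [set w | (n.+1%:R^-1)%:E < (g w)%:E]; split.
  - exact: measurable_gt.
  - have n0 : (0 < n.+1%:R^-1 :> R)%R by rewrite invr_gt0.
    have := markov_ge0 P mEg (fun w => g0 w : 0 <= (g w)%:E) n0.
    move=> /le_trans/(_ Ig); rewrite pmule_rle0 ?lte_fin// => h.
    by apply/eqP; rewrite eq_le h measure_ge0.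
  - by move=> w /= /negP; rewrite -ltNge lte_fin.
apply: filterS => w h; apply/eqP; rewrite eq_le g0 andbT.
apply/ler_addgt0Pr => e e0; have [N _ hN] := near_infty_natSinv_lt (PosNum e0).
by rewrite add0r; apply: le_trans (h N) _; apply: ltW; exact: (hN N (leqnn N)).
Qed.

Section measure.
Hypothesis mL : measurable_fun [set: Omega] L.
Hypothesis L_ge0 : forall w, (0 <= L w)%R.

Local Notation Q := (density mL L_ge0).

Let density0 : Q set0 = 0.
Proof. by rewrite /density integral_set0. Qed.

Let density_ge0 A : 0 <= Q A.
Proof. by apply: integral_ge0 => w _; rewrite lee_fin. Qed.

Let density_sigma_additive : semi_sigma_additive Q.
Proof.
move=> /= A mA tA mUA; rewrite /density ge0_integral_bigcup//=; last 2 first.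
- by apply: measurable_funTS; exact/measurable_EFinP.
- by move=> w _; rewrite lee_fin.
apply: is_cvg_ereal_nneg_natsum_cond => n _ _.
by apply: integral_ge0 => w _; rewrite lee_fin.
Qed.

HB.instance Definition _ := isMeasure.Build _ _ _ Q
  density0 density_ge0 density_sigma_additive.

Lemma integral_density (g : Omega -> \bar R) : measurable_fun [set: Omega] g ->
  (forall w, 0 <= g w) -> \int[Q]_w g w = \int[P]_w ((L w)%:E * g w).
Proof.
move=> mg g0; transitivity (\int[Q]_w ((1 : R)%:E * g w)).
  by apply: eq_integral => w _; rewrite mul1e.
apply/esym; apply: (ge0_integral_transfer (X1 := id) (X2 := id)) => // U mU.
have -> : \int[Q]_w ((1 : R)%:E * (\1_U (id w))%:E) = Q U.
  under eq_integral do rewrite mul1e.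
  by rewrite integral_indic// setIT.
rewrite /density [RHS]integral_mkcond; apply: eq_integral => w _.
by rewrite patchE /= indicE; case: (w \in U); rewrite ?mule1 ?mule0.
Qed.

Lemma integral_density_set (A : set Omega) (g : Omega -> R) : measurable A ->
  measurable_fun [set: Omega] g -> (forall w, (0 <= g w)%R) ->
  \int[Q]_(w in A) (g w)%:E = \int[P]_w (L w * \1_A w * g w)%:E.
Proof.
move=> mA mg g0; rewrite integral_mkcond integral_density.
- apply: eq_integral => w _; rewrite patchE indicE.
  case: (w \in A); first by rewrite mulr1 EFinM.
  by transitivity ((L w)%:E * 0); rewrite // mule0 mulr0 mul0r.
- by apply/(measurable_restrictT _ mA); apply: measurable_funTS; exact/measurable_EFinP.
- by move=> w; rewrite patchE; case: ifP => _ //; rewrite lee_fin.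
Qed.

Lemma density_ae (X : Omega -> Prop) : {ae P, forall w, X w} -> {ae Q, forall w, X w}.
Proof.
move=> [N [mN N0 XN]]; exists N; split=> //.
by rewrite /density null_set_integral//; apply: measurable_funTS; exact/measurable_EFinP.
Qed.

(** A strictly positive density has the same null sets as [P]; finiteness and comparisons obtained
    under the new measure can thus be read under [P]. *)
Lemma density_ae_inv (X : Omega -> Prop) : (forall w, (0 < L w)%R) ->
  {ae Q, forall w, X w} -> {ae P, forall w, X w}.
Proof.
move=> L0 [N [mN N0 XN]].
have : {ae P, forall w, (L w * \1_N w)%R = 0%R}.
  apply: ae_eq0.
  - by apply: measurable_funM => //; exact: measurable_indic.
  - by move=> w; rewrite mulr_ge0.
  - have <- : Q N = \int[P]_w (L w * \1_N w)%:E; last by rewrite N0.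
    rewrite /density integral_mkcond; apply: eq_integral => w _.
    by rewrite patchE indicE; case: (w \in N); rewrite ?mulr1 ?mulr0.
apply: filterS => w /eqP; rewrite mulf_eq0 gt_eqF//= indicE.
case: (boolP (w \in N)) => [_|wN _]; first by rewrite oner_eq0.
by apply: contrapT => nX; move: wN; rewrite notin_setE; apply; exact: XN.
Qed.

End measure.
End density.

Section path_integrals.
Context d (Omega : measurableType d) (R : realType) (P : probability Omega R) (T : R).

Lemma measurable_path_integral (a b : R) (f : R -> Omega -> R) : 0 <= a -> b <= T ->
  measurable_fun (strip T) (fun x => f x.1 x.2) ->
  measurable_fun [set: Omega] (fun w => \int[lebesgue_measure]_(s in `[a, b]) f s w).
Proof.
move=> a0 bT mf; rewrite /Rintegral; apply: (@measurableT_comp _ _ _ _ _ _ fine) => //.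
under eq_fun do rewrite integralE.
have mE : measurable_fun (strip T) (fun x => (f x.1 x.2)%:E) by exact/measurable_EFinP.
have mP : measurable_fun (strip T) (fun x : R * Omega => maxe (f x.1 x.2)%:E 0%E).
  exact: measurable_maxe.
have mN : measurable_fun (strip T) (fun x : R * Omega => maxe (- (f x.1 x.2)%:E)%E 0%E).
  by apply: measurable_maxe => //; exact: measurableT_comp.
have iP := measurable_subinterval_integral (f := fun s w => maxe (f s w)%:E 0%E) a0 bT mP.
have iN := measurable_subinterval_integral (f := fun s w => maxe (- (f s w)%:E)%E 0%E) a0 bT mN.
have mI1 := iP (fun s w _ => _ : (0 <= maxe (f s w)%:E 0)%E).
have mI2 := iN (fun s w _ => _ : (0 <= maxe (- (f s w)%:E) 0)%E).
have := emeasurable_funB (mI1 _) (mI2 _) => h.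
have mI : measurable_fun [set: Omega] (fun w => (\int[lebesgue_measure]_(s in `[a, b]) maxe (f s w)%:E 0 -
  \int[lebesgue_measure]_(s in `[a, b]) maxe (- (f s w)%:E) 0)%E).
  by apply: h => s w; rewrite le_max lexx orbT.
congr (measurable_fun _ _) : mI; apply/funext => w.
by congr (_ - _)%E; apply: eq_integral => s _; rewrite ?funeposE ?funenegE.
Qed.

Lemma Rintegral_sub (f : R -> R) (t u : R) :
  lebesgue_measure.-integrable `[0, T] (EFin \o f) -> 0 <= t -> t <= u -> u <= T ->
  \int[lebesgue_measure]_(s in `[0, u]) f s - \int[lebesgue_measure]_(s in `[0, t]) f s =
  \int[lebesgue_measure]_(s in `[t, u]) f s.
Proof.
move=> fi t0 tu uT.
have fu : lebesgue_measure.-integrable `[0, u] (EFin \o f).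
  by apply: integrableS fi => //; exact: sub_itv0.
rewrite (Rintegral_itvB fu)//.
rewrite Rintegral_itv_obnd_cbnd//; apply: integrableS fu => //.
by move=> s /=; rewrite !in_itv/= => /andP[ts ->]; rewrite andbT (le_trans t0)// ltW.
Qed.

End path_integrals.

Section integral_versions.
Context d (Omega : measurableType d) (R : realType) (P : probability Omega R)
  (T : R) (m : nat) (B : R -> Omega -> 'cV[R]_m).
Hypothesis T_gt0 : 0 < T.
Hypothesis P_complete : measure_is_complete P.
Hypothesis B_brownian : is_brownian_motion P T B.

Local Notation leb := (@lebesgue_measure R).

(** Lets the supermartingale inequality be applied to -X as well, which for the optimal q turns it
    into equality. *)
Lemma is_stochastic_integral_opp (Z : R -> Omega -> 'cV[R]_m) M :
  is_stochastic_integral P T B Z M ->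
  is_stochastic_integral P T B (fun t w => - Z t w) (fun t w => - M t w).
Proof.
move=> [mM cM [H [Hs c1 c2]]].
have /choice[D HD] := fun n => simple_linear T_gt0 (-1) (is_simple0 P B T_gt0) (Hs n).
have e0 s w : sp_eval (SimpleProcess 0 (fun=> 0) (fun _ _ => 0) : simple_process Omega R m) s w = 0.
  by rewrite /sp_eval big_ord0.
have i0 s w : sp_integral B (SimpleProcess 0 (fun=> 0) (fun _ _ => 0) : simple_process Omega R m) s w = 0.
  by rewrite /sp_integral big_ord0.
have eD n s w : sp_eval (D n) s w = - sp_eval (H n) s w.
  by have [_ -> _] := HD n; rewrite e0 add0r scaleN1r.
have iD n s w : sp_integral B (D n) s w = - sp_integral B (H n) s w.
  by have [_ _ ->] := HD n; rewrite i0 add0r mulN1r.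
split=> [t tT||].
- by have := mM t tT; exact: measurableT_comp.
- apply: filterS cM => w /cont_onP cMw; apply/cont_onP.
  rewrite (_ : (fun t => _) = fun t => -1 * M t w); first exact: cont_onZ.
  by apply/funext => t; rewrite mulN1r.
exists D; split=> [n||]; first by have [] := HD n.
- congr (cvg_in_prob P _) : c1; apply/funext => n; apply/funext => w.
  by apply: eq_integral => s _; rewrite !enorm_sqr eD -opprD dotNl dotNr opprK.
- congr (cvg_in_prob P _) : c2; apply/funext => n; apply/funext => w; congr ereal_sup.
  by apply/seteqP; split => _ [t tT <-]; exists t => //; rewrite iD -opprD normrN.
Qed.

Lemma stochastic_integralP (q : R -> Omega -> 'cV[R]_m) :
  (exists M, is_stochastic_integral P T B q M) ->
  is_stochastic_integral P T B q (stochastic_integral P T B q).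
Proof. exact: xgetPex. Qed.

Lemma stochastic_exponentialE (q : R -> Omega -> 'cV[R]_m) w :
  stochastic_exponential P T B q T w = expR (log_density T q (stochastic_integral P T B q) w).
Proof.
rewrite /stochastic_exponential /log_density; congr (expR (_ - _ * _)).
by apply: eq_Rintegral => s _; rewrite enorm_sqr.
Qed.

(* Without a stochastic integral the default value [0] would give a density
   [expR (- 1/2 int |q|^2)], which has mass one only if [q = 0]. *)
Lemma density_stochastic_integral (q : R -> Omega -> 'cV[R]_m) : measurable_process T q ->
  square_integrable P T q -> density_measure P T B q [set: Omega] = 1%E ->
  is_stochastic_integral P T B q (stochastic_integral P T B q).
Proof.
move=> mq sq; rewrite /density_measure => EL.
case: (pselect (exists M, is_stochastic_integral P T B q M)) => [|nex]; first exact: stochastic_integralP.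
have SI0 : stochastic_integral P T B q = fun _ _ => 0.
  by apply: xgetPN => M hM; apply: nex; exists M.
pose N w := \int[leb]_(x in `[0, T]) dot (q x w) (q x w).
have N0 w : 0 <= N w by exact: l2norm_ge0.
have mN : measurable_fun [set: Omega] N by exact: measurable_Rintegral_sq.
have LE w : stochastic_exponential P T B q T w = expR (- (2^-1 * N w)).
  by rewrite stochastic_exponentialE /log_density SI0 sub0r.
pose g w := 1 - expR (- (2^-1 * N w)).
have g0 w : 0 <= g w by rewrite subr_ge0 -expR0 ler_expR oppr_le0 mulr_ge0.
have mexp : measurable_fun [set: Omega] (fun w => expR (- (2^-1 * N w))).
  by apply: measurableT_comp => //; apply: measurableT_comp => //; exact: measurable_funM.
have mg : measurable_fun [set: Omega] g by exact: measurable_funB.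
have : (\int[P]_w (expR (- (2^-1 * N w)) + 1 * g w)%:E = 1)%E.
  rewrite -[RHS](integral_probability_cst P); apply: eq_integral => w _.
  by rewrite mul1r /g addrC subrK.
rewrite ge0_integralDZ//.
under eq_integral do rewrite -LE.
rewrite EL mul1e => /eqP Ig.
have {}Ig : (\int[P]_w (g w)%:E <= 0)%E.
  have I0 : (0 <= \int[P]_w (g w)%:E)%E by apply: integral_ge0 => w _; rewrite lee_fin.
  move: Ig I0; case: (\int[P]_w (g w)%:E)%E => [r| |] //.
  by rewrite -EFinD => /eqP[]; rewrite !lee_fin => h _; lra.
have q0 : {ae P, forall w, l2 T (q ^~ w) /\ N w = 0}.
  apply: filterS2 (square_integrable_l2 mq sq) (ae_eq0 mg g0 Ig) => w lw gw; split=> //.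
  have : expR (- (2^-1 * N w)) = expR 0 by move: gw; rewrite /g expR0 => /eqP; rewrite subr_eq0 => /eqP.
  by move/expR_inj => h; have := N0 w; lra.
rewrite SI0; split=> [t _||].
- exact: measurable_cst.
- by apply: aeW => w; apply/cont_onP; exact: cont_on_cst.
exists (fun=> SimpleProcess 0 (fun=> 0) (fun _ _ => 0)); split=> [n||].
- exact: is_simple0.
- apply: ae_cvg_in_prob.
    move=> n e; apply: measurable_gt; apply: measurable_strip_integral.
      apply/measurable_EFinP; under eq_fun do rewrite enorm_sqr /sp_eval big_ord0 sub0r dotNl dotNr opprK.
      exact: measurable_process_dot.
    by move=> t w _; rewrite lee_fin sqr_ge0.
  apply: filterS q0 => w [lw Nw] e e0; apply: nearW => n.
  under eq_integral do rewrite enorm_sqr /sp_eval big_ord0 sub0r dotNl dotNr opprK.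
  by rewrite l2normE// /l2norm -/(N w) Nw lee_fin ltW.
- move=> e e0; rewrite (_ : (fun n => _) = fun=> 0%E); first exact: cvg_cst.
  apply/funext => n; rewrite (_ : [set w | _] = set0) ?measure0//.
  apply/seteqP; split => w //=; rewrite ltNge => /negP; apply.
  apply: ge_ereal_sup => _ [t _ <-]; rewrite lee_fin.
  by rewrite /sp_integral big_ord0 subr0 normr0 ltW.
Qed.

End integral_versions.

Section change_of_measure.
Context d (Omega : measurableType d) (R : realType) (P : probability Omega R)
  (T : R) (m : nat) (B : R -> Omega -> 'cV[R]_m).
Hypothesis T_gt0 : 0 < T.
Hypothesis P_complete : measure_is_complete P.
Hypothesis B_brownian : is_brownian_motion P T B.
Variable q : R -> Omega -> 'cV[R]_m.
Hypothesis mq : measurable_process T q.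
Hypothesis sq : square_integrable P T q.

Local Notation leb := (@lebesgue_measure R).
Local Notation L := (stochastic_exponential P T B q T).
Local Notation Mq := (stochastic_integral P T B q).
Local Notation ld := (log_density T q Mq).

Hypothesis hq : is_stochastic_integral P T B q Mq.
Hypothesis EL : (\int[P]_w (L w)%:E = 1)%E.

Lemma stochastic_exponential_gt0 w : 0 < L w. Proof. exact: expR_gt0. Qed.

Lemma stochastic_exponential_ge0 w : 0 <= L w. Proof. exact: expR_ge0. Qed.

Lemma measurable_stochastic_exponential : measurable_fun [set: Omega] L.
Proof.
rewrite (_ : L = expR \o ld); last by apply/funext => w; rewrite stochastic_exponentialE.
by apply: measurableT_comp => //; exact: (measurable_log_density T_gt0 P_complete B_brownian mq hq).
Qed.

Definition Q_measure : {measure set Omega -> \bar R} :=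
  density P measurable_stochastic_exponential stochastic_exponential_ge0.

Lemma entropy_fun_stochastic_exponential w : entropy_fun (ld w) = L w * ln (L w) - L w + 1.
Proof. by rewrite stochastic_exponentialE expRK /entropy_fun; ring. Qed.

Lemma measurable_xlnx : measurable_fun [set: Omega] (fun w => (L w * ln (L w))%:E).
Proof.
have mL := measurable_stochastic_exponential.
by apply/measurable_EFinP; apply: measurable_funM => //; exact: measurableT_comp.
Qed.

(** [entropy_fun] is L ln L - L + 1, nonnegative, while L ln L has both signs and its integral is a
    difference in the extended reals. Its negative part is at most 1, so the two finiteness
    conditions agree when L has mean 1. *)
Lemma finite_entropyP : finite_entropy P T B q <->
  (\int[P]_w (entropy_fun (ld w))%:E < +oo)%E.
Proof.
rewrite /finite_entropy; set g := fun w => (L w * ln (L w))%:E.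
have mg : measurable_fun [set: Omega] g := measurable_xlnx.
have mP := measurable_funepos mg; have mN := measurable_funeneg mg.
have mL := measurable_stochastic_exponential.
have mphi : measurable_fun [set: Omega] (fun w => entropy_fun (ld w)).
  apply: measurableT_comp; first exact: measurable_entropy_fun.
  exact: (measurable_log_density T_gt0 P_complete B_brownian mq hq).
have neg1 : (\int[P]_w (g^\- w) <= 1)%E.
  rewrite -[leRHS](integral_probability_cst P); apply: ge0_le_integral => //.
  move=> w _; rewrite funenegE ge_max lee01 andbT /g -EFinN lee_fin.
  have := entropy_fun_ge0 (ld w); rewrite entropy_fun_stochastic_exponential; have := stochastic_exponential_ge0 w; lra.
have neg0 : (0 <= \int[P]_w (g^\- w))%E by apply: integral_ge0.
have pos0 : (0 <= \int[P]_w (g^\+ w))%E by apply: integral_ge0.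
have Eg : (\int[P]_w g w = \int[P]_w (g^\+ w) - \int[P]_w (g^\- w))%E by rewrite integralE.
have mphiE : measurable_fun [set: Omega] (fun w => (entropy_fun (ld w))%:E) by exact/measurable_EFinP.
have mLE : measurable_fun [set: Omega] (fun w => (L w)%:E) by exact/measurable_EFinP.
rewrite Eg; split=> [h|h].
  have posoo : (\int[P]_w (g^\+ w) < +oo)%E.
    move: h neg1 neg0; case: (\int[P]_w (g^\- w))%E => [r| |] //.
    by case: (\int[P]_w (g^\+ w))%E => [r'| |]; rewrite ?ltry.
  apply: (@le_lt_trans _ _ (\int[P]_w (g^\+ w + 1))%E).
    apply: ge0_le_integral => //.
    - by move=> w _; rewrite lee_fin entropy_fun_ge0.
    - exact: emeasurable_funD.
    - move=> w _; apply: (@le_trans _ _ (g w + 1)%E); last by rewrite leeD2r// funeposE le_max lexx.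
      rewrite /g -EFinD lee_fin entropy_fun_stochastic_exponential; have := stochastic_exponential_ge0 w; lra.
  by rewrite ge0_integralD// (integral_probability_cst P) lte_add_pinfty// ltry.
apply: (@le_lt_trans _ _ (\int[P]_w (g^\+ w))%E); first by rewrite leeBlDr ?leeDl// ge0_fin_numE// (le_lt_trans neg1)// ltry.
apply: (@le_lt_trans _ _ (\int[P]_w ((entropy_fun (ld w))%:E + (L w)%:E))%E).
  apply: ge0_le_integral => //.
  - exact: emeasurable_funD.
  - move=> w _; rewrite funeposE ge_max -EFinD !lee_fin; apply/andP; split.
      by rewrite entropy_fun_stochastic_exponential; lra.
    by rewrite addr_ge0 ?entropy_fun_ge0 ?stochastic_exponential_ge0.
rewrite ge0_integralD//.
- by rewrite EL lte_add_pinfty// ltry.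
- by move=> w _; rewrite lee_fin entropy_fun_ge0.
- by move=> w _; rewrite lee_fin stochastic_exponential_ge0.
Qed.

(** An exponential moment of any positive order under [P] gives integrability under a measure of
    finite entropy, by [entropy_young] at c U. It is enough for the negative part of Y, whose order
    [eps] may be small. *)
Lemma integral_Q_young (U : Omega -> R) (c : R) : 0 < c -> measurable_fun [set: Omega] U ->
  (forall w, 0 <= U w) -> (\int[P]_w (expR (c * U w))%:E < +oo)%E ->
  (\int[P]_w (entropy_fun (ld w))%:E < +oo)%E ->
  (\int[Q_measure]_w (U w)%:E < +oo)%E.
Proof.
move=> c0 mU U0 EU Ephi.
have mphi : measurable_fun [set: Omega] (fun w => entropy_fun (ld w)).
  apply: measurableT_comp; first exact: measurable_entropy_fun.
  exact: (measurable_log_density T_gt0 P_complete B_brownian mq hq).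
have mexp : measurable_fun [set: Omega] (fun w => expR (c * U w)).
  by apply: measurableT_comp => //; exact: measurable_funM.
rewrite integral_density//; [|exact/measurable_EFinP].
apply: (@le_lt_trans _ _ (\int[P]_w (0 + c^-1 * (expR (c * U w) + 1 * entropy_fun (ld w)))%:E)%E).
  apply: (@le_trans _ _ (\int[P]_w (L w * U w)%:E)%E); first by under eq_integral do rewrite -EFinM.
  apply: ge0_le_real_integral.
  - by apply: measurable_funM => //; exact: measurable_stochastic_exponential.
  - by apply: measurable_funD => //; apply: measurable_funM => //; apply: measurable_funD => //; exact: measurable_funM.
  - by move=> w; rewrite mulr_ge0// stochastic_exponential_ge0.
  - move=> w; rewrite add0r mul1r -(ler_pM2l c0) mulVKf ?gt_eqF//.
    have := entropy_young (c * U w) (ld w); rewrite stochastic_exponentialE; lra.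
rewrite ge0_integralDZ//; last 3 first.
- by apply: measurable_funD => //; exact: measurable_funM.
- by move=> w; rewrite addr_ge0 ?expR_ge0// mul1r entropy_fun_ge0.
- by rewrite invr_ge0 ltW.
rewrite ge0_integralDZ//; last by move=> w; exact: entropy_fun_ge0.
rewrite integral0 add0e mul1e lte_mul_pinfty ?lee_fin ?invr_ge0 ?(ltW c0)//.
exact: lte_add_pinfty.
Qed.

Section drift.
Variables (Z : R -> Omega -> 'cV[R]_m) (MZ : R -> Omega -> R).
Hypothesis mZ : measurable_process T Z.
Hypothesis sZ : square_integrable P T Z.
Hypothesis hZ : is_stochastic_integral P T B Z MZ.
Variables (t : R) (D xi : Omega -> R).
Hypothesis tT : 0 <= t <= T.
Hypothesis mD : measurable_fun [set: Omega] D.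
Hypothesis mxi : measurable_fun [set: Omega] xi.
Hypothesis xi_ge0 : forall w, 0 <= xi w.
Hypothesis drifted_ge : {ae P, forall w, forall s, t <= s <= T ->
  - xi w <= drifted q Z MZ s w - drifted q Z MZ t w}.
Hypothesis DE : {ae P, forall w, D w = drifted q Z MZ T w - drifted q Z MZ t w}.
Hypothesis Exi : (\int[Q_measure]_w (xi w)%:E < +oo)%E.

(** The lower bound holds for [D] only almost surely, whereas [density_supermartingale] uses it
    everywhere; the maximum enforces it without changing [D] almost surely. *)
Let D' w := Num.max (D w) (- xi w).

Let mD' : measurable_fun [set: Omega] D'.
Proof. by apply: measurable_maxr => //; exact: measurableT_comp. Qed.

Let D'_ge w : - xi w <= D' w. Proof. by rewrite le_max lexx orbT. Qed.

Let D'E : {ae P, forall w, D' w = D w}.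
Proof.
apply: filterS2 drifted_ge DE => w h Dw; rewrite /D'.
apply/max_idPl; rewrite Dw; apply: h; have /andP[_ ->] := tT; exact: lexx.
Qed.

Let bound A : <<s augmented_gen P B t >> A ->
  (\int[Q_measure]_(w in A) (xi w + D' w)%:E <= \int[Q_measure]_(w in A) (xi w)%:E)%E.
Proof.
move=> FA; have mA : measurable A.
  by apply: (augmented_gen_measurable P_complete B_brownian (t := t)) => //; have /andP[] := tT.
rewrite !integral_density_set//; [|exact: measurable_funD|by move=> w; rewrite -(subrr (xi w)) lerD2l].
have LE : L = fun w => expR (ld w) by apply/funext => w; rewrite stochastic_exponentialE.
rewrite LE; apply: (density_supermartingale T_gt0 P_complete B_brownian mq mZ sq sZ hq hZ tT FA mD' mxi xi_ge0 D'_ge drifted_ge).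
- by apply: filterS2 D'E DE => w -> ->.
- by move: EL; rewrite LE.
- have hE : (\int[Q_measure]_w (xi w)%:E = \int[P]_w ((L w)%:E * (xi w)%:E))%E.
    by apply: integral_density; [exact/measurable_EFinP|move=> w; rewrite lee_fin].
  move: Exi; rewrite hE LE => h; apply: le_lt_trans h.
  by under eq_integral do rewrite EFinM.
Qed.

Let xiD'_ge0 w : 0 <= xi w + D' w.
Proof. by rewrite -(subrr (xi w)) lerD2l. Qed.

Let xi_integrable : Q_measure.-integrable [set: Omega] (EFin \o xi).
Proof.
apply/integrableP; split; first exact/measurable_EFinP.
by under eq_integral do rewrite /= ger0_norm//.
Qed.

Let xiD_integrable : Q_measure.-integrable [set: Omega] (EFin \o (fun w => xi w + D' w)).
Proof.
apply/integrableP; split; first by apply/measurable_EFinP; exact: measurable_funD.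
have -> : (\int[Q_measure]_w `|(EFin \o (fun w => xi w + D' w)%R) w| = \int[Q_measure]_w (xi w + D' w)%:E)%E.
  by apply: eq_integral => w _; rewrite /= ger0_norm.
apply: le_lt_trans Exi; apply: bound; exact: (@measurableT _ (g_sigma_algebraType (augmented_gen P B t))).
Qed.

Let D'_integrable : Q_measure.-integrable [set: Omega] (EFin \o D').
Proof.
have -> : EFin \o D' = EFin \o (fun w => (xi w + D' w) + -1 * xi w).
  by apply/funext => w /=; congr (_%:E); ring.
exact: (integrable_realD measurableT xiD_integrable (integrable_realZ (-1) measurableT xi_integrable)).
Qed.

Let D'_eq : {ae Q_measure, forall w, D' w = D w}.
Proof. exact: density_ae D'E. Qed.

Lemma drift_integrable : Q_measure.-integrable [set: Omega] (EFin \o D).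
Proof.
apply/integrableP; split; first exact/measurable_EFinP.
have /integrableP[mD'E] := D'_integrable; apply: le_lt_trans.
rewrite le_eqVlt; apply/orP; left; apply/eqP; apply: ae_eq_integral => //.
- by apply: measurableT_comp => //; exact/measurable_EFinP.
- exact: measurableT_comp.
- by apply: filterS D'_eq => w h _ /=; rewrite h.
Qed.

Lemma drift_integral_le0 A : <<s augmented_gen P B t >> A ->
  (\int[Q_measure]_(w in A) (D w)%:E <= 0)%E.
Proof.
move=> FA; have mA : measurable A.
  by apply: (augmented_gen_measurable P_complete B_brownian (t := t)) => //; have /andP[] := tT.
have iS f : Q_measure.-integrable [set: Omega] (EFin \o f) -> Q_measure.-integrable A (EFin \o f).
  exact: integrableS.
have -> : (\int[Q_measure]_(w in A) (D w)%:E = \int[Q_measure]_(w in A) (D' w)%:E)%E.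
  apply: ae_eq_integral => //.
  - by apply: measurable_funTS; exact/measurable_EFinP.
  - by apply: measurable_funTS; exact/measurable_EFinP.
  - by apply: filterS D'_eq => w h _ /=; rewrite h.
have := bound FA.
have -> : (\int[Q_measure]_(w in A) (xi w + D' w)%:E =
    \int[Q_measure]_(w in A) (xi w)%:E + \int[Q_measure]_(w in A) (D' w)%:E)%E.
  exact: (integralD mA (iS _ xi_integrable) (iS _ D'_integrable)).
have := integrable_fin_num mA (iS _ xi_integrable).
move: (\int[Q_measure]_(w in A) (xi w)%:E)%E => [r| |] // _.
by rewrite -{2}(adde0 r%:E) leeD2lE.
Qed.

End drift.
End change_of_measure.

Section sup_exponential.
Context d (Omega : measurableType d) (R : realType) (P : probability Omega R).
Hypothesis P_complete : measure_is_complete P.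

Lemma measurable_expeR_comp (X : Omega -> \bar R) : measurable_fun [set: Omega] X ->
  measurable_fun [set: Omega] (fun w => expeR (X w)).
Proof.
move=> mX _ Y mY; apply: (measurability _ (ErealGenOInfty.measurableE R)) => //.
move=> _ [_ [c ->] <-]; rewrite setTI.
have [c0|c0] := ltP c 0.
  rewrite (_ : _ @^-1` _ = setT) ?measurableT//; apply/seteqP; split => w //= _.
  by rewrite in_itv/= andbT (lt_le_trans _ (expeR_ge0 _))// lte_fin.
rewrite (_ : _ @^-1` _ = setT `&` X @^-1` [set` `]lne c%:E, +oo[]).
  by apply: mX => //; exact: emeasurable_itv.
have cK : expeR (lne c%:E) = c%:E by apply: lneK; rewrite in_itv/= leey andbT lee_fin.
by apply/seteqP; split => w /=; rewrite !in_itv/= !andbT -{1}cK lte_expeR => // -[].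
Qed.

Variables (T : R) (X : R -> Omega -> R) (c : R).
Hypothesis T_gt0 : 0 < T.
Hypothesis c_gt0 : 0 < c.
Hypothesis mX : forall t, 0 <= t <= T -> measurable_fun [set: Omega] (X t).
Hypothesis X_ge0 : forall t w, 0 <= X t w.
Hypothesis cX : {ae P, forall w, cont_on T (X ^~ w)}.

Let supX w := ereal_sup [set (X t w)%:E | t in `[0, T]].

Hypothesis EsupX : (\int[P]_w expeR (c%:E * supX w) < +oo)%E.

Let supX_ge t w : 0 <= t <= T -> ((X t w)%:E <= supX w)%E.
Proof. by move=> tT; apply: ereal_sup_ubound; exists t => //=; rewrite in_itv. Qed.

Let supX_ge0 w : (0 <= supX w)%E.
Proof.
by apply: (@le_trans _ _ (X 0 w)%:E); [rewrite lee_fin|apply: supX_ge; rewrite lexx ltW].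
Qed.

(** Replaces the extended supremum by a real random variable: its exponential moment is finite, so
    the supremum is finite almost surely and [fine] loses nothing there. *)
Lemma sup_process_exp : exists S : Omega -> R, [/\ measurable_fun [set: Omega] S,
  forall w, 0 <= S w, (\int[P]_w (expR (c * S w))%:E < +oo)%E &
  {ae P, forall w, forall t, 0 <= t <= T -> X t w <= S w}].
Proof.
have msup : measurable_fun [set: Omega] supX by exact: (measurable_sup_process P_complete T_gt0 mX cX).
have mcsup : measurable_fun [set: Omega] (fun w => c%:E * supX w)%E by exact: emeasurable_funM.
exists (fun w => fine (supX w)); split.
- exact: measurableT_comp.
- by move=> w; exact: fine_ge0.
- apply: le_lt_trans EsupX; apply: ge0_le_integral => //.
  + apply/measurable_EFinP; apply: measurableT_comp => //; apply: measurable_funM => //.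
    exact: measurableT_comp.
  + exact: measurable_expeR_comp.
  + move=> w _; have := supX_ge0 w; case: (supX w) => [r| |] //= _.
    by rewrite gt0_muley ?lte_fin//= leey.
have : P.-integrable [set: Omega] (fun w => expeR (c%:E * supX w)).
  apply/integrableP; split; first exact: measurable_expeR_comp.
  by under eq_integral do rewrite gee0_abs ?expeR_ge0//.
move=> /(integrable_ae measurableT); apply: filterS => w /(_ I) fin t tT.
have := supX_ge w tT; have := supX_ge0 w; move: fin; case: (supX w) => [r| |] //=.
by rewrite gt0_muley ?lte_fin.
Qed.

End sup_exponential.

Section ae_comparison.
Context d (Omega : measurableType d) (R : realType).

Lemma ae_le_integral (mu : {measure set Omega -> \bar R}) (A : set Omega) (f g : Omega -> R) :
  measurable A -> mu.-integrable A (EFin \o f) -> mu.-integrable A (EFin \o g) ->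
  {ae mu, forall w, f w <= g w} ->
  (\int[mu]_(w in A) (f w)%:E <= \int[mu]_(w in A) (g w)%:E)%E.
Proof.
move=> mA fi gi fg.
have mf : measurable_fun A f by apply/measurable_EFinP; have /integrableP[] := fi.
have mg : measurable_fun A g by apply/measurable_EFinP; have /integrableP[] := gi.
have aeE : ae_eq mu A (EFin \o g) (fun w => (Num.max (f w) (g w))%:E).
  by apply: filterS fg => w h _ /=; congr (_%:E); apply/esym/max_idPr.
have mm : measurable_fun A (fun w => (Num.max (f w) (g w))%:E).
  by apply/measurable_EFinP; exact: measurable_maxr.
rewrite (ae_eq_integral _ _ mA _ mm aeE); last by apply/measurable_EFinP.
apply: le_integral => //.
- apply/integrableP; split; first exact: mm.
  have /integrableP[mEg] := gi; apply: le_lt_trans.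
  rewrite le_eqVlt; apply/orP; left; apply/eqP; apply: ae_eq_integral => //.
  + by apply: measurableT_comp => //; exact/measurable_EFinP.
  + exact: measurableT_comp.
  + by apply: filterS aeE => w h Aw; congr (`|_|%E); exact/esym/(h Aw).
- by move=> w _; rewrite /= lee_fin le_max lexx.
Qed.

(** On the set tested u is positive, so a nonpositive integral makes L u vanish there almost surely;
    positivity of L leaves no room for the set. *)
Lemma density_ae_le0 (P : probability Omega R) (L u : Omega -> R)
    (mL : measurable_fun [set: Omega] L) (L_ge0 : forall w, 0 <= L w) :
  (forall w, 0 < L w) -> measurable_fun [set: Omega] u ->
  (\int[density P mL L_ge0]_(w in [set w | (0 < u w)%R]) (u w)%:E <= 0)%E ->
  {ae P, forall w, u w <= 0}.
Proof.
move=> L0 mu Iu; set A := [set w | _] in Iu.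
have mA : measurable A.
  have := measurable_fun_ltr (measurable_cst (0 : R)) mu; move=> /(_ measurableT [set true] I).
  by rewrite setTI; congr measurable; apply/seteqP; split.
pose g w := Num.max (u w) 0.
have g0 w : 0 <= g w by rewrite le_max lexx orbT.
have mg : measurable_fun [set: Omega] g by exact: measurable_maxr.
have : {ae P, forall w, L w * \1_A w * g w = 0}.
  apply: ae_eq0.
  - by apply: measurable_funM => //; apply: measurable_funM => //; exact: measurable_indic.
  - by move=> w; rewrite !mulr_ge0.
  - rewrite -(integral_density_set P mL L_ge0 mA mg g0); apply: le_trans Iu.
    rewrite le_eqVlt; apply/orP; left; apply/eqP; apply: eq_integral => w.
    by rewrite inE /A /g/= => /ltW /max_idPl ->.
apply: filterS => w /eqP; rewrite !mulf_eq0 gt_eqF//= indicE.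
case: (boolP (w \in A)) => [|]; last by rewrite notin_setE /A/= => /negP; rewrite -leNgt.
by rewrite inE /A/= oner_eq0/= /g => /ltW /max_idPl -> /eqP ->.
Qed.

End ae_comparison.

Section paths.
Context (R : realType) (T : R).
Local Notation leb := (@lebesgue_measure R).

Lemma path_increment m (F : R) (y M g : R -> R) (z q : R -> 'cV[R]_m) t u :
  l2 T z -> l2 T q -> leb.-integrable `[0, T] (EFin \o g) ->
  (forall s, 0 <= s <= T -> y s = F + \int[leb]_(r in `[s, T]) g r - (M T - M s)) ->
  0 <= t -> t <= u -> u <= T ->
  (M u - \int[leb]_(r in `[0, u]) dot (z r) (q r)) -
  (M t - \int[leb]_(r in `[0, t]) dot (z r) (q r)) =
  y u - y t - \int[leb]_(r in `[t, u]) (dot (z r) (q r) - g r).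
Proof.
move=> lz lq ig yE t0 tu uT; have idot := integrable_dot lz lq.
have sub : `[t, u]%classic `<=` `[0, T]%classic.
  by move=> x; rewrite /= !in_itv/= => /andP[h1 h2]; rewrite (le_trans t0 h1) (le_trans h2 uT).
rewrite RintegralB//; [|exact: integrableS idot|exact: integrableS ig].
rewrite -(Rintegral_sub idot t0 tu uT) -(Rintegral_sub ig t0 tu uT).
have u0 := le_trans t0 tu; have tT := le_trans tu uT.
rewrite (yE u) ?u0//= (yE t) ?t0//=.
by rewrite -(Rintegral_sub ig u0 uT (lexx T)) -(Rintegral_sub ig t0 tT (lexx T)); ring.
Qed.

Lemma path_dual_le (h : R -> R) (phi : R -> \bar R) t u :
  leb.-integrable `[0, T] (EFin \o h) -> measurable_fun `[0, T]%classic phi ->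
  (forall s, 0 <= phi s)%E -> (forall s, (h s)%:E <= phi s)%E ->
  (\int[leb]_(s in `[0%R, T]) phi s < +oo)%E -> 0 <= t -> u <= T ->
  \int[leb]_(s in `[t, u]) h s <= fine (\int[leb]_(s in `[t, u]) phi s)%E <=
  fine (\int[leb]_(s in `[0%R, T]) phi s)%E.
Proof.
move=> ih mphi phi0 hphi Iphi t0 uT.
have sub : `[t, u]%classic `<=` `[0, T]%classic.
  by move=> x; rewrite /= !in_itv/= => /andP[h1 h2]; rewrite (le_trans t0 h1) (le_trans h2 uT).
have iphi : leb.-integrable `[0, T] phi.
  by apply/integrableP; split=> //; under eq_integral do rewrite gee0_abs//.
have iphi' : leb.-integrable `[t, u] phi by exact: integrableS iphi.
have ih' : leb.-integrable `[t, u] (EFin \o h) by exact: integrableS ih.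
have mtu : measurable `[t, u]%classic by exact: measurable_itv.
have mT : measurable `[0, T]%classic by exact: measurable_itv.
have f1 : (\int[leb]_(s in `[t, u]) phi s)%E \is a fin_num by exact: integrable_fin_num.
have f2 : (\int[leb]_(s in `[0%R, T]) phi s)%E \is a fin_num by exact: integrable_fin_num.
have f3 : (\int[leb]_(s in `[t, u]) (h s)%:E)%E \is a fin_num by exact: integrable_fin_num.
apply/andP; split; apply: fine_le => //.
  by apply: le_integral => // s _; exact: hphi.
by apply: ge0_subset_integral.
Qed.

End paths.

Lemma measurable_strip_section d d' (Omega : measurableType d) (S : measurableType d')
    (R : realType) (T : R) (X : R * Omega -> S) w :
  measurable_fun (strip T) X -> measurable_fun `[0, T]%classic (fun s : R => X (s, w)).
Proof.
move=> mX; apply: (@measurable_comp _ _ _ _ _ _ (strip T) X _ (fun s : R => (s, w))) => //.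
- exact: measurable_strip.
- by move=> _ [s + <-]; rewrite /= in_itv/= => sT; exact/stripP.
- exact: measurable_funTS.
Qed.

Section initial_value.
Context d (Omega : measurableType d) (R : realType) (P : probability Omega R)
  (T : R) (m : nat) (B : R -> Omega -> 'cV[R]_m).
Hypothesis T_gt0 : 0 < T.
Hypothesis P_complete : measure_is_complete P.
Hypothesis B_brownian : is_brownian_motion P T B.

(** Integrals of simple processes vanish at time 0, and the approximation is uniform over times
    including 0. *)
Lemma stochastic_integral_at0 (Z : R -> Omega -> 'cV[R]_m) M : measurable_process T Z ->
  square_integrable P T Z -> is_stochastic_integral P T B Z M -> {ae P, forall w, M 0 w = 0}.
Proof.
move=> mZ sZ hZ.
have [H [G [Hs _ +]]] := stochastic_integral_approx2 T_gt0 P_complete B_brownian mZ mZ sZ sZ hZ hZ.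
apply: filterS => w hw; apply/eqP; rewrite -normr_eq0 eq_le normr_ge0 andbT.
apply/ler_addgt0Pr => e e0; have [N _ hN] := hw e e0; rewrite add0r.
have [|h _ _ _ _] := hN N (leqnn N) 0; first by rewrite lexx ltW.
move: h; rewrite /sp_integral big1 ?sub0r ?normrN// => k _.
have [tT _ _ _] := Hs N.
have tk j : (j <= sp_size (H N))%N -> Num.min (sp_time (H N) j) 0 = 0.
  by move=> jN; apply/min_idPr; have /andP[] := tT j jN.
by rewrite !tk ?subrr ?dot0r//; exact: ltnW.
Qed.

End initial_value.

(** * Duality *)

Section duality.
Context (R : realType) (disp : measure_display)
    (Omega : measurableType disp) (P : probability Omega R)
    (T : R) (d m : nat) (alpha : R)
    (B : R -> Omega -> 'cV[R]_m)
    (b : R -> Omega -> 'cV[R]_d) (sigma : R -> Omega -> 'M[R]_(d, m))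
    (C : set 'cV[R]_d) (F : Omega -> R) (p : nat) (eps : R)
    (Y : R -> Omega -> R) (Z : R -> Omega -> 'cV[R]_m).
Hypothesis P_complete : measure_is_complete P.
Hypothesis T_gt0 : 0 < T.
Hypothesis alpha_gt0 : 0 < alpha.
Hypothesis B_brownian : is_brownian_motion P T B.
Hypothesis b_predictable : predictable_mx P T B b.
Hypothesis sigma_predictable : predictable_mx P T B sigma.
Hypothesis sigma_invertible : forall t w, 0 <= t <= T -> sigma t w *m (sigma t w)^T \in unitmx.
Hypothesis theta_bounded : bounded_mx T (fun t w => risk_premium (sigma t w) (b t w)).
Hypothesis C_convex : convex_set (C : set (convex_lmodType 'cV[R]_d)).
Hypothesis C0 : C 0.
Hypothesis F_measurable : filtration_measurable P B T F.
Hypothesis p_gt1 : (1 < p)%N.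
Hypothesis eps_gt0 : 0 < eps.

Local Notation leb := (@lebesgue_measure R).
Local Notation Ft t := (g_sigma_algebraType (augmented_gen P B t)).
Local Notation PT := (g_sigma_algebraType (predictable_gen P T B)).
Local Notation f t w := (generator alpha C (sigma t w) (b t w)).
Local Notation fstar := (fun t w => convex_dual (f t w)).

Hypothesis solution : bsde_solution P T B F (fun t w => f t w) Y Z.
Hypothesis solution_exp : exp_integrable_solution P T (p%:R * alpha) eps Y Z.

Let Cc x y (a : R) : C x -> C y -> 0 <= a <= 1 -> C (a *: x + (1 - a) *: y).
Proof.
move=> Cx Cy /andP[a0 a1]; have := @C_convex x y (Itv01 a0 a1).
by rewrite !inE => /(_ Cx Cy).
Qed.

Let Y_predictable : predictable P T B Y. Proof. by have [[]] := solution. Qed.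
Let Z_predictable : predictable_mx P T B Z. Proof. by have [[]] := solution. Qed.
Let sZ : square_integrable P T Z. Proof. by have [] := solution. Qed.
Let mZ : measurable_process T Z.
Proof. exact: (predictable_process T_gt0 P_complete B_brownian Z_predictable). Qed.

Let sigma_entries : @measurable_entries R _ PT (strip T) _ _ (fun x => sigma x.1 x.2).
Proof. by move=> i j; exact: sigma_predictable. Qed.
Let b_entries : @measurable_entries R _ PT (strip T) _ _ (fun x => b x.1 x.2).
Proof. by move=> i j; exact: b_predictable. Qed.
Let sigma_unit (x : PT) : strip T x -> sigma x.1 x.2 *m (sigma x.1 x.2)^T \in unitmx.
Proof. by case: x => t w /stripP; exact: sigma_invertible. Qed.

Let measurable_fZ : measurable_fun (strip T) (fun x : R * Omega => f x.1 x.2 (Z x.1 x.2)).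
Proof.
apply: (predictable_measurable_fun T_gt0 P_complete B_brownian (X := fun x => f x.1 x.2 (Z x.1 x.2))).
by apply: (@measurable_generator R _ PT (strip T)) => // i j; exact: Z_predictable.
Qed.

Lemma measurable_fstar (q : R -> Omega -> 'cV[R]_m) : predictable_mx P T B q ->
  measurable_fun (strip T) (fun x : R * Omega => fstar x.1 x.2 (q x.1 x.2)).
Proof.
move=> pq; apply: (predictable_measurable_fun T_gt0 P_complete B_brownian (X := fun x => fstar x.1 x.2 (q x.1 x.2))).
by apply: (@measurable_convex_dual R _ PT (strip T)) => // i j; exact: pq.
Qed.

Let fstar_ge0 t w q : (0 <= fstar t w q)%E.
Proof. exact: convex_dual_ge0. Qed.

Let FY t : 0 <= t <= T -> filtration_measurable P B t (Y t).
Proof. by move=> tT; exact: (predictable_section T_gt0 (X := fun x => Y x.1 x.2) tT Y_predictable). Qed.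

Let mY t : 0 <= t <= T -> measurable_fun [set: Omega] (Y t).
Proof.
move=> tT; apply: (filtration_measurable_fun P_complete B_brownian (t := t)); last exact: FY.
by have /andP[] := tT.
Qed.

Let cY : {ae P, forall w, cont_on T (Y ^~ w)}.
Proof. by have [_ cY _ _ _] := solution; apply: filterS cY => w /cont_onP. Qed.

Let mF : measurable_fun [set: Omega] F.
Proof. exact: (filtration_measurable_fun P_complete B_brownian (t := T)). Qed.

Let supYp w := ereal_sup [set (Num.max (Y t w) 0)%:E | t in `[0, T]].
Let supYm w := ereal_sup [set (Num.max (- Y t w) 0)%:E | t in `[0, T]].
Let IZ w : \bar R := (\int[leb]_(s in `[0%R, T]) (enorm (Z s w) ^+ 2)%:E)%E.

Let c_gt0 : 0 < p%:R * alpha.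
Proof. by rewrite mulr_gt0// ltr0n ltnW. Qed.

Let max_ge0 (x : R) : 0 <= Num.max x 0. Proof. by rewrite le_max lexx orbT. Qed.

Let mYp t : 0 <= t <= T -> measurable_fun [set: Omega] (fun w => Num.max (Y t w) 0).
Proof. by move=> tT; apply: measurable_maxr => //; exact: mY. Qed.

Let mYm t : 0 <= t <= T -> measurable_fun [set: Omega] (fun w => Num.max (- Y t w) 0).
Proof. by move=> tT; apply: measurable_maxr => //; apply: measurableT_comp => //; exact: mY. Qed.

Let cYp : {ae P, forall w, cont_on T (fun t => Num.max (Y t w) 0)}.
Proof. by apply: filterS cY => w; exact: cont_on_max. Qed.

Let cYm : {ae P, forall w, cont_on T (fun t => Num.max (- Y t w) 0)}.
Proof.
apply: filterS cY => w cYw; apply: cont_on_max.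
rewrite (_ : (fun t => _) = fun t => -1 * Y t w); first exact: cont_onZ.
by apply/funext => t; rewrite mulN1r.
Qed.

Let msupYp : measurable_fun [set: Omega] supYp.
Proof. exact: (measurable_sup_process P_complete T_gt0 mYp cYp). Qed.

Let msupYm : measurable_fun [set: Omega] supYm.
Proof. exact: (measurable_sup_process P_complete T_gt0 mYm cYm). Qed.

Let mIZ : measurable_fun [set: Omega] IZ.
Proof.
apply: measurable_strip_integral; last by move=> t w _; rewrite lee_fin sqr_ge0.
by apply/measurable_EFinP; under eq_fun do rewrite enorm_sqr; exact: measurable_process_dot.
Qed.

Let IZ_ge0 w : (0 <= IZ w)%E.
Proof. by apply: integral_ge0 => s _; rewrite lee_fin sqr_ge0. Qed.

Let Esum : (\int[P]_w expeR ((p%:R * alpha)%:E * supYp w) + \int[P]_w expeR (eps%:E * supYm w) +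
  \int[P]_w IZ w < +oo)%E.
Proof.
have mp : measurable_fun [set: Omega] (fun w => expeR ((p%:R * alpha)%:E * supYp w)).
  by apply: measurable_expeR_comp; exact: emeasurable_funM.
have mm : measurable_fun [set: Omega] (fun w => expeR (eps%:E * supYm w)).
  by apply: measurable_expeR_comp; exact: emeasurable_funM.
have : (\int[P]_w (expeR ((p%:R * alpha)%:E * supYp w) + expeR (eps%:E * supYm w) + IZ w) < +oo)%E
  by exact: solution_exp.
rewrite ge0_integralD//; last 2 first.
- by move=> w _; rewrite adde_ge0 ?expeR_ge0.
- exact: emeasurable_funD.
by rewrite ge0_integralD// => w _; exact: expeR_ge0.
Qed.

Let Eparts : [/\ \int[P]_w expeR ((p%:R * alpha)%:E * supYp w) < +oo,
  \int[P]_w expeR (eps%:E * supYm w) < +oo & \int[P]_w IZ w < +oo]%E.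
Proof.
have i1 : (0 <= \int[P]_w expeR ((p%:R * alpha)%:E * supYp w))%E by apply: integral_ge0 => w _; exact: expeR_ge0.
have i2 : (0 <= \int[P]_w expeR (eps%:E * supYm w))%E by apply: integral_ge0 => w _; exact: expeR_ge0.
have i3 : (0 <= \int[P]_w IZ w)%E by apply: integral_ge0 => w _.
split; apply: le_lt_trans Esum.
- by rewrite -addeA leeDl// adde_ge0.
- by rewrite addeAC leeDr// adde_ge0.
- by rewrite leeDr// adde_ge0.
Qed.

Local Notation MZ := (stochastic_integral P T B Z).

Let sq_norm_Z : (sq_norm P T Z < +oo)%E.
Proof.
have [_ _ EZ] := Eparts; apply: le_lt_trans EZ; rewrite le_eqVlt; apply/orP; left; apply/eqP.
by apply: eq_integral => w _; apply: eq_integral => s _; rewrite enorm_sqr.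
Qed.

Let hZ : is_stochastic_integral P T B Z MZ.
Proof.
exact: (stochastic_integralP (stochastic_integral_exists T_gt0 P_complete B_brownian Z_predictable sq_norm_Z)).
Qed.

(** Two kinds of bounds are kept apart because their exponential orders differ: p alpha above and
    only [eps] below. *)
Let envelope : exists Yp Ym : Omega -> R, [/\
  measurable_fun [set: Omega] Yp /\ measurable_fun [set: Omega] Ym,
  (forall w, 0 <= Yp w) /\ (forall w, 0 <= Ym w),
  (\int[P]_w (expR (p%:R * alpha * Yp w))%:E < +oo)%E,
  (\int[P]_w (expR (eps * Ym w))%:E < +oo)%E &
  {ae P, forall w, forall t, 0 <= t <= T -> - Ym w <= Y t w <= Yp w}].
Proof.
have [Ep Em _] := Eparts.
have [Yp [mYp' Yp0 EYp aeYp]] :=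
  sup_process_exp P_complete T_gt0 c_gt0 mYp (fun t w => max_ge0 (Y t w)) cYp Ep.
have [Ym [mYm' Ym0 EYm aeYm]] :=
  sup_process_exp P_complete T_gt0 eps_gt0 mYm (fun t w => max_ge0 (- Y t w)) cYm Em.
exists Yp, Ym; split=> //; apply: filterS2 aeYp aeYm => w hp hm t tT.
have := hp t tT; have := hm t tT; rewrite !ge_max => /andP[h1 _] /andP[h2 _].
by rewrite h2 andbT lerNl.
Qed.

Local Notation h q t w := (dot (Z t w) (q t w) - f t w (Z t w)).

Let lZ : {ae P, forall w, l2 T (Z ^~ w)}.
Proof. exact: square_integrable_l2. Qed.

Let ifZ : {ae P, forall w, leb.-integrable `[0, T] (fun s => (f s w (Z s w))%:E)}.
Proof.
have [_ _ _ fi _] := solution; apply: filterS fi => w fw; apply/integrableP; split=> //.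
apply/measurable_EFinP.
exact: (measurable_strip_section (X := fun x => f x.1 x.2 (Z x.1 x.2))).
Qed.

Let YE : {ae P, forall w, forall t, 0 <= t <= T ->
  Y t w = F w + \int[leb]_(s in `[t, T]) f s w (Z s w) - (MZ T w - MZ t w)}.
Proof. by have [] := solution. Qed.

Let Y_final : {ae P, forall w, Y T w = F w}.
Proof.
apply: filterS YE => w /(_ T); rewrite lexx ltW// => /(_ isT) ->.
by rewrite set_itv1 Rintegral_set1 subrr addr0 subr0.
Qed.

Let measurable_h q : measurable_process T q ->
  measurable_fun (strip T) (fun x : R * Omega => h q x.1 x.2).
Proof. by move=> mq; apply: measurable_funB => //; exact: measurable_process_dot. Qed.

Let ih q w : l2 T (q ^~ w) -> l2 T (Z ^~ w) ->
  leb.-integrable `[0, T] (fun s => (f s w (Z s w))%:E) ->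
  leb.-integrable `[0, T] (EFin \o (fun s => h q s w)).
Proof. by move=> lq lz fw; apply: (integrableB _ (integrable_dot lz lq) fw). Qed.

Let increment q : measurable_process T q -> square_integrable P T q ->
  {ae P, forall w, forall t u, 0 <= t -> t <= u -> u <= T ->
    drifted q Z MZ u w - drifted q Z MZ t w = Y u w - Y t w - \int[leb]_(s in `[t, u]) h q s w}.
Proof.
move=> mq sq; have lq := square_integrable_l2 mq sq.
apply: filterS2 (filterI lq lZ) (filterI ifZ YE) => w [lqw lZw] [fw yw] t u t0 tu uT.
exact: (path_increment lZw lqw fw yw).
Qed.

Let measurable_drifted q s : measurable_process T q -> 0 <= s <= T ->
  measurable_fun [set: Omega] (drifted q Z MZ s).
Proof.
move=> mq /andP[s0 sT]; apply: measurable_funB.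
  have [mM _ _] := hZ; apply: (filtration_measurable_fun P_complete B_brownian (t := s)) => //.
  by apply: mM; rewrite s0 sT.
apply: (measurable_path_integral (f := fun s w => dot (Z s w) (q s w)) (lexx 0) sT).
exact: measurable_process_dot.
Qed.

Section admissible_control.
Variables (Yp Ym : Omega -> R).
Hypothesis mYp' : measurable_fun [set: Omega] Yp.
Hypothesis mYm' : measurable_fun [set: Omega] Ym.
Hypothesis Yp_ge0 : forall w, 0 <= Yp w.
Hypothesis Ym_ge0 : forall w, 0 <= Ym w.
Hypothesis EYp : (\int[P]_w (expR (p%:R * alpha * Yp w))%:E < +oo)%E.
Hypothesis EYm : (\int[P]_w (expR (eps * Ym w))%:E < +oo)%E.
Hypothesis Y_bounds : {ae P, forall w, forall t, 0 <= t <= T -> - Ym w <= Y t w <= Yp w}.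

Variable q : R -> Omega -> 'cV[R]_m.
Hypothesis pq : predictable_mx P T B q.
Hypothesis sq : square_integrable P T q.

Let mq : measurable_process T q.
Proof. exact: (predictable_process T_gt0 P_complete B_brownian pq). Qed.

Local Notation L := (stochastic_exponential P T B q T).
Local Notation Mq := (stochastic_integral P T B q).
Local Notation ld := (log_density T q Mq).

(** These hypotheses are weaker than [admissible]: the section is used both for arbitrary admissible
    q and for the optimal one, whose finite cost is a conclusion ([optimal_cost]) and is therefore
    assumed only in a subsection. *)
Hypothesis hq : is_stochastic_integral P T B q Mq.
Hypothesis EL : (\int[P]_w (L w)%:E = 1)%E.
Hypothesis Eent : (\int[P]_w (entropy_fun (ld w))%:E < +oo)%E.

Local Notation Q := (Q_measure T_gt0 P_complete B_brownian mq hq).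

Let I (w : Omega) : \bar R := (\int[leb]_(s in `[0%R, T]) fstar s w (q s w))%E.

Let mI : measurable_fun [set: Omega] I.
Proof. by apply: measurable_strip_integral => //; exact: measurable_fstar. Qed.

Let I_ge0 w : (0 <= I w)%E. Proof. exact: integral_ge0. Qed.

Let Y_envelope : (\int[Q]_w (Yp w + 1 * Ym w)%:E < +oo)%E.
Proof.
rewrite ge0_integralDZ// mul1e; apply: lte_add_pinfty.
  exact: (integral_Q_young T_gt0 P_complete B_brownian mq hq c_gt0 mYp' Yp_ge0 EYp Eent).
exact: (integral_Q_young T_gt0 P_complete B_brownian mq hq eps_gt0 mYm' Ym_ge0 EYm Eent).
Qed.

Let dominated (g X : Omega -> R) : measurable_fun [set: Omega] g -> measurable_fun [set: Omega] X ->
  (forall w, 0 <= X w) -> (\int[Q]_w (X w)%:E < +oo)%E ->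
  {ae P, forall w, `|g w| <= X w} -> Q.-integrable [set: Omega] (EFin \o g).
Proof.
move=> mg mX X0 EX gX; apply/integrableP; split; first exact/measurable_EFinP.
apply: le_lt_trans EX; apply: ae_ge0_le_integral => //.
- by apply: measurableT_comp => //; exact/measurable_EFinP.
- by move=> w _; rewrite lee_fin.
- exact/measurable_EFinP.
- by apply: density_ae; apply: filterS gX => w h _ /=; rewrite lee_fin.
Qed.

Let mEnv : measurable_fun [set: Omega] (fun w => Yp w + 1 * Ym w).
Proof. by apply: measurable_funD => //; exact: measurable_funM. Qed.

Let Env_ge0 w : 0 <= Yp w + 1 * Ym w.
Proof. by rewrite mul1r addr_ge0. Qed.

Lemma solution_integrable t : 0 <= t <= T -> Q.-integrable [set: Omega] (EFin \o Y t).
Proof.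
move=> tT; apply: (dominated (mY tT) mEnv Env_ge0 Y_envelope).
apply: filterS Y_bounds => w yb; rewrite mul1r ler_norml; have /andP[h1 h2] := yb t tT.
have := Yp_ge0 w; have := Ym_ge0 w; move: h1 h2; lra.
Qed.

Local Notation D t := (fun w => drifted q Z MZ T w - drifted q Z MZ t w).

Let mD t : 0 <= t <= T -> measurable_fun [set: Omega] (D t).
Proof.
move=> tT; apply: measurable_funB; apply: measurable_drifted => //.
by rewrite lexx ltW.
Qed.

(** The real-valued payoff; when the cost is finite it agrees almost surely with [dual_payoff]. *)
Let pf t w := F w - fine (\int[leb]_(s in `[t, T]) fstar s w (q s w))%E.

Let mpayoff t : 0 <= t -> measurable_fun [set: Omega]
  (fun w => \int[leb]_(s in `[t, T]) fstar s w (q s w))%E.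
Proof.
move=> t0; apply: (measurable_subinterval_integral (f := fun s w => fstar s w (q s w)) t0 (lexx T)) => //.
exact: measurable_fstar.
Qed.

Let mpf t : 0 <= t -> measurable_fun [set: Omega] (pf t).
Proof. by move=> t0; apply: measurable_funB => //; apply: measurableT_comp => //; exact: mpayoff. Qed.

Section finite_cost.
Hypothesis EI : (\int[Q]_w I w < +oo)%E.

Let I_fin : {ae P, forall w, (I w < +oo)%E}.
Proof.
apply: (density_ae_inv (mL := measurable_stochastic_exponential T_gt0 P_complete B_brownian mq hq)
  (L_ge0 := stochastic_exponential_ge0 _ _ _ _)); first exact: stochastic_exponential_gt0.
have : Q.-integrable [set: Omega] I.
  by apply/integrableP; split=> //; under eq_integral do rewrite gee0_abs//.
by move=> /(integrable_ae measurableT); apply: filterS => w /(_ Logic.I); rewrite ge0_fin_numE.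
Qed.

Let fstar_path w : measurable_fun `[0, T]%classic (fun s => fstar s w (q s w)).
Proof.
exact: (measurable_strip_section (X := fun x => fstar x.1 x.2 (q x.1 x.2)) w (measurable_fstar pq)).
Qed.

Let dual_le : {ae P, forall w, forall t u, 0 <= t -> u <= T ->
  \int[leb]_(s in `[t, u]) h q s w <= fine (\int[leb]_(s in `[t, u]) fstar s w (q s w))%E <=
  fine (I w)}.
Proof.
have lq := square_integrable_l2 mq sq.
apply: filterS2 (filterI lq lZ) (filterI ifZ I_fin) => w [lqw lZw] [fw Iw] t u t0 uT.
apply: path_dual_le => //; first exact: ih.
by move=> s; exact: fenchel_young.
Qed.

(** Bounds the increments of X from below: those of Y by the two envelopes, and the integral of Z.q
    - f(Z) by the total dual cost. *)
Let xi w := Yp w + 1 * Ym w + 1 * fine (I w).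

Let mxi : measurable_fun [set: Omega] xi.
Proof.
apply: measurable_funD; first by apply: measurable_funD => //; exact: measurable_funM.
by apply: measurable_funM => //; exact: measurableT_comp.
Qed.

Let xi_ge0 w : 0 <= xi w.
Proof. by rewrite /xi !mul1r !addr_ge0// fine_ge0. Qed.

Let Exi : (\int[Q]_w (xi w)%:E < +oo)%E.
Proof.
rewrite ge0_integralDZ//.
- rewrite mul1e; apply: lte_add_pinfty => //; apply: le_lt_trans EI.
  apply: ge0_le_integral => //.
  + by move=> w _; rewrite lee_fin fine_ge0.
  + by apply/measurable_EFinP; exact: measurableT_comp.
  + by move=> w _; have := I_ge0 w; case: (I w) => [r| |] //= _; rewrite leey.
- exact: measurableT_comp.
- by move=> w; exact: fine_ge0.
Qed.

Let D_ge t : 0 <= t <= T -> {ae P, forall w, forall s, t <= s <= T ->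
  - xi w <= drifted q Z MZ s w - drifted q Z MZ t w}.
Proof.
move=> /andP[t0 tT]; apply: filterS2 (filterI (increment mq sq) Y_bounds) dual_le.
move=> w [inc yb] dl s /andP[ts sT]; rewrite (inc t s t0 ts sT).
have /andP[d1 d2] := dl t s t0 sT.
have /andP[y1 _] := yb s (introT andP (conj (le_trans t0 ts) sT)).
have /andP[_ y2] := yb t (introT andP (conj t0 tT)).
rewrite /xi !mul1r; move: (le_trans d1 d2) y1 y2; lra.
Qed.

Lemma drift_le0 t A : 0 <= t <= T -> <<s augmented_gen P B t >> A ->
  (\int[Q]_(w in A) (D t w)%:E <= 0)%E.
Proof.
move=> tT FA; apply: (drift_integral_le0 sq EL mZ sZ hZ tT (mD tT) mxi xi_ge0 (D_ge tT) _ Exi FA).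
exact: aeW.
Qed.

Let D_integrable t : 0 <= t <= T -> Q.-integrable [set: Omega] (EFin \o D t).
Proof.
move=> tT; apply: (drift_integrable sq EL mZ sZ hZ tT (mD tT) mxi xi_ge0 (D_ge tT) _ Exi).
exact: aeW.
Qed.

Lemma payoff_integrable t : 0 <= t <= T -> Q.-integrable [set: Omega] (EFin \o pf t).
Proof.
move=> /andP[t0 tT]; apply: (dominated (mpf t0) mxi xi_ge0 Exi).
apply: filterS2 (filterI Y_bounds Y_final) dual_le => w [yb yF] dl; rewrite /pf -yF.
have /andP[y1 y2] : - Ym w <= Y T w <= Yp w by apply: yb; rewrite lexx ltW.
have /andP[_ d2] := dl t T t0 (lexx T).
have d0 : 0 <= fine (\int[leb]_(s in `[t, T]) fstar s w (q s w))%E by rewrite fine_ge0// integral_ge0.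
rewrite /xi !mul1r ler_norml; move: d2 d0 y1 y2 (Yp_ge0 w) (Ym_ge0 w); lra.
Qed.

Lemma payoff_integral t A : 0 <= t <= T -> measurable A ->
  (\int[Q]_(w in A) dual_payoff T F fstar q t w = \int[Q]_(w in A) (pf t w)%:E)%E.
Proof.
move=> /andP[t0 tT] mA; apply: ae_eq_integral => //.
- apply: measurable_funTS; apply: emeasurable_funB; first exact/measurable_EFinP.
  exact: mpayoff.
- by apply: measurable_funTS; apply/measurable_EFinP; exact: mpf.
apply: density_ae; apply: filterS I_fin => w Iw _; rewrite /dual_payoff /pf EFinB fineK//.
rewrite ge0_fin_numE; last exact: integral_ge0.
apply: le_lt_trans Iw; apply: ge0_subset_integral => //.
  exact: fstar_path.
by move=> s; rewrite /= !in_itv/= => /andP[ts ->]; rewrite (le_trans t0 ts).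
Qed.

(** Test on the event A where V exceeds Y_t, which belongs to F_t. There V may be replaced by the
    payoff, the payoff is at most Y_t + D, and the integral of D over A is nonpositive; so A is
    negligible. *)
Lemma dual_value_le t V : 0 <= t <= T -> is_dual_value P T B F fstar q t V ->
  {ae P, forall w, (V w <= (Y t w)%:E)%E}.
Proof.
move=> tT [mV iV EV]; have /andP[t0 tT'] := tT.
have mV' : measurable_fun [set: Omega] V.
  move=> _ U mU; apply: (augmented_gen_measurable P_complete B_brownian (t := t)) => //.
  exact: mV.
have FV : filtration_measurable P B t (fine \o V).
  by apply: (@measurableT_comp _ _ _ _ _ _ fine) => //; exact: mV.
pose u w := fine (V w) - Y t w.
have Fu : filtration_measurable P B t u by apply: measurable_funB; [exact: FV|exact: FY].
have mu : measurable_fun [set: Omega] u by exact: (filtration_measurable_fun P_complete B_brownian (t := t)).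
pose A := [set w | 0 < u w].
have FA : <<s augmented_gen P B t >> A.
  have := measurable_fun_ltr (measurable_cst (0 : R)) Fu; move=> /(_ measurableT [set true] Logic.I).
  by rewrite setTI; congr (<<s _ >> _); apply/seteqP; split.
have mA : measurable A by exact: (augmented_gen_measurable P_complete B_brownian (t := t)).
have Vi : Q.-integrable [set: Omega] V by apply/integrableP; split.
have Vfin : {ae Q, forall w, V w \is a fin_num}.
  by apply: filterS (integrable_ae measurableT Vi) => w; exact.
have vE : {ae Q, forall w, V w = (fine (V w))%:E}.
  by apply: filterS Vfin => w h; rewrite fineK.
have vi : Q.-integrable [set: Omega] (EFin \o (fine \o V)).
  apply/integrableP; split; first by apply/measurable_EFinP; exact: measurableT_comp.
  have /integrableP[_] := Vi; apply: le_lt_trans.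
  rewrite le_eqVlt; apply/orP; left; apply/eqP; apply: ae_eq_integral => //.
  + by apply: measurableT_comp => //; apply/measurable_EFinP; exact: measurableT_comp.
  + exact: measurableT_comp.
  + by apply: filterS vE => w Vw _; rewrite [in RHS]Vw.
have Yi := solution_integrable tT.
have iS g : Q.-integrable [set: Omega] (EFin \o g) -> Q.-integrable A (EFin \o g).
  exact: integrableS.
have u0 : {ae P, forall w, u w <= 0}.
  apply: (density_ae_le0 (mL := measurable_stochastic_exponential T_gt0 P_complete B_brownian mq hq)
    (L_ge0 := stochastic_exponential_ge0 _ _ _ _)) => //; first exact: stochastic_exponential_gt0.
  rewrite -/A -/Q.
  have -> : (\int[Q]_(w in A) (u w)%:E = \int[Q]_(w in A) (fine (V w))%:E - \int[Q]_(w in A) (Y t w)%:E)%E.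
    exact: (integralB mA (iS _ vi) (iS _ Yi)).
  have -> : (\int[Q]_(w in A) (fine (V w))%:E = \int[Q]_(w in A) (pf t w)%:E)%E.
    rewrite -payoff_integral// -(EV A FA); apply: ae_eq_integral => //.
    + by apply: measurable_funTS; apply/measurable_EFinP; exact: measurableT_comp.
    + exact: measurable_funTS.
    + by apply: filterS vE => w Vw _ /=; rewrite -Vw.
  have pY : (\int[Q]_(w in A) (pf t w)%:E <= \int[Q]_(w in A) (Y t w + (D t) w)%:E)%E.
    apply: ae_le_integral => //; first exact: (iS _ (payoff_integrable tT)).
      exact: (iS _ (integrable_realD measurableT Yi (D_integrable tT))).
    apply: density_ae; apply: filterS2 (filterI (increment mq sq) Y_final) dual_le => w [inc yF] dl.
    rewrite (inc t T t0 tT' (lexx T)) /pf -yF; have /andP[+ _] := dl t T t0 (lexx T); lra.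
  have DE : (\int[Q]_(w in A) (Y t w + (D t) w)%:E =
      \int[Q]_(w in A) (Y t w)%:E + \int[Q]_(w in A) ((D t) w)%:E)%E.
    exact: (integralD mA (iS _ Yi) (iS _ (D_integrable tT))).
  rewrite leeBlDr ?add0e; last by apply: integrable_fin_num => //; exact: iS.
  apply: le_trans pY _; rewrite DE -[leRHS]adde0; apply: leeD2l; exact: drift_le0.
apply: filterS2 (density_ae_inv (L_ge0 := stochastic_exponential_ge0 _ _ _ _)
  (stochastic_exponential_gt0 _ _ _ _) vE) u0 => w -> h.
by rewrite lee_fin -subr_le0.
Qed.

End finite_cost.

Section optimal.
Hypothesis attained : forall t w, fstar t w (q t w) = (h q t w)%:E.

Let h_ge0 t w : 0 <= h q t w.
Proof. by rewrite -lee_fin -attained. Qed.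

Let nZ t w := - Z t w.
Let nMZ t w := - MZ t w.

Let mnZ : measurable_process T nZ.
Proof.
move=> i; rewrite (_ : (fun x => _) = fun x => - Z x.1 x.2 i 0).
  exact: measurableT_comp.
by apply/funext => x; rewrite /nZ mxE.
Qed.

Let snZ : square_integrable P T nZ.
Proof.
apply: filterS sZ => w; congr (_ < _)%E; apply: eq_integral => s _.
by rewrite !enorm_sqr /nZ dotNl dotNr opprK.
Qed.

Let hnZ : is_stochastic_integral P T B nZ nMZ.
Proof. exact: is_stochastic_integral_opp. Qed.

Let drifted_opp : {ae P, forall w, forall s, s <= T ->
  drifted q nZ nMZ s w = - drifted q Z MZ s w}.
Proof.
apply: filterS2 lZ (square_integrable_l2 mq sq) => w lZw lqw s sT.
rewrite /drifted opprD opprK; congr (_ + _).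
rewrite (@eq_Rintegral _ _ _ leb _ (fun x => -1 * dot (Z x w) (q x w))); last first.
  by move=> x _; rewrite /nZ dotNl mulN1r.
rewrite RintegralZl//; first by rewrite mulN1r opprK.
by apply: integrableS (integrable_dot lZw lqw) => //; exact: sub_itv0.
Qed.

(** For the optimal q the cost density equals h >= 0, so it helps in this direction: -X is bounded
    below by the envelopes of Y alone, and finite cost is not yet presupposed. *)
Let D_ge' t : 0 <= t <= T -> {ae P, forall w, forall s, t <= s <= T ->
  - (Yp w + 1 * Ym w) <= drifted q nZ nMZ s w - drifted q nZ nMZ t w}.
Proof.
move=> /andP[t0 tT]; apply: filterS2 (filterI (increment mq sq) Y_bounds) drifted_opp.
move=> w [inc yb] dop s /andP[ts sT]; rewrite !dop//.
have := inc t s t0 ts sT.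
have : 0 <= \int[leb]_(r in `[t, s]) h q r w by apply: Rintegral_ge0 => r _.
have /andP[_ y1] := yb s (introT andP (conj (le_trans t0 ts) sT)).
have /andP[y2 _] := yb t (introT andP (conj t0 tT)).
rewrite mul1r; move: y1 y2; lra.
Qed.

Let mD' t : 0 <= t <= T -> measurable_fun [set: Omega] (fun w => - (D t) w).
Proof. by move=> tT; apply: measurableT_comp => //; exact: mD. Qed.

Let DE' t : 0 <= t <= T -> {ae P, forall w, - (D t) w = drifted q nZ nMZ T w - drifted q nZ nMZ t w}.
Proof. by move=> /andP[_ tT]; apply: filterS drifted_opp => w dop; rewrite !dop//; ring. Qed.

Let D_integrable t : 0 <= t <= T -> Q.-integrable [set: Omega] (EFin \o (fun w => - (D t) w)).
Proof.
by move=> tT; exact: (drift_integrable sq EL mnZ snZ hnZ tT (mD' tT) mEnv Env_ge0 (D_ge' tT) (DE' tT) Y_envelope).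
Qed.

Let D_ge0 t A : 0 <= t <= T -> <<s augmented_gen P B t >> A ->
  (\int[Q]_(w in A) (- (D t) w)%:E <= 0)%E.
Proof.
by move=> tT FA; exact: (drift_integral_le0 sq EL mnZ snZ hnZ tT (mD' tT) mEnv Env_ge0 (D_ge' tT) (DE' tT) Y_envelope FA).
Qed.

Let T00 : 0 <= (0 : R) <= T. Proof. by rewrite lexx ltW. Qed.
Let TT0 : 0 <= T <= T. Proof. by rewrite lexx ltW. Qed.

Let fstar_integral : {ae P, forall w, forall t, 0 <= t <= T ->
  (\int[leb]_(s in `[t, T]) fstar s w (q s w))%E = (\int[leb]_(s in `[t, T]) h q s w)%:E}.
Proof.
have lq := square_integrable_l2 mq sq.
apply: filterS2 (filterI lq lZ) ifZ => w [lqw lZw] fw r /andP[r0 rT].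
under eq_integral do rewrite attained.
rewrite /Rintegral fineK//; apply: integrable_fin_num => //.
apply: integrableS (ih lqw lZw fw) => //.
by move=> s; rewrite /= !in_itv/= => /andP[rs ->]; rewrite (le_trans r0 rs).
Qed.

(** Equality in Fenchel-Young gives int fstar = Y_T - Y_0 - (X_T - X_0). The increment of X is
    integrable by the estimate for -X, and so is Y; this opens the way to the results that assume
    finite cost. *)
Lemma optimal_cost : (\int[Q]_w I w < +oo)%E.
Proof.
pose g w := (Y T w + -1 * Y 0 w) + - (D 0) w.
have gi : Q.-integrable [set: Omega] (EFin \o g).
  apply: (integrable_realD measurableT _ (D_integrable T00)).
  exact: (integrable_realD measurableT (solution_integrable TT0) (integrable_realZ (-1) measurableT (solution_integrable T00))).
have /integrableP[mg] := gi; apply: le_lt_trans; apply: ae_ge0_le_integral => //.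
  exact: measurableT_comp.
apply: density_ae; apply: filterS2 (increment mq sq) fstar_integral => w inc fE _.
rewrite /I fE//= lee_fin; apply: le_trans (ler_norm _).
have := inc 0 T (lexx 0) (ltW T_gt0) (lexx T); rewrite /g; lra.
Qed.

(** The increment of X integrates to zero over every event of F_t: [drift_le0] gives one sign and
    the estimate for -X the other. The payoff is Y_t plus this increment. *)
Lemma optimal_dual_value t : 0 <= t <= T ->
  is_dual_value P T B F fstar q t (fun w => (Y t w)%:E).
Proof.
move=> tT; have Yi := solution_integrable tT; have /andP[t0 tT'] := tT; split.
- by apply/measurable_EFinP; exact: FY.
- by have /integrableP[] := Yi.
move=> A FA; have mA : measurable A.
  by apply: (augmented_gen_measurable P_complete B_brownian (t := t)).
rewrite -!/(Q : set Omega -> \bar R) payoff_integral//; last exact: optimal_cost.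
have iS g : Q.-integrable [set: Omega] (EFin \o g) -> Q.-integrable A (EFin \o g).
  exact: integrableS.
have Di : Q.-integrable [set: Omega] (EFin \o D t).
  have -> : EFin \o D t = EFin \o (fun w => -1 * - (D t) w).
    by apply/funext => w /=; rewrite mulrNN mul1r.
  exact: (integrable_realZ (-1) measurableT (D_integrable tT)).
have D0 : (\int[Q]_(w in A) ((D t) w)%:E = 0)%E.
  apply/eqP; rewrite eq_le drift_le0//=; last exact: optimal_cost.
  have := D_ge0 tT FA.
  have -> : (\int[Q]_(w in A) (- (D t) w)%:E = - \int[Q]_(w in A) ((D t) w)%:E)%E.
    rewrite -integralN//; apply: fin_num_adde_defl.
    by rewrite fin_numN; apply: (integrable_neg_fin_num mA); exact: iS.
  by rewrite leeNl oppe0.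
have -> : (\int[Q]_(w in A) (pf t w)%:E = \int[Q]_(w in A) (Y t w + (D t) w)%:E)%E.
  apply: ae_eq_integral => //.
  - by apply: measurable_funTS; apply/measurable_EFinP; exact: mpf.
  - by apply: measurable_funTS; apply/measurable_EFinP; apply: measurable_funD; [exact: mY|exact: mD].
  apply: density_ae; apply: filterS2 (filterI (increment mq sq) Y_final) fstar_integral => w [inc yF] fE _.
  rewrite /pf fE//= -yF (inc t T t0 tT' (lexx T)); congr (_%:E); ring.
have -> : (\int[Q]_(w in A) (Y t w + (D t) w)%:E =
    \int[Q]_(w in A) (Y t w)%:E + \int[Q]_(w in A) ((D t) w)%:E)%E.
  exact: (integralD mA (iS _ Yi) (iS _ Di)).
by rewrite D0 adde0.
Qed.

End optimal.

End admissible_control.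

Lemma admissible_dual_value_le q t V : 0 <= t <= T -> admissible P T B F fstar q ->
  is_dual_value P T B F fstar q t V -> {ae P, forall w, (V w <= (Y t w)%:E)%E}.
Proof.
move=> tT [pq sq ent EL EF] hV.
have [Yp [Ym [[mYp' mYm'] [Yp0 Ym0] EYp EYm yb]]] := envelope.
have mq := predictable_process T_gt0 P_complete B_brownian pq.
have hq := density_stochastic_integral T_gt0 mq sq EL.
have Eent := (finite_entropyP T_gt0 P_complete B_brownian mq hq EL).1 ent.
apply: (dual_value_le mYp' mYm' Yp0 Ym0 EYp EYm yb sq EL Eent _ tT hV).
apply: le_lt_trans EF; apply: ge0_le_integral.
- exact: measurableT.
- by move=> w _; exact: integral_ge0.
- by apply: measurable_strip_integral => //; exact: measurable_fstar.
- apply: emeasurable_funD; first by apply/measurable_EFinP; exact: measurableT_comp.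
  under eq_fun do under eq_integral do rewrite gee0_abs//.
  by apply: measurable_strip_integral => //; exact: measurable_fstar.
- move=> w _; under [X in (_ <= _ + X)%E]eq_integral do rewrite gee0_abs//.
  by rewrite leeDr.
Qed.

(** Boundedness of theta enters through the growth bound of the gradient: it makes q square
    integrable along with Z, so that the stochastic integral of q exists. *)
Let optimal_control : exists q, [/\ predictable_mx P T B q,
  forall t w, fstar t w (q t w) = (h q t w)%:E & (sq_norm P T q < +oo)%E].
Proof.
have /choice[g Hg] := fun x : R * Omega =>
  generator_gradient alpha_gt0 C0 Cc (sigma x.1 x.2) (b x.1 x.2) (Z x.1 x.2).
have pg : predictable_mx P T B (fun t w => g (t, w)).
  move=> i j; rewrite /predictable (_ : (fun x => _) = fun x => g x i j); last first.
    by apply/funext => -[].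
  apply: (@measurable_gradient R _ PT (strip T) d m alpha C (fun x => sigma x.1 x.2)
    (fun x => b x.1 x.2) (fun x => Z x.1 x.2)) => //.
  by move=> x k; have [/(_ k)] := Hg x.
exists (fun t w => g (t, w)); split; first exact: pg.
  move=> t w; apply: convex_dual_subgradient => k.
  by have [/(_ k)/andP[]] := Hg (t, w).
have mg := predictable_process T_gt0 P_complete B_brownian pg.
have [K HK] := theta_bounded.
(* K bounds the coordinates of theta, so the term 6 |theta|^2 of the growth bound is at most 6 m
   K^2. *)
pose c : R := 6 * (m%:R * K ^+ 2).
have c0 : 0 <= c by rewrite mulr_ge0// mulr_ge0// sqr_ge0.
have a0 : 0 <= 4 * alpha ^+ 2 by rewrite mulr_ge0// sqr_ge0.
have mZZ : measurable_fun (strip T) (fun x => (dot (Z x.1 x.2) (Z x.1 x.2))%:E).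
  by apply/measurable_EFinP; exact: measurable_process_dot.
have mgg : measurable_fun (strip T) (fun x => (dot (g (x.1, x.2)) (g (x.1, x.2)))%:E).
  by apply/measurable_EFinP; exact: (measurable_process_dot mg mg).
apply: (@le_lt_trans _ _ (strip_int P T
    (fun t w => (4 * alpha ^+ 2)%:E * (dot (Z t w) (Z t w))%:E + c%:E)%E)).
  apply: le_strip_integral => //.
  - by apply: emeasurable_funD => //; exact: emeasurable_funM.
  - by move=> t w _; rewrite lee_fin dot_ge0.
  move=> t w tT; rewrite -EFinM -EFinD lee_fin; have [_ +] := Hg (t, w); move=> /le_trans; apply.
  rewrite lerD2l /c ler_wpM2l// dotE.
  apply: (@le_trans _ _ (\sum_(i < m) K ^+ 2)); last by rewrite sumr_const card_ord mulr_natl.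
  apply: ler_sum => i _; rewrite -expr2 -real_normK ?num_real// lerXn2r ?nnegrE//.
    by apply: le_trans (HK t w i 0 tT).
  exact: HK.
rewrite strip_integralD//; last 2 first.
- exact: emeasurable_funM.
- by move=> t w _; rewrite -EFinM lee_fin mulr_ge0// dot_ge0.
apply: lte_add_pinfty; last exact: strip_int_cst.
rewrite strip_integralZ//; last by move=> t w _; rewrite lee_fin dot_ge0.
by apply: lte_mul_pinfty; [rewrite lee_fin| |exact: sq_norm_Z].
Qed.

Let optimal_entropy q : predictable_mx P T B q -> square_integrable P T q ->
  is_stochastic_integral P T B q (stochastic_integral P T B q) ->
  (forall t w, fstar t w (q t w) = (h q t w)%:E) ->
  (\int[P]_w (expR (log_density T q (stochastic_integral P T B q) w))%:E = 1)%E /\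
  (\int[P]_w (entropy_fun (log_density T q (stochastic_integral P T B q) w))%:E < +oo)%E.
Proof.
move=> pq sq hq attained; have mq := predictable_process T_gt0 P_complete B_brownian pq.
have [Yp [Ym [[mYp' mYm'] [Yp0 Ym0] EYp EYm yb]]] := envelope.
have T00 : 0 <= (0 : R) <= T by rewrite lexx ltW.
pose W w := Num.max (- Y 0 w) 0.
have W0 w : 0 <= W w by exact: max_ge0.
have FW : filtration_measurable P B 0 W.
  apply: measurable_maxr => //; apply: measurableT_comp => //; exact: FY.
have mW : measurable_fun [set: Omega] W by exact: mYm.
have EW : (\int[P]_w (W w)%:E < +oo)%E.
  (* From x <= exp(eps x) / eps, applied to the envelope of the negative part. *)
  apply: (@le_lt_trans _ _ (\int[P]_w (eps^-1%:E * (expR (eps * Ym w))%:E))%E).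
    apply: ae_ge0_le_integral => //.
    - by move=> w _; rewrite lee_fin.
    - exact/measurable_EFinP.
    - by move=> w _; rewrite -EFinM lee_fin mulr_ge0 ?expR_ge0// invr_ge0 ltW.
    - apply: emeasurable_funM => //; apply/measurable_EFinP; apply: measurableT_comp => //.
      exact: measurable_funM.
    apply: filterS yb => w /(_ 0 T00)/andP[y0 _] _; rewrite -EFinM lee_fin.
    apply: (@le_trans _ _ (Ym w)); first by rewrite ge_max Ym0 andbT lerNl.
    rewrite -(ler_pM2l eps_gt0) mulVKf ?gt_eqF//.
    by apply: le_trans (expR_ge1Dx _); rewrite lerDr.
  rewrite ge0_integralZl//.
  - by apply: lte_mul_pinfty => //; rewrite lee_fin invr_ge0 ltW.
  - by apply/measurable_EFinP; apply: measurableT_comp => //; exact: measurable_funM.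
  - by rewrite lee_fin invr_ge0 ltW.
have EW0 : (0 <= \int[P]_w (W w)%:E)%E by apply: integral_ge0 => w _; rewrite lee_fin.
have EYp0 : (0 <= \int[P]_w (expR (p%:R * alpha * Yp w))%:E)%E.
  by apply: integral_ge0 => w _; rewrite lee_fin expR_ge0.
have fEW : (\int[P]_w (W w)%:E)%E \is a fin_num by rewrite ge0_fin_numE.
have fEY : (\int[P]_w (expR (p%:R * alpha * Yp w))%:E)%E \is a fin_num by rewrite ge0_fin_numE.
have p1 : 1 < (p%:R : R) by rewrite ltr1n.
(* X starts at 0, so X_s = Y_s - Y_0 - int_0^s h, and h = fstar(q) >= |q|^2/(2 alpha).
   Multiplication by alpha produces exactly the half bracket of q added on the left. *)
have upper : {ae P, forall w, forall s, 0 <= s <= T ->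
    alpha * drifted q Z MZ s w + 2^-1 * \int[leb]_(x in `[0, s]) dot (q x w) (q x w) <=
    alpha * (Yp w + W w)}.
  have lq := square_integrable_l2 mq sq.
  have M0 := stochastic_integral_at0 T_gt0 P_complete B_brownian mZ sZ hZ.
  apply: filterS2 (filterI (filterI lq lZ) (filterI ifZ M0)) (filterI yb (increment mq sq)).
  move=> w [[lqw lZw] [fw m0]] [ybw inc] s /andP[s0 sT].
  have dr0 : drifted q Z MZ 0 w = 0.
    by rewrite /drifted m0 set_itv1 Rintegral_set1 subrr.
  have := inc 0 s (lexx 0) s0 sT; rewrite dr0 subr0 => ->.
  have sub := sub_itv0 sT.
  have hq' : (2 * alpha)^-1 * \int[leb]_(x in `[0, s]) dot (q x w) (q x w) <=
      \int[leb]_(x in `[0, s]) h q x w.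
    rewrite -RintegralZl//; last exact: integrableS (l2_integrable lqw).
    apply: le_Rintegral => //.
    - apply: (integrable_realZ (2 * alpha)^-1) => //; exact: integrableS (l2_integrable lqw).
    - exact: integrableS (ih lqw lZw fw).
    - by move=> x _; rewrite -lee_fin -attained; exact: convex_dual_ge.
  have /andP[_ y1] := ybw s (introT andP (conj s0 sT)).
  have y2 : - Y 0 w <= W w by rewrite le_max lexx.
  move: hq'; rewrite -(ler_pM2l alpha_gt0) mulrA.
  have -> : alpha * (2 * alpha)^-1 = 2^-1 by field; rewrite gt_eqF.
  have : alpha * (Y s w - Y 0 w) <= alpha * (Yp w + W w).
    by rewrite ler_pM2l//; exact: lerD.
  rewrite mulrBr; lra.
have wW : (\int[P]_w (W w)%:E <= (fine (\int[P]_w (W w)%:E))%:E)%E by rewrite fineK.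
have wY : (\int[P]_w (expR (p%:R * alpha * Yp w))%:E <=
    (fine (\int[P]_w (expR (p%:R * alpha * Yp w))%:E))%:E)%E by rewrite fineK.
have [EL Eent] := finite_entropy_bound T_gt0 P_complete B_brownian mq mZ sq sZ hq hZ
  alpha_gt0 p1 mYp' FW W0 wW wY upper.
split=> //; exact: le_lt_trans Eent (ltry _).
Qed.

Lemma optimal_admissible : exists2 q, admissible P T B F fstar q &
  forall t, 0 <= t <= T -> is_dual_value P T B F fstar q t (fun w => (Y t w)%:E).
Proof.
have [q [pq attained Eq]] := optimal_control.
have mq := predictable_process T_gt0 P_complete B_brownian pq.
have [Yp [Ym [[mYp' mYm'] [Yp0 Ym0] EYp EYm yb]]] := envelope.
have sq : square_integrable P T q.
  have mN : measurable_fun [set: Omega]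
      (fun w => \int[leb]_(s in `[0%R, T]) (dot (q s w) (q s w))%:E)%E.
    apply: measurable_strip_integral; last by move=> t w _; rewrite lee_fin dot_ge0.
    by apply/measurable_EFinP; exact: measurable_process_dot.
  have N0 w : (0 <= \int[leb]_(s in `[0%R, T]) (dot (q s w) (q s w))%:E)%E.
    by apply: integral_ge0 => s _; rewrite lee_fin dot_ge0.
  have : P.-integrable [set: Omega] (fun w => \int[leb]_(s in `[0%R, T]) (dot (q s w) (q s w))%:E)%E.
    by apply/integrableP; split=> //; under eq_integral do rewrite gee0_abs//.
  move=> /(integrable_ae measurableT); apply: filterS => w /(_ Logic.I).
  rewrite ge0_fin_numE//; congr (_ < _)%E; apply: eq_integral => s _.
  by rewrite enorm_sqr.
have hq := stochastic_integralP (stochastic_integral_exists T_gt0 P_complete B_brownian pq Eq).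
have [Eld Eent] := optimal_entropy pq sq hq attained.
have EL : (\int[P]_w (stochastic_exponential P T B q T w)%:E = 1)%E.
  by rewrite -[RHS]Eld; apply: eq_integral => w _; rewrite stochastic_exponentialE.
have TT0 : 0 <= T <= T by rewrite lexx ltW.
exists q; last first.
  exact: (optimal_dual_value mYp' mYm' Yp0 Ym0 EYp EYm yb pq sq hq EL Eent attained).
split=> //.
  exact: (finite_entropyP T_gt0 P_complete B_brownian mq hq EL).2.
have EI := optimal_cost mYp' mYm' Yp0 Ym0 EYp EYm yb pq sq hq EL Eent attained.
have Yi := solution_integrable mYp' mYm' Yp0 Ym0 EYp EYm yb pq hq Eent TT0.
pose Q := Q_measure T_gt0 P_complete B_brownian mq hq.
have {}EI : (\int[Q]_w \int[leb]_(s in `[0%R, T]) fstar s w (q s w) < +oo)%E by exact: EI.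
have EY : (\int[Q]_w `|Y T w|%:E < +oo)%E by have /integrableP[_] := Yi.
suff : (\int[Q]_w (`|F w|%:E + \int[leb]_(s in `[0%R, T]) `|fstar s w (q s w)|) < +oo)%E by [].
have -> : (\int[Q]_w (`|F w|%:E + \int[leb]_(s in `[0%R, T]) `|fstar s w (q s w)|) =
    \int[Q]_w (`|F w|%:E + \int[leb]_(s in `[0%R, T]) fstar s w (q s w)))%E.
  apply: eq_integral => w _; congr (_ + _)%E; apply: eq_integral => s _.
  by rewrite gee0_abs.
rewrite ge0_integralD//; last 3 first.
- by apply/measurable_EFinP; exact: measurableT_comp.
- by move=> w _; exact: integral_ge0.
- by apply: measurable_strip_integral => //; exact: measurable_fstar.
apply: lte_add_pinfty => //; apply: le_lt_trans EY.
apply: ae_ge0_le_integral => //.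
- by apply/measurable_EFinP; exact: measurableT_comp.
- by apply/measurable_EFinP; apply: measurableT_comp => //; exact: mY.
by apply: density_ae; apply: filterS Y_final => w yF _; rewrite /= yF.
Qed.

Lemma convex_dual_representation :
  (forall t, 0 <= t <= T ->
     is_esssup P
       [set V | exists2 q, admissible P T B F fstar q &
                           is_dual_value P T B F fstar q t V]
       (fun w => (Y t w)%:E)) /\
  (exists2 q, admissible P T B F fstar q &
     forall t, 0 <= t <= T ->
       is_dual_value P T B F fstar q t (fun w => (Y t w)%:E)).
Proof.
split; last exact: optimal_admissible.
move=> t tT; split.
- by apply/measurable_EFinP; exact: mY.
- by move=> V [q aq hV]; exact: admissible_dual_value_le tT aq hV.
- move=> W mW HW; have [q aq hq] := optimal_admissible.
  by apply: HW; exists q => //; exact: hq.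
Qed.

End duality.

Theorem theorem5p3 (R : realType) (disp : measure_display)
    (Omega : measurableType disp) (P : probability Omega R)
    (P_complete : measure_is_complete P)
    (T : R) (T_gt0 : 0 < T)
    (d m : nat) (d_ge1 : (1 <= d)%N) (d_le_m : (d <= m)%N)
    (alpha : R) (alpha_gt0 : 0 < alpha)
    (B : R -> Omega -> 'cV[R]_m) (B_brownian : is_brownian_motion P T B)
    (b : R -> Omega -> 'cV[R]_d) (sigma : R -> Omega -> 'M[R]_(d, m))
    (b_predictable : predictable_mx P T B b)
    (b_bounded : bounded_mx T b)
    (sigma_predictable : predictable_mx P T B sigma)
    (sigma_bounded : bounded_mx T sigma)
    (sigma_invertible : forall t w, 0 <= t <= T ->
       sigma t w *m (sigma t w)^T \in unitmx)
    (theta_bounded :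
       bounded_mx T (fun t w => risk_premium (sigma t w) (b t w)))
    (C : set 'cV[R]_d) (C_closed : closed C)
    (C_convex : convex_set (C : set (convex_lmodType 'cV[R]_d)))
    (C0 : C 0)
    (F : Omega -> R) (F_measurable : filtration_measurable P B T F)
    (p : nat) (p_gt1 : (1 < p)%N) (eps : R) (eps_gt0 : 0 < eps)
    (F_pos : (\int[P]_w (expR (p%:R * alpha * Num.max (F w) 0))%:E < +oo)%E)
    (F_neg : (\int[P]_w (expR (eps * Num.max (- F w) 0))%:E < +oo)%E)
    (Y : R -> Omega -> R) (Z : R -> Omega -> 'cV[R]_m) :
  let f t w := generator alpha C (sigma t w) (b t w) in
  let fstar t w := convex_dual (f t w) in
  bsde_solution P T B F f Y Z ->
  exp_integrable_solution P T (p%:R * alpha) eps Y Z ->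
  (forall t, 0 <= t <= T ->
     is_esssup P
       [set V | exists2 q, admissible P T B F fstar q &
                           is_dual_value P T B F fstar q t V]
       (fun w => (Y t w)%:E)) /\
  (exists2 q, admissible P T B F fstar q &
     forall t, 0 <= t <= T ->
       is_dual_value P T B F fstar q t (fun w => (Y t w)%:E)).
Proof.
move=> f fstar solution solution_exp.
exact: (convex_dual_representation P_complete T_gt0 alpha_gt0 B_brownian b_predictable
  sigma_predictable sigma_invertible theta_bounded C_convex C0 F_measurable p_gt1 eps_gt0
  solution solution_exp).
Qed.
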